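(* Let $\{\psi_v\}_{v\in V_N}$ be the $(\boldsymbol\sigma,\boldsymbol\lambda)$-GFF on $V_N$. Then $$\lim_{N\to\infty}\frac{\max_{v\in V_N}\psi_v}{\log N^2}=\gamma^\star:=\int_0^1\frac{\sigma^2(s)}{\bar\sigma(s)}\,ds\qquad\text{in probability.}$$
   Context: Boxes and GFF. Let $N\ge 1$ be an integer and $V_N=\{0,1,\dots,N\}^2\subseteq\mathbb Z^2$. For a finite $B\subseteq\mathbb Z^2$ put $\partial B=\{v\in B:\exists z\in\mathbb{Z}^2\setminus B,\ \|v-z\|_2=1\}$ and $B^o=B\setminus\partial B$. Let $(W_k)_{k\ge0}$ be the simple random walk on $\mathbb Z^2$ started at $u$ under $\mathscr P_u$ (expectation $\mathscr E_u$), and $\tau_{\partial B}=\min\{k\ge0:W_k\in\partial B\}$. Set $G_B(u,v)=\frac{\pi}{2}\,\mathscr E_u\big[\sum_{k=0}^{\tau_{\partial B}-1}1_{\{W_k=v\}}\big]$ for $u,v\in B$ (empty sums are $0$). The Gaussian free field (GFF) on $V_N$ is the centered Gaussian vector $\{\phi_v\}_{v\in V_N}$ with covariance matrix $G_{V_N}$. Neighborhoods. For $v=(v_1,v_2)\in V_N$ and $\lambda\in(0,1)$ let $[v]_\lambda=\big([v_1-\tfrac12N^{1-\lambda},v_1+\tfrac12N^{1-\lambda}]\times[v_2-\tfrac12N^{1-\lambda},v_2+\tfrac12N^{1-\lambda}]\big)\cap V_N$; also $[v]_0=V_N$ and $[v]_1=\{v\}$. Let $\mathcal F_{v,\lambda}=\sigma(\{\phi_w: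 w\in V_N,\ w\notin[v]_\lambda^o\})$ and $\phi_v(\lambda)=\mathbb E[\phi_v\mid\mathcal F_{v,\lambda}]$. Scale-inhomogeneous GFF. Fix $M\in\mathbb N$, $\boldsymbol\sigma=(\sigma_1,\dots,\sigma_M)\in(0,\infty)^M$ and $\boldsymbol\lambda=(\lambda_1,\dots,\lambda_M)$ with $0=\lambda_0<\lambda_1<\dots<\lambda_M=1$. The $(\boldsymbol\sigma,\boldsymbol\lambda)$-GFF on $V_N$ is $\psi_v=\sum_{i=1}^M\sigma_i(\phi_v(\lambda_i)-\phi_v(\lambda_{i-1}))$, $v\in V_N$. Let $\sigma(s)=\sigma_1 1_{\{0\}}(s)+\sum_{i=1}^M\sigma_i1_{(\lambda_{i-1},\lambda_i]}(s)$, $s\in[0,1]$. Effective variance. Let $\hat{\mathcal J}_{\sigma^2}$ be the least concave majorant on $[0,1]$ of $s\mapsto\int_0^s\sigma^2(r)\,dr$ (its graph is the concave hull). $\bar\sigma$ denotes the unique positive, non-increasing, left-continuous step function with $\hat{\mathcal J}_{\sigma^2}(s)=\int_0^s\bar\sigma^2(r)\,dr$ for all $s\in(0,1]$. *)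

(* Defs.v *)
From HB Require Import structures.
From mathcomp Require Import all_boot all_order all_algebra.
From mathcomp Require Import all_classical all_reals all_analysis.

Set Implicit Arguments.
Unset Strict Implicit.
Unset Printing Implicit Defensive.

Import Order.TTheory GRing.Theory Num.Theory.
Import numFieldNormedType.Exports.

Local Open Scope classical_set_scope.
Local Open Scope ring_scope.

(** * Lattice geometry *)

Definition Z2 : Type := (int * int)%type.

(* For lattice points, Euclidean distance 1 is squared distance 1. *)
Definition lattice_adj (v z : Z2) : bool :=
  (v.1 - z.1) ^+ 2 + (v.2 - z.2) ^+ 2 == 1.

Definition boundary (B : set Z2) : set Z2 :=
  [set v | B v /\ exists z, ~ B z /\ lattice_adj v z].

Definition inner (B : set Z2) : set Z2 := B `\` boundary B.

Definition VN (N : nat) : set Z2 :=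
  [set v | 0 <= v.1 <= N%:Z /\ 0 <= v.2 <= N%:Z].

(* The same box as a finite type; it indexes the fields on [VN N]. *)
Definition box (N : nat) : finType := ('I_N.+1 * 'I_N.+1)%type.

Definition site (N : nat) (v : box N) : Z2 :=
  ((nat_of_ord v.1)%:Z, (nat_of_ord v.2)%:Z).

Definition nbhd (R : realType) (N : nat) (l : R) (v : Z2) : set Z2 :=
  if l == 0 then VN N else if l == 1 then [set v] else
  let r := 2^-1 * (N%:R `^ (1 - l)) in
  VN N `&` [set w | w.1%:~R \in `[v.1%:~R - r, v.1%:~R + r] /\
                    w.2%:~R \in `[v.2%:~R - r, v.2%:~R + r]].

(** * Simple random walk and Green function *)

Definition srw_kernel (R : realType) (x y : Z2) : R :=
  if lattice_adj x y then 4^-1 else 0.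

(* Z2 carries no measurable structure, hence the first conjunct: each W k is
   a random variable with values in a countable discrete space. *)
Definition simple_random_walk (R : realType) (d : measure_display)
    (Om : measurableType d) (P : probability Om R) (W : nat -> Om -> Z2)
    (u : Z2) : Prop :=
  (forall k x, measurable [set w | W k w = x]) /\
  (forall k (x : nat -> Z2),
     P [set w | forall i, (i <= k)%N -> W i w = x i] =
     ((x 0%N == u)%:R * \prod_(i < k) srw_kernel R (x i) (x i.+1))%:E).

(* Equal to +oo on the event that B is never hit. *)
Definition hitting_time (R : realType) (Om : Type) (W : nat -> Om -> Z2)
    (B : set Z2) (w : Om) : \bar R :=
  ereal_inf [set (k%:R)%:E | k in [set k : nat | B (W k w)]].

Definition green (R : realType) (d : measure_display)
    (Om : measurableType d) (P : Z2 -> probability Om R)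
    (W : nat -> Om -> Z2) (B : set Z2) (u v : Z2) : \bar R :=
  ((pi / 2)%:E *
   \int[P u]_w
     \sum_(0 <= k <oo | (k%:R)%:E < hitting_time R W (boundary B) w)
        ((W k w == v)%:R)%:E)%E.

(** * Gaussian vectors and the Gaussian free field *)

(* [normal_prob m 0] is a junk value, so the degenerate law is given apart. *)
Definition gaussian_law (R : realType) (m s : R) (B : set R) : \bar R :=
  if s == 0 then \d_m B else normal_prob m s B.

Definition gaussian_vector (R : realType) (d : measure_display)
    (T : measurableType d) (P : probability T R) (I : finType)
    (X : I -> {RV P >-> R}) : Prop :=
  forall a : I -> R, exists m s : R, 0 <= s /\
    forall B : set R, measurable B ->
      P [set w | B (\sum_i a i * X i w)] = gaussian_law m s B.

Definition is_gff (R : realType) (d : measure_display)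
    (T : measurableType d) (P : probability T R) (N : nat)
    (G : Z2 -> Z2 -> \bar R) (phi : box N -> {RV P >-> R}) : Prop :=
  [/\ gaussian_vector phi,
      forall v, 'E_P[phi v]%E = 0%E
    & forall u v, covariance P (phi u) (phi v) = G (site u) (site v)].

(** * Conditional expectation and the inhomogeneous field *)

Definition is_cond_expectation (R : realType) (d : measure_display)
    (T : measurableType d) (P : probability T R) (F : set (set T))
    (X Y : T -> R) : Prop :=
  [/\ forall B : set R, measurable B -> F (Y @^-1` B),
      P.-integrable [set: T] (EFin \o Y)
    & forall A, F A -> (\int[P]_(w in A) (Y w)%:E = \int[P]_(w in A) (X w)%:E)%E].

Definition outer_sigma_algebra (R : realType) (d : measure_display)
    (T : measurableType d) (N : nat) (phi : box N -> T -> R)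
    (v : box N) (l : R) : set (set T) :=
  <<s \bigcup_(w in [set w : box N | ~ inner (nbhd N l (site v)) (site w)])
        preimage_set_system [set: T] (phi w) measurable >>.

(* Only sigma 1, ..., sigma M and lam 0, ..., lam M are used; [phic l v] stands
   for the conditional expectation phi_v(l). *)
Definition inhomogeneous_field (R : realType) (T : Type) (N M : nat)
    (sigma lam : nat -> R) (phic : R -> box N -> T -> R)
    (v : box N) (w : T) : R :=
  \sum_(1 <= i < M.+1) sigma i * (phic (lam i) v w - phic (lam i.-1) v w).

Definition field_max (R : realType) (N : nat) (f : box N -> R) : R :=
  \big[Order.max/f (ord0, ord0)]_(v : box N) f v.

(** * Variance profile and its concavification *)

Definition sigma_fun (R : realType) (M : nat) (sigma lam : nat -> R) (s : R)
    : R :=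
  sigma 1%N * \1_[set 0 : R] s +
  \sum_(1 <= i < M.+1) sigma i * \1_(`]lam i.-1, lam i]%classic) s.

Definition var_integral (R : realType) (f : R -> R) (s : R) : R :=
  \int[lebesgue_measure]_(r in `[0, s]) (f r) ^+ 2.

Definition concave01 (R : realType) (f : R -> R) : Prop :=
  convex_function (`[0, 1]%classic : set R) (fun s => - f s).

Definition least_concave_majorant (R : realType) (J Jhat : R -> R) : Prop :=
  [/\ concave01 Jhat,
      {in `[0, 1], forall s, J s <= Jhat s}
    & forall g : R -> R, concave01 g ->
        {in `[0, 1], forall s, J s <= g s} ->
        {in `[0, 1], forall s, Jhat s <= g s}].

Definition step_function01 (R : realType) (f : R -> R) : Prop :=
  exists (n : nat) (t : nat -> R),
    [/\ t 0%N = 0, t n = 1, forall i, (i < n)%N -> t i < t i.+1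
      & forall i, (i < n)%N ->
          exists c, {in `]t i, t i.+1[, forall s, f s = c}].

(* The value at 0 is left free: it is irrelevant to all integrals, and the
   identity with Jhat determines [sbar] on ]0, 1] only. *)
Definition is_effective_sigma (R : realType) (Jhat sbar : R -> R) : Prop :=
  [/\ {in `]0, 1], forall s, 0 < sbar s},
      {in `]0, 1] &, forall s r, s <= r -> sbar r <= sbar s},
      {in `]0, 1], forall s, sbar r @[r --> s^'-] --> sbar s},
      step_function01 sbar
    & {in `]0, 1], forall s, Jhat s = var_integral sbar s}].

(** * Convergence in probability to a constant *)

(* The N-th variable may live on its own probability space. *)
Definition cvg_in_probability (R : realType) (d : nat -> measure_display)
    (T : forall N, measurableType (d N)) (P : forall N, probability (T N) R)
    (X : forall N, T N -> R) (c : R) : Prop :=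
  forall eps : R, 0 < eps ->
    P N [set w | eps < `|X N w - c|] @[N --> \oo] --> 0%E.

(* Main.v *)
(** In the Gaussian space of the field, phi_v - phi_v(l) is the orthogonal
  projection of phi_v off the field outside the box [v]_l.  The killed Green
  functions are compared, by the maximum principle, with the explicit potential
  log(1 + |x|^2) / 2, whose discrete Laplacian has total mass pi / 2; this gives
  Var(phi_v(l') - phi_v(l)) = (l' - l + o(1)) log N, small fluctuations of
  phi(l) within a box of side N^(1-l), and small covariances between increments
  over separated boxes.

  Let b_i be the value of the effective deviation on the i-th interval, of length
  D_i, and let S_k(v) be the sum of the first k increments weighted by sigma_i / b_i.
  Then Var S_k(v) <= lambda_k log N, so a union bound over N^(2 lambda_k) points
  shows that S_k <= 2 (lambda_k + o(1)) log N everywhere.  As b is nonincreasing,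
  Abel summation turns this into psi_v <= 2 (sum_i b_i D_i + o(1)) log N, and
  sum_i b_i D_i = sum_i (sigma_i^2 / b_i) D_i because the concave hull touches the
  variance profile wherever its slope changes.  Conversely, a truncated second
  moment argument, under the tilting that shifts the i-th increment by
  2 (sigma_i / b_i) D_i log N, produces points with
  psi_v >= 2 (sum_i (sigma_i^2 / b_i) D_i - o(1)) log N; the truncation needs strict
  inequalities, obtained by refining the scales and dropping the first ones. *)

From HB Require Import structures.
From mathcomp Require Import all_boot all_order all_algebra.
From mathcomp Require Import all_classical all_reals all_analysis.
From mathcomp Require Import measurable_realfun.
From mathcomp Require Import ring lra zify.
Require Import Defs.

Set Implicit Arguments.
Unset Strict Implicit.
Unset Printing Implicit Defensive.

Import Order.TTheory GRing.Theory Num.Theory.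
Import numFieldNormedType.Exports.

Local Open Scope classical_set_scope.
Local Open Scope ring_scope.

(** First-order asymptotics tolerate any error that is small compared with [ln N], and this decides
    the tools. The potential kernel of the lattice is harmonic off its pole but has no closed form,
    while [flog] is explicit but not harmonic. So the pole of the killed Green function is averaged
    against [elog] (see [smear]): the averaged function and [- flog] then have the same Laplacian,
    and the maximum principle compares them with no further error. The averaging moves a projection
    by a bounded norm, because [prj A] is Lipschitz uniformly in [A]; against a vector of norm at
    most of order [sqrt (ln N)] this is negligible.

    The hypothesis on the field only gives the laws of single linear combinations. Tail bounds
    therefore dominate indicators by combinations of exponentials of the field, or minorize them,
    and the conditional expectation is identified by trigonometric test functions; joint densities
    never appear.

    Each [N] has its own probability space, so every estimate is stated for all [N] large enough and
    then for every form [ip] and every field over it. *)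

Ltac nonneg := repeat first
  [ exact: expR_ge0 | exact: sqr_ge0 | exact: normr_ge0 | exact: ler0n | exact: ler01
  | assumption | (apply: ltW; assumption) | apply: addr_ge0 | apply: mulr_ge0
  | apply: divr_ge0 | apply: exprn_ge0 | rewrite invr_ge0 ].

(** * Normal laws *)

Section normal_integral.
Context {R : realType}.
Local Notation mu := (@lebesgue_measure R).
Variables m s : R.
Let nu := normal_prob m s.
Let p := normal_pdf m s.
Let mp : measurable_fun [set: R] p. Proof. exact: measurable_normal_pdf. Qed.
Let p0 x : 0 <= p x. Proof. exact: normal_pdf_ge0. Qed.

Import HBNNSimple.

Let integral_nnsfun_density (f : {nnsfun _ >-> R}) :
  (\int[nu]_x (f x)%:E = \int[mu]_x ((f x)%:E * (p x)%:E))%E.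
Proof.
under [LHS]eq_integral do rewrite fimfunE -fsumEFin//.
rewrite [LHS]ge0_integral_fsum//; last 2 first.
  - by move=> r; exact/measurable_EFinP/measurableT_comp.
  - by move=> n x _; rewrite EFinM nnfun_muleindic_ge0.
under [RHS]eq_integral.
  move=> x xD; rewrite fimfunE -fsumEFin// muleC ge0_mule_fsumr; last first.
    by move=> r; rewrite EFinM nnfun_muleindic_ge0.
  over.
rewrite [RHS]ge0_integral_fsum//; last 2 first.
  - move=> r; apply: emeasurable_funM; first exact/measurable_EFinP.
    by apply/measurable_EFinP; apply: measurable_funM => //; exact: measurable_indic.
  - move=> n x _; apply: mule_ge0; first by rewrite lee_fin.
    by rewrite EFinM nnfun_muleindic_ge0.
apply: eq_fsbigr => r _; rewrite integralZl_indic_nnsfun//= integral_indic//= setIT.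
transitivity (r%:E * \int[mu]_(x in f @^-1` [set r]) (p x)%:E)%E; first by [].
under [RHS]eq_integral do rewrite EFinM muleCA.
rewrite /=.
have [r0|r0] := leP 0 r; last first.
  rewrite preimage_nnfun0// integral_set0 mule0.
  by rewrite integral0_eq// => x _; rewrite indic0 ?mule0.
rewrite ge0_integralZl//=.
- congr (_ * _)%E; rewrite integral_mkcond; apply: eq_integral => x _.
  rewrite patchE indicE; case: ifPn => xA; first by rewrite ?mule1.
  by rewrite mule0.
- apply/measurable_EFinP; apply: measurable_funM => //.
- by move=> x _; rewrite mule_ge0// lee_fin p0.
Qed.

(** The density formula passes from simple functions to nonnegative ones by monotone convergence on
    both sides. *)
Lemma ge0_integral_normal_prob (f : _ -> \bar R) : measurable_fun setT f ->
  (forall x, (0 <= f x)%E) -> (\int[nu]_x f x = \int[mu]_x (f x * (p x)%:E))%E.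
Proof.
move=> mf f0; pose f_ := nnsfun_approx measurableT mf.
transitivity (lim (\int[nu]_x (f_ n x)%:E @[n --> \oo])%E).
  rewrite -monotone_convergence//=.
  - apply: eq_integral => ? /[!inE] xD; apply/esym/cvg_lim => //=.
    exact: cvg_nnsfun_approx.
  - by move=> n; exact/measurable_EFinP/measurable_funTS.
  - by move=> n ? _; rewrite lee_fin.
  - by move=> ? _ ? ? mn; rewrite lee_fin; exact/lefP/nd_nnsfun_approx.
rewrite (_ : (fun n => _) = fun n => (\int[mu]_x ((f_ n x)%:E * (p x)%:E))%E); last first.
  by apply/funext => n; rewrite integral_nnsfun_density.
rewrite -monotone_convergence//=.
- apply: eq_integral => x /[!inE] xD; apply/cvg_lim => //=.
  by apply: cvgeZr => //; apply: cvg_nnsfun_approx.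
- move=> n; apply: emeasurable_funM; last exact/measurable_EFinP.
  exact/measurable_EFinP/measurable_funTS.
- by move=> n x _; rewrite -EFinM lee_fin mulr_ge0 ?p0.
- move=> x _ k n kn; apply: lee_wpmul2r; first by rewrite lee_fin p0.
  by rewrite lee_fin; exact/lefP/nd_nnsfun_approx.
Qed.
End normal_integral.

Section normal.
Context {R : realType}.
Variables (m s : R).
Hypothesis s0 : s != 0.
Local Notation mu := (@lebesgue_measure R).

(** Cameron-Martin formula in dimension one: the substitution [x + h * s ^+ 2] completes the square
    in the density. A constant [f] gives the moment generating function, a quadratic one the tilted
    second moments. *)
Lemma normal_prob_shift (h : R) (f : R -> R) : continuous f -> (forall x, 0 <= f x) ->
  (\int[normal_prob m s]_x (expR (h * (x - m)) * f x)%:E =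
   (expR (h ^+ 2 * s ^+ 2 / 2))%:E * \int[normal_prob m s]_x (f (x + h * s ^+ 2))%:E)%E.
Proof.
move=> cf f0.
have mf : measurable_fun [set: R] f by exact: continuous_measurable_fun.
have ce : continuous (fun x : R => expR (h * (x - m))).
  move=> x; apply: continuous_comp; last exact: continuous_expR.
  apply: cvgM; first exact: cvg_cst.
  apply: cvgB; [exact: cvg_id|exact: cvg_cst].
have me := continuous_measurable_fun ce.
have cs : continuous (fun x : R => x + h * s ^+ 2).
  by move=> x; apply: cvgD; [exact: cvg_id|exact: cvg_cst].
have ms := continuous_measurable_fun cs.
have p0 := normal_pdf_ge0 m s.
rewrite ge0_integral_normal_prob; first last.
- by move=> x; rewrite lee_fin mulr_ge0 ?expR_ge0.
- by apply/measurable_EFinP; apply: measurable_funM.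
rewrite ge0_integral_normal_prob; first last.
- by move=> x; rewrite lee_fin.
- apply/measurable_EFinP; exact: measurableT_comp.
under eq_integral do rewrite -EFinM.
have DF : (fun x : R => x + h * s ^+ 2)^`()%classic = cst 1.
  apply/funext => x; rewrite derive1E deriveD//= derive_id derive_cst addr0//.
rewrite (@increasing_ge0_integration_by_substitutionT _ (fun x => x + h * s ^+ 2)); first last.
- by move=> x; rewrite !mulr_ge0 ?expR_ge0.
- move=> x; apply: cvgM; last exact: continuous_normal_pdf.
  by apply: cvgM; [exact: ce|exact: cf].
- exact: cvg_addrr.
- exact: cvg_addrr_Ny.
- by move=> x.
- by rewrite DF; exact: is_cvg_cst.
- by rewrite DF; exact: is_cvg_cst.
- by rewrite DF => x; exact: cvg_cst.
- by move=> x y xy; rewrite ltrD2r.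
rewrite DF -ge0_integralZl//=.
- apply: eq_integral => x _; rewrite !fctE -!EFinM; congr EFin.
  rewrite mulr1 /= !normal_pdfE// /normal_fun.
  set y := f _; set a := expR _; set b := expR _; set c := expR _; set e := expR _.
  have E : a * b = c * e by rewrite -!expRD; congr expR; field; rewrite s0.
  transitivity (normal_peak s * y * (a * b)); first by ring.
  by rewrite E; ring.
- have H : measurable_fun [set: R] (fun x : R => ((f (x + h * s ^+ 2))%:E * (normal_pdf m s x)%:E)%E).
    have mp : measurable_fun [set: R] (normal_pdf m s) by exact: measurable_normal_pdf.
    have mfs : measurable_fun [set: R] (fun x : R => f (x + h * s ^+ 2)).
      exact: (measurableT_comp mf ms).
    by apply: emeasurable_funM; exact/measurable_EFinP.
  exact: H.
- by move=> x _; rewrite -EFinM lee_fin mulr_ge0.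
Qed.

Lemma normal_prob_mgf (h : R) :
  (\int[normal_prob m s]_x (expR (h * x))%:E = (expR (h * m + h ^+ 2 * s ^+ 2 / 2))%:E)%E.
Proof.
have := @normal_prob_shift h (cst (expR (h * m))) _ _.
rewrite /cst /= integral_cst//= probability_setT mule1 -EFinM -expRD addrC.
move=> <-; last 2 first.
- by move=> x; exact: cvg_cst.
- by move=> x; exact: expR_ge0.
apply: eq_integral => x _; rewrite -expRD; congr (expR _)%:E; ring.
Qed.
End normal.

(** With [a = t / 2] this is the square of [tanh a <= a], which follows from
    [expR (2 * a) * (1 - a) <= 1 + a]. Together with the next lemma it replaces differentiating a
    moment generating function twice under the integral. *)
Lemma expR_symm_le {R : realType} (t : R) :
  expR t + expR (- t) - 2 <= t ^+ 2 * (expR t + expR (- t)) / 2.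
Proof.
wlog t0 : t / 0 <= t => [H|].
  have [/H//|t0] := leP 0 t.
  have := H (- t); rewrite opprK sqrrN [expR (- t) + _]addrC; apply.
  by rewrite oppr_ge0 ltW.
pose a := t / 2.
have a0 : 0 <= a by rewrite divr_ge0.
have key : expR (2 * a) * (1 - a) <= 1 + a.
  pose g : R -> R := (fun x => 1 + x) \- (expR \o (fun x => 2 * x)) \* (fun x => 1 - x).
  have dg (x : R) : is_derive x 1 g (1 - expR (2 * x) * (1 - 2 * x)).
    rewrite /g; apply: is_derive_eq.
    rewrite /= /GRing.scale /=. ring.
  have gc : {within `[0, a], continuous g}.
    by apply: derivable_within_continuous => x _; exact: ex_derive.
  have [c cI] := MVT_segment a0 (fun x _ => dg x) gc.
  have : 0 <= 1 - expR (2 * c) * (1 - 2 * c).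
    have e1 := expRxMexpNx_1 (2 * c).
    by rewrite -{1}e1 -mulrBr mulr_ge0 ?expR_ge0// subr_ge0; exact: expR_ge1Dx.
  rewrite /g /= subr0 mulr0 expR0 => h E.
  suff : 0 <= (1 + a - expR (2 * a) * (1 - a)) - (1 + 0 - 1 * 1) by lra.
  by rewrite E mulr_ge0// subr0.
have key2 : (expR a - expR (- a)) <= a * (expR a + expR (- a)).
  rewrite -(ler_pM2l (expR_gt0 a)).
  have e1 : expR a * expR (- a) = 1 by rewrite -expRD subrr expR0.
  have e2 : expR a * expR a = expR (2 * a) by rewrite -expRD; congr expR; ring.
  have -> : expR a * (expR a - expR (- a)) = expR (2 * a) - 1 by rewrite mulrBr e1 e2.
  have -> : expR a * (a * (expR a + expR (- a))) = a * (expR (2 * a) + 1).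
    by rewrite mulrCA mulrDr e1 e2.
  by move: key; set E := expR _ => key; lra.
have d0 : 0 <= expR a - expR (- a) by rewrite subr_ge0 ler_expR; lra.
have sq : (expR a - expR (- a)) ^+ 2 <= a ^+ 2 * (expR a + expR (- a)) ^+ 2.
  by rewrite -exprMn ler_pXn2r// ?nnegrE//; apply: le_trans key2.
have tE : t = a + a by rewrite /a; lra.
have e1 : expR a * expR (- a) = 1 by rewrite -expRD subrr expR0.
have -> : expR t = expR a ^+ 2 by rewrite tE expRD.
have -> : expR (- t) = expR (- a) ^+ 2 by rewrite tE opprD expRD.
have : 2 <= expR a ^+ 2 + expR (- a) ^+ 2.
  by have := sqr_ge0 (expR a - expR (- a)); move: e1; set X := expR a; set Y := expR _; nra.
rewrite tE; move: e1 sq; set X := expR a; set Y := expR _ => e1 sq ge2.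
have : a ^+ 2 * (X + Y) ^+ 2 <= (a + a) ^+ 2 * (X ^+ 2 + Y ^+ 2) / 2.
  have -> : (X + Y) ^+ 2 = X ^+ 2 + Y ^+ 2 + 2 by rewrite sqrrD e1; ring.
  have : 0 <= a ^+ 2 * (X ^+ 2 + Y ^+ 2 - 2) by rewrite mulr_ge0 ?sqr_ge0// subr_ge0.
  lra.
apply: le_trans; rewrite -(_ : (X - Y) ^+ 2 = X ^+ 2 + Y ^+ 2 - 2)//.
by rewrite sqrrB e1; ring.
Qed.

(** The excess over 2 is the square of [expR a - expR (- a)] at [a = t / 2], and that difference is
    at least [2 * a] by the mean value theorem. *)
Lemma expR_symm_ge {R : realType} (t : R) : 2 + t ^+ 2 <= expR t + expR (- t).
Proof.
have sq (a : R) : expR (a + a) + expR (- (a + a)) = (expR a - expR (- a)) ^+ 2 + 2.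
  have e1 : expR a * expR (- a) = 1 by rewrite -expRD subrr expR0.
  rewrite opprD !expRD sqrrB e1; ring.
wlog t0 : t / 0 <= t => [H|].
  have [/H//|t0] := leP 0 t.
  have := H (- t); rewrite opprK sqrrN [expR (- t) + _]addrC; apply.
  by rewrite oppr_ge0 ltW.
pose a := t / 2.
have a0 : 0 <= a by rewrite divr_ge0.
have tE : t = a + a by rewrite /a; lra.
pose g : R -> R := expR \- (expR \o -%R) \- (fun x => 2 * x).
have dg (x : R) : is_derive x 1 g (expR x + expR (- x) - 2).
  rewrite /g; apply: is_derive_eq.
  rewrite /= /GRing.scale /=; ring.
have gc : {within `[0, a], continuous g}.
  by apply: derivable_within_continuous => x _; exact: ex_derive.
have [c cI] := MVT_segment a0 (fun x _ => dg x) gc.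
rewrite /g /= oppr0 expR0 mulr0 subrr !subr0 => E.
have key : 2 * a <= expR a - expR (- a).
  rewrite -subr_ge0 E mulr_ge0 ?addr0//.
  have -> : c = c / 2 + c / 2 by lra.
  by rewrite sq addrK sqr_ge0.
rewrite tE sq [leLHS]addrC lerD2r.
have -> : a + a = 2 * a by ring.
by rewrite ler_pXn2r// ?nnegrE ?mulr_ge0//; apply: le_trans key; rewrite mulr_ge0.
Qed.

(** * Moments of a real Gaussian variable, derived from its law *)

Section gaussian_rv.
Context {R : realType} {d : measure_display} {T : measurableType d}.
Variables (P : probability T R) (X : {RV P >-> R}) (m s : R).
Hypothesis s0 : 0 <= s.
Hypothesis law : forall B : set R, measurable B ->
      P [set w | B (X w)] = gaussian_law m s B.

Let ge0_integral_law (f : R -> R) : continuous f -> (forall x, 0 <= f x) ->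
  (\int[P]_w (f (X w))%:E =
   if (s == 0)%R then (f m)%:E else \int[normal_prob m s]_x (f x)%:E)%E.
Proof.
move=> cf f0; have mf := continuous_measurable_fun cf.
have mEf : measurable_fun [set: R] (EFin \o f) by exact/measurable_EFinP.
case: ifPn => [/eqP se|sn].
  transitivity (\int[distribution P X]_x (EFin \o f) x)%E.
    by rewrite ge0_integral_distribution// => x; rewrite lee_fin.
  transitivity (\int[@dirac _ R m R]_x (EFin \o f) x)%E.
    apply: eq_measure_integral => A mA _.
    transitivity (gaussian_law m s A); first exact: law.
    by rewrite /gaussian_law se eqxx.
  by rewrite integral_dirac// diracT mul1e.
(* The law is compared with [normal_prob] as measures on [measurableTypeR R], so [X] is repackaged
   with this target. *)
have mX' : measurable_fun [set: T] (X : T -> measurableTypeR R) by move=> _ B mB; exact: (@measurable_funP _ _ T R setT X measurableT B mB).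
pose X'mixin := isMeasurableFun.Build _ _ T (measurableTypeR R) X mX'.
pose X' : {mfun T >-> measurableTypeR R} := HB.pack (X : T -> measurableTypeR R) X'mixin.
transitivity (\int[distribution P X']_x (EFin \o f) x)%E.
  by rewrite ge0_integral_distribution// => x; rewrite lee_fin.
apply: eq_measure_integral => A mA _.
transitivity (gaussian_law m s A); first exact: law.
by rewrite /gaussian_law (negbTE sn).
Qed.

Lemma gaussian_mgf (h : R) :
  (\int[P]_w (expR (h * X w))%:E = (expR (h * m + h ^+ 2 * s ^+ 2 / 2))%:E)%E.
Proof.
rewrite (@ge0_integral_law (fun x => expR (h * x))); last 2 first.
- move=> x; apply: continuous_comp; last exact: continuous_expR.
  by apply: cvgM; [exact: cvg_cst|exact: cvg_id].
- by move=> x; exact: expR_ge0.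
case: ifPn => [/eqP ->|sn]; last exact: normal_prob_mgf.
by rewrite expr0n/= mulr0 mul0r addr0.
Qed.

Let mX : measurable_fun setT X. Proof. exact: measurable_funP. Qed.

Lemma integrable_expR_gaussian (h : R) : P.-integrable setT (fun w => (expR (h * X w))%:E).
Proof.
apply/integrableP; split.
  by apply/measurable_EFinP; apply: measurableT_comp => //; exact: measurable_funM.
under eq_integral do rewrite abse_EFin ger0_norm ?expR_ge0//.
by rewrite gaussian_mgf ltry.
Qed.

Lemma integrable_gaussian : P.-integrable setT (EFin \o X).
Proof.
apply: (@le_integrable _ _ _ P _ _ _ (fun w => (expR (1 * X w))%:E + (expR (-1 * X w))%:E)%E) => //.
- exact/measurable_EFinP.
- move=> w _; rewrite /= lee_fin [leRHS]ger0_norm ?addr_ge0 ?expR_ge0// mul1r mulN1r.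
  rewrite ler_norml; apply/andP; split.
    have := expR_ge1Dx (- X w); have := expR_ge0 (X w); lra.
  have := expR_ge1Dx (X w); have := expR_ge0 (- X w); lra.
- by apply: integrableD => //; exact: integrable_expR_gaussian.
Qed.

(** Integrating [1 + h * X <= expR (h * X)] makes the exponent [h * m + h ^+ 2 * s ^+ 2 / 2]
    nonnegative for every [h], which the linear term forbids near [h = 0] unless [m = 0]. *)
Lemma gaussian_mean0 : ('E_P[X] = 0)%E -> m = 0.
Proof.
rewrite unlock => EX; apply/eqP/negPn/negP => m0.
have H (h : R) : 0 <= h * m + h ^+ 2 * s ^+ 2 / 2.
  rewrite -ler_expR expR0 -lee_fin -gaussian_mgf.
  have -> : 1%E = (\int[P]_w (1 + h * X w)%:E)%E.
    under eq_integral do rewrite EFinD EFinM.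
    rewrite integralD//=; last 2 first.
    - exact: finite_measure_integrable_cst.
    - by apply: integrableZl => //; exact: integrable_gaussian.
    rewrite integralZl//; last exact: integrable_gaussian.
    by rewrite integral_cst//= probability_setT EX mule0 adde0 mul1e.
  apply: le_integral => //.
  - under eq_fun do rewrite EFinD EFinM.
    apply: integrableD => //=; first exact: finite_measure_integrable_cst.
    by apply: integrableZl => //; exact: integrable_gaussian.
  - exact: integrable_expR_gaussian.
  - by move=> w _; rewrite lee_fin expR_ge1Dx.
have p : 0 < s ^+ 2 + 1 by rewrite ltr_wpDl ?sqr_ge0.
(* Close to the minimizer [- m / s ^+ 2] of the exponent; the added 1 covers [s = 0]. *)
have := H (- m / (s ^+ 2 + 1)); apply/negP; rewrite -ltNge.
have -> : - m / (s ^+ 2 + 1) * m + (- m / (s ^+ 2 + 1)) ^+ 2 * s ^+ 2 / 2 =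
  - (m ^+ 2 * (s ^+ 2 + 2) / (s ^+ 2 + 1) ^+ 2 / 2) by field; rewrite gt_eqF.
have p2 : 0 < s ^+ 2 + 2 by rewrite ltr_wpDl ?sqr_ge0.
by rewrite oppr_lt0 divr_gt0// divr_gt0 ?exprn_gt0// mulr_gt0// exprn_even_gt0.
Qed.


(** The second moment [U] is squeezed with the generating function alone. Integrating [expR_symm_ge]
    gives [up]: at [h = 1] it proves [U] finite, and for small [h] that [U] is at most the variance.
    Integrating [expR_symm_le], whose right side is a tilted second moment computed by [shift],
    gives [lo] and the converse. *)
Lemma gaussian_second_moment : m = 0 -> (\int[P]_w (X w)%:E = 0)%E ->
  (P.-integrable setT (fun w => (X w ^+ 2)%:E)) /\ (\int[P]_w (X w ^+ 2)%:E = (s ^+ 2)%:E)%E.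
Proof.
move=> me EX0; pose U := (\int[P]_w (X w ^+ 2)%:E)%E.
have mX2 : measurable_fun setT (fun w => X w ^+ 2) by exact: measurable_funX.
have U0 : (0 <= U)%E by apply: integral_ge0 => w _; rewrite lee_fin sqr_ge0.
have mexp (h : R) : measurable_fun setT (fun w => expR (h * X w)).
  by apply: measurableT_comp => //; exact: measurable_funM.
have mexpN (h : R) : measurable_fun setT (fun w => expR (- (h * X w))).
  by under eq_fun do rewrite -mulNr; exact: mexp.
have cosh (h : R) : (\int[P]_w (expR (h * X w) + expR (- (h * X w)))%:E =
    (2 * expR (h ^+ 2 * s ^+ 2 / 2))%:E)%E.
  under eq_integral do rewrite EFinD -mulNr.
  rewrite integralD//; try exact: integrable_expR_gaussian.
  rewrite !gaussian_mgf me !mulr0 !add0r sqrrN -EFinD; congr EFin; ring.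
have up (h : R) : ((h ^+ 2)%:E * U + (2 : R)%:E <= (2 * expR (h ^+ 2 * s ^+ 2 / 2))%:E)%E.
  rewrite -cosh /U.
  have <- : (\int[P]_w (h ^+ 2 * X w ^+ 2)%:E)%E = ((h ^+ 2)%:E * \int[P]_w (X w ^+ 2)%:E)%E.
    under eq_integral do rewrite EFinM.
    apply: ge0_integralZl => //.
    - exact/measurable_EFinP.
    - by move=> w _; rewrite lee_fin sqr_ge0.
    - by rewrite lee_fin sqr_ge0.
  have <- : (\int[P]_w (cst (2 : R)%:E w))%E = (2 : R)%:E :> \bar R.
    by rewrite integral_cst//= probability_setT mule1.
  rewrite -ge0_integralD//; last 2 first.
  - by apply/measurable_EFinP; apply: measurable_funM.
  - by move=> w _; rewrite lee_fin.
  apply: ge0_le_integral => //.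
  - move=> w _; apply: adde_ge0; first by rewrite lee_fin mulr_ge0 ?sqr_ge0.
    by rewrite /= lee_fin.
  - by apply/measurable_EFinP; apply: measurable_funD => //; apply: measurable_funM.
  - apply/measurable_EFinP; apply: measurable_funD => //; exact: mexpN.
  - by move=> w _; rewrite /= -EFinD lee_fin -exprMn addrC expR_symm_ge.
  by move=> w _; rewrite lee_fin mulr_ge0 ?sqr_ge0.
have Ufin : U \is a fin_num.
  rewrite ge0_fin_numE//; have := up 1; rewrite expr1n mul1e => H.
  apply: (@le_lt_trans _ _ (U + (2 : R)%:E)%E); first by rewrite leeDl.
  by apply: (le_lt_trans H); rewrite ltry.
have iX2 : P.-integrable setT (fun w => (X w ^+ 2)%:E).
  apply/integrableP; split; first exact/measurable_EFinP.
  under eq_integral do rewrite abse_EFin ger0_norm ?sqr_ge0//.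
  by rewrite -/U -ge0_fin_numE.
split=> //; rewrite -/U; have [u uE] : exists u, U = u%:E by exists (fine U); rewrite fineK.
rewrite uE; congr EFin.
have u0 : 0 <= u by rewrite -lee_fin -uE.
have upr (y : R) : 0 < y -> u * y <= s ^+ 2 * (expR y - 1).
  move=> y0; have [s00|sn0] := eqVneq s 0.
    have := up 1; rewrite uE -EFinM -EFinD lee_fin s00 expr0n/= mulr0 mul0r expR0.
    nra.
  (* This [h] turns the exponent [h ^+ 2 * s ^+ 2 / 2] into [y]. *)
  have := up (Num.sqrt (2 * y) / s).
  rewrite uE -EFinM -EFinD lee_fin exprMn sqr_sqrtr; last by rewrite mulr_ge0// ltW.
  have -> : 2 * y * s^-1 ^+ 2 * s ^+ 2 / 2 = y by field.
  have -> : 2 * y * s^-1 ^+ 2 * u = 2 * (u * y) / s ^+ 2 by field.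
  rewrite -lerBrDr ler_pdivrMr; last by rewrite exprn_even_gt0.
  lra.
have shift (h c : R) : (\int[P]_w (expR (h * X w) * (X w + c) ^+ 2)%:E =
   (expR (h ^+ 2 * s ^+ 2 / 2))%:E * \int[P]_w ((X w + h * s ^+ 2 + c) ^+ 2)%:E)%E.
  have csq (b : R) : continuous (fun x : R => (x + b) ^+ 2).
    move=> x; rewrite /continuous_at; under eq_fun do rewrite expr2; rewrite expr2.
    by apply: cvgM; apply: cvgD; [exact: cvg_id|exact: cvg_cst|exact: cvg_id|exact: cvg_cst].
  have cexp : continuous (fun x : R => expR (h * x)).
    move=> x; apply: continuous_comp; last exact: continuous_expR.
    by apply: cvgM; [exact: cvg_cst|exact: cvg_id].
  rewrite (@ge0_integral_law (fun x => expR (h * x) * (x + c) ^+ 2)); last 2 first.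
  - by move=> x; apply: cvgM; [exact: cexp|exact: csq].
  - by move=> x; rewrite mulr_ge0 ?expR_ge0 ?sqr_ge0.
  under [in RHS]eq_integral do rewrite -addrA.
  rewrite (@ge0_integral_law (fun x => (x + (h * s ^+ 2 + c)) ^+ 2)); last 2 first.
  - exact: csq.
  - by move=> x; rewrite sqr_ge0.
  case: ifPn => [/eqP s00|sn0].
    by rewrite me s00 expr0n/= !mulr0 mul0r expR0 mul1r !add0r mul1e.
  under [in RHS]eq_integral do rewrite addrA.
  have := @normal_prob_shift R m s sn0 h (fun x => (x + c) ^+ 2) (csq c) (fun x => sqr_ge0 _).
  by move=> <-; apply: eq_integral => x _; rewrite me subr0.
have lo (h : R) : 2 * (expR (h ^+ 2 * s ^+ 2 / 2) - 1) <=
    h ^+ 2 * expR (h ^+ 2 * s ^+ 2 / 2) * (u + h ^+ 2 * s ^+ 4).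
  have c2 : (\int[P]_w (expR (h * X w) * X w ^+ 2 + expR (- (h * X w)) * X w ^+ 2)%:E =
     (2 * expR (h ^+ 2 * s ^+ 2 / 2) * (u + h ^+ 2 * s ^+ 4))%:E)%E.
    have isq (b : R) : (\int[P]_w ((X w + b) ^+ 2)%:E = (u + b ^+ 2)%:E)%E.
      have -> : (fun w => ((X w + b) ^+ 2)%:E) =
          (fun w => (X w ^+ 2)%:E + (b *+ 2)%:E * (X w)%:E + (b ^+ 2)%:E)%E.
        by apply/funext => w; rewrite -EFinM -!EFinD; congr EFin; ring.
      have i1 : P.-integrable setT (fun w => ((b *+ 2)%:E * (X w)%:E)%E).
        by apply: integrableZl => //; exact: integrable_gaussian.
      rewrite integralD//; last 2 first.
      - by apply: integrableD.
      - exact: finite_measure_integrable_cst.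
      rewrite integralD// integralZl//; last exact: integrable_gaussian.
      rewrite -/U uE.
      have -> : (\int[P]_w (X w)%:E = 0)%E by exact: EX0.
      by rewrite mule0 adde0 integral_cst//= probability_setT mule1 -EFinD.
    under eq_integral do rewrite EFinD -mulNr.
    have e0 w k : (0 <= (expR (k * X w) * X w ^+ 2)%:E)%E.
      by rewrite lee_fin mulr_ge0 ?expR_ge0 ?sqr_ge0.
    have me2 k : measurable_fun setT (fun w => (expR (k * X w) * X w ^+ 2)%:E).
      by apply/measurable_EFinP; apply: measurable_funM.
    rewrite ge0_integralD//.
    have sh0 k : (\int[P]_w (expR (k * X w) * X w ^+ 2)%:E =
        (expR (k ^+ 2 * s ^+ 2 / 2) * (u + (k * s ^+ 2) ^+ 2))%:E)%E.
      have := shift k 0; under eq_integral do rewrite addr0.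
      move=> ->; under eq_integral do rewrite addr0.
      by rewrite isq EFinM.
    rewrite !sh0 -EFinD; congr EFin; rewrite sqrrN; ring.
  have H : (\int[P]_w (expR (h * X w) + expR (- (h * X w)))%:E <=
     \int[P]_w (2 + h ^+ 2 / 2 * (expR (h * X w) * X w ^+ 2 + expR (- (h * X w)) * X w ^+ 2))%:E)%E.
    apply: ge0_le_integral => //.
    - by apply/measurable_EFinP; apply: measurable_funD.
    - apply/measurable_EFinP; apply: measurable_funD => //; apply: measurable_funM => //.
      by apply: measurable_funD; apply: measurable_funM => //; exact: mexpN.
    move=> w _; rewrite lee_fin.
    have := expR_symm_le (h * X w); set A := expR _; set B := expR _.
    by rewrite exprMn; lra.
  move: H; rewrite cosh.
  under eq_integral do rewrite EFinD EFinM.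
  have m2 : measurable_fun setT (fun w => (expR (h * X w) * X w ^+ 2 + expR (- (h * X w)) * X w ^+ 2)%:E).
    apply/measurable_EFinP; apply: measurable_funD; apply: measurable_funM => //; exact: mexpN.
  have p2 w : (0 <= (expR (h * X w) * X w ^+ 2 + expR (- (h * X w)) * X w ^+ 2)%:E)%E.
    by rewrite lee_fin; nonneg.
  rewrite ge0_integralD//; last 2 first.
  - by move=> w _; rewrite mule_ge0// lee_fin divr_ge0 ?sqr_ge0.
  - by apply: emeasurable_funM.
  rewrite integral_cst//= probability_setT mule1 ge0_integralZl//; last first.
    by rewrite lee_fin divr_ge0 ?sqr_ge0.
  rewrite c2 -EFinM -EFinD lee_fin; set A := expR _; lra.
have [s00|sn0] := eqVneq s 0.
  have := upr 1 ltr01; rewrite s00 expr0n/=; nra.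
have s2 : 0 < s ^+ 2 by rewrite exprn_even_gt0.
have u2 : u <= s ^+ 2.
  rewrite leNgt; apply/negP => us.
  (* With this [y] the number [u * (1 - y)] is the midpoint of [u] and [s ^+ 2], hence above
     [s ^+ 2]; but [upr] with [expR y * (1 - y) <= 1] yields [u * (1 - y) <= s ^+ 2]. *)
  pose y := (u - s ^+ 2) / (2 * u).
  have u1 : 0 < u by apply: lt_trans us.
  have y0 : 0 < y by rewrite divr_gt0 ?mulr_gt0// subr_gt0.
  have y1 : y * (2 * u) = u - s ^+ 2 by rewrite /y divfK// gt_eqF// mulr_gt0.
  have := upr y y0.
  have e1 : expR y * (1 - y) <= 1.
    by rewrite -{2}(expRxMexpNx_1 y) ler_pM2l ?expR_gt0//; exact: (expR_ge1Dx (- y)).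
  move: e1; set E := expR y => e1 H.
  have y2 : y < 1 by nra.
  have : u * y * (1 - y) <= s ^+ 2 * y.
    apply: (@le_trans _ _ (s ^+ 2 * (E - 1) * (1 - y))); first by rewrite ler_pM2r ?subr_gt0.
    by rewrite -mulrA ler_pM2l//; lra.
  rewrite mulrAC ler_pM2r//; lra.
apply/eqP; rewrite eq_le u2 /= leNgt; apply/negP => us.
(* with y = h^2 s^2 / 2, [lo] reads  E - 1 <= y E (u / s^2 + 2 y)  and  E - 1 >= y E / E *)
pose y := (s ^+ 2 - u) / (8 * s ^+ 2).
have y0 : 0 < y by apply: divr_gt0; [rewrite subr_gt0|apply: mulr_gt0].
have y1 : y * (8 * s ^+ 2) = s ^+ 2 - u by rewrite /y divfK// gt_eqF// mulr_gt0.
have y2 : y <= 1 / 8 by nra.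
have := lo (Num.sqrt (2 * y) / s).
rewrite exprMn sqr_sqrtr; last by rewrite mulr_ge0// ltW.
have -> : 2 * y * s^-1 ^+ 2 * s ^+ 2 / 2 = y by field.
have -> : 2 * y * s^-1 ^+ 2 * s ^+ 4 = 2 * y * s ^+ 2 by field.
have e1 : expR y * (1 - y) <= 1.
  by rewrite -{2}(expRxMexpNx_1 y) ler_pM2l ?expR_gt0//; exact: (expR_ge1Dx (- y)).
have := expR_ge1Dx y; move: e1; set E := expR y => e1 e2.
have E1 : y <= E - 1 by lra.
have -> : 2 * y * s^-1 ^+ 2 * E * (u + 2 * y * s ^+ 2) = 2 * y * (E * (u / s ^+ 2 + 2 * y)) by field.
rewrite -subr_ge0 => H0.
have uE2 : u / s ^+ 2 = 1 - 8 * y.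
  by apply: (mulIf (lt0r_neq0 s2)); rewrite divfK ?gt_eqF//; lra.
(* What is left reads [E - 1 <= y * E * (1 - 6 * y)]. Since [E * (1 - y) <= 1], the right side is
   below [y], while [y <= E - 1]. *)
move: H0; rewrite uE2; nra.
Qed.

End gaussian_rv.

(** * The lattice logarithm *)

Section zsum.
Context {V : zmodType}.

(** Growing by opposite pairs makes telescoping and the use of evenness plain inductions on [n]. *)
Fixpoint zsum (n : nat) (F : int -> V) : V :=
  if n is m.+1 then zsum m F + F n%:Z + F (- n%:Z) else F 0.

Lemma zsum_ext n (F G : int -> V) : (forall a, F a = G a) -> zsum n F = zsum n G.
Proof. by move=> FG; elim: n => [|n IH] /=; rewrite ?IH !FG. Qed.

Lemma zsumD n (F G : int -> V) : zsum n (fun a => F a + G a) = zsum n F + zsum n G.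
Proof. by elim: n => [//|n IH] /=; rewrite IH [X in X + _ = _]addrACA [LHS]addrACA. Qed.

Lemma zsumN n (F : int -> V) : zsum n (fun a => - F a) = - zsum n F.
Proof. by elim: n => [//|n IH] /=; rewrite IH !opprD. Qed.

Lemma zsumB n (F G : int -> V) : zsum n (fun a => F a - G a) = zsum n F - zsum n G.
Proof. by rewrite zsumD zsumN. Qed.

Lemma zsum_delta n (F : int -> V) (c : int) : `|c| <= n%:Z :> int ->
    (forall a : int, a != c -> F a = 0) ->
  zsum n F = F c.
Proof.
elim: n => [|n IH] cn F0 /=.
  by congr F; lia.
have [cn'|cn'] := boolP (`|c| <= n%:Z :> int).
  by rewrite IH// (F0 n.+1%:Z) ?(F0 (- n.+1%:Z)) ?addr0//; lia.
have z : zsum n F = 0.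
  have : forall a : int, `|a| <= n%:Z :> int -> F a = 0 by move=> a an; apply: F0; lia.
  elim: n {IH cn cn'} => [|n IH] H /=; first by apply: H; lia.
  by rewrite IH ?H ?addr0//; try lia; move=> a an; apply: H; lia.
have [ce|ce] : c = n.+1%:Z \/ c = - n.+1%:Z by lia.
  have Z : F (- n.+1%:Z) = 0 by apply: F0; rewrite ce; apply/eqP; lia.
  by rewrite z add0r Z addr0 ce.
have Z : F n.+1%:Z = 0 by apply: F0; rewrite ce; apply/eqP; lia.
by rewrite z Z !add0r ce.
Qed.

Lemma zsum_exch n m (F : int -> int -> V) :
  zsum n (fun a => zsum m (F a)) = zsum m (fun b => zsum n (F ^~ b)).
Proof. by elim: n => [//|n IH] /=; rewrite IH !zsumD. Qed.

End zsum.

Section zsumR.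
Context {R : numDomainType}.

Lemma zsum_tele n (F : int -> R) : zsum n (fun a => F (a + 1) - F a) = F (n%:Z + 1) - F (- n%:Z).
Proof.
elim: n => [|n IH] /=; first by rewrite oppr0.
rewrite IH; have -> : n.+1%:Z = n%:Z + 1 by lia.
have -> : - (n%:Z + 1) + 1 = - n%:Z :> int by lia.
ring.
Qed.

Lemma zsumZl n (k : R) F : zsum n (fun a => k * F a) = k * zsum n F.
Proof. by elim: n => [//|n IH] /=; rewrite IH !mulrDr. Qed.

Lemma ler_zsum n (F G : int -> R) : (forall a, F a <= G a) -> zsum n F <= zsum n G.
Proof. by move=> FG; elim: n => [|n IH] /=; rewrite ?FG// !lerD. Qed.

Lemma zsum_even n (F : int -> R) : (forall a, F (- a) = F a) ->
  zsum n F = F 0 + 2 * \sum_(1 <= i < n.+1) F i%:Z.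
Proof.
move=> Fe; elim: n => [|n IH] /=; first by rewrite big_geq// mulr0 addr0.
rewrite IH Fe [in RHS]big_nat_recr//=; ring.
Qed.
End zsumR.

Definition xr (x : Z2) : Z2 := (x.1 + 1, x.2).
Definition xl (x : Z2) : Z2 := (x.1 - 1, x.2).
Definition xu (x : Z2) : Z2 := (x.1, x.2 + 1).
Definition xd (x : Z2) : Z2 := (x.1, x.2 - 1).
Definition zsub (x y : Z2) : Z2 := (x.1 - y.1, x.2 - y.2).

Section lattice_log.
Context {R : realType}.

Definition avg (h : Z2 -> R) (x : Z2) : R :=
  (h (xr x) + h (xl x) + h (xu x) + h (xd x)) / 4.

Definition nsq (x : Z2) : R := x.1%:~R ^+ 2 + x.2%:~R ^+ 2.
(* [flog] replaces the potential kernel: its discrete Laplacian [elog] is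
   nonnegative, summable and of total mass pi / 2. *)
Definition flog (x : Z2) : R := ln (1 + nsq x) / 2.
Definition elog (x : Z2) : R := avg flog x - flog x.

Lemma nsq_ge0 x : 0 <= nsq x. Proof. by rewrite addr_ge0 ?sqr_ge0. Qed.

Lemma ln_le_lin (t : R) : 0 < 1 + t -> ln (1 + t) <= t.
Proof. by move=> t1; rewrite -ler_expR lnK// expR_ge1Dx. Qed.

Lemma ln_ge_lin (t : R) : 0 < 1 + t -> t / (1 + t) <= ln (1 + t).
Proof.
move=> t1; have : ln (1 + t)^-1 <= - (t / (1 + t)).
  have e : (1 + t)^-1 = 1 + - (t / (1 + t)) by field; rewrite gt_eqF.
  by rewrite {1}e; apply: ln_le_lin; rewrite -e invr_gt0.
by rewrite lnV// lerN2.
Qed.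

(** The values of [1 + nsq] at the four neighbours multiply to [s ^+ 4] plus the displayed
    numerator: the cubic term in [s] cancels, a trace of the harmonicity of the logarithm in the
    plane. Positivity and the decay in [s ^- 2] can then be read off. *)
Lemma elogE x : let s := 1 + nsq x in
  elog x = ln (1 + (2 * s ^+ 2 + 8 * s + 5 + 16 * x.1%:~R ^+ 2 * x.2%:~R ^+ 2) / s ^+ 4) / 8.
Proof.
move=> s; have s0 : 0 < s by rewrite ltr_pwDl ?nsq_ge0.
rewrite /elog /avg /flog -/s.
have p (y : Z2) : 1 + nsq y \is Num.pos by rewrite posrE ltr_pwDl ?nsq_ge0.
rewrite -!mulrDl -!lnM ?posrE ?mulr_gt0 -?posrE//.
set P := _ * _ * _ * _.
have -> : ln P / 2 / 4 - ln s / 2 = (ln P - ln (s ^+ 4)) / 8.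
  by rewrite lnXn//= -mulr_natl; field.
rewrite -ln_div ?posrE ?exprn_gt0 ?mulr_gt0 -?posrE//; congr (ln _ / _).
set q := 2 * _ + _ + _ + _.
have -> : 1 + q / s ^+ 4 = (s ^+ 4 + q) / s ^+ 4 by field; rewrite gt_eqF.
congr (_ / _); rewrite /q.
by rewrite /P /s /nsq /= !rmorphD/= !rmorphN/= ?rmorph1; ring.
Qed.

Lemma elog_ge0 x : 0 <= elog x.
Proof.
have s0 : 0 <= 1 + nsq x by rewrite addr_ge0 ?nsq_ge0.
have p0 : 0 <= 16 * x.1%:~R ^+ 2 * x.2%:~R ^+ 2 :> R.
  by rewrite mulr_ge0 ?sqr_ge0// mulr_ge0 ?sqr_ge0.
rewrite elogE divr_ge0// ln_ge0// lerDl divr_ge0 ?exprn_ge0//.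
by rewrite addr_ge0// addr_ge0// addr_ge0 ?mulr_ge0 ?sqr_ge0.
Qed.

Lemma elog_le x : elog x <= 3 / (1 + nsq x) ^+ 2.
Proof.
rewrite elogE; set s := 1 + nsq x; have s1 : 1 <= s by rewrite lerDl nsq_ge0.
have s0 : 0 < s by apply: lt_le_trans s1.
set q := _ / s ^+ 4.
have q0 : 0 <= q.
  have p0 : 0 <= 16 * x.1%:~R ^+ 2 * x.2%:~R ^+ 2 :> R.
    by rewrite mulr_ge0 ?sqr_ge0// mulr_ge0 ?sqr_ge0.
  rewrite divr_ge0 ?exprn_ge0 ?(ltW s0)//.
  by rewrite addr_ge0// addr_ge0// addr_ge0 ?mulr_ge0 ?sqr_ge0// ltW.
(* [19 = 2 + 8 + 5 + 4]: lower powers of [s] are raised using [1 <= s], and the mixed term is at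
   most [4 * s ^+ 2]. Then [19 / 8 <= 3]. *)
have qs : q <= 19 / s ^+ 2.
  rewrite ler_pdivlMr ?exprn_gt0// /q mulrAC ler_pdivrMr ?exprn_gt0//.
  have -> : 19 * s ^+ 4 = (19 * s ^+ 2) * s ^+ 2 by ring.
  rewrite ler_wpM2r ?sqr_ge0//.
  have : 4 * (x.1%:~R ^+ 2 * x.2%:~R ^+ 2) <= s ^+ 2 :> R.
    rewrite /s /nsq; set a := x.1%:~R ^+ 2 : R; set b := x.2%:~R ^+ 2 : R.
    have a0 : 0 <= a by exact: sqr_ge0. have b0 : 0 <= b by exact: sqr_ge0.
    rewrite -subr_ge0.
    have -> : (1 + (a + b)) ^+ 2 - 4 * (a * b) = (a - b) ^+ 2 + 2 * (a + b) + 1 by ring.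
    by rewrite !addr_ge0 ?sqr_ge0 ?mulr_ge0 ?addr_ge0.
  move: s1; nra.
have := @ln_le_lin q; rewrite ltr_pwDl// => /(_ isT) H.
rewrite ler_pdivrMr//; apply: (le_trans H); apply: (le_trans qs).
by rewrite mulrAC ler_pM2r ?invr_gt0 ?exprn_gt0//; lra.
Qed.

(** The mean value theorem for [atan] at scale [A]; it compares the sums of [A / (A ^+ 2 + i ^+ 2)]
    with their integral. *)
Lemma atan_diff (A x : R) : 0 < A -> 0 <= x ->
  A / (A ^+ 2 + (x + 1) ^+ 2) <= atan ((x + 1) / A) - atan (x / A) <= A / (A ^+ 2 + x ^+ 2).
Proof.
move=> A0 x0.
have lt : x / A <= (x + 1) / A by rewrite ler_pM2r ?invr_gt0// lerDl.
have dg (y : R) : is_derive y 1 (@atan R) (1 + y ^+ 2)^-1 by exact: is_derive1_atan.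
have gc : {within `[x / A, (x + 1) / A], continuous (@atan R)}.
  by apply: derivable_within_continuous => y _; exact: ex_derive.
have [c] := MVT_segment lt (fun x _ => dg x) gc.
rewrite in_itv /= => /andP[c1 c2] ->.
have c0 : 0 <= c by apply: le_trans c1; rewrite divr_ge0// ltW.
have -> : (x + 1) / A - x / A = A^-1 by rewrite -mulrBl addrAC subrr add0r mul1r.
have E (y : R) : A / (A ^+ 2 + y ^+ 2) = (1 + (y / A) ^+ 2)^-1 * A^-1.
  by field; rewrite gt_eqF//= gt_eqF// ltr_pwDl ?sqr_ge0// exprn_gt0.
have p (y : R) : 0 < 1 + y ^+ 2 by rewrite ltr_pwDl ?sqr_ge0.
rewrite !E !ler_pM2r ?invr_gt0// !lef_pV2 ?posrE// !lerD2l !ler_pXn2r ?nnegrE ?c2 ?c1//; try by rewrite divr_ge0 ?addr_ge0// ltW.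
Qed.

Lemma atan_ltpi2 (x : R) : atan x <= 2.
Proof.
have := atan_ltpi2 x; have := @pi_ge2 R; have := @pihalf_02 R; lra.
Qed.

Lemma sum_atan_le (A : R) n : 0 < A ->
  \sum_(1 <= i < n.+1) A / (A ^+ 2 + i%:R ^+ 2) <= atan (n%:R / A).
Proof.
move=> A0; elim: n => [|n IH]; first by rewrite big_geq// mul0r atan0.
rewrite big_nat_recr//=; have := @atan_diff A n%:R A0 (ler0n _ _).
rewrite -natr1; lra.
Qed.

Lemma sum_atan_ge (A : R) n : 0 < A ->
  atan ((n%:R + 2) / A) - atan (2 / A) <= \sum_(1 <= i < n.+1) A / (A ^+ 2 + (i%:R + 1) ^+ 2).
Proof.
move=> A0; elim: n => [|n IH]; first by rewrite big_geq// add0r subrr.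
rewrite big_nat_recr//=; have := @atan_diff A (n%:R + 2) A0.
rewrite addr_ge0// => /(_ isT) /andP[_ H]; rewrite -natr1.
have e : n%:R + 1 + 2 = n%:R + 2 + 1 :> R by ring.
rewrite e; have e2 : n%:R + 1 + 1 = n%:R + 2 :> R by ring.
rewrite e2; lra.
Qed.

(** Discrete divergence theorem: the Laplacian summed over a square is the flux through its four
    sides. The reflections and the exchange of coordinates preserve [flog], so the sides contribute
    equally, which absorbs the 4 in [avg]. *)
Lemma elog_mass_flux n :
  zsum n (fun a => zsum n (fun b => elog (a, b))) =
  zsum n (fun b => flog (n%:Z + 1, b) - flog (n%:Z, b)).
Proof.
pose D a b := flog (a, b) - flog (a - 1, b).
have flogN1 a b : flog (- a, b) = flog (a, b) by rewrite /flog /nsq /= rmorphN/= sqrrN.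
have flogC a b : flog (a, b) = flog (b, a).
  by rewrite /flog /nsq /=; congr (ln (_ + _) / _); exact: addrC.
have D1 b : zsum n (fun a => D (a + 1) b - D a b) = 2 * (flog (n%:Z + 1, b) - flog (n%:Z, b)).
  rewrite (zsum_tele n (D ^~ b)) /D addrK.
  have -> : - n%:Z - 1 = - (n%:Z + 1) :> int by lia.
  by rewrite !flogN1; ring.
have eE a b : elog (a, b) = ((D (a + 1) b - D a b) + (D (b + 1) a - D b a)) / 4.
  rewrite /elog /avg /D /xr /xl /xu /xd /= !addrK.
  rewrite (flogC (b + 1) a) (flogC b a) (flogC (b - 1) a); by field.
under zsum_ext => a do under zsum_ext => b do rewrite eE mulrC.
under zsum_ext => a do rewrite zsumZl zsumD.
rewrite zsumZl zsumD zsum_exch.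
under zsum_ext => b do rewrite D1.
by rewrite zsumZl; field.
Qed.

(** Each flux term is about [n / (n ^+ 2 + b ^+ 2)], and the sum over [b] between [- n] and [n] is
    about [2 * atan 1]; this is where [pi / 2] comes from. *)
Lemma elog_mass_ub n : (0 < n)%N ->
  zsum n (fun a => zsum n (fun b => elog (a, b))) <= pi / 2 + 4 / n%:R.
Proof.
move=> n0; have N0 : 0 < n%:R :> R by rewrite ltr0n.
rewrite elog_mass_flux.
have p (a b : int) : 0 < 1 + nsq (a, b) :> R by rewrite ltr_pwDl ?nsq_ge0.
have H (b : int) : flog (n%:Z + 1, b) - flog (n%:Z, b) <= (n%:R + 1 / 2) / (n%:R ^+ 2 + b%:~R ^+ 2) :> R.
  rewrite /flog -mulrBl -ln_div ?posrE//.
  have -> : (1 + nsq (n%:Z + 1, b)) / (1 + nsq (n%:Z, b)) = 1 + (2 * n%:R + 1) / (1 + nsq (n%:Z, b)) :> R.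
    have -> : 1 + nsq (n%:Z + 1, b) = (1 + nsq (n%:Z, b)) + (2 * n%:R + 1) :> R.
      by rewrite /nsq /= rmorphD/= -!pmulrn; ring.
    by rewrite mulrDl divff ?gt_eqF.
  have q0 : 0 <= (2 * n%:R + 1) / (1 + nsq (n%:Z, b)) :> R.
    by have pb := p n%:Z b; nonneg.
  have H1 := @ln_le_lin ((2 * n%:R + 1) / (1 + nsq (n%:Z, b))).
  rewrite ler_pdivrMr//; apply: le_trans (H1 _) _; first by rewrite ltr_pwDl.
  have -> : (n%:R + 1 / 2) / (n%:R ^+ 2 + b%:~R ^+ 2) * 2 = (2 * n%:R + 1) / (n%:R ^+ 2 + b%:~R ^+ 2) :> R.
    by field; rewrite gt_eqF// ltr_pwDl ?sqr_ge0 ?exprn_gt0.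
  rewrite ler_wpM2l ?addr_ge0 ?mulr_ge0// lef_pV2 ?posrE//; first by rewrite /nsq /=; lra.
  by rewrite ltr_pwDl ?sqr_ge0 ?exprn_gt0.
apply: (le_trans (ler_zsum n H)).
rewrite zsum_even => [|a]; last by rewrite rmorphN/= sqrrN.
rewrite rmorph0 expr0n/= addr0.
have -> : \sum_(1 <= i < n.+1) (n%:R + 1 / 2) / (n%:R ^+ 2 + i%:Z%:~R ^+ 2) =
   ((n%:R + 1 / 2) / n%:R) * \sum_(1 <= i < n.+1) n%:R / (n%:R ^+ 2 + i%:R ^+ 2) :> R.
  rewrite mulr_sumr; apply: eq_bigr => i _; rewrite -pmulrn mulrA divfK ?gt_eqF//.
have := @sum_atan_le n%:R n N0; rewrite divff ?gt_eqF// atan1.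
set S := \sum_(_ <= _ < _) _ => HS.
have -> : (n%:R + 1 / 2) / n%:R ^+ 2 = (1 + (1 / 2) * n%:R^-1) * n%:R^-1 :> R by field; rewrite gt_eqF.
have -> : (n%:R + 1 / 2) / n%:R = 1 + (1 / 2) * n%:R^-1 :> R by field; rewrite gt_eqF.
have i1 : n%:R^-1 <= 1 :> R by rewrite invf_le1// ler1n.
have i0 : 0 < n%:R^-1 :> R by rewrite invr_gt0.
have S0 : 0 <= S by apply: sumr_ge0 => i _; rewrite divr_ge0 ?addr_ge0 ?sqr_ge0.
have := @pihalf_02 R; move: HS i1 i0; set r := n%:R^-1 => HS i1 i0 /andP[p0 p2].
have : r * r <= r by nra.
have : r * S <= r by nra.
lra.
Qed.

Lemma elog_mass_lb n : (0 < n)%N ->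
  pi / 2 - 6 / n%:R <= zsum n (fun a => zsum n (fun b => elog (a, b))).
Proof.
move=> n0; have N0 : 0 < n%:R :> R by rewrite ltr0n.
rewrite elog_mass_flux.
(* The lower bound of the logarithm divides by the larger argument [1 + nsq (n + 1, b)], that is by
   [A ^+ 2 + b ^+ 2 + 1]. *)
pose A : R := n%:R + 1.
have A0 : 0 < A by rewrite addr_gt0.
have p (a b : int) : 0 < 1 + nsq (a, b) :> R by rewrite ltr_pwDl ?nsq_ge0.
have H (b : int) : (n%:R + 1 / 2) / (A ^+ 2 + b%:~R ^+ 2 + 1) <= flog (n%:Z + 1, b) - flog (n%:Z, b) :> R.
  rewrite /flog -mulrBl -ln_div ?posrE//.
  have E1 : (1 + nsq (n%:Z + 1, b)) / (1 + nsq (n%:Z, b)) = 1 + (2 * n%:R + 1) / (1 + nsq (n%:Z, b)) :> R.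
    have -> : 1 + nsq (n%:Z + 1, b) = (1 + nsq (n%:Z, b)) + (2 * n%:R + 1) :> R.
      by rewrite /nsq /= rmorphD/= -!pmulrn; ring.
    by rewrite mulrDl divff ?gt_eqF.
  have q0 : 0 <= (2 * n%:R + 1) / (1 + nsq (n%:Z, b)) :> R.
    by have pb := p n%:Z b; nonneg.
  have H1 := @ln_ge_lin ((2 * n%:R + 1) / (1 + nsq (n%:Z, b))).
  rewrite E1 ler_pdivlMr//; apply: le_trans (H1 _); last by rewrite ltr_pwDl.
  rewrite -E1.
  have -> : A ^+ 2 + b%:~R ^+ 2 + 1 = 1 + nsq (n%:Z + 1, b) :> R.
    by rewrite /A /nsq /= rmorphD/= -!pmulrn; ring.
  rewrite le_eqVlt; apply/orP; left; apply/eqP; field.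
  by rewrite gt_eqF ?p//= gt_eqF ?p.
apply: le_trans (ler_zsum n H).
rewrite zsum_even => [|a]; last by rewrite rmorphN/= sqrrN.
rewrite rmorph0 expr0n/= addr0.
have H2 : ((n%:R + 1 / 2) / A) * \sum_(1 <= i < n.+1) A / (A ^+ 2 + (i%:R + 1) ^+ 2) <=
   \sum_(1 <= i < n.+1) (n%:R + 1 / 2) / (A ^+ 2 + i%:Z%:~R ^+ 2 + 1).
  rewrite mulr_sumr; apply: ler_sum => i _; rewrite -pmulrn mulrA divfK ?gt_eqF//.
  rewrite ler_wpM2l ?addr_ge0// lef_pV2 ?posrE ?ltr_pwDr ?ltr_pwDl ?addr_ge0 ?sqr_ge0 ?exprn_gt0//.
  by have : 0 <= i%:R :> R by []; nra.
have := @sum_atan_ge A n A0.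
have E : (n%:R + 2) / A = 1 + A^-1 by rewrite /A; field; rewrite gt_eqF// -/A.
have a1 : pi / 4 <= atan ((n%:R + 2) / A).
  rewrite -atan1 E; have := @atan_diff A A A0 (ltW A0); rewrite divff ?gt_eqF// => /andP[h _].
  have -> : 1 + A^-1 = (A + 1) / A by rewrite mulrDl divff ?gt_eqF// mul1r.
  rewrite -subr_ge0; apply: le_trans h; rewrite divr_ge0 ?addr_ge0 ?sqr_ge0// ltW//.
have a2 : atan (2 / A) <= 2 / A.
  have := @atan_diff A 0 A0 (lexx _); have := @atan_diff A 1 A0 ler01.
  rewrite mul0r atan0 add0r subr0 expr0n/= addr0 expr1n => /andP[_ h1] /andP[_ h2].
  have e1 : A / (A ^+ 2 + 1) <= A^-1.
    rewrite ler_pdivrMr ?ltr_pwDl ?exprn_gt0//; rewrite -subr_ge0.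
    have -> : A^-1 * (A ^+ 2 + 1) - A = A^-1 by field; rewrite gt_eqF.
    by rewrite invr_ge0 ltW.
  have e2 : A / A ^+ 2 = A^-1 by field; rewrite gt_eqF.
  have -> : 2 = 1 + 1 :> R by ring.
  have e3 : (1 + 1) / A = A^-1 + A^-1 by ring.
  rewrite mul1r in h1 h2; rewrite [leRHS]e3; lra.
set S := \sum_(_ <= _ < _) _ in H2 *; set S2 := \sum_(_ <= _ < _) _ in H2 *.
move=> HS; have c0 : 0 <= (n%:R + 1 / 2) / (A ^+ 2 + 1).
  by rewrite divr_ge0 ?addr_ge0 ?sqr_ge0.
have E3 : (n%:R + 1 / 2) / A = 1 - (1 / 2) * A^-1 by rewrite /A; field; rewrite gt_eqF// -/A.
rewrite E3 in H2.
have i0 : 0 < A^-1 by rewrite invr_gt0.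
have i1 : A^-1 <= n%:R^-1 by rewrite lef_pV2 ?posrE// lerDl.
have i2 : A^-1 <= 1 by rewrite invf_le1// lerDr.
have S0 : 0 <= S by apply: sumr_ge0 => i _; rewrite divr_ge0 ?addr_ge0 ?sqr_ge0// ltW.
have := @pihalf_02 R => /andP[p0 p2].
have HS2 : pi / 4 - 2 * A^-1 <= S by lra.
have Y : pi / 4 - 3 * A^-1 <= S2.
  apply: le_trans H2; move: HS2 i0 i2 S0; set r := A^-1 => HS2 i0 i2 S0.
  have [S1|S1] := leP S 1; first by nra.
  by nra.
lra.
Qed.

(** By [elog_le], [elog] decays like the inverse fourth power of the distance, so its first moment
    converges in dimension two. The constant later bounds the norm of [prj A z - smear z]. *)
Lemma elog_l1_sum : exists C : R, 0 <= C /\ forall n,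
  zsum n (fun a => zsum n (fun b => elog (a, b) * (`|a%:~R| + `|b%:~R|))) <= C.
Proof.
(* Row [a] contributes at most [60 / (1 + |a|) ^+ 2]. All rows give at most [60 + 2 * 60], and there
   are two coordinates. *)
exists 360; split=> [|n]; first by rewrite ler0n.
pose w (a b : int) : R := `|a%:~R| * elog (a, b).
have wb (a : int) : zsum n (w a) <= 60 / (1 + `|a%:~R|) ^+ 2.
  pose A : R := 1 + `|a%:~R|.
  have A1 : 1 <= A by rewrite lerDl.
  have A0 : 0 < A by apply: lt_le_trans A1.
  have wle (b : int) : w a b <= 12 / A ^+ 2 * (A / (A ^+ 2 + b%:~R ^+ 2)).
    rewrite /w.
    have h1 : `|a%:~R| <= A by rewrite lerDr.
    have h2 := elog_le (a, b); set s := 1 + nsq (a, b) in h2.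
    have sA : A ^+ 2 + b%:~R ^+ 2 <= 2 * s.
      rewrite /s /nsq /A /=.
      have e : `|a%:~R| ^+ 2 = a%:~R ^+ 2 :> R by rewrite real_normK ?num_real.
      rewrite -e; have := sqr_ge0 (`|a%:~R| - 1 : R); have := sqr_ge0 (b%:~R : R); nra.
    have B0 : 0 < A ^+ 2 + b%:~R ^+ 2 by rewrite ltr_pwDl ?sqr_ge0 ?exprn_gt0.
    have s0 : 0 < s by rewrite ltr_pwDl ?nsq_ge0.
    have h3 : elog (a, b) <= 12 / (A ^+ 2 + b%:~R ^+ 2) ^+ 2.
      apply: (le_trans h2); rewrite ler_pdivrMr ?exprn_gt0// mulrAC ler_pdivlMr ?exprn_gt0//.
      nra.
    apply: (@le_trans _ _ (A * (12 / (A ^+ 2 + b%:~R ^+ 2) ^+ 2))).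
      by apply: ler_pM => //; exact: elog_ge0.
    have -> : A * (12 / (A ^+ 2 + b%:~R ^+ 2) ^+ 2) = 12 / (A ^+ 2 + b%:~R ^+ 2) * (A / (A ^+ 2 + b%:~R ^+ 2)).
      by field; rewrite gt_eqF.
    rewrite ler_wpM2r ?divr_ge0 ?(ltW A0) ?(ltW B0)// ler_wpM2l// lef_pV2 ?posrE ?exprn_gt0//.
    by rewrite lerDl sqr_ge0.
  apply: (le_trans (ler_zsum n wle)); rewrite zsumZl -/A.
  rewrite zsum_even => [|b]; last by rewrite rmorphN/= sqrrN.
  rewrite rmorph0 expr0n/= addr0.
  have -> : \sum_(1 <= i < n.+1) A / (A ^+ 2 + i%:Z%:~R ^+ 2) = \sum_(1 <= i < n.+1) A / (A ^+ 2 + i%:R ^+ 2).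
    by apply: eq_bigr => i _; rewrite -pmulrn.
  have h1 := @sum_atan_le A n A0; have h2 := atan_ltpi2 (n%:R / A).
  have h3 : A / A ^+ 2 <= 1 by rewrite ler_pdivrMr ?exprn_gt0//; nra.
  set S := \sum_(_ <= _ < _) _ in h1 *.
  rewrite mulrAC ler_wpM2r ?invr_ge0 ?exprn_ge0 ?(ltW A0)//; lra.
have ws : zsum n (fun a => zsum n (w a)) <= 180.
  apply: (le_trans (ler_zsum n wb)).
  rewrite zsum_even => [|a]; last by rewrite rmorphN/= normrN.
  rewrite rmorph0 normr0 addr0 expr1n divr1.
  (* Telescoping, since [1 / (1 + k) ^+ 2 <= 1 / k - 1 / (1 + k)]. *)
  have sb m : \sum_(1 <= i < m.+1) 60 / (1 + `|i%:Z%:~R|) ^+ 2 <= 60 * (1 - (1 + m%:R)^-1) :> R.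
    elim: m => [|m IH]; first by rewrite big_geq// addr0 invr1 subrr mulr0.
    rewrite big_nat_recr//=.
    have -> : `|m.+1%:Z%:~R| = 1 + m%:R :> R by rewrite -pmulrn ger0_norm// -natr1 addrC.
    apply: (le_trans (lerD IH (lexx _))).
    set k := 1 + m%:R : R; have k0 : 0 < k by rewrite ltr_pwDl.
    have -> : 1 + m.+1%:R = 1 + k :> R by rewrite -natr1 /k; ring.
    rewrite -subr_ge0.
    have -> : 60 * (1 - (1 + k)^-1) - (60 * (1 - k^-1) + 60 / (1 + k) ^+ 2) = 60 / (k * (1 + k) ^+ 2).
      have k1 : k != 0 by rewrite gt_eqF.
      have k2 : 1 + k != 0 by rewrite gt_eqF// addr_gt0.
      by field; rewrite ?k1 ?k2.
    by rewrite divr_ge0 ?mulr_ge0 ?exprn_ge0 ?addr_ge0 ?(ltW k0).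
  have := sb n; have : 0 <= (1 + n%:R)^-1 :> R by rewrite invr_ge0 addr_ge0.
  lra.
have elogC a b : elog (a, b) = elog (b, a) :> R.
  rewrite !elogE /nsq /= [b%:~R ^+ 2 + _]addrC; congr (ln (1 + (_ + _) / _) / _); ring.
have -> : zsum n (fun a => zsum n (fun b => elog (a, b) * (`|a%:~R| + `|b%:~R|))) =
    zsum n (fun a => zsum n (w a)) + zsum n (fun a => zsum n (w a)).
  rewrite [X in _ = _ + X]zsum_exch -zsumD; apply: zsum_ext => a; rewrite -zsumD; apply: zsum_ext => b.
  by rewrite /w (elogC b a) mulrDr mulrC [_ * `|b%:~R|]mulrC.
lra.
Qed.

End lattice_log.

(** * Killed Green functions as inner products *)

Definition inI (N : nat) (x : Z2) : bool := (0 < x.1 < N%:Z) && (0 < x.2 < N%:Z).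
Definition inV (N : nat) (x : Z2) : bool := (0 <= x.1 <= N%:Z) && (0 <= x.2 <= N%:Z).

Lemma inI_inV N x : inI N x -> inV N x.
Proof. rewrite /inI /inV => /andP[/andP[? ?] /andP[? ?]]; lia. Qed.

Lemma site_inV N (v : box N) : inV N (site v).
Proof. by case: v => [[a ha] [b hb]]; rewrite /inV /site /=; lia. Qed.

Lemma inV_site N x : inV N x -> exists v : box N, site v = x.
Proof.
case: x => a b; rewrite /inV /= => /andP[/andP[a0 aN] /andP[b0 bN]].
have ha : (`|a| < N.+1)%N by lia.
have hb : (`|b| < N.+1)%N by lia.
by exists (Ordinal ha, Ordinal hb); rewrite /site /=; congr pair; lia.
Qed.

Lemma inI_site N x : inI N x -> exists v : box N, site v = x.
Proof. by move=> /inI_inV /inV_site. Qed.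

(** The outer vertex boundary, on which boundary values are prescribed; the points of [boundary] lie
    inside the set instead. *)
Definition bd (A : pred Z2) : pred Z2 :=
  fun x => ~~ A x && [|| A (xr x), A (xl x), A (xu x) | A (xd x)].

Section max_principle.
Context {R : realType}.
Variables (N : nat) (A : pred Z2).
Hypothesis AI : forall x, A x -> inI N x.

(** Where a maximum above [m] is attained, all neighbours must attain it too and so cannot lie on
    the boundary. Stepping to the right then never leaves [A], although [A] is inside a finite
    box. *)
Lemma max_principle (h : Z2 -> R) m :
  (forall x, A x -> h x <= avg h x) -> (forall x, bd A x -> h x <= m) ->
  forall x, A x -> h x <= m.
Proof.
move=> sub bdm x0 Ax0; rewrite leNgt; apply/negP => mx0.
have [v0 v0E] := inI_site (AI Ax0).
have Pv0 : A (site v0) by rewrite v0E.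
pose v := [arg max_(v > v0 | A (site v)) h (site v)]%O.
have [Av vmax] : A (site v) /\ forall x, A x -> h x <= h (site v).
  rewrite /v; case: Order.TotalTheory.arg_maxP => // i Pi imax; split=> // x Ax.
  by have [w wE] := inI_site (AI Ax); rewrite -wE; apply: imax; rewrite wE.
pose M := h (site v).
have mM : m < M by apply: lt_le_trans mx0 (vmax _ Ax0).
have step x : A x -> h x = M -> A (xr x) /\ h (xr x) = M.
  move=> Ax hx.
  have leM y : y \in [:: xr x; xl x; xu x; xd x] -> h y <= M.
    move=> yx; have [/vmax//|nAy] := boolP (A y).
    apply: (le_trans _ (ltW mM)); apply: bdm; rewrite /bd nAy /=.
    have e a b : a + b - b = a :> int by lia.
    have e' a b : a - b + b = a :> int by lia.
    by move: yx Ax; rewrite !inE /xr /xl /xu /xd => /or4P[] /eqP -> /=;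
      case: (x) => a b /= Ax; rewrite ?e ?e' Ax ?orbT.
  have a1 : h (xr x) <= M by apply: leM; rewrite !inE eqxx.
  have a2 : h (xl x) <= M by apply: leM; rewrite !inE eqxx ?orbT.
  have a3 : h (xu x) <= M by apply: leM; rewrite !inE eqxx ?orbT.
  have a4 : h (xd x) <= M by apply: leM; rewrite !inE eqxx ?orbT.
  have := sub _ Ax; rewrite hx /avg => av.
  have hr : h (xr x) = M by apply/eqP; rewrite eq_le a1 /=; lra.
  split=> //; apply/negPn/negP => nA.
  have : h (xr x) <= m.
    apply: bdm; rewrite /bd nA /= /xr /xl /=; case: (x) Ax => a b /= Ax.
    by rewrite addrK Ax /= ?orbT.
  by rewrite hr leNgt mM.
(* Iterating [step]; after [N] steps the point is outside the open box. *)
have it k : A ((site v).1 + k%:Z, (site v).2) /\ h ((site v).1 + k%:Z, (site v).2) = M.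
  elim: k => [|k [Ak hk]]; first by rewrite addr0 -surjective_pairing.
  have := step _ Ak hk; rewrite /xr /=.
  by have -> : (site v).1 + k%:Z + 1 = (site v).1 + k.+1%:Z by lia.
have [/AI] := it N; rewrite /inI /= => /andP[/andP[_ ?] _] _.
have : 0 <= (site v).1 by rewrite /site.
lia.
Qed.

Lemma min_principle (h : Z2 -> R) m :
  (forall x, A x -> avg h x <= h x) -> (forall x, bd A x -> m <= h x) ->
  forall x, A x -> m <= h x.
Proof.
move=> sup bdm x Ax; rewrite -lerN2; apply: (@max_principle (fun x => - h x)) => // y hy.
  by rewrite -[leRHS]opprK lerN2; apply: le_trans (sup _ hy); rewrite /avg; lra.
by rewrite lerN2; exact: bdm.
Qed.

End max_principle.

(* [ip] is the covariance form on a space of linear combinations of the field;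
   [gff_poisson] characterizes pi / 2 times the Green function of the walk killed
   off the open box. *)
Record gff_form (R : realType) (V : lmodType R) (N : nat) (ip : V -> V -> R)
    (phi : Z2 -> V) : Prop := GffForm {
  gff_lin : forall a x y z, ip (a *: x + y) z = a * ip x z + ip y z;
  gff_sym : forall x y, ip x y = ip y x;
  gff_ge0 : forall x, 0 <= ip x x;
  gff_off : forall x, ~~ inI N x -> phi x = 0;
  gff_poisson : forall x z, inI N x ->
    ip (phi x) (phi z) - avg (fun y => ip (phi y) (phi z)) x = pi / 2 * (x == z)%:R }.

Section form.
Context {R : realType} {V : lmodType R}.
Variables (N : nat) (ip : V -> V -> R) (phi : Z2 -> V).
Hypothesis G : gff_form N ip phi.

Let ipC := gff_sym G.
Lemma ip0l z : ip 0 z = 0.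
Proof. by have := gff_lin G 1 0 0 z; rewrite scaler0 addr0 mul1r; lra. Qed.
Lemma ipDl x y z : ip (x + y) z = ip x z + ip y z.
Proof. by rewrite -{1}[x]scale1r (gff_lin G) mul1r. Qed.
Lemma ipZl a x z : ip (a *: x) z = a * ip x z.
Proof. by rewrite -[a *: x]addr0 (gff_lin G) ip0l addr0. Qed.
Lemma ipNl x z : ip (- x) z = - ip x z.
Proof. by rewrite -scaleN1r ipZl mulN1r. Qed.
Lemma ipBl x y z : ip (x - y) z = ip x z - ip y z.
Proof. by rewrite ipDl ipNl. Qed.
Lemma ip0r z : ip z 0 = 0. Proof. by rewrite ipC ip0l. Qed.
Lemma ipDr x y z : ip z (x + y) = ip z x + ip z y.
Proof. by rewrite ipC ipDl !(ipC z). Qed.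
Lemma ipZr a x z : ip z (a *: x) = a * ip z x.
Proof. by rewrite ipC ipZl !(ipC z). Qed.
Lemma ipNr x z : ip z (- x) = - ip z x.
Proof. by rewrite ipC ipNl !(ipC z). Qed.
Lemma ipBr x y z : ip z (x - y) = ip z x - ip z y.
Proof. by rewrite ipDr ipNr. Qed.
Lemma ip_suml (I : Type) (s : seq I) (P : pred I) (F : I -> V) z :
  ip (\sum_(i <- s | P i) F i) z = \sum_(i <- s | P i) ip (F i) z.
Proof. by elim/big_rec2 : _ => [|i a b _ <-]; rewrite ?ip0l ?ipDl. Qed.
Lemma ip_sumr (I : Type) (s : seq I) (P : pred I) (F : I -> V) z :
  ip z (\sum_(i <- s | P i) F i) = \sum_(i <- s | P i) ip z (F i).
Proof. by rewrite ipC ip_suml; apply: eq_bigr => i _; rewrite ipC. Qed.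

Definition sq x := ip x x.

Lemma sqE x : sq x = ip x x. Proof. by []. Qed.
Definition nrm x := Num.sqrt (sq x).

Lemma sq_ge0 x : 0 <= sq x. Proof. exact: gff_ge0 G x. Qed.
Lemma nrm_ge0 x : 0 <= nrm x. Proof. exact: sqrtr_ge0. Qed.
Lemma nrm_sq x : nrm x ^+ 2 = sq x. Proof. by rewrite sqr_sqrtr ?sq_ge0. Qed.
Lemma sqD x y : sq (x + y) = sq x + 2 * ip x y + sq y.
Proof. by rewrite /sq ipDl !ipDr (ipC y x); ring. Qed.
Lemma sqZ a x : sq (a *: x) = a ^+ 2 * sq x.
Proof. by rewrite /sq ipZl ipZr mulrA. Qed.
Lemma sqN x : sq (- x) = sq x.
Proof. by rewrite /sq ipNl ipNr opprK. Qed.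
Lemma sqB x y : sq (x - y) = sq x - 2 * ip x y + sq y.
Proof. by rewrite sqD sqN ipNr; ring. Qed.
Lemma sqD_le x y : sq (x + y) <= 2 * (sq x + sq y).
Proof. by rewrite sqD; have := sq_ge0 (x - y); rewrite sqB; lra. Qed.

Lemma cauchy_schwarz x y : ip x y ^+ 2 <= sq x * sq y.
Proof.
(* The form is only semidefinite. If [sq y = 0] but [ip x y] were not zero, the multiple of [y]
   chosen below would produce a vector of square [- 1]. *)
have [y0|y0] := eqVneq (sq y) 0.
  rewrite y0 mulr0; have [->|xy] := eqVneq (ip x y) 0; first by rewrite expr0n.
  have := sq_ge0 (x - ((sq x + 1) / (2 * ip x y)) *: y).
  rewrite sqB sqZ y0 mulr0 addr0 ipZr.
  have -> : sq x - 2 * ((sq x + 1) / (2 * ip x y) * ip x y) = - 1 by field.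
  lra.
have yp : 0 < sq y by rewrite lt_neqAle eq_sym y0 sq_ge0.
have := sq_ge0 (sq y *: x - ip x y *: y).
rewrite sqB !sqZ ipZl ipZr.
have -> : sq y ^+ 2 * sq x - 2 * (sq y * (ip x y * ip x y)) + ip x y ^+ 2 * sq y =
   sq y * (sq x * sq y - ip x y ^+ 2) by ring.
by rewrite pmulr_rge0// subr_ge0.
Qed.

Lemma ip_le_nrm x y : `|ip x y| <= nrm x * nrm y.
Proof.
rewrite -sqrtrM ?sq_ge0// -sqrtr_sqr.
by rewrite ler_wsqrtr// cauchy_schwarz.
Qed.

Lemma nrmD x y : nrm (x + y) <= nrm x + nrm y.
Proof.
rewrite -[leRHS]ger0_norm ?addr_ge0 ?nrm_ge0// -sqrtr_sqr ler_wsqrtr// sqrrD !nrm_sq sqD.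
have := ip_le_nrm x y; have := ler_norm (ip x y); rewrite mulr2n; lra.
Qed.

Lemma nrmZ a x : nrm (a *: x) = `|a| * nrm x.
Proof. by rewrite /nrm sqZ sqrtrM ?sqr_ge0// sqrtr_sqr. Qed.

Lemma nrmN x : nrm (- x) = nrm x. Proof. by rewrite /nrm sqN. Qed.

Lemma nrm0 : nrm 0 = 0. Proof. by rewrite /nrm /sq ip0l sqrtr0. Qed.

Lemma nrm_zsum n (F : int -> V) : nrm (zsum n F) <= zsum n (fun a => nrm (F a)).
Proof. by elim: n => [//|n IH] /=; rewrite !(le_trans (nrmD _ _))// !lerD// (le_trans (nrmD _ _)) ?lerD. Qed.

Lemma ip_zsumr n (F : int -> V) z : ip z (zsum n F) = zsum n (fun a => ip z (F a)).
Proof. by elim: n => [//|n IH] /=; rewrite !ipDr IH. Qed.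

Lemma sq0_ip x y : sq y = 0 -> ip x y = 0.
Proof.
by move=> y0; apply/eqP; rewrite -sqrf_eq0 eq_le sqr_ge0 andbT -(mulr0 (sq x)) -y0 cauchy_schwarz.
Qed.

(** Gram-Schmidt, one vector at a time: [z] is the part of [phi w] orthogonal to the earlier
    vectors, and [y] is corrected along it. When [sq z = 0] the correction is zero, since [z] is
    then orthogonal to everything. *)
Lemma proj_seq (s : seq Z2) (x : V) : uniq s -> exists (y : V) (c : Z2 -> R),
  (forall w, w \in s -> ip y (phi w) = 0) /\ y = x - \sum_(w <- s) c w *: phi w.
Proof.
elim: s x => [|w s IH] x /=.
  by exists x, (fun=> 0); split=> //; rewrite big_nil subr0.
move=> /andP[ws us]; have [y [c [yo yE]]] := IH x us.
have [z [e [zo zE]]] := IH (phi w) us.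
have span0 u k : (forall v, v \in s -> ip u (phi v) = 0) -> ip u (\sum_(w <- s) k w *: phi w) = 0.
  move=> uo; rewrite ip_sumr big_seq big1// => v vs; by rewrite ipZr uo ?mulr0.
have phE : phi w = z + \sum_(w <- s) e w *: phi w by rewrite zE subrK.
have ipw u : (forall v, v \in s -> ip u (phi v) = 0) -> ip u (phi w) = ip u z.
  by move=> uo; rewrite {1}phE ipDr span0// addr0.
pose a := if sq z == 0 then 0 else ip y z / sq z.
exists (y - a *: z), (fun v => if v == w then a else c v - a * e v); split.
  move=> v; rewrite inE => /predU1P[->|vs]; last by rewrite ipBl ipZl yo// zo// mulr0 subrr.
  rewrite ipBl ipZl !ipw// -/(sq z) /a; case: ifPn => [/eqP z0|z0].
    by rewrite mul0r subr0 sq0_ip.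
  by rewrite divfK// subrr.
rewrite big_cons eqxx yE zE.
have -> : \sum_(j <- s) (if j == w then a else c j - a * e j) *: phi j =
   \sum_(j <- s) c j *: phi j - a *: \sum_(j <- s) e j *: phi j.
  rewrite scaler_sumr -sumrB !big_seq; apply: eq_bigr => v vs.
  rewrite ifN; first by rewrite scalerBl scalerA.
  by apply: contraNneq ws => <-.
by rewrite scalerBr !opprD !opprK !addrA; congr (_ + _); rewrite -!addrA; congr (_ + _); rewrite addrC.
Qed.

Definition Ipts : seq Z2 := [seq (a%:Z, b%:Z) | a <- iota 1 N.-1, b <- iota 1 N.-1].

Lemma mem_Ipts x : inI N x -> x \in Ipts.
Proof.
case: x => a b; rewrite /inI /= => /andP[/andP[a0 aN] /andP[b0 bN]].
have -> : (a, b) = (`|a|%N%:Z, `|b|%N%:Z) :> Z2 by congr pair; lia.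
by apply: (allpairs_f (fun a b : nat => (a%:Z, b%:Z) : Z2)); rewrite mem_iota; lia.
Qed.

Lemma uniq_Ipts : uniq Ipts.
Proof.
apply: allpairs_uniq; rewrite ?iota_uniq// => -[a b] [c d] _ _ /= [-> ->]//.
Qed.

Definition outpts (A : pred Z2) : seq Z2 := [seq w <- Ipts | ~~ A w].

Lemma mem_outpts A w : w \in outpts A -> ~~ A w.
Proof. by rewrite mem_filter => /andP[]. Qed.

Lemma projv_exists A x : exists y c, (forall w, ~~ A w -> ip y (phi w) = 0) /\
  y = x - \sum_(w <- outpts A) c w *: phi w.
Proof.
have [y [c [yo yE]]] := @proj_seq (outpts A) x (filter_uniq _ uniq_Ipts).
exists y, c; split=> // w nAw; have [wI|wI] := boolP (inI N w).
  by apply: yo; rewrite mem_filter nAw mem_Ipts.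
by rewrite (gff_off G wI) ip0r.
Qed.

(* For [A x], this is [phi x] minus its conditional expectation given the field
   outside [A], seen in the Gaussian space. *)
Definition prj (A : pred Z2) (x : Z2) : V :=
  if A x then projT1 (cid (projv_exists A (phi x))) else 0.

Lemma prj_out A x : ~~ A x -> prj A x = 0. Proof. by rewrite /prj => /negbTE ->. Qed.

Lemma prj_orth A x w : ~~ A w -> ip (prj A x) (phi w) = 0.
Proof.
rewrite /prj; case: ifP => _; last by rewrite ip0l.
by case: cid => y [c []] /= H _; exact: H.
Qed.

Lemma prj_span (A : pred Z2) x : exists c : Z2 -> R, (forall w, A w -> c w = 0) /\
  phi x - prj A x = \sum_(w <- Ipts) c w *: phi w.
Proof.
have [Ax|nAx] := boolP (A x).
  rewrite /prj Ax; case: cid => y [c [_ yE]] /=.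
  exists (fun w => if A w then 0 else c w); split=> [w -> //|].
  rewrite yE opprB addrC subrK /outpts big_filter big_mkcond; apply: eq_bigr => w _.
  by case: (A w); rewrite //= scale0r.
rewrite prj_out// subr0; exists (fun w => (w == x)%:R); split=> [w Aw|].
  by case: eqP nAx => // <-; rewrite Aw.
have [xI|xI] := boolP (inI N x).
  rewrite (bigD1_seq x) ?mem_Ipts ?uniq_Ipts//= eqxx scale1r big1 ?addr0//.
  by move=> w /negbTE ->; rewrite scale0r.
rewrite (gff_off G xI) big1// => w _; case: eqP => [->|_]; last by rewrite scale0r.
by rewrite (gff_off G xI) scaler0.
Qed.

(** The difference [phi x - prj A x] lies in the span of the field outside [A], which [y] does not
    see. *)
Lemma prj_ip A x y : (forall w, ~~ A w -> ip y (phi w) = 0) -> ip (prj A x) y = ip (phi x) y.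
Proof.
move=> yo; have [c [c0 cE]] := prj_span A x.
apply/eqP; rewrite eq_sym -subr_eq0 -ipBl cE ip_suml big1// => w _.
rewrite ipZl; have [Aw|nAw] := boolP (A w); first by rewrite c0 ?mul0r.
by rewrite (ipC (phi w)) yo ?mulr0.
Qed.

(** By [grn_poisson], for [A] inside the open box this solves the equation of [pi / 2] times the
    Green function of the walk killed off [A]. *)
Definition grn A x y := ip (prj A x) (prj A y).

Lemma grn_def A x y : grn A x y = ip (prj A x) (prj A y). Proof. by []. Qed.

Lemma grnC A x y : grn A x y = grn A y x. Proof. exact: ipC. Qed.
Lemma grnE A x y : grn A x y = ip (prj A x) (phi y).
Proof. by rewrite /grn ipC prj_ip 1?ipC// => w; exact: prj_orth. Qed.
Lemma grn_outl A x y : ~~ A x -> grn A x y = 0.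
Proof. by move=> /prj_out Ax; rewrite /grn Ax ip0l. Qed.
Lemma grn_outr A x y : ~~ A y -> grn A x y = 0.
Proof. by move=> Ay; rewrite grnC grn_outl. Qed.
Lemma grn_sq A x : grn A x x = sq (prj A x). Proof. by []. Qed.

(** Tower property: [prj B y] is orthogonal to the field outside [B], hence outside the larger [A],
    so both projections of [phi x] pair with it as [phi x] does. *)
Lemma prj_nested (A B : pred Z2) x y : (forall z, B z -> A z) -> ip (prj A x) (prj B y) = grn B x y.
Proof.
move=> BA; rewrite ipC (ipC (prj B y)) prj_ip; first by rewrite grnC grnE ipC.
by move=> w nAw; apply: prj_orth; apply: contra nAw; exact: BA.
Qed.

Lemma avgD h k (x : Z2) : avg (fun y => h y + k y) x = avg h x + avg k x :> R.
Proof. by rewrite /avg; ring. Qed.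
Lemma avgZ a h (x : Z2) : avg (fun y => a * h y) x = a * avg h x :> R.
Proof. by rewrite /avg; ring. Qed.
Lemma avgB h k (x : Z2) : avg (fun y => h y - k y) x = avg h x - avg k x :> R.
Proof. by rewrite /avg; ring. Qed.
Lemma avg_sum (s : seq Z2) (c : Z2 -> R) (h : Z2 -> Z2 -> R) x :
  avg (fun y => \sum_(w <- s) c w * h w y) x = \sum_(w <- s) c w * avg (h w) x.
Proof.
elim: s => [|w s IH]; first by rewrite /avg !big_nil; ring.
rewrite big_cons -IH -avgZ -avgD; congr (avg _ _); apply/funext => y.
by rewrite big_cons.
Qed.
Lemma avg_ext (h k : Z2 -> R) x : h =1 k -> avg h x = avg k x.
Proof. by move=> hk; congr (avg _ _); apply/funext. Qed.

(** * Green functions of subdomains and their comparison with the logarithm *)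

Section domain.
Variable A : pred Z2.
Hypothesis AI : forall x, A x -> inI N x.

(* The discrepancy [phi x - prj A x] is the harmonic extension to [A] of the
   field outside [A], tested here against an arbitrary vector. *)
Lemma harmonic_part x y : A x ->
  ip (phi x - prj A x) y = avg (fun x' => ip (phi x' - prj A x') y) x.
Proof.
move=> Ax; have [y' [c [yo yE]]] := projv_exists A y.
have rE x' : ip (phi x' - prj A x') y = \sum_(w <- outpts A) c w * ip (phi x') (phi w).
  have -> : y = y' + \sum_(w <- outpts A) c w *: phi w by rewrite yE subrK.
  rewrite ipDr ipBl prj_ip// subrr add0r ip_sumr big_seq [RHS]big_seq.
  apply: eq_bigr => w /mem_outpts nAw.
  by rewrite ipZr ipBl prj_orth// subr0.
rewrite rE (avg_ext _ rE) avg_sum !big_seq; apply: eq_bigr => w /mem_outpts nAw.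
congr (_ * _); apply/eqP; rewrite -subr_eq0 (gff_poisson G _ (AI Ax)).
have [xw|_] := eqVneq x w; first by rewrite -xw Ax in nAw.
by rewrite mulr0.
Qed.

Lemma grn_poisson x z : A x ->
  grn A x z - avg (fun x' => grn A x' z) x = pi / 2 * (x == z)%:R.
Proof.
move=> Ax; have [Az|nAz] := boolP (A z); last first.
  rewrite (avg_ext (k := fun=> 0) _ (fun x' => grn_outr x' nAz)) grn_outr//.
  have [xz|_] := eqVneq x z; first by rewrite -xz Ax in nAz.
  by rewrite /avg mulr0; lra.
have H := harmonic_part (phi z) Ax.
have := gff_poisson G z (AI Ax).
have e x' : ip (phi x' - prj A x') (phi z) = ip (phi x') (phi z) - grn A x' z.
  by rewrite ipBl grnE.
rewrite e (avg_ext _ e) avgB in H; lra.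
Qed.

Lemma grn_ge0 x z : 0 <= grn A x z.
Proof.
have [Ax|] := boolP (A x); last by move=> /grn_outl ->.
apply: (@min_principle R N A AI (grn A ^~ z)) Ax => [y Ay|y /andP[nAy _]].
  by rewrite -subr_ge0 (grn_poisson _ Ay) mulr_ge0 ?divr_ge0 ?pi_ge0.
by rewrite grn_outl.
Qed.

(** Off the pole [z] the function is harmonic, so the maximum principle on [A] without [z] applies,
    with boundary values at most the value at the pole. *)
Lemma grn_le_diag x z : grn A x z <= grn A z z.
Proof.
have [->//|xz] := eqVneq x z.
have [Ax|] := boolP (A x); last by move=> /grn_outl ->; exact: grn_ge0.
pose B y := A y && (y != z).
apply: (@max_principle R N B _ (grn A ^~ z)) => [y /andP[/AI]//|y /andP[Ay yz]|y|].
- by have := grn_poisson z Ay; rewrite (negbTE yz) mulr0; lra.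
- rewrite /bd => /andP[nB _]; have [->//|yz] := eqVneq y z.
  by rewrite grn_outl ?grn_ge0//; apply: contra nB => Ay; rewrite /B Ay.
- by rewrite /B Ax.
Qed.

Definition adj4 (x y : Z2) := [|| y == xr x, y == xl x, y == xu x | y == xd x].

(** In the equation at the pole, the four gaps to the neighbours are nonnegative and add up to
    [4 * (pi / 2)]. Hence [prj A] has steps of norm at most 4, whatever [A] is. *)
Lemma grn_diff_adj x y : adj4 x y -> grn A x x - grn A y x <= 8.
Proof.
have [Ax xy|nAx _] := boolP (A x); last by rewrite !(grn_outr _ nAx) subrr.
have := grn_poisson x Ax; rewrite eqxx mulr1 /avg.
have a1 := grn_le_diag (xr x) x; have a2 := grn_le_diag (xl x) x.
have a3 := grn_le_diag (xu x) x; have a4 := grn_le_diag (xd x) x.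
have := @pihalf_02 R => /andP[_ p2].
by move: xy; rewrite /adj4 => /or4P[] /eqP ->; lra.
Qed.

Lemma adj4C x y : adj4 x y -> adj4 y x.
Proof.
case: x => a b; case: y => c e; rewrite /adj4 /xr /xl /xu /xd /=.
by move=> /or4P[] /eqP[-> ->]; apply/or4P; [apply: Or42|apply: Or41|apply: Or44|apply: Or43];
  apply/eqP; congr pair; lia.
Qed.

Lemma nrm_prj_adj x y : adj4 x y -> nrm (prj A x - prj A y) <= 4.
Proof.
move=> xy; rewrite -(@ger0_norm _ (4 : R))// -sqrtr_sqr ler_wsqrtr//.
rewrite sqB -/(grn A x y) -!grn_sq.
have := grn_diff_adj xy; have := grn_diff_adj (adj4C xy); rewrite (grnC A x y); lra.
Qed.

Lemma nrm_prj_dist1 a b (k : nat) : nrm (prj A (a + k%:Z, b) - prj A (a, b)) <= 4 * k%:R.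
Proof.
elim: k => [|k IH]; first by rewrite addr0 subrr nrm0 mulr0.
have -> : prj A (a + k.+1%:Z, b) - prj A (a, b) =
  (prj A (a + k.+1%:Z, b) - prj A (a + k%:Z, b)) + (prj A (a + k%:Z, b) - prj A (a, b)).
  by rewrite addrA subrK.
apply: (le_trans (nrmD _ _)); rewrite -natr1.
have : nrm (prj A (a + k.+1%:Z, b) - prj A (a + k%:Z, b)) <= 4.
  apply: nrm_prj_adj; rewrite /adj4 /xl /=; apply/orP; right; apply/orP; left.
  by apply/eqP; congr pair; lia.
lra.
Qed.

Lemma nrm_prj_dist2 a b (k : nat) : nrm (prj A (a, b + k%:Z) - prj A (a, b)) <= 4 * k%:R.
Proof.
elim: k => [|k IH]; first by rewrite addr0 subrr nrm0 mulr0.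
have -> : prj A (a, b + k.+1%:Z) - prj A (a, b) =
  (prj A (a, b + k.+1%:Z) - prj A (a, b + k%:Z)) + (prj A (a, b + k%:Z) - prj A (a, b)).
  by rewrite addrA subrK.
apply: (le_trans (nrmD _ _)); rewrite -natr1.
have : nrm (prj A (a, b + k.+1%:Z) - prj A (a, b + k%:Z)) <= 4.
  apply: nrm_prj_adj; rewrite /adj4 /xd /=; apply/or4P; apply: Or44.
  by apply/eqP; congr pair; lia.
lra.
Qed.

Lemma nrm_prj_dist z a b : nrm (prj A z - prj A (z.1 + a, z.2 + b)) <= 4 * (`|a%:~R| + `|b%:~R|).
Proof.
have d1 x y (c : int) : nrm (prj A (x + c, y) - prj A (x, y)) <= 4 * `|c%:~R|.
  have [c0|c0] := leP 0 c.
    have -> : c = `|c|%N%:Z by lia.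
    by rewrite -pmulrn normr_nat nrm_prj_dist1.
  have := nrm_prj_dist1 (x + c) y `|c|%N.
  have -> : x + c + `|c|%N%:Z = x by lia.
  rewrite -nrmN opprB => /le_trans; apply.
  by rewrite natr_absz ltr0_norm// rmorphN/= ler_wpM2l// lerNl; apply: lerNnormlW.
have d2 x y (c : int) : nrm (prj A (x, y + c) - prj A (x, y)) <= 4 * `|c%:~R|.
  have [c0|c0] := leP 0 c.
    have -> : c = `|c|%N%:Z by lia.
    by rewrite -pmulrn normr_nat nrm_prj_dist2.
  have := nrm_prj_dist2 x (y + c) `|c|%N.
  have -> : y + c + `|c|%N%:Z = y by lia.
  rewrite -nrmN opprB => /le_trans; apply.
  by rewrite natr_absz ltr0_norm// rmorphN/= ler_wpM2l// lerNl; apply: lerNnormlW.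
case: z => x y /=.
rewrite -nrmN opprB.
have -> : prj A (x + a, y + b) - prj A (x, y) =
  (prj A (x + a, y + b) - prj A (x, y + b)) + (prj A (x, y + b) - prj A (x, y)).
  by rewrite addrA subrK.
rewrite mulrDr; apply: (le_trans (nrmD _ _)); exact: lerD.
Qed.

(** Walk horizontally to the side of the box, where the projection vanishes, with steps of norm at
    most 4. *)
Lemma nrm_prj_le z : nrm (prj A z) <= 4 * N%:R.
Proof.
have [Az|nAz] := boolP (A z); last by rewrite prj_out// nrm0 mulr_ge0.
have := nrm_prj_dist z (- z.1) 0; rewrite addrN addr0 (@prj_out A (0, z.2)); last first.
  by apply/negP => /AI; rewrite /inI ltxx.
rewrite subr0 => /le_trans; apply.
rewrite rmorph0 normr0 addr0 rmorphN/= normrN ler_wpM2l//.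
have /andP[/andP[z0 zN] _] := AI Az.
have e0 : 0 <= z.1%:~R :> R by rewrite ler0z ltW.
have e1 : z.1%:~R <= N%:Z%:~R :> R by rewrite ler_int ltW.
by rewrite ger0_norm.
Qed.

(* Wide enough to contain every box around the reflection of a site of [VN N]
   across a side. *)
Definition near_box (z : Z2) : bool :=
  (- N%:Z <= z.1 <= 2 * N%:Z) && (- N%:Z <= z.2 <= 2 * N%:Z).

(** [prj A] averaged around [z] with the kernel [2 / pi * elog], of mass nearly one. Pairing with it
    replaces the point source of [grn A ^~ z] by the source [elog], which is exactly the Laplacian
    of [flog]. *)
Definition smear (z : Z2) : V :=
  zsum (2 * N) (fun a => zsum (2 * N) (fun b =>
    (2 / pi * elog (a, b)) *: prj A (z.1 + a, z.2 + b))).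

Lemma smear_poisson x z : A x -> near_box z ->
  ip (prj A x) (smear z) - avg (fun x' => ip (prj A x') (smear z)) x = elog (zsub x z).
Proof.
move=> Ax zn.
have E x' : ip (prj A x') (smear z) = zsum (2 * N) (fun a => zsum (2 * N) (fun b =>
    2 / pi * elog (a, b) * grn A x' (z.1 + a, z.2 + b))).
  rewrite ip_zsumr; apply: zsum_ext => a; rewrite ip_zsumr; apply: zsum_ext => b.
  by rewrite ipZr.
have avg_zsum (F : int -> Z2 -> R) n :
    avg (fun x' => zsum n (F ^~ x')) x = zsum n (fun a => avg (F a) x).
  elim: n => [//|n IH] /=; rewrite avgD avgD IH//.
rewrite E (avg_ext _ E) avg_zsum -zsumB.
pose D a b := 2 / pi * elog (a, b) * (pi / 2 * (x == (z.1 + a, z.2 + b))%:R) : R.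
rewrite (@zsum_ext _ _ _ (fun a => zsum (2 * N) (D a))); last first.
  move=> a; rewrite (avg_zsum (fun b x' => 2 / pi * elog (a, b) * grn A x' (z.1 + a, z.2 + b))) -zsumB.
  by apply: zsum_ext => b; rewrite avgZ -mulrBr grn_poisson.
have Dneq a b : x != (z.1 + a, z.2 + b) -> D a b = 0.
  by move=> /negbTE h; rewrite /D h !mulr0.
have /andP[/andP[x1 x1N] /andP[x2 x2N]] := AI Ax.
have /andP[/andP[z1 z1N] /andP[z2 z2N]] := zn.
(* The range [2 * N] contains every difference between a point of the open box and a point of
   [near_box], so the truncation of the kernel loses nothing here. *)
rewrite (@zsum_delta _ _ _ (x.1 - z.1)); first last.
- move=> a na; have -> : D a = fun=> 0.
    apply/funext => b; apply: Dneq; apply: contra na => /eqP ->/=.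
    by apply/eqP; lia.
  by elim: (2 * N)%N => [//|n IH] /=; rewrite IH !addr0.
- by lia.
rewrite (@zsum_delta _ _ _ (x.2 - z.2)); first last.
- move=> b nb; apply: Dneq; apply: contra nb => /eqP ->/=.
  by apply/eqP; lia.
- by lia.
rewrite /D /zsub.
have -> : x == (z.1 + (x.1 - z.1), z.2 + (x.2 - z.2)).
  by apply/eqP; rewrite {1}(surjective_pairing x); congr pair; lia.
have pn : pi != 0 :> R by rewrite gt_eqF// pi_gt0.
have pp (q e : R) : q != 0 -> 2 / q * e * (q / 2 * 1) = e by move=> h; field.
exact: pp.
Qed.

Definition flogz (z x : Z2) : R := flog (zsub x z).

(** The two Laplacians cancel exactly, so the sum is harmonic on all of [A], pole included, with
    boundary values those of [flogz z]. The bounds below follow by the maximum principle. *)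
Lemma smear_harmonic x z : A x -> near_box z ->
  ip (prj A x) (smear z) + flogz z x = avg (fun x' => ip (prj A x') (smear z) + flogz z x') x.
Proof.
move=> Ax zn; have := smear_poisson Ax zn.
have e : avg (flogz z) x = avg flog (zsub x z).
  rewrite /avg /flogz /zsub /xr /xl /xu /xd /=.
  by congr ((flog _ + flog _ + flog _ + flog _) / _); congr pair; lia.
rewrite avgD e /elog -/(flogz z x); lra.
Qed.

Lemma smear_diff_ub z1 z2 m x : A x -> near_box z1 -> near_box z2 ->
  (forall w, bd A w -> flogz z1 w - flogz z2 w <= m) ->
  ip (prj A x) (smear z1) - ip (prj A x) (smear z2) <= m - flogz z1 x + flogz z2 x.
Proof.
move=> Ax n1 n2 H.
pose h x' := (ip (prj A x') (smear z1) + flogz z1 x') - (ip (prj A x') (smear z2) + flogz z2 x').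
suff : h x <= m by rewrite /h; lra.
apply: (@max_principle R N A AI h m) Ax => [y Ay|w bw].
  by rewrite /h avgB -!smear_harmonic.
have /andP[/prj_out w0 _] := bw.
by rewrite /h w0 !ip0l !add0r; exact: H.
Qed.

Lemma smear_ub z m x : A x -> near_box z -> (forall w, bd A w -> flogz z w <= m) ->
  ip (prj A x) (smear z) <= m - flogz z x.
Proof.
move=> Ax n1 H; pose h x' := ip (prj A x') (smear z) + flogz z x'.
suff : h x <= m by rewrite /h; lra.
apply: (@max_principle R N A AI h m) Ax => [y Ay|w bw]; first by rewrite /h -smear_harmonic.
by have /andP[/prj_out w0 _] := bw; rewrite /h w0 ip0l add0r; exact: H.
Qed.

Lemma smear_lb z m x : A x -> near_box z -> (forall w, bd A w -> m <= flogz z w) ->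
  m - flogz z x <= ip (prj A x) (smear z).
Proof.
move=> Ax n1 H; pose h x' := ip (prj A x') (smear z) + flogz z x'.
suff : m <= h x by rewrite /h; lra.
apply: (@min_principle R N A AI h m) Ax => [y Ay|w bw]; first by rewrite /h -smear_harmonic.
by have /andP[/prj_out w0 _] := bw; rewrite /h w0 ip0l add0r; exact: H.
Qed.

(** The difference is a kernel average of [prj A z - prj A (z + (a, b))], at most [4 * C] by the
    Lipschitz bound, plus the missing mass times [prj A z], at most [3 / N * (4 * N)]. *)
Lemma nrm_smear C z : (0 < N)%N ->
  (forall n, zsum n (fun a => zsum n (fun b =>
     elog (a, b) * (`|a%:~R| + `|b%:~R|))) <= C :> R) ->
  nrm (prj A z - smear z) <= 4 * C + 12.
Proof.
move=> N0 HC; pose n := (2 * N)%N; have n0 : (0 < n)%N by rewrite /n muln_gt0.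
pose p (a b : int) : R := 2 / pi * elog (a, b).
have pi0 := @pi_gt0 R; have pin : pi != 0 :> R by rewrite gt_eqF.
have pp : 2 / pi * (pi / 2) = 1 :> R.
  have h (q : R) : q != 0 -> 2 / q * (q / 2) = 1 by move=> h; field.
  exact: h.
have p0 a b : 0 <= p a b by rewrite mulr_ge0 ?divr_ge0 ?(ltW pi0) ?elog_ge0.
pose m := zsum n (fun a => zsum n (fun b => p a b)).
have zsum_scale k (c : int -> R) (v : V) : zsum k (fun a => c a *: v) = zsum k c *: v.
  by elim: k => [//|k IH] /=; rewrite IH !scalerDl.
have E : prj A z - smear z = zsum n (fun a => zsum n (fun b =>
    p a b *: (prj A z - prj A (z.1 + a, z.2 + b)))) + (1 - m) *: prj A z.
  rewrite (@zsum_ext _ n _ (fun a => zsum n (fun b => p a b) *: prj A z -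
     zsum n (fun b => p a b *: prj A (z.1 + a, z.2 + b)))); last first.
    move=> a; rewrite -zsum_scale -zsumB; apply: zsum_ext => b.
    by rewrite scalerBr.
  rewrite zsumB zsum_scale -/m -/(smear z) scalerBl scale1r.
  by rewrite addrAC [X in _ = X - _]addrC subrK.
have m1 : `|1 - m| <= 3 / N%:R.
  have mE : m = 2 / pi * zsum n (fun a => zsum n (fun b => elog (a, b))).
    by rewrite -zsumZl; apply: zsum_ext => a; rewrite zsumZl.
  have nE : n%:R = 2 * N%:R :> R by rewrite /n natrM.
  have ub := @elog_mass_ub R n n0; have lb := @elog_mass_lb R n n0.
  rewrite mE ler_norml; set S := zsum n _ in ub lb *.
  have c1 : 2 / pi <= 1 :> R by rewrite ler_pdivrMr// mul1r pi_ge2.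
  have c0 : 0 < 2 / pi :> R by rewrite divr_gt0.
  have NR : 0 < N%:R :> R by rewrite ltr0n.
  have r1 : 4 / n%:R <= 3 / N%:R :> R.
    rewrite nE; have -> : 4 / (2 * N%:R) = 2 / N%:R :> R by field; rewrite gt_eqF.
    by rewrite ler_pM2r ?invr_gt0//; lra.
  have r2 : 6 / n%:R = 3 / N%:R :> R by rewrite nE; field; rewrite gt_eqF.
  have r0 : 0 <= 3 / N%:R :> R by rewrite divr_ge0.
  rewrite r2 in lb; set r := 3 / N%:R in r1 r2 r0 lb *.
  have u1 : 2 / pi * S <= 1 + 2 / pi * r.
    have -> : 1 + 2 / pi * r = 2 / pi * (pi / 2 + r) by rewrite mulrDr pp.
    by rewrite ler_pM2l//; lra.
  have l1 : 1 - 2 / pi * r <= 2 / pi * S.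
    have -> : 1 - 2 / pi * r = 2 / pi * (pi / 2 - r) by rewrite mulrBr pp.
    by rewrite ler_pM2l//; lra.
  have : 2 / pi * r <= r by rewrite ler_piMl.
  by move=> h; apply/andP; split; lra.
rewrite E; apply: (le_trans (nrmD _ _)); apply: lerD; last first.
  rewrite nrmZ; apply: (@le_trans _ _ (3 / N%:R * (4 * N%:R))).
    by rewrite ler_pM ?normr_ge0 ?nrm_ge0// nrm_prj_le.
  by rewrite le_eqVlt; apply/orP; left; apply/eqP; field; rewrite pnatr_eq0 -lt0n.
apply: (le_trans (nrm_zsum _ _)).
apply: (@le_trans _ _ (zsum n (fun a => zsum n (fun b => 4 * (elog (a, b) * (`|a%:~R| + `|b%:~R|)))))); last first.
  under zsum_ext => a do rewrite zsumZl.
  by rewrite zsumZl ler_wpM2l.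
apply: ler_zsum => a; apply: (le_trans (nrm_zsum _ _)); apply: ler_zsum => b.
rewrite nrmZ ger0_norm// mulrCA.
have c1 : p a b <= elog (a, b).
  by rewrite /p ler_piMl ?elog_ge0// ler_pdivrMr// mul1r pi_ge2.
by apply: ler_pM => //; [exact: nrm_ge0|exact: nrm_prj_dist].
Qed.

End domain.
End form.

(** * Green function estimates *)

Section green_error.
Context {R : realType}.

Lemma flog_sub0 (z : Z2) : flogz z z = 0 :> R.
Proof. by rewrite /flogz /flog /zsub /nsq /= !subrr expr0n/= !addr0 ln1 mul0r. Qed.

Definition within (r : R) (x : Z2) : bool := (`|x.1%:~R| <= r) && (`|x.2%:~R| <= r).

Lemma sqr_norm_le (a r : R) : `|a| <= r -> a ^+ 2 <= r ^+ 2.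
Proof.
move=> h; rewrite -real_normK ?num_real// ler_pXn2r ?nnegrE//.
by apply: le_trans h.
Qed.

Lemma flog_within r x : within r x -> flog x <= ln (1 + 2 * r ^+ 2) / 2.
Proof.
move=> /andP[/sqr_norm_le h1 /sqr_norm_le h2].
rewrite /flog ler_pM2r// ler_ln ?posrE /nsq; first lra.
  by rewrite ltr_pwDl ?addr_ge0 ?sqr_ge0.
by rewrite ltr_pwDl// mulr_ge0 ?sqr_ge0.
Qed.

Lemma flog_nwithin r x : 0 <= r -> ~~ within r x -> ln (1 + r ^+ 2) / 2 <= flog x.
Proof.
move=> r0; rewrite negb_and -!ltNge => h.
rewrite /flog ler_pM2r// ler_ln ?posrE /nsq; last 2 first.
- by rewrite ltr_pwDl ?sqr_ge0.
- by rewrite ltr_pwDl ?addr_ge0 ?sqr_ge0.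
have q (a : R) : r < `|a| -> r ^+ 2 <= a ^+ 2.
  move=> /ltW ra; rewrite -(@real_normK _ a) ?num_real//.
  by rewrite ler_pXn2r ?nnegrE.
have := sqr_ge0 (x.1%:~R : R); have := sqr_ge0 (x.2%:~R : R).
by case/orP : h => /q; lra.
Qed.

Lemma within_le (r s : R) x : r <= s -> within r x -> within s x.
Proof. by move=> rs /andP[h1 h2]; rewrite /within (le_trans h1) ?(le_trans h2). Qed.

Lemma intrB_tri (a b c : int) : (a - c)%:~R = (a - b)%:~R + (b - c)%:~R :> R.
Proof. by rewrite -rmorphD/= addrA subrK. Qed.

Lemma within_sub (r s : R) x y z : within r (zsub x y) -> within s (zsub y z) ->
  within (r + s) (zsub x z).
Proof.
rewrite /within /zsub /= => /andP[h1 h2] /andP[h3 h4].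
rewrite (intrB_tri x.1 y.1 z.1) (intrB_tri x.2 y.2 z.2).
by apply/andP; split; apply: (le_trans (ler_normD _ _)); exact: lerD.
Qed.

Lemma within_subC (r : R) x y : within r (zsub x y) = within r (zsub y x).
Proof. by rewrite /within /zsub /= -opprB rmorphN normrN -(opprB y.2) rmorphN normrN. Qed.

Lemma within_sub0 (r : R) x : 0 <= r -> within r (zsub x x).
Proof. by move=> r0; rewrite /within /zsub /= !subrr rmorph0 normr0 r0. Qed.

Lemma inV_near N x : inV N x -> near_box N x.
Proof. rewrite /near_box /inV => /andP[/andP[? ?] /andP[? ?]]; lia. Qed.

Lemma inV_within N x y : inV N x -> inV N y -> within N%:R (zsub x y).
Proof.
rewrite /inV /within /zsub /= => /andP[/andP[? ?] /andP[? ?]] /andP[/andP[? ?] /andP[? ?]].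
rewrite -!intr_norm -[N%:R]/(N%:Z%:~R) !ler_int; apply/andP; split; lia.
Qed.

Lemma nbr_cases (A : pred Z2) w : bd A w -> exists y, [/\ A y, adj4 w y & ~~ A w].
Proof.
by case/andP => nAw /or4P[] h; eexists; split; try exact: h; rewrite // /adj4 eqxx ?orbT.
Qed.

Lemma adj4_within w y : adj4 w y -> within 1 (zsub w y).
Proof.
rewrite /adj4 /within /zsub /xr /xl /xu /xd => /or4P[] /eqP -> /=;
  rewrite -!intr_norm -[1 : R]/(1%:Z%:~R) !ler_int; apply/andP; split; lia.
Qed.

Lemma adj4_inV N w y : adj4 w y -> inI N y -> inV N w.
Proof.
rewrite /adj4 /inI /inV /xr /xl /xu /xd => /or4P[] /eqP -> /= /andP[/andP[? ?] /andP[? ?]];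
  rewrite -andbA; apply/and4P; split; lia.
Qed.

(** The radius [r - 1] leaves room for the neighbours: this is the closed box of radius [r] without
    its inner boundary (see [inner_nbhd]). *)
Definition bx (N : nat) (v : Z2) (r : R) : pred Z2 :=
  fun x => inI N x && within (r - 1) (zsub x v).

Lemma bxI N v r x : bx N v r x -> inI N x. Proof. by case/andP. Qed.

Lemma bd_inV N (A : pred Z2) w : (forall x, A x -> inI N x) -> bd A w -> inV N w.
Proof. by move=> AI /nbr_cases[y [/AI yI wy _]]; exact: adj4_inV wy yI. Qed.

Lemma bd_bx N v r w : bd (bx N v r) w ->
  [/\ inV N w, within r (zsub w v) & (inI N w -> ~~ within (r - 1) (zsub w v))].
Proof.
move=> bw; split; first by apply: bd_inV bw; exact: bxI.
  have [y [/andP[_ yv] /adj4_within wy _]] := nbr_cases bw.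
  by have := within_sub wy yv; rewrite addrC subrK.
by move=> wI; case/andP : bw => + _; rewrite /bx wI.
Qed.

Context {V : lmodType R}.
Variables (N : nat) (ip : V -> V -> R) (phi : Z2 -> V).
Hypothesis G : gff_form N ip phi.
Local Notation grn := (grn G).
Local Notation prj := (prj G).
Local Notation sq := (sq ip).
Let L : R := ln N%:R.

(* Up to [om], of order sqrt(log N) uniformly in the domain, [grn A] obeys the
   comparison bounds of a function with Laplacian exactly that of [flog]. *)
Definition green_bounds (om : R) :=
  [/\ 0 <= om,
   (forall A : pred Z2, (forall x, A x -> inI N x) -> forall z1 z2 m x, A x ->
     near_box N z1 -> near_box N z2 ->
     (forall w, bd A w -> flogz z1 w - flogz z2 w <= m) ->
     grn A x z1 - grn A x z2 <= m - flogz z1 x + flogz z2 x + om),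
   (forall A : pred Z2, (forall x, A x -> inI N x) -> forall z m x, A x -> near_box N z ->
     (forall w, bd A w -> flogz z w <= m) -> grn A x z <= m - flogz z x + om) &
   (forall A : pred Z2, (forall x, A x -> inI N x) -> forall z m x, A x -> near_box N z ->
     (forall w, bd A w -> m <= flogz z w) -> m - flogz z x - om <= grn A x z)].

Lemma ln1D2sq : (0 < N)%N -> ln (1 + 2 * N%:R ^+ 2) / 2 <= L + 1.
Proof.
move=> N0; have NR : 1 <= N%:R :> R by rewrite ler1n.
have N1 : 0 < N%:R :> R by rewrite ltr0n.
rewrite ler_pdivrMr//.
have -> : (L + 1) * 2 = ln (N%:R ^+ 2 * expR 2).
  by rewrite lnM ?posrE ?exprn_gt0 ?expR_gt0// expRK lnXn// /L; ring.
rewrite ler_ln ?posrE ?mulr_gt0 ?exprn_gt0 ?expR_gt0//.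
have := expR_ge1Dx (2 : R); nra.
Qed.

(** By Cauchy-Schwarz, passing from [prj A z] to [smear] costs [K] times the norm [t] of [prj A x].
    That norm bounds itself: [t ^+ 2 <= L + 1 + K * t] gives [t ^+ 2 <= 2 * (L + 1) + K ^+ 2]. The
    outer factor 2 is for differences of two Green functions. *)
Lemma green_bounds_exist C : (0 < N)%N -> 0 <= C ->
  (forall n, zsum n (fun a => zsum n (fun b =>
     elog (a, b) * (`|a%:~R| + `|b%:~R|))) <= C :> R) ->
  green_bounds (2 * ((4 * C + 12) * Num.sqrt (2 * (L + 1) + (4 * C + 12) ^+ 2))).
Proof.
move=> N0 C0 HC; set K := 4 * C + 12.
have K0 : 0 <= K by rewrite addr_ge0// mulr_ge0.
have L0 : 0 <= L by rewrite ln_ge0// ler1n.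
have sm (A : pred Z2) (AI : forall x, A x -> inI N x) x z : near_box N z ->
    `|grn A x z - ip (prj A x) (smear G A z)| <= K * nrm ip (prj A x).
  move=> nz; rewrite /grn -(ipBr G) mulrC (le_trans (ip_le_nrm G _ _))// ler_wpM2l ?nrm_ge0//.
  exact: nrm_smear.
have nb (A : pred Z2) (AI : forall x, A x -> inI N x) x :
    nrm ip (prj A x) <= Num.sqrt (2 * (L + 1) + K ^+ 2).
  have [Ax|nAx] := boolP (A x); last by rewrite prj_out// (nrm0 G) sqrtr_ge0.
  have xV := inI_inV (AI _ Ax).
  rewrite -[leLHS]ger0_norm ?nrm_ge0// -sqrtr_sqr ler_wsqrtr// (nrm_sq G).
  have := @smear_ub _ _ _ _ _ G A AI x (L + 1) x Ax (inV_near xV).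
  rewrite flog_sub0 subr0 => H.
  have {}H : ip (prj A x) (smear G A x) <= L + 1.
    apply: H => w bw; apply: le_trans (ln1D2sq N0); apply: flog_within.
    by apply: inV_within => //; exact: bd_inV bw.
  have := sm A AI x x (inV_near xV).
  rewrite [grn A x x]grn_def -/(sq _) -(nrm_sq G).
  set t := nrm ip (prj A x); have := sqr_ge0 (K - t).
  move=> h1 /(le_trans (ler_norm _)); rewrite sqrrB mulr2n in h1; lra.
set om := K * _.
have smo (A : pred Z2) (AI : forall x, A x -> inI N x) x z : near_box N z ->
    `|grn A x z - ip (prj A x) (smear G A z)| <= om.
  by move=> nz; apply: le_trans (sm A AI x z nz) _; rewrite ler_wpM2l// nb.
have om0 : 0 <= om by rewrite mulr_ge0 ?sqrtr_ge0.
split; first by rewrite mulr_ge0.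
- move=> A AI z1 z2 m x Ax n1 n2 H.
  have := smear_diff_ub G AI Ax n1 n2 H.
  have := smo A AI x z1 n1; have := smo A AI x z2 n2.
  rewrite !ler_norml => /andP[h1 h2] /andP[h3 h4]; lra.
- move=> A AI z m x Ax n1 H.
  have := smear_ub G AI Ax n1 H; have := smo A AI x z n1.
  by rewrite !ler_norml => /andP[h1 h2]; lra.
- move=> A AI z m x Ax n1 H.
  have := smear_lb G AI Ax n1 H; have := smo A AI x z n1.
  by rewrite !ler_norml => /andP[h1 h2]; lra.
Qed.

Lemma prj_diff_sq (A B : pred Z2) v : (forall z, B z -> A z) ->
  sq (prj A v - prj B v) = grn A v v - grn B v v.
Proof.
move=> BA; rewrite (sqB G) (prj_nested G _ _ BA) //.
have -> : grn A v v = sq (prj A v) by [].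
have -> : grn B v v = sq (prj B v) by [].
by ring.
Qed.

(** By orthogonality the left side is [grn A v v - grn B v v]. As a function of the first argument
    this difference is harmonic on [B], the poles cancelling, and equals [grn A] on the boundary of
    [B]. *)
Lemma prj_diff_le (A B : pred Z2) v m :
  (forall z, A z -> inI N z) -> (forall z, B z -> A z) -> B v ->
  (forall x, bd B x -> grn A x v <= m) -> sq (prj A v - prj B v) <= m.
Proof.
move=> AI BA Bv H; rewrite prj_diff_sq//.
have BI z : B z -> inI N z by move=> /BA /AI.
have e x : grn A x v - grn B x v = ip (phi x - prj B x) (phi v) - ip (phi x - prj A x) (phi v).
  by rewrite !(ipBl G) -!grnE; ring.
apply: (@max_principle R N B BI (fun x => grn A x v - grn B x v) m) Bv => [x Bx|x hx].
  rewrite e (avg_ext _ e) avgB -(harmonic_part G BI _ Bx).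
  by rewrite -(harmonic_part G AI _ (BA _ Bx)).
by have /andP[nB _] := hx; rewrite (grn_outl G _ nB) subr0; exact: H.
Qed.

(** The product is [ip (phi u) y] minus its harmonic extension from the boundary, and both numbers
    lie between 0 and [m]. *)
Lemma prj_ip_le (A : pred Z2) u y m :
  (forall z, A z -> inI N z) -> A u ->
  (forall x, A x || bd A x -> 0 <= ip (phi x) y <= m) -> `|ip (prj A u) y| <= m.
Proof.
move=> AI Au H.
have e x : ip (phi x - prj A x) y = ip (phi x) y - ip (prj A x) y by rewrite (ipBl G).
have bdE x : bd A x -> ip (phi x - prj A x) y = ip (phi x) y.
  by case/andP => nA _; rewrite e (prj_out G nA) (ip0l G) subr0.
have harm x : A x -> ip (phi x - prj A x) y = avg (fun z => ip (phi z - prj A z) y) x.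
  exact: harmonic_part.
have h1 : ip (phi u - prj A u) y <= m.
  apply: (@max_principle R N A AI (fun x => ip (phi x - prj A x) y)) Au => [x Ax|x hx].
    by rewrite -harm.
  by rewrite bdE//; have := H x; rewrite hx orbT => /(_ isT)/andP[].
have h2 : 0 <= ip (phi u - prj A u) y.
  apply: (@min_principle R N A AI (fun x => ip (phi x - prj A x) y)) Au => [x Ax|x hx].
    by rewrite -harm.
  by rewrite bdE//; have := H x; rewrite hx orbT => /(_ isT)/andP[].
have := H u; rewrite Au => /(_ isT)/andP[].
by rewrite e in h1 h2; rewrite ler_norml => h3 h4; apply/andP; split; lra.
Qed.

(** Comparable arguments cost only an additive constant; [ln 2 <= 1] turns the factor [2 ^+ k] into
    [k]. *)
Lemma half_ln_le (k : nat) (X Y : R) : 0 < X -> X <= (2 ^+ k) ^+ 2 * Y ->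
  ln X / 2 <= ln Y / 2 + k%:R.
Proof.
move=> X0 XY; have c0 : 0 < (2 ^+ k) ^+ 2 :> R by rewrite !exprn_gt0.
have Y0 : 0 < Y by rewrite -(pmulr_rgt0 _ c0); apply: lt_le_trans XY.
have l2 : ln (2 : R) <= 1 by have := @ln_le_lin R 1; rewrite ltr_pwDl// => /(_ isT).
have : ln X <= ln ((2 ^+ k) ^+ 2 * Y) by rewrite ler_ln ?posrE// mulr_gt0.
rewrite lnM ?posrE// !lnXn ?exprn_gt0//.
have : ln (2 : R) *+ k <= k%:R by rewrite -[leLHS]mulr_natl ler_piMr.
set b := ln 2 *+ k; set c := k%:R; rewrite mulr2n; lra.
Qed.

Lemma phi_prjI x y : ip (phi x) y = ip (prj (inI N) x) y.
Proof.
apply/eqP; rewrite -subr_eq0 -(ipBl G) (gff_sym G); apply/eqP/(sq0_ip G).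
rewrite (sqB G) (gff_sym G (phi x)) prj_ip; last by move=> w wI; rewrite (gff_off G wI) (ip0r G).
have -> : sq (prj (inI N) x) = ip (prj (inI N) x) (phi x) by rewrite -grnE.
rewrite prj_ip; last by move=> w wI; rewrite (gff_off G wI) (ip0r G).
by rewrite ?sqE; ring.
Qed.

Lemma ip_phi_grn x z : ip (phi x) (phi z) = grn (inI N) x z.
Proof. by rewrite phi_prjI grnE. Qed.

Lemma sq_phi_sub x y : sq (phi x - y) = sq (prj (inI N) x - y).
Proof.
rewrite !(sqB G) phi_prjI; congr (_ + _); congr (_ - _).
by rewrite ?sqE phi_prjI (gff_sym G) phi_prjI.
Qed.

Variable om : R.
Hypothesis GB : green_bounds om.

Lemma om_ge0 : 0 <= om. Proof. by case: GB. Qed.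

Let gb3 (A : pred Z2) (AI : forall x, A x -> inI N x) z1 z2 m x : A x ->
     near_box N z1 -> near_box N z2 ->
     (forall w, bd A w -> flogz z1 w - flogz z2 w <= m) ->
     grn A x z1 - grn A x z2 <= m - flogz z1 x + flogz z2 x + om.
Proof. by case: GB => _ H _ _; exact: H. Qed.

Let gb1 (A : pred Z2) (AI : forall x, A x -> inI N x) z m x : A x -> near_box N z ->
     (forall w, bd A w -> flogz z w <= m) -> grn A x z <= m - flogz z x + om.
Proof. by case: GB => _ _ H _; exact: H. Qed.

Let gb2 (A : pred Z2) (AI : forall x, A x -> inI N x) z m x : A x -> near_box N z ->
     (forall w, bd A w -> m <= flogz z w) -> m - flogz z x - om <= grn A x z.
Proof. by case: GB => _ _ _ H; exact: H. Qed.

Lemma bx_self v r : 1 <= r -> inI N v -> bx N v r v.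
Proof. by move=> r1 vI; rewrite /bx vI within_sub0// subr_ge0. Qed.

Lemma bx_lt1 v r w : r < 1 -> ~~ bx N v r w.
Proof.
move=> r1; rewrite /bx /within !negb_and -!ltNge; apply/orP; right; apply/orP; left.
by apply: lt_le_trans (normr_ge0 _); rewrite subr_lt0.
Qed.

Lemma grn_bx_ub v z r s x : 0 <= r -> 0 <= s -> inV N z -> within s (zsub v z) ->
  bx N v r x -> grn (bx N v r) x z <= ln (1 + 2 * (r + s) ^+ 2) / 2 - flogz z x + om.
Proof.
move=> r0 s0 zV vz bxx; apply: gb1 => //; [exact: bxI|exact: inV_near|move=> w /bd_bx[_ wr _]].
by apply: flog_within; exact: within_sub wr vz.
Qed.

Lemma bx_mono v r r' x : r' <= r -> bx N v r' x -> bx N v r x.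
Proof. by move=> rr /andP[xI xv]; rewrite /bx xI; apply: within_le xv; rewrite lerD2r. Qed.

Lemma prj_bx_diff_small v r r' : inV N v -> 0 <= r -> r' < 1 ->
  sq (prj (bx N v r) v - prj (bx N v r') v) <= ln (1 + 2 * r ^+ 2) / 2 + om.
Proof.
move=> vV r0 r1; rewrite (@prj_out _ _ _ _ _ G (bx N v r')) ?bx_lt1// subr0.
have l0 : 0 <= ln (1 + 2 * r ^+ 2) / 2 by rewrite divr_ge0// ln_ge0// lerDl mulr_ge0 ?sqr_ge0.
have [vb|vb] := boolP (bx N v r v); last first.
  by rewrite prj_out// ?sqE (ip0l G) addr_ge0 ?om_ge0.
have := @grn_bx_ub v v r 0 v r0 (lexx _) vV (within_sub0 _ (lexx _)) vb.
by rewrite addr0 flog_sub0 subr0.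
Qed.

(** Reduced by [prj_diff_le] to [grn A ^~ u] on the boundary of the small box. There the potential
    is at least the half logarithm of [1 + (r' - 1) ^+ 2], while on the boundary of [A] it is at
    most that of [1 + 2 * s ^+ 2]. *)
Lemma prj_bx_diff (A : pred Z2) u s r' : (forall x, A x -> inI N x) ->
  (forall x, bx N u r' x -> A x) -> (forall w, bd A w -> within s (zsub w u)) ->
  inV N u -> r' <= s -> 1 <= r' ->
  sq (prj A u - prj (bx N u r') u) <= ln (1 + 2 * s ^+ 2) / 2 - ln (1 + (r' - 1) ^+ 2) / 2 + om.
Proof.
move=> AI BA As uV rs r1.
have b0 : 0 <= ln (1 + 2 * s ^+ 2) / 2 - ln (1 + (r' - 1) ^+ 2) / 2 + om.
  rewrite addr_ge0 ?om_ge0// subr_ge0 ler_pM2r// ler_ln ?posrE; last 2 first.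
  - by rewrite ltr_pwDl ?sqr_ge0.
  - by rewrite ltr_pwDl// mulr_ge0 ?sqr_ge0.
  rewrite lerD2l; nra.
have [uI|uI] := boolP (inI N u); last first.
  rewrite !prj_out ?subr0 ?sqE ?(ip0l G)//.
  - by apply: contra uI; exact: bxI.
  - by apply: contra uI; exact: AI.
apply: prj_diff_le => // [|x bx']; first exact: bx_self.
have [Ax|nAx] := boolP (A x); last by rewrite grn_outl.
have [_ _ /(_ (AI _ Ax)) xf] := bd_bx bx'.
apply: (le_trans (gb1 AI Ax (inV_near uV) (m := ln (1 + 2 * s ^+ 2) / 2) _)).
  by move=> w /As; exact: flog_within.
rewrite lerD2r lerD2l lerN2; apply: flog_nwithin => //.
by rewrite subr_ge0.
Qed.

Lemma flog_diff_le (rho : R) u v w : 0 < rho -> ~~ within rho (zsub w v) ->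
  within (rho / 2) (zsub u v) ->
  flogz v w - flogz u w <= 2 :> R /\ flogz u w - flogz v w <= 2 :> R.
Proof.
move=> rho0; rewrite /flogz /flog => wv uv.
pose a : R := Num.max `|(zsub w v).1%:~R| `|(zsub w v).2%:~R|.
have a1 : `|(zsub w v).1%:~R| <= a by rewrite le_max lexx.
have a2 : `|(zsub w v).2%:~R| <= a by rewrite le_max lexx orbT.
have ra : rho < a.
  by move: wv; rewrite /within negb_and -!ltNge lt_max.
have a0 : 0 < a by apply: lt_trans ra.
have p (x : Z2) : 0 < 1 + nsq x :> R by rewrite ltr_pwDl ?nsq_ge0.
have n1 : nsq (zsub w v) <= 2 * a ^+ 2 :> R.
  by rewrite /nsq; have := sqr_norm_le a1; have := sqr_norm_le a2; lra.
have n2 : a ^+ 2 <= nsq (zsub w v) :> R.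
  rewrite /nsq /a; have := sqr_ge0 ((zsub w v).1%:~R : R); have := sqr_ge0 ((zsub w v).2%:~R : R).
  by rewrite maxEle; case: ifP => _; rewrite real_normK ?num_real//; lra.
have wu : within (a + a / 2) (zsub w u).
  apply: (@within_sub a (a / 2) w v u); first by rewrite /within a1.
  by rewrite within_subC; apply: within_le uv; rewrite ler_pM2r// ltW.
have m1 : nsq (zsub w u) <= 9 / 2 * a ^+ 2.
  rewrite /nsq; case/andP : wu => /sqr_norm_le h1 /sqr_norm_le h2; lra.
have m2 : a ^+ 2 / 4 <= nsq (zsub w u).
  have [h|h] := leP (a ^+ 2 / 4) (nsq (zsub w u)) => //; exfalso.
  have q (b c : R) : b ^+ 2 + c ^+ 2 < a ^+ 2 / 4 -> `|b| < a / 2.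
    move=> bc; rewrite -(@ltr_pXn2r _ 2)// ?nnegrE ?divr_ge0 ?(ltW a0)// real_normK ?num_real//.
    by have := sqr_ge0 c; lra.
  have h1 := q _ _ h; have h2 : `|(zsub w u).2%:~R| < a / 2 :> R by apply: (q _ (zsub w u).1%:~R); rewrite addrC.
  move: uv; rewrite within_subC /within => /andP[k1 k2].
  have c1 : `|(zsub w v).1%:~R| < a :> R.
    rewrite /zsub /= (intrB_tri _ u.1); apply: (le_lt_trans (ler_normD _ _)).
    by have := within_subC rho u v; move: k1 h1; rewrite /zsub /= -(opprB v.1) rmorphN normrN; lra.
  have c2 : `|(zsub w v).2%:~R| < a :> R.
    rewrite /zsub /= (intrB_tri _ u.2); apply: (le_lt_trans (ler_normD _ _)).
    by move: k2 h2; rewrite /zsub /= -(opprB v.2) rmorphN normrN; lra.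
  have : a < a by rewrite {1}/a gt_max c1 c2.
  by rewrite ltxx.
split; rewrite lerBlDl; apply: (@half_ln_le 2) => //; rewrite -!natrX; lra.
Qed.

(* Near the boundary, a centre is traded for its mirror image outside the box,
   where the Green function vanishes. *)
Lemma reflection v w (s : R) : inV N v -> inV N w -> ~~ inI N w -> within s (zsub w v) ->
  exists z, [/\ near_box N z, ~~ inI N z, within (2 * s) (zsub z v)
    & forall x, inV N x -> flogz v x <= flogz z x :> R].
Proof.
move=> vV wV wI wv.
have [z [c1 c2 c3 c4]] : exists z : Z2, [/\ near_box N z, ~~ inI N z,
    (`|z.1 - v.1| <= 2 * `|w.1 - v.1|) && (`|z.2 - v.2| <= 2 * `|w.2 - v.2|)
    & forall x, inV N x -> (`|x.1 - v.1| <= `|x.1 - z.1|) && (`|x.2 - v.2| <= `|x.2 - z.2|)].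
  case: v w vV wV wI {wv} => [v1 v2] [w1 w2]; rewrite /inV /inI /near_box /=.
  move=> /andP[/andP[? ?] /andP[? ?]] /andP[/andP[? ?] /andP[? ?]] h.
  have : [\/ w1 = 0, w1 = N%:Z, w2 = 0 | w2 = N%:Z].
    have [e|?] := eqVneq w1 0; first exact: Or41.
    have [e|?] := eqVneq w1 N%:Z; first exact: Or42.
    have [e|?] := eqVneq w2 0; first exact: Or43.
    apply: Or44; lia.
  case=> e.
  - exists (- v1, v2) => /=; split; [lia|lia|apply/andP; split; lia|].
    by move=> [x1 x2] /= /andP[/andP[? ?] /andP[? ?]]; apply/andP; split; lia.
  - exists (2 * N%:Z - v1, v2) => /=; split; [lia|lia|apply/andP; split; lia|].
    by move=> [x1 x2] /= /andP[/andP[? ?] /andP[? ?]]; apply/andP; split; lia.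
  - exists (v1, - v2) => /=; split; [lia|lia|apply/andP; split; lia|].
    by move=> [x1 x2] /= /andP[/andP[? ?] /andP[? ?]]; apply/andP; split; lia.
  - exists (v1, 2 * N%:Z - v2) => /=; split; [lia|lia|apply/andP; split; lia|].
    by move=> [x1 x2] /= /andP[/andP[? ?] /andP[? ?]]; apply/andP; split; lia.
exists z; split=> // [|x xV].
  case/andP : c3; case/andP : wv; rewrite /within /zsub /= -!intr_norm => a1 a2 b1 b2.
  have q (b c : int) : b <= 2 * c -> c%:~R <= s -> b%:~R <= 2 * s.
    move=> bc cs; apply: (@le_trans _ _ (2 * c)%:~R); first by rewrite ler_int.
    by rewrite rmorphM/= ler_wpM2l.
  by rewrite (q _ _ b1) ?(q _ _ b2).
have /andP[b1 b2] := c4 x xV.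
rewrite /flogz /flog ler_pM2r// ler_ln ?posrE ?ltr_pwDl ?nsq_ge0// lerD2l /nsq /zsub /=.
have q (b c : int) : `|b| <= `|c| -> b%:~R ^+ 2 <= c%:~R ^+ 2 :> R.
  move=> bc; rewrite -(@real_normK _ b%:~R) ?num_real// -(@real_normK _ c%:~R) ?num_real//.
  by rewrite ler_pXn2r ?nnegrE// -!intr_norm ler_int.
by rewrite lerD// q.
Qed.

(** Comparing the centre [v] with its mirror image [z], where the Green function is zero, bounds
    [grn (inI N) x v] by a difference of potentials. On the boundary of the small box inside the
    open box, [x] is within [3 * r] of [z] and not within [r - 1] of [v], so this difference is
    bounded. *)
Lemma near_boundary_bound v r z : inV N v -> 2 <= r -> near_box N z -> ~~ inI N z ->
  within (2 * r) (zsub z v) -> (forall x, inV N x -> flogz v x <= flogz z x :> R) ->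
  sq (phi v - prj (bx N v r) v) <= 4 + om.
Proof.
move=> vV r2 zn zI zv zx; rewrite sq_phi_sub.
have r1 : 1 <= r by lra.
have r0 : 0 <= r by lra.
have b0 : 0 <= 4 + om by rewrite addr_ge0 ?om_ge0.
have [vI|vI] := boolP (inI N v); last first.
  by rewrite !prj_out ?subr0 ?sqE ?(ip0l G)//; apply: contra vI; exact: bxI.
apply: prj_diff_le => // [y /bxI//||x bx']; first exact: bx_self.
have [xI|xI] := boolP (inI N x); last by rewrite grn_outl.
have [xV xr /(_ xI) xf] := bd_bx bx'.
have := @gb3 (inI N) (fun _ h => h) v z 0 x xI (inV_near vV) zn _.
have -> : grn (inI N) x z = 0 by rewrite grn_outr.
rewrite subr0 sub0r => H; apply: (le_trans (H _)).
  by move=> w bw; rewrite subr_le0 zx//; apply: bd_inV bw.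
rewrite lerD2r addrC.
have zx3 : within (3 * r) (zsub x z).
  have -> : 3 * r = r + 2 * r by ring.
  by apply: (@within_sub r (2 * r) x v z) => //; rewrite within_subC.
have h1 := flog_within zx3.
have h2 : ln (1 + (r - 1) ^+ 2) / 2 <= flogz v x by apply: flog_nwithin => //; rewrite subr_ge0.
have h3 : ln (1 + 2 * (3 * r) ^+ 2) / 2 <= ln (1 + (r - 1) ^+ 2) / 2 + 4.
  apply: (@half_ln_le 4); first by rewrite ltr_pwDl// mulr_ge0 ?sqr_ge0.
  rewrite -!natrX; nra.
rewrite /flogz in h1 *; rewrite /flogz in h2; lra.
Qed.

(** If a side is within [r / 2] of [v], each of the two fields has bounded variance by reflection.
    Otherwise a common box [D] of radius [2 * r] splits each field into its harmonic part [H] and a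
    part between [D] and the small box, of bounded variance by [prj_bx_diff]. The harmonic parts at
    [u] and [v] are close because the potentials of both centres nearly agree on the boundaries of
    [D] and of the open box. *)
Lemma coarse_field_diff u v r : inV N u -> inV N v -> 4 <= r -> within (r / 4) (zsub u v) ->
  sq ((phi u - prj (bx N u r) u) - (phi v - prj (bx N v r) v)) <= 48 + 16 * om.
Proof.
move=> uV vV r4 uv.
have o0 := om_ge0.
have r2 : 2 <= r by lra.
have [[w [wV wI wv]]|bdfar] :=
    pselect (exists w, [/\ inV N w, ~~ inI N w & within (r / 2) (zsub w v)]).
  have b1 : sq (phi v - prj (bx N v r) v) <= 4 + om.
    have [z [z1 z2 z3 z4]] := reflection vV wV wI wv.
    apply: near_boundary_bound z1 z2 _ z4 => //.
    by apply: within_le z3; lra.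
  have b2 : sq (phi u - prj (bx N u r) u) <= 4 + om.
    have wu : within (r / 2 + r / 4) (zsub w u).
      by apply: within_sub wv _; rewrite within_subC.
    have [z [z1 z2 z3 z4]] := reflection uV wV wI wu.
    apply: near_boundary_bound z1 z2 _ z4 => //.
    by apply: within_le z3; lra.
  apply: (le_trans (sqD_le G _ _)); rewrite (sqN G); lra.
have far w : inV N w -> ~~ inI N w -> ~~ within (r / 2) (zsub w v).
  by move=> wV wI; apply/negP => wv; apply: bdfar; exists w.
have vI : inI N v.
  apply/negPn/negP => vI; have := far v vV vI; rewrite within_sub0//; lra.
have uI : inI N u.
  apply/negPn/negP => uI; have /negP := far u uV uI; apply.
  by apply: within_le uv; lra.
pose D := bx N v (2 * r).
have DI x : D x -> inI N x by exact: bxI.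
have Dv : D v by apply: bx_self => //; lra.
have Du : D u by rewrite /D /bx uI; apply: within_le uv; lra.
have uD x : bx N u r x -> D x.
  move=> /andP[xI xu]; rewrite /D /bx xI.
  by apply: within_le (within_sub xu uv); lra.
have vD x : bx N v r x -> D x by apply: bx_mono; lra.
have bD w : bd D w -> within (2 * r) (zsub w v) by case/bd_bx.
have bDu w : bd D w -> within (2 * r + r / 4) (zsub w u).
  by move=> /bD wv; apply: within_sub wv _; rewrite within_subC.
have d1 : sq (prj D v - prj (bx N v r) v) <= 4 + om.
  apply: (le_trans (@prj_bx_diff D v (2 * r) r DI vD bD vV _ _)); try lra.
  rewrite lerD2r lerBlDr [leRHS]addrC; apply: (@half_ln_le 4).
    by rewrite ltr_pwDl// mulr_ge0 ?sqr_ge0.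
  rewrite -!natrX; nra.
have d2 : sq (prj D u - prj (bx N u r) u) <= 4 + om.
  apply: (le_trans (@prj_bx_diff D u (2 * r + r / 4) r DI uD bDu uV _ _)); try lra.
  rewrite lerD2r lerBlDr [leRHS]addrC; apply: (@half_ln_le 4).
    by rewrite ltr_pwDl// mulr_ge0 ?sqr_ge0.
  rewrite -!natrX; nra.
pose H x := phi x - prj D x.
have HphiE x y : ip (H x) (phi y) = grn (inI N) x y - grn D x y.
  by rewrite /H (ipBl G) ip_phi_grn -grnE.
have Hprj x y : ip (H x) (prj D y) = 0.
  by rewrite /H (ipBl G) (gff_sym G (phi x)) -grnE -/(grn D x y) grnC subrr.
have fd w : inV N w -> ~~ within (r / 2) (zsub w v) ->
    flogz v w - flogz u w <= 2 :> R /\ flogz u w - flogz v w <= 2 :> R.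
  move=> wV wv; apply: (@flog_diff_le (r / 2)) => //; first lra.
  by apply: within_le uv; lra.
have farD w : bd D w -> ~~ within (r / 2) (zsub w v).
  move=> bw; have [wV _ wf] := bd_bx bw; have [wI|wI] := boolP (inI N w); last exact: far.
  by apply: contra (wf wI); apply: within_le; lra.
have farI w : bd (inI N) w -> ~~ within (r / 2) (zsub w v).
  by move=> bw; apply: far; [apply: bd_inV bw|case/andP : bw].
have bIV w : bd (inI N) w -> inV N w by apply: bd_inV.
have bDV w : bd D w -> inV N w by apply: bd_inV.
have uN := inV_near uV; have vN := inV_near vV.
have k1 : ip (H v) (phi v) - ip (H v) (phi u) <= 4 + 2 * om.
  rewrite !HphiE.
  have := @gb3 (inI N) (fun _ h => h) v u 2 v vI vN uN (fun w bw => (fd w (bIV _ bw) (farI _ bw)).1).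
  have := @gb3 D DI u v 2 v Dv uN vN (fun w bw => (fd w (bDV _ bw) (farD _ bw)).2).
  lra.
have k2 : ip (H u) (phi u) - ip (H u) (phi v) <= 4 + 2 * om.
  rewrite !HphiE.
  have := @gb3 (inI N) (fun _ h => h) u v 2 u uI uN vN (fun w bw => (fd w (bIV _ bw) (farI _ bw)).2).
  have := @gb3 D DI v u 2 u Du vN uN (fun w bw => (fd w (bDV _ bw) (farD _ bw)).1).
  lra.
(* [H] is orthogonal to every [prj D], so one factor [H u - H v] may be replaced by [phi u - phi v],
   and the square becomes a sum of the differences bounded in [k1] and [k2]. *)
have sH : sq (H u - H v) <= 8 + 4 * om.
  have -> : sq (H u - H v) = ip (H u - H v) (phi u - phi v).
    have Wp x : ip (H u - H v) (prj D x) = 0 by rewrite (ipBl G) !Hprj subrr.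
    have WE : H u - H v = (phi u - phi v) - (prj D u - prj D v).
      by rewrite /H !opprD !opprK addrACA.
    rewrite ?sqE [X in ip _ X]WE (ipBr G) [X in _ - X](ipBr G).
    by rewrite !Wp subrr subr0.
  by rewrite (ipBr G) (ipBl G (H u) (H v)) (ipBl G (H u) (H v) (phi v)); lra.
have -> : phi u - prj (bx N u r) u - (phi v - prj (bx N v r) v) =
   (H u - H v) + ((prj D u - prj (bx N u r) u) - (prj D v - prj (bx N v r) v)).
  have E (x y z : V) : x - z = (x - y) + (y - z) by rewrite addrA subrK.
  by rewrite (E (phi u) (prj D u)) (E (phi v) (prj D v)) opprD addrACA.
apply: (le_trans (sqD_le G _ _)).
have := sqD_le G (prj D u - prj (bx N u r) u) (- (prj D v - prj (bx N v r) v)).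
rewrite (sqN G); lra.
Qed.

Lemma center_variance c v r : inV N v -> 4 <= r -> within (r / 4) (zsub v c) ->
  (forall w, inV N w -> ~~ inI N w -> ~~ within (r - 1) (zsub w c)) ->
  `|sq (prj (bx N c r) v) - ln r| <= 2 + om.
Proof.
move=> vV r4 vc deep; have r0 : 0 < r by lra.
have vI : inI N v.
  apply/negPn/negP => vI; have /negP := deep v vV vI; apply.
  by apply: within_le vc; lra.
have Av : bx N c r v by rewrite /bx vI; apply: within_le vc; lra.
have lr : ln r = ln (r ^+ 2) / 2 by rewrite lnXn// mulr2n; lra.
rewrite -[sq _]/(grn (bx N c r) v v) ler_norml; apply/andP; split.
  have := gb2 (@bxI N c r) Av (inV_near vV) (m := ln (1 + (r / 2) ^+ 2) / 2).
  rewrite flog_sub0 subr0 => H.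
  have {}H : ln (1 + (r / 2) ^+ 2) / 2 - om <= grn (bx N c r) v v.
    apply: H => w bw; apply: flog_nwithin; first lra.
    have wf : ~~ within (r - 1) (zsub w c).
      have [wV _ wf] := bd_bx bw; have [wI|wI] := boolP (inI N w); first exact: wf.
      exact: deep.
    by apply: contra wf => wv; apply: within_le (within_sub wv vc); lra.
  have : ln r <= ln (1 + (r / 2) ^+ 2) / 2 + 1.
    rewrite lr; apply: (@half_ln_le 1); first by rewrite exprn_gt0.
    rewrite expr1; nra.
  lra.
have := @grn_bx_ub c v r (r / 4) v (ltW r0) _ vV _ Av.
rewrite flog_sub0 subr0 within_subC => H.
have {}H := H _ vc; rewrite divr_ge0 ?(ltW r0)// in H.
have : ln (1 + 2 * (r + r / 4) ^+ 2) / 2 <= ln r + 2.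
  rewrite lr; apply: (@half_ln_le 2); first by rewrite ltr_pwDl// mulr_ge0 ?sqr_ge0.
  rewrite -!natrX; nra.
have := H isT; lra.
Qed.

(** If the box of [u] is contained in that of [v], the tower property gives the Green function of
    the small box at [v], which lies outside it: zero. If not, points of the box of [u] are farther
    than [rv / 3] from [v], so the Green function of the box of [v] is bounded there. *)
Lemma separated_cov u v ru rv : inV N v -> 1 <= ru -> 0 <= rv -> ~~ within (2 * ru) (zsub u v) ->
  `|ip (prj (bx N u ru) u) (prj (bx N v rv) v)| <= 3 + om.
Proof.
move=> vV ru1 rv0 uv; have o0 := om_ge0.
have [uI|uI] := boolP (inI N u); last first.
  by rewrite prj_out ?(ip0l G) ?normr0 ?addr_ge0//; apply: contra uI; exact: bxI.
have Au : bx N u ru u by exact: bx_self.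
have [[z [zu zv]]|nested] := pselect (exists z, bx N u ru z /\ ~~ bx N v rv z); last first.
  have sub z : bx N u ru z -> bx N v rv z.
    by move=> zu; apply/negPn/negP => zv; apply: nested; exists z.
  rewrite (gff_sym G) (prj_nested G _ _ sub) grn_outl ?normr0 ?addr_ge0//.
  apply: contra uv => /andP[_]; rewrite within_subC; apply: within_le; lra.
apply: prj_ip_le => // [x /bxI//|x xA].
have -> : ip (phi x) (prj (bx N v rv) v) = grn (bx N v rv) x v.
  by rewrite (gff_sym G) -grnE grnC.
have BI y : bx N v rv y -> inI N y by exact: bxI.
rewrite (grn_ge0 G BI) /=.
have [Bx|nBx] := boolP (bx N v rv x); last by rewrite grn_outl ?addr_ge0.
have xu : within ru (zsub x u).
  by case/orP: xA => [/andP[_]|/bd_bx[]//]; apply: within_le; lra.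
have := @grn_bx_ub v v rv 0 x rv0 (lexx _) vV (within_sub0 _ (lexx _)) Bx.
rewrite addr0 => H; apply: (le_trans H).
case/andP : zu => zI zu; move: zv; rewrite /bx zI /= => zv.
have xv : ~~ within (rv / 3) (zsub x v).
  apply/negP => xv.
  have uv2 : within (ru + rv / 3) (zsub u v).
    by apply: within_sub _ xv; rewrite within_subC.
  have h1 : 2 * ru < ru + rv / 3.
    by rewrite ltNge; apply/negP => h; move/negP : uv; apply; apply: within_le uv2.
  have := within_sub zu uv2.
  by apply/negP; apply: contra zv; apply: within_le; lra.
have h2 : ln (1 + (rv / 3) ^+ 2) / 2 <= flogz v x by apply: flog_nwithin => //; lra.
have : ln (1 + 2 * rv ^+ 2) / 2 <= ln (1 + (rv / 3) ^+ 2) / 2 + 3.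
  apply: (@half_ln_le 3); first by rewrite ltr_pwDl// mulr_ge0 ?sqr_ge0.
  rewrite -!natrX; nra.
lra.
Qed.

Lemma disjoint_cov (A B : pred Z2) u v : (forall x, A x -> inI N x) ->
  (forall x, A x || bd A x -> ~~ B x) -> ip (prj A u) (prj B v) = 0.
Proof.
move=> AI AB; have [Au|nAu] := boolP (A u); last by rewrite prj_out// (ip0l G).
apply/eqP; rewrite -normr_le0; apply: prj_ip_le => // x xA.
by rewrite (gff_sym G) -grnE grn_outr ?lexx// AB.
Qed.

End green_error.

(** * Estimates at the scales [N ^ (1 - l)], in units of [ln N] *)

Section asymptotics.
Context {R : realType}.

Lemma ln_large (B : R) : exists N0 : nat, (0 < N0)%N /\
  forall N, (N0 <= N)%N -> B <= ln N%:R.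
Proof.
exists (Num.truncn (expR B)).+1; split=> // N hN.
have N0 : 0 < N%:R :> R by rewrite ltr0n; apply: leq_trans hN.
rewrite -ler_expR lnK ?posrE//.
apply: le_trans (ltW (truncnS_gt _)) _.
by rewrite ler_nat.
Qed.

Lemma eps_ln_large (eps B : R) : 0 < eps -> exists N0 : nat, (0 < N0)%N /\
  forall N, (N0 <= N)%N -> B <= eps * ln N%:R.
Proof.
move=> e0; have [N0 [N00 H]] := ln_large (B / eps).
exists N0; split=> // N /H; by rewrite ler_pdivrMr// mulrC.
Qed.

Lemma green_bounds_le (V : lmodType R) N ip (phi : Z2 -> V) (G : gff_form N ip phi) a b :
  a <= b -> green_bounds G a -> green_bounds G b.
Proof.
move=> ab [h1 h2 h3 h4]; split.
- exact: le_trans ab.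
- by move=> A AI z1 z2 m x Ax n1 n2 H; apply: (le_trans (h2 A AI z1 z2 m x Ax n1 n2 H)); rewrite lerD2l.
- by move=> A AI z m x Ax n1 H; apply: (le_trans (h3 A AI z m x Ax n1 H)); rewrite lerD2l.
- by move=> A AI z m x Ax n1 H; apply: le_trans (h4 A AI z m x Ax n1 H); rewrite lerD2l lerN2.
Qed.

Lemma green_bounds_eps (eps : R) : 0 < eps -> exists N0 : nat, (0 < N0)%N /\
  forall N, (N0 <= N)%N -> forall (V : lmodType R) ip (phi : Z2 -> V)
    (G : gff_form N ip phi), green_bounds G (eps * ln N%:R).
Proof.
move=> e0; have [C [C0 HC]] := @elog_l1_sum R.
pose K := 4 * C + 12.
have K0 : 0 < K by rewrite ltr_wpDl// mulr_ge0.
(* Once [1 <= L], the error is at most [2 * K * sqrt ((4 + K ^+ 2) * L)]; squaring shows that it is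
   below [eps * L] when [L] exceeds this value. *)
pose B := 1 + 4 * K ^+ 2 * (4 + K ^+ 2) / eps ^+ 2.
have [N0 [N00 H]] := ln_large B.
exists N0; split=> // N hN V ip phi G.
have Np : (0 < N)%N by apply: leq_trans hN.
apply: green_bounds_le (green_bounds_exist G Np C0 HC).
have := H N hN; rewrite -/K; set L := ln _ => BL.
have b0 : 0 <= 4 * K ^+ 2 * (4 + K ^+ 2) / eps ^+ 2.
  by nonneg.
have L1 : 1 <= L by apply: le_trans BL; rewrite lerDl.
have eL : 0 <= eps * L by rewrite mulr_ge0 ?ltW//; lra.
rewrite -[leRHS]ger0_norm// -sqrtr_sqr mulrA.
rewrite -[X in X * _]ger0_norm; last by rewrite mulr_ge0 ?ltW.
rewrite -[`|2 * K|]sqrtr_sqr -sqrtrM ?sqr_ge0// ler_wsqrtr//.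
have h1 : 2 * (L + 1) + K ^+ 2 <= (4 + K ^+ 2) * L by have := sqr_ge0 K; nra.
apply: (@le_trans _ _ ((2 * K) ^+ 2 * ((4 + K ^+ 2) * L))); first by rewrite ler_wpM2l ?sqr_ge0.
rewrite [leRHS]exprMn [leRHS]mulrC.
have -> : (2 * K) ^+ 2 * ((4 + K ^+ 2) * L) = (4 * K ^+ 2 * (4 + K ^+ 2) / eps ^+ 2) * L * eps ^+ 2.
  by field; rewrite gt_eqF.
rewrite ler_wpM2r ?sqr_ge0// expr2 ler_wpM2r//; first lra.
by apply: le_trans BL; rewrite lerDr.
Qed.

(** At [l = 0] the radius [N + 1] makes [bx] the whole open box; at [l = 1] the radius 0 makes it
    empty. These match the exceptional cases of [nbhd]. *)
Definition rad (N : nat) (l : R) : R :=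
  if l == 0 then N%:R + 1 else if l == 1 then 0 else 2^-1 * N%:R `^ (1 - l).

Lemma powN_ge1 N (l : R) : (0 < N)%N -> l <= 1 -> 1 <= N%:R `^ (1 - l) :> R.
Proof.
move=> N0 l1; rewrite -[leLHS](powRr0 N%:R) ler_powR ?ler1n// subr_ge0//.
Qed.

Lemma ln_powN N (l : R) : (0 < N)%N -> ln (N%:R `^ (1 - l)) = (1 - l) * ln N%:R :> R.
Proof. by move=> N0; rewrite ln_powR. Qed.

Lemma rad_ub N (l : R) : (0 < N)%N -> l < 1 -> rad N l <= 2 * N%:R `^ (1 - l).
Proof.
move=> N0 l1; rewrite /rad; have p1 := powN_ge1 N0 (ltW l1).
case: ifPn => [/eqP ->|l0]; last by rewrite lt_eqF//; lra.
rewrite subr0 powRr1//; have : 1 <= N%:R :> R by rewrite ler1n.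
lra.
Qed.

Lemma rad_ge0 N (l : R) : 0 <= rad N l.
Proof. by rewrite /rad; case: ifP => _; [|case: ifP => _//]; rewrite ?addr_ge0 ?mulr_ge0 ?powR_ge0. Qed.

Lemma ln_rad_ub N (l : R) : (0 < N)%N -> l < 1 ->
  ln (1 + 2 * rad N l ^+ 2) / 2 <= (1 - l) * ln N%:R + 2.
Proof.
move=> N0 l1; have p1 := powN_ge1 N0 (ltW l1); have r0 := rad_ge0 N l; have r2 := rad_ub N0 l1.
have -> : (1 - l) * ln N%:R = ln ((N%:R `^ (1 - l)) ^+ 2) / 2.
  by rewrite lnXn ?(lt_le_trans ltr01)// ln_powN// mulr2n; lra.
apply: (@half_ln_le _ 2); first by rewrite ltr_pwDl// mulr_ge0 ?sqr_ge0.
rewrite -!natrX; move: p1 r2 r0; set p := _ `^ _; set r := rad _ _ => p1 r2 r0; nra.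
Qed.

Lemma ln_rad_lb N (l : R) : (0 < N)%N -> 0 < l < 1 ->
  (1 - l) * ln N%:R <= ln (1 + (rad N l - 1) ^+ 2) / 2 + 2.
Proof.
move=> N0 /andP[l0 l1]; have p1 := powN_ge1 N0 (ltW l1).
have -> : (1 - l) * ln N%:R = ln ((N%:R `^ (1 - l)) ^+ 2) / 2.
  by rewrite lnXn ?(lt_le_trans ltr01)// ln_powN// mulr2n; lra.
apply: (@half_ln_le _ 2); first by rewrite exprn_gt0// (lt_le_trans ltr01).
rewrite -!natrX /rad gt_eqF// lt_eqF//; move: p1; set p := _ `^ _ => p1.
by have := sqr_ge0 (3 * p - 8); lra.
Qed.

Lemma powN_large (l B : R) : l < 1 -> exists N0 : nat, (0 < N0)%N /\
  forall N, (N0 <= N)%N -> B <= N%:R `^ (1 - l).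
Proof.
move=> l1; have l10 : 0 < 1 - l by rewrite subr_gt0.
have [N0 [N00 H]] := eps_ln_large (ln (Num.max B 1)) l10.
exists N0; split=> // N hN; have Np : (0 < N)%N by apply: leq_trans hN.
have := H N hN; rewrite -ln_powN// ler_ln ?posrE ?lt_max ?ltr01 ?orbT//.
  by apply: le_trans; rewrite le_max lexx.
by apply: powR_gt0; rewrite ltr0n.
Qed.

Lemma rad_large (l B : R) : 0 < l < 1 -> exists N0 : nat, (0 < N0)%N /\
  forall N, (N0 <= N)%N -> B <= rad N l.
Proof.
move=> /andP[l0 l1]; have [N0 [N00 H]] := powN_large (2 * B) l1.
exists N0; split=> // N /H; rewrite /rad gt_eqF// lt_eqF//; lra.
Qed.

Lemma rad_mono N (l l' : R) : (0 < N)%N -> 0 <= l -> l <= l' -> l' <= 1 -> rad N l' <= rad N l.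
Proof.
move=> N0 l0 ll l1.
have N1 : 1 <= N%:R :> R by rewrite ler1n.
rewrite /rad; have [l'0|l'0] := eqVneq l' 0.
  by have -> : l = 0 by [apply: le_anti; rewrite l0 andbT -l'0]; rewrite eqxx.
have l'p : 0 < l' by rewrite lt_neqAle eq_sym l'0 (le_trans l0).
have [l'1|l'1] := eqVneq l' 1; first exact: rad_ge0.
have [_|l00] := eqVneq l 0.
  have : N%:R `^ (1 - l') <= N%:R `^ 1 :> R by rewrite ler_powR//; lra.
  rewrite powRr1//; lra.
rewrite lt_eqF; last by rewrite (le_lt_trans ll)// lt_neqAle l'1.
by rewrite ler_pM2l// ler_powR//; lra.
Qed.

Lemma increment_variance (l l' eps : R) : 0 <= l -> l < l' -> l' <= 1 -> 0 < eps ->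
  exists N0 : nat, (0 < N0)%N /\ forall N, (N0 <= N)%N ->
  forall (V : lmodType R) ip (phi : Z2 -> V) (G : gff_form N ip phi) v, inV N v ->
  sq ip (prj G (bx N v (rad N l)) v - prj G (bx N v (rad N l')) v) <= (l' - l + eps) * ln N%:R.
Proof.
move=> l0 ll l1 e0; have e20 : 0 < eps / 2 by rewrite divr_gt0.
have [N1 [N10 H1]] := green_bounds_eps e20.
have [N2 [N20 H2]] := eps_ln_large 4 e20.
have lt1 : l < 1 by apply: lt_le_trans l1.
have [l'1|l'1] := eqVneq l' 1.
  exists (maxn N1 N2); split; first by rewrite leq_max N10.
  move=> N; rewrite geq_max => /andP[h1 h2] V ip phi G v vV.
  have Np : (0 < N)%N by apply: leq_trans h1.
  have := @prj_bx_diff_small _ _ _ _ _ G _ (H1 _ h1 V ip phi G) v (rad N l) (rad N l') vV (rad_ge0 _ _).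
  have -> : rad N l' = 0 by rewrite /rad l'1 oner_eq0 eqxx.
  move=> /(_ ltr01) h; apply: (le_trans h).
  have := ln_rad_ub Np lt1; have := H2 N h2; rewrite l'1; lra.
have l'lt : l' < 1 by rewrite lt_neqAle l'1.
have l'0 : 0 < l' by apply: le_lt_trans ll.
have [N3 [N30 H3]] := @rad_large l' 1 (introT andP (conj l'0 l'lt)).
exists (maxn N1 (maxn N2 N3)); split; first by rewrite leq_max N10.
move=> N; rewrite !geq_max => /and3P[h1 h2 h3] V ip phi G v vV.
have Np : (0 < N)%N by apply: leq_trans h1.
have rr := rad_mono Np l0 (ltW ll) l1.
have := @prj_bx_diff _ _ _ _ _ G _ (H1 _ h1 V ip phi G) (bx N v (rad N l)) v (rad N l) (rad N l').
move=> /(_ _ _ _ vV rr (H3 N h3)) h; apply: le_trans (h _ _ _) _.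
- by move=> x; exact: bxI.
- by move=> x; exact: bx_mono.
- by move=> w /bd_bx[].
have := ln_rad_ub Np lt1; have := @ln_rad_lb N l' Np; rewrite l'0 l'lt => /(_ isT).
have := H2 N h2; lra.
Qed.

Lemma coarse_field (l eps : R) : 0 < l < 1 -> 0 < eps ->
  exists N0 : nat, (0 < N0)%N /\ forall N, (N0 <= N)%N ->
  forall (V : lmodType R) ip (phi : Z2 -> V) (G : gff_form N ip phi) u v,
  inV N u -> inV N v -> within (rad N l / 4) (zsub u v) ->
  sq ip ((phi u - prj G (bx N u (rad N l)) u) - (phi v - prj G (bx N v (rad N l)) v))
    <= eps * ln N%:R.
Proof.
move=> l01 e0; have e20 : 0 < eps / 32 by rewrite divr_gt0.
have [N1 [N10 H1]] := green_bounds_eps e20.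
have [N2 [N20 H2]] := eps_ln_large 96 e0.
have [N3 [N30 H3]] := @rad_large l 4 l01.
exists (maxn N1 (maxn N2 N3)); split; first by rewrite leq_max N10.
move=> N; rewrite !geq_max => /and3P[h1 h2 h3] V ip phi G u v uV vV uv.
apply: le_trans (coarse_field_diff (H1 _ h1 V ip phi G) uV vV (H3 N h3) uv) _.
have := H2 N h2; lra.
Qed.

Lemma center_variance_eps (l eps : R) : 0 < l < 1 -> 0 < eps ->
  exists N0 : nat, (0 < N0)%N /\ forall N, (N0 <= N)%N ->
  forall (V : lmodType R) ip (phi : Z2 -> V) (G : gff_form N ip phi) c v,
  inV N v -> within (rad N l / 4) (zsub v c) ->
  (forall w, inV N w -> ~~ inI N w -> ~~ within (rad N l - 1) (zsub w c)) ->
  `|sq ip (prj G (bx N c (rad N l)) v) - (1 - l) * ln N%:R| <= eps * ln N%:R.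
Proof.
move=> l01 e0; have /andP[l0 l1] := l01; have e20 : 0 < eps / 2 by rewrite divr_gt0.
have [N1 [N10 H1]] := green_bounds_eps e20.
have [N2 [N20 H2]] := eps_ln_large 3 e20.
have [N3 [N30 H3]] := @rad_large l 4 l01.
exists (maxn N1 (maxn N2 N3)); split; first by rewrite leq_max N10.
move=> N; rewrite !geq_max => /and3P[h1 h2 h3] V ip phi G c v vV vc deep.
have Np : (0 < N)%N by apply: leq_trans h1.
have := center_variance (H1 _ h1 V ip phi G) vV (H3 N h3) vc deep.
have lr : ln (rad N l) = (1 - l) * ln N%:R - ln 2.
  rewrite /rad gt_eqF// lt_eqF// lnM ?posrE ?invr_gt0 ?powR_gt0 ?ltr0n// lnV ?posrE// ln_powN//.
  by rewrite addrC.
have l2 : 0 <= ln (2 : R) <= 1.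
  by rewrite ln_ge0 ?ler1n//=; have := @ln_le_lin R 1; rewrite ltr_pwDl// => /(_ isT).
rewrite lr !ler_norml; have := H2 N h2; lra.
Qed.

Lemma separated_cov_eps (eps : R) : 0 < eps ->
  exists N0 : nat, (0 < N0)%N /\ forall N, (N0 <= N)%N ->
  forall (V : lmodType R) ip (phi : Z2 -> V) (G : gff_form N ip phi) u v (ru rv : R),
  inV N v -> 0 <= rv -> ~~ within (2 * ru) (zsub u v) ->
  `|ip (prj G (bx N u ru) u) (prj G (bx N v rv) v)| <= eps * ln N%:R.
Proof.
move=> e0; have e20 : 0 < eps / 2 by rewrite divr_gt0.
have [N1 [N10 H1]] := green_bounds_eps e20.
have [N2 [N20 H2]] := eps_ln_large 3 e20.
exists (maxn N1 N2); split; first by rewrite leq_max N10.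
move=> N; rewrite !geq_max => /andP[h1 h2] V ip phi G u v ru rv vV rv0 uv.
have [ru1|ru1] := leP 1 ru; last first.
  rewrite prj_out ?bx_lt1// (ip0l G) normr0 mulr_ge0 ?ltW//.
  by have := H2 N h2; have : 0 < eps by []; set L := ln _; nra.
apply: le_trans (separated_cov (H1 _ h1 V ip phi G) vV ru1 rv0 uv) _.
have := H2 N h2; lra.
Qed.

End asymptotics.

(** * The Green function of the killed walk *)

Lemma lattice_adjE (y v : Z2) : lattice_adj y v = [|| y == xr v, y == xl v, y == xu v | y == xd v].
Proof.
case: y v => [a b] [a' b']; rewrite /lattice_adj /xr /xl /xu /xd !xpair_eqE /=.
apply/idP/idP => [/eqP|].
  rewrite !expr2 => h.
  have q (p p' : int) : p * p + p' * p' = 1 -> p = -1 \/ p = 0 \/ p = 1.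
    move=> pp; have p1 : p * p <= 1 by have := sqr_ge0 p'; rewrite expr2; lia.
    have : -1 <= p by nia.
    have : p <= 1 by nia.
    lia.
  have h1 := q _ _ h; have h2 := q (b - b') (a - a'); rewrite addrC in h2.
  have {}h2 := h2 h.
  by case: h1 => [|[]] h1; case: h2 => [|[]] h2; move: h; rewrite h1 h2//= => _; lia.
by move=> /or4P[] /andP[/eqP -> /eqP ->]; apply/eqP; rewrite !expr2; lia.
Qed.

Lemma srw_kernelE (R : realType) (y v : Z2) : srw_kernel R y v =
  ((y == xr v)%:R + (y == xl v)%:R + (y == xu v)%:R + (y == xd v)%:R) / 4.
Proof.
rewrite /srw_kernel lattice_adjE; case: v => a b; rewrite /xr /xl /xu /xd /=.
have n1 : (a + 1 == a - 1) = false by lia.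
have n2 : (b + 1 == b - 1) = false by lia.
have n3 : (a + 1 == a) = false by lia.
have n4 : (a - 1 == a) = false by lia.
case: eqVneq => [->|_]; rewrite ?xpair_eqE ?n1 ?n2 ?n3 ?n4 /=; first by rewrite !addr0 mul1r.
case: eqVneq => [->|_]; rewrite ?xpair_eqE ?n1 ?n2 ?n3 ?n4 /=; first by rewrite !addr0 add0r mul1r.
case: eqVneq => [->|_]; rewrite ?xpair_eqE ?eqxx ?n1 ?n2 ?n3 ?n4 /=; first by rewrite !addr0 !add0r mul1r.
case: eqVneq => _; rewrite !add0r ?mul1r ?mul0r//.
Qed.

Section killed_walk.
Context {R : realType} {d : measure_display} {Om : measurableType d}.
Variables (P : probability Om R) (W : nat -> Om -> Z2) (u : Z2).
Hypothesis hW : simple_random_walk P W u.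
Variable B : set Z2.

Definition avoids k : set Om := [set w | forall j, (j <= k)%N -> ~ B (W j w)].

(** Avoidance is split along the countably many initial paths, coded by [pickle]. On each piece the
    finite-history law of [simple_random_walk] applies directly, with no measurable structure on
    [Z2]. *)
Definition path_event k (n : nat) : set Om :=
  [set w | exists x : seq Z2, [/\ pickle_inv n = Some x, size x = k.+1,
     (forall i, (i <= k)%N -> ~ B (nth (0, 0) x i)) &
     forall i, (i <= k)%N -> W i w = nth (0, 0) x i]].

Lemma avoids_paths k : avoids k = \bigcup_n path_event k n.
Proof.
apply/seteqP; split=> [w aw|w [n _ [x [_ _ xB xW]]] j jk]; last by rewrite xW//; exact: xB.
exists (pickle [seq W i w | i <- iota 0 k.+1]) => //.
exists [seq W i w | i <- iota 0 k.+1]; have e i : (i <= k)%N ->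
    nth (0, 0) [seq W i w | i <- iota 0 k.+1] i = W i w.
  by move=> ik; rewrite (nth_map 0%N) ?size_iota// nth_iota.
split; first exact: pickleK_inv.
- by rewrite size_map size_iota.
- by move=> i ik; rewrite e//; exact: aw.
- by move=> i ik; rewrite e.
Qed.

Lemma path_event_triv k : trivIset setT (path_event k).
Proof.
move=> i j _ _ [w [[x [xi xs _ xW]] [y [yj ys _ yW]]]].
have xy : x = y.
  apply: (@eq_from_nth _ (0, 0)); first by rewrite xs.
  by move=> l; rewrite xs ltnS => lk; rewrite -xW// yW.
have := @pickle_invK (seq Z2) i; rewrite /= xi /= => <-.
by have := @pickle_invK (seq Z2) j; rewrite /= yj /= => <-; rewrite xy.
Qed.

Lemma history_measurable k (x : nat -> Z2) :
  measurable [set w | forall i, (i <= k)%N -> W i w = x i].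
Proof.
elim: k => [|k IH].
  rewrite (_ : [set w | _] = [set w | W 0%N w = x 0%N]); first exact: hW.1.
  apply/seteqP; split=> w /=; first exact.
  by move=> h i; rewrite leqn0 => /eqP ->.
rewrite (_ : [set w | _] = [set w | forall i, (i <= k)%N -> W i w = x i] `&`
  [set w | W k.+1 w = x k.+1]); first by apply: measurableI => //; exact: hW.1.
apply/seteqP; split=> w /=.
  by move=> h; split; [move=> i ik; apply: h; exact: leqW|exact: h].
by move=> [h1 h2] i; rewrite leq_eqVlt => /orP[/eqP ->//|]; exact: h1.
Qed.

Lemma path_eventE k n : path_event k n = set0 \/ exists x : seq Z2,
  path_event k n = [set w | forall i, (i <= k)%N -> W i w = nth (0, 0) x i].
Proof.
have [[w [x [xn xs xB _]]]|] := pselect (path_event k n !=set0); last first.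
  by move=> /set0P/negP; rewrite negbK => /eqP; left.
right; exists x; apply/seteqP; split=> [w' [y []]|w' h].
  by rewrite xn => -[<-] _ _.
by exists x.
Qed.

Lemma path_event_measurable k n : measurable (path_event k n).
Proof.
have [->|[x ->]] := path_eventE k n; first exact: measurable0.
exact: history_measurable.
Qed.

Lemma avoids_measurable k : measurable (avoids k).
Proof. by rewrite avoids_paths; apply: bigcupT_measurable => n; exact: path_event_measurable. Qed.

Lemma avoids_sum k (C : set Om) : measurable C ->
  P (avoids k `&` C) = (\sum_(n <oo) P (path_event k n `&` C))%E.
Proof.
move=> mC; rewrite avoids_paths setI_bigcupl measure_bigcup//=.
- by apply: eq_eseriesl => n; rewrite in_setT.
- by move=> n _; apply: measurableI => //; exact: path_event_measurable.
- by apply: trivIset_setIr; exact: path_event_triv.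
Qed.

Definition killed k y : \bar R := P (avoids k `&` [set w | W k w = y]).

(** Markov property on one piece: [z] is the endpoint of the path. For an empty piece any point
    serves. *)
Lemma path_event_last k n : exists z : Z2,
  (forall y, P (path_event k n `&` [set w | W k w = y]) = P (path_event k n) * ((z == y)%:R)%:E)%E /\
  (forall v, P (path_event k n `&` [set w | W k.+1 w = v]) =
     P (path_event k n) * (srw_kernel R z v)%:E)%E.
Proof.
have [->|[x ->]] := path_eventE k n.
  by exists u; split=> y; rewrite set0I measure0 mul0e.
exists (nth (0, 0) x k); split=> y.
  case: eqVneq => [<-|xy]; rewrite ?mule1 ?mule0.
    by congr (P _); apply/seteqP; split=> w /=; [case|move=> h; split=> //; exact: h].
  rewrite [X in P X](_ : _ = set0) ?measure0//; apply/seteqP; split=> // w /= [h e].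
  by move: xy; rewrite -e h// eqxx.
pose x' i := if (i <= k)%N then nth (0, 0) x i else y.
rewrite [X in P X](_ : _ = [set w | forall i, (i <= k.+1)%N -> W i w = x' i]); last first.
  apply/seteqP; split=> w /=.
    move=> [h1 h2] i; rewrite leq_eqVlt => /orP[/eqP ->|]; first by rewrite /x' ltnn.
    by rewrite ltnS => ik; rewrite h1// /x' ik.
  move=> h; split; last by rewrite h// /x' ltnn.
  by move=> i ik; rewrite h ?leqW// /x' ik.
rewrite (hW.2 k.+1 x') (hW.2 k (nth (0, 0) x)) -EFinM big_ord_recr/= mulrA.
congr ((_ * _ * _)%:E); last by rewrite /x' leqnn ltnn.
by apply: eq_bigr => i _; rewrite /x' ltn_ord ltnW.
Qed.

Lemma killed_out k v : B v -> killed k v = 0%E.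
Proof.
move=> Bv; rewrite /killed [X in P X](_ : _ = set0) ?measure0//.
by apply/seteqP; split=> // w /= [h e]; have := h k (leqnn k); rewrite e.
Qed.

Lemma killed0 v : ~ B v -> killed 0%N v = ((u == v)%:R)%:E.
Proof.
move=> Bv; rewrite /killed.
rewrite [X in P X](_ : _ = [set w | forall i, (i <= 0)%N -> W i w = v]).
  by rewrite (hW.2 0%N (fun=> v)) big_ord0 mulr1 eq_sym.
apply/seteqP; split=> w /=.
  by move=> [_ h] i; rewrite leqn0 => /eqP ->.
move=> h; split; last exact: h.
by move=> j; rewrite leqn0 => /eqP ->; rewrite h.
Qed.

(** Forward equation: decompose by the position at time [k]. At the last time avoidance is
    automatic, as [v] is not in [B]. *)
Lemma killedS k v : ~ B v -> (killed k.+1 v = (4^-1)%:E *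
  (killed k (xr v) + killed k (xl v) + killed k (xu v) + killed k (xd v)))%E.
Proof.
move=> Bv; rewrite /killed.
have -> : avoids k.+1 `&` [set w | W k.+1 w = v] = avoids k `&` [set w | W k.+1 w = v].
  apply/seteqP; split=> w /= [h e]; split=> //.
    by move=> j jk; apply: h; exact: leqW.
  by move=> j; rewrite leq_eqVlt => /orP[/eqP ->|]; [rewrite e|exact: h].
have mW j y : measurable [set w | W j w = y] by exact: hW.1.
rewrite !avoids_sum// -!nneseriesD//; do ?[by move=> *; rewrite ?adde_ge0].
rewrite -nneseriesZl; last by move=> *; rewrite !adde_ge0.
apply: eq_eseriesr => n _; have [z [h1 h2]] := path_event_last k n.
rewrite !h1 h2 srw_kernelE -!ge0_muleDr ?lee_fin//; do ?[by rewrite -!EFinD lee_fin ?addr_ge0].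
by rewrite muleCA -!EFinD -EFinM [in RHS]mulrC.
Qed.

Lemma hitting_time_gt k w : ((k%:R)%:E < hitting_time R W B w)%E <-> avoids k w.
Proof.
split=> [h j jk Bj|h].
  move: h; rewrite ltNge => /negP; apply.
  apply: (@le_trans _ _ (j%:R)%:E); last by rewrite lee_fin ler_nat.
  by apply: ereal_inf_lbound; exists j.
apply: (@lt_le_trans _ _ (k.+1%:R)%:E); first by rewrite lte_fin ltr_nat.
apply: le_ereal_inf_tmp => _ [j Bj <-]; rewrite lee_fin ler_nat ltnNge.
by apply/negP => jk; exact: h Bj.
Qed.

Lemma killed_ge0 k v : (0 <= killed k v)%E. Proof. exact: measure_ge0. Qed.

Lemma occupation_killed v :
  (\int[P]_w \sum_(0 <= k <oo | ((k%:R)%:E < hitting_time R W B w)%E) ((W k w == v)%:R)%:E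
   = \sum_(k <oo) killed k v)%E.
Proof.
have mE k : measurable (avoids k `&` [set w | W k w = v]).
  by apply: measurableI; [exact: avoids_measurable|exact: hW.1].
transitivity (\int[P]_w \sum_(0 <= k <oo) (\1_(avoids k `&` [set w | W k w = v]) w)%:E)%E.
  apply: eq_integral => w _; rewrite eseries_mkcond; apply: eq_eseriesr => k _.
  rewrite indicE; case: ifPn => [/hitting_time_gt h|/negP h].
    rewrite in_setI (mem_set h) /=; congr ((_ : bool)%:R%:E).
    by apply/eqP/idP; rewrite inE.
  by rewrite memNset// => -[/hitting_time_gt].
rewrite /= integral_nneseries//.
- by apply: eq_eseriesr => k _; rewrite integral_indic// setIT.
- by move=> k; apply/measurable_EFinP; exact: measurable_indic.
Qed.

Lemma occupation_out v : B v -> (\sum_(k <oo) killed k v = 0)%E.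
Proof. by move=> Bv; rewrite eseries0// => k _ _; exact: killed_out. Qed.

Lemma occupation_rec v : ~ B v -> (\sum_(k <oo) killed k v = ((u == v)%:R)%:E + (4^-1)%:E *
  (\sum_(k <oo) killed k (xr v) + \sum_(k <oo) killed k (xl v) + \sum_(k <oo) killed k (xu v)
   + \sum_(k <oo) killed k (xd v)))%E.
Proof.
move=> Bv; rewrite nneseries_recl//.
rewrite killed0//; congr (_ + _)%E.
rewrite -!nneseriesD//; do ?[by move=> *; rewrite ?adde_ge0 ?killed_ge0].
rewrite -nneseriesZl; last by move=> *; rewrite !adde_ge0 ?killed_ge0.
rewrite -nneseries_addn//.
by apply: eq_eseriesr => n _; rewrite addn1 killedS.
Qed.

End killed_walk.

Lemma boundary_VN N v : VN N v -> boundary (VN N) v <-> ~~ inI N v.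
Proof.
case: v => a b [/= /andP[a0 aN] /andP[b0 bN]]; split.
  move=> [_ [[a' b']]] [nz]; rewrite lattice_adjE /inI /= => h; apply/negP => i; apply: nz.
  by move: h i; rewrite /VN /xr /xl /xu /xd !xpair_eqE /= => h /andP[i1 i2]; split; lia.
rewrite /inI /= => h; split; first by split; rewrite /= ?a0 ?b0.
have [e|?] := eqVneq a 0; first by exists (a - 1, b); rewrite lattice_adjE /VN /xr /xl /xu /xd /= !xpair_eqE; split; [move=> -[]|]; lia.
have [e|?] := eqVneq b 0; first by exists (a, b - 1); rewrite lattice_adjE /VN /xr /xl /xu /xd /= !xpair_eqE; split; [move=> -[]|]; lia.
have [e|?] := eqVneq a N%:Z; first by exists (a + 1, b); rewrite lattice_adjE /VN /xr /xl /xu /xd /= !xpair_eqE; split; [move=> -[]|]; lia.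
by exists (a, b + 1); rewrite lattice_adjE /VN /xr /xl /xu /xd /= !xpair_eqE; split; [move=> -[]|]; lia.
Qed.

Section green_function.
Context {R : realType} {d : measure_display} {Om : measurableType d}.
Variables (P : Z2 -> probability Om R) (W : nat -> Om -> Z2).
Hypothesis hW : forall u, simple_random_walk (P u) W u.
Variable N : nat.

Lemma green_boundary u v : VN N v -> ~~ inI N v -> green P W (VN N) u v = 0%E.
Proof.
move=> Vv vI; rewrite /green (occupation_killed (hW u)) (occupation_out) ?mule0//.
exact/boundary_VN.
Qed.

(** The forward equations summed over time, an equation in the second argument. It is additive in
    the extended reals because finiteness comes only later, from the identification with a
    covariance. *)
Lemma green_interior u v : inI N v -> (green P W (VN N) u v = (pi / 2 * (u == v)%:R)%:E +
  (4^-1)%:E * (green P W (VN N) u (xr v) + green P W (VN N) u (xl v)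
               + green P W (VN N) u (xu v) + green P W (VN N) u (xd v)))%E.
Proof.
move=> vI; rewrite /green !(occupation_killed (hW u)) (occupation_rec (hW u)); last first.
  move/boundary_VN => /(_ _)/negP; apply => //.
  by move: vI; rewrite /inI /VN /= => /andP[/andP[? ?] /andP[? ?]]; split; apply/andP; split; lia.
have h v' : (0 <= \sum_(k <oo) killed (P u) W (boundary (VN N)) k v')%E.
  by apply: nneseries_ge0 => k _ _; exact: killed_ge0.
rewrite -!ge0_muleDr ?adde_ge0 ?lee_fin//.
rewrite EFinM muleCA; apply: ge0_muleDr; first by rewrite lee_fin.
by rewrite mule_ge0 ?lee_fin ?invr_ge0// !adde_ge0.
Qed.

End green_function.

(** * Elementary limits that approximate half lines by trigonometric functions *)

Lemma sin_mean_value {R : realType} (y : R) : exists2 c, `|c| <= `|y| & sin y = y * cos c.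
Proof.
have pos (z : R) : 0 < z -> exists2 c, `|c| <= z & sin z = z * cos c.
  move=> z0; have [|c cz] := @MVT R sin cos 0 z z0 (fun x _ => is_derive_sin x).
    by apply: continuous_subspaceT => x; exact: continuous_sin.
  rewrite sin0 !subr0 mulrC => ->; exists c => //.
  by move: cz; rewrite in_itv/= => /andP[c0 cz]; rewrite gtr0_norm// ltW.
have [y0|y0|->] := ltgtP y 0.
- have [|c c1 c2] := pos (- y); first by rewrite oppr_gt0.
  by exists c; rewrite ?(ltr0_norm y0)//; move: c2; rewrite sinN mulNr => /oppr_inj.
- by have [c c1 c2] := pos y y0; exists c => //; rewrite (gtr0_norm y0).
- by exists 0; rewrite ?sin0 ?mul0r.
Qed.

Lemma norm_sin_le {R : realType} (y : R) : `|sin y| <= `|y|.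
Proof. by have [c _ ->] := sin_mean_value y; rewrite normrM ler_piMr ?cos_max. Qed.

Lemma cvg_sin_scale {R : realType} (x : R) :
  k.+1%:R * sin (k.+1%:R^-1 * x) @[k --> \oo] --> x.
Proof.
have h k : exists c, `|c| <= k.+1%:R^-1 * `|x| /\ k.+1%:R * sin (k.+1%:R^-1 * x) = x * cos c.
  have [c c1 c2] := sin_mean_value (k.+1%:R^-1 * x); exists c; split.
    by rewrite (le_trans c1)// normrM ger0_norm// invr_ge0.
  by rewrite c2 mulrA mulrA mulfV ?mul1r// pnatr_eq0.
pose c k := sval (cid (h k)).
have c1 k : `|c k| <= k.+1%:R^-1 * `|x| by exact: (svalP (cid (h k))).1.
rewrite (_ : (fun k => _) = (fun k => x * cos (c k))); last first.
  by apply/funext => k; exact: (svalP (cid (h k))).2.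
rewrite -[X in _ --> X]mulr1 -(@cos0 R).
apply: cvgMl_tmp; apply: (@continuous_cvg _ _ _ _ _ _ (@cos R)); first exact: continuous_cos.
apply/norm_cvg0P; apply: (@squeeze_cvgr _ _ _ _ (fun=> 0) (fun k => k.+1%:R^-1 * `|x|)).
- by apply: nearW => k; rewrite normr_ge0 c1.
- exact: cvg_cst.
- rewrite -[X in _ --> X](mul0r `|x|); apply: cvgMr_tmp; exact: cvg_harmonic.
Qed.

Lemma cvg_exp_exp {R : realType} (y : R) :
  expR (- expR (k%:R * y)) @[k --> \oo] --> (if y < 0 then 1 else if y == 0 then expR (-1) else 0).
Proof.
have e k : expR (k%:R * y) = expR y ^+ k by rewrite expRM_natl.
have [y0|y0|->] := ltgtP y 0.
- under eq_fun do rewrite e.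
  have -> : (1 : R) = expR (- 0) by rewrite oppr0 expR0.
  apply: (@continuous_cvg _ _ _ _ _ _ (@expR R)); first exact: continuous_expR.
  by apply: cvgN; apply: cvg_expr; rewrite ger0_norm ?expR_ge0// expR_lt1.
- under eq_fun do rewrite e.
  apply: (@squeeze_cvgr _ _ _ _ (fun=> 0) (fun k => expR (- y) ^+ k)).
  + apply: nearW => k; rewrite expR_ge0/= [expR (- y)]expRN exprVn expRN lef_pV2 ?posrE ?expR_gt0 ?exprn_gt0 ?expR_gt0//.
    by apply: le_trans (expR_ge1Dx _); rewrite lerDr.
  + exact: cvg_cst.
  + by apply: cvg_expr; rewrite ger0_norm ?expR_ge0// expR_lt1 oppr_lt0.
- by under eq_fun do rewrite mulr0 expR0; exact: cvg_cst.
Qed.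

Lemma series_exp_le {R : realType} (x : R) n : `|\sum_(i < n) x ^+ i / i`!%:R| <= expR `|x|.
Proof.
apply: (le_trans (ler_norm_sum _ _ _)).
have h : \sum_(i < n) `|x ^+ i / i`!%:R| = series (exp_coeff `|x|) n.
  rewrite /series /= big_mkord; apply: eq_bigr => i _.
  by rewrite /exp_coeff /= normrM normrX normfV [`|_`!%:R|]ger0_norm.
rewrite h /expR; apply: nondecreasing_cvgn_le; last exact: is_cvg_series_exp_coeff.
apply/nondecreasing_seqP => k; rewrite /series /= big_nat_recr//= lerDl.
by rewrite /exp_coeff /= divr_ge0 ?exprn_ge0.
Qed.

Lemma cvg_series_exp {R : realType} (x : R) :
  \sum_(i < n) x ^+ i / i`!%:R @[n --> \oo] --> expR x.
Proof.
rewrite (_ : (fun n => _) = series (exp_coeff x)); first exact: is_cvg_series_exp_coeff.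
by apply/funext => n; rewrite /series /= big_mkord.
Qed.

(** * Conditional expectation in a Gaussian space *)

Section null_functionals.
Context {R : realType} {d : measure_display} {T : measurableType d}.
Variables (P : probability T R).

(** Bounded test functions orthogonal to [Z]. The class is closed under linear combinations and
    bounded pointwise limits, and the approximations below use nothing else. *)
Definition annihilates (Z g : T -> R) : Prop :=
  [/\ measurable_fun [set: T] g, exists C, forall w, `|g w| <= C
    & (\int[P]_w (Z w * g w)%:E = 0)%E].

Section fixed.
Variable Z : T -> R.
Hypothesis iZ : P.-integrable [set: T] (EFin \o Z).

Let mZ : measurable_fun [set: T] Z.
Proof. exact/measurable_EFinP/(measurable_int _ iZ). Qed.

Lemma integrable_mul_bounded (g : T -> R) (C : R) : measurable_fun [set: T] g ->
  (forall w, `|g w| <= C) -> P.-integrable [set: T] (fun w => (Z w * g w)%:E).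
Proof.
move=> mg gC; apply: (@le_integrable _ _ _ P _ measurableT _ (fun w => (C%:E * (Z w)%:E)%E)).
- by apply/measurable_EFinP; exact: measurable_funM.
- move=> w _; rewrite /= lee_fin !normrM mulrC ler_wpM2r// (le_trans (gC w))// ler_norm//.
- by apply: integrableZl.
Qed.

Lemma annihilates_lin (a : R) (f g : T -> R) : annihilates Z f -> annihilates Z g ->
  annihilates Z (fun w => a * f w + g w).
Proof.
move=> [mf [C fC] f0] [mg [D gD] g0]; split.
- by apply: measurable_funD => //; exact: measurable_funM.
- exists (`|a| * C + D) => w; rewrite (le_trans (ler_normD _ _))// lerD// normrM ler_wpM2l//.
have -> : (fun w => (Z w * (a * f w + g w))%:E) =
    (fun w => a%:E * (Z w * f w)%:E + (Z w * g w)%:E)%E.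
  by apply/funext => w; rewrite -EFinM -EFinD; congr EFin; ring.
have i1 := integrable_mul_bounded mf fC; have i2 := integrable_mul_bounded mg gD.
rewrite integralD//; last exact: integrableZl.
by rewrite integralZl// f0 g0 mule0 adde0.
Qed.

Lemma annihilates0 : annihilates Z (fun=> 0).
Proof.
split; [exact: measurable_cst|by exists 0 => w; rewrite normr0|].
by under eq_integral do rewrite mulr0; rewrite integral0.
Qed.

Lemma annihilates_sum (c : nat -> R) (f : nat -> T -> R) n :
  (forall i, annihilates Z (f i)) -> annihilates Z (fun w => \sum_(i < n) c i * f i w).
Proof.
move=> H; elim: n => [|n IH]; first by under eq_fun do rewrite big_ord0; exact: annihilates0.
under eq_fun do rewrite big_ord_recr /= addrC.
exact: annihilates_lin.
Qed.

Lemma annihilates_lim (C : R) (f : nat -> T -> R) (g : T -> R) : (forall k, annihilates Z (f k)) ->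
  (forall k w, `|f k w| <= C) -> (forall w, f k w @[k --> \oo] --> g w) -> annihilates Z g.
Proof.
move=> H fC fg.
have mg : measurable_fun [set: T] g.
  apply: (@measurable_fun_cvg _ _ _ setT f) => // k; by case: (H k).
have gC w : `|g w| <= C.
  apply: (ler_cvg_to (cvg_norm (fg w)) (cvg_cst C)).
  by apply: nearW => k; exact: fC.
split=> //; first by exists C.
have mf k := measurable_int _ (integrable_mul_bounded (let: And3 h _ _ := H k in h) (fC k)).
have [|||_ _ h] := @dominated_convergence _ _ _ P _ measurableT (fun k w => (Z w * f k w)%:E)
  (fun w => (Z w * g w)%:E) (fun w => (C%:E * (abse \o (EFin \o Z)) w)%E)
  mf (measurable_int _ (integrable_mul_bounded mg gC)).
- by apply: aeW => w _; apply: cvg_EFin; [exact: nearW|]; apply: cvgMl_tmp.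
- by apply: integrableZl => //; exact: integrable_abse.
- by apply: aeW => w k _; rewrite /= lee_fin normrM mulrC ler_wpM2r.
have e0 : [sequence (\int[P]_w (Z w * f n w)%:E)%E]_n = (fun=> 0%E).
  by apply/funext => n /=; case: (H n).
by rewrite e0 in h; have := cvg_unique _ h (cvg_cst _) => ->.
Qed.

Section trigonometric.
Variable X : T -> R.
Hypothesis mX : measurable_fun [set: T] X.
Hypothesis Hcos : forall t, annihilates Z (fun w => cos (t * X w)).
Hypothesis Hsin : forall t, annihilates Z (fun w => sin (t * X w)).

(** Testing jointly with all frequencies makes the property stable under multiplication by
    [sin (c * X)], through the product-to-sum formulas; powers of the sine follow. *)
Let stable (g : T -> R) := forall t, annihilates Z (fun w => g w * cos (t * X w)) /\
  annihilates Z (fun w => g w * sin (t * X w)).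

Let stable_sin c g : stable g -> stable (fun w => sin (c * X w) * g w).
Proof.
move=> H t; have [h1 h2] := H (c + t); have [h3 h4] := H (c - t); split.
  have -> : (fun w => sin (c * X w) * g w * cos (t * X w)) =
     (fun w => 2^-1 * (g w * sin ((c + t) * X w)) + (2^-1 * (g w * sin ((c - t) * X w)) + 0)).
    by apply/funext => w; rewrite mulrDl mulrBl sinD sinB; field.
  by do 2!apply: annihilates_lin => //; exact: annihilates0.
have -> : (fun w => sin (c * X w) * g w * sin (t * X w)) =
   (fun w => - 2^-1 * (g w * cos ((c + t) * X w)) + (2^-1 * (g w * cos ((c - t) * X w)) + 0)).
  by apply/funext => w; rewrite mulrDl mulrBl cosD cosB; field.
by do 2!apply: annihilates_lin => //; exact: annihilates0.
Qed.

Let annihilates_sinX c k : annihilates Z (fun w => sin (c * X w) ^+ k).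
Proof.
suff /(_ 0)[+ _] : stable (fun w => sin (c * X w) ^+ k).
  by under eq_fun do rewrite mul0r cos0 mulr1.
elim: k => [|k IH].
  by move=> t; split; under eq_fun do rewrite expr0 mul1r.
by under eq_fun do rewrite exprS; exact: stable_sin.
Qed.

(** The exponential series converges boundedly because its argument is bounded. The next lemma uses
    the series a second time, for the exponential of this exponential. *)
Let annihilates_exp_sin c s : annihilates Z (fun w => expR (s * sin (c * X w))).
Proof.
apply: (@annihilates_lim (expR `|s|)
  (fun n w => \sum_(i < n) (s ^+ i / i`!%:R) * sin (c * X w) ^+ i)).
- by move=> k; apply: (@annihilates_sum (fun i => s ^+ i / i`!%:R) (fun i w => sin (c * X w) ^+ i)) => i; exact: annihilates_sinX.
- move=> k w; have := series_exp_le (s * sin (c * X w)) k.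
  under eq_bigr do rewrite exprMn mulrAC.
  move=> /le_trans; apply; rewrite ler_expR normrM ler_piMr//; exact: sin_max.
- move=> w; have := @cvg_series_exp R (s * sin (c * X w)).
  by under eq_fun => n do under eq_bigr do rewrite exprMn mulrAC.
Qed.

Let annihilates_exp_exp_sin c s b :
  annihilates Z (fun w => expR (- expR (s * sin (c * X w) - b))).
Proof.
have termE w (i : nat) : (- expR (s * sin (c * X w) - b)) ^+ i / i`!%:R =
    ((- expR (- b)) ^+ i / i`!%:R) * expR (i%:R * s * sin (c * X w)).
  rewrite -[i%:R * s * _]mulrA expRM_natl expRD; set A := expR (s * _); set B := expR (- b).
  by have -> : - (A * B) = - B * A by [ring]; rewrite exprMn mulrAC.
apply: (@annihilates_lim (expR (expR (`|s| + `|b|)))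
  (fun n w => \sum_(i < n) ((- expR (- b)) ^+ i / i`!%:R) * expR (i%:R * s * sin (c * X w)))).
- move=> k; apply: (@annihilates_sum (fun i => (- expR (- b)) ^+ i / i`!%:R)
    (fun i w => expR (i%:R * s * sin (c * X w)))) => i.
  exact: annihilates_exp_sin.
- move=> k w; have := series_exp_le (- expR (s * sin (c * X w) - b)) k.
  rewrite (eq_bigr (fun i : 'I_k => ((- expR (- b)) ^+ i / i`!%:R) * expR (i%:R * s * sin (c * X w)))).
    move=> /le_trans; apply; rewrite ler_expR normrN ger0_norm ?expR_ge0// ler_expR.
    rewrite (le_trans (ler_norm _))// (le_trans (ler_normB _ _))// lerD2r normrM ler_piMr//.
    exact: sin_max.
  by move=> i _; exact: termE.
- move=> w; have := @cvg_series_exp R (- expR (s * sin (c * X w) - b)).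
  by under eq_fun => n do under eq_bigr do rewrite termE.
Qed.

Let expRN_expR_bd (y : R) : `|expR (- expR y)| <= 1.
Proof. by rewrite ger0_norm ?expR_ge0// -expR0 ler_expR oppr_le0 expR_ge0. Qed.

(* [expR (- expR (n (x - c)))] tends to the indicator of [x < c] as n grows, and it
   is a limit of trigonometric polynomials since [x = lim k sin (x / k)]. *)
Lemma annihilates_ray (b : R) : annihilates Z (fun w => ((X w < b)%R)%:R).
Proof.
have h1 n c : annihilates Z (fun w => expR (- expR (n%:R * (X w - c)))).
  apply: (@annihilates_lim 1
    (fun k w => expR (- expR ((n%:R * k.+1%:R) * sin (k.+1%:R^-1 * X w) - n%:R * c)))).
  - by move=> k; exact: annihilates_exp_exp_sin.
  - by move=> k w; exact: expRN_expR_bd.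
  - move=> w; apply: (@continuous_cvg _ _ _ _ _ _ (@expR R)); first exact: continuous_expR.
    apply: cvgN; apply: (@continuous_cvg _ _ _ _ _ _ (@expR R)); first exact: continuous_expR.
    rewrite mulrBr; apply: cvgB; last exact: cvg_cst.
    under eq_fun do rewrite -mulrA.
    by apply: cvgMl_tmp; exact: cvg_sin_scale.
have h2 c : annihilates Z (fun w => if X w - c < 0 then 1 else if X w - c == 0 then expR (-1) else 0).
  apply: (@annihilates_lim 1 (fun n w => expR (- expR (n%:R * (X w - c))))) => //.
  by move=> w; exact: cvg_exp_exp.
(* The limit found in [h2] takes the stray value [expR (- 1)] at the threshold; letting thresholds
   increase strictly to [b] removes it. *)
apply: (@annihilates_lim 1 (fun k w => if X w - (b - k.+1%:R^-1) < 0 then 1 else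
  if X w - (b - k.+1%:R^-1) == 0 then expR (-1) else 0)) => //.
  move=> k w; case: ifP => _; first by rewrite normr1.
  by case: ifP => _; rewrite ?normr0// ger0_norm ?expR_ge0// -expR0 ler_expR oppr_le0.
move=> w; have [Xb|Xb] := ltP (X w) b; last first.
  rewrite (_ : (fun k => _) = (fun=> 0)); first exact: cvg_cst.
  apply/funext => k; have : 0 < k.+1%:R^-1 :> R by rewrite invr_gt0.
  move=> k0; have k1 : 0 < X w - (b - k.+1%:R^-1) by move: k0 Xb; set q := _^-1; lra.
  by rewrite ltNge (ltW k1) gt_eqF.
apply: (cvg_near_cst (1 : R)).
have : k.+1%:R^-1 @[k --> \oo] --> (0 : R) by exact: cvg_harmonic.
move=> /cvgrPdist_lt/(_ (b - X w)); rewrite subr_gt0 => /(_ Xb).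
apply: filterS => k; rewrite sub0r normrN ger0_norm ?invr_ge0// => hk.
have k1 : X w - (b - k.+1%:R^-1) < 0 by move: hk; set q := _^-1; lra.
by rewrite k1.
Qed.

End trigonometric.
End fixed.
End null_functionals.

Section linear_family.
Context {R : realType} {d : measure_display} {T : measurableType d}.
Variables (P : probability T R) (V : lmodType R) (X : V -> T -> R).
Hypothesis XL : forall a x y w, X (a *: x + y) w = a * X x w + X y w.
Hypothesis mX : forall x, measurable_fun [set: T] (X x).
Variables (Z : T -> R) (S : V -> Prop).
Hypothesis iZ : P.-integrable [set: T] (EFin \o Z).
Hypothesis SL : forall a x y, S x -> S y -> S (a *: x + y).
Hypothesis S0 : S 0.
Hypothesis HZ : forall b, S b -> annihilates P Z (fun w => cos (X b w)) /\
                               annihilates P Z (fun w => sin (X b w)).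

Let rays (s : seq (V * R)) : set T := [set w | all (fun p => X p.1 w < p.2)%R s].

Let mrays s : measurable (rays s).
Proof.
elim: s => [|p s IH]; first by rewrite (_ : rays _ = setT)//; exact/seteqP.
rewrite (_ : rays _ = (X p.1 @^-1` `]-oo, p.2[) `&` rays s).
  by apply: measurableI => //; rewrite -[X in measurable X]setTI; exact: mX.
by apply/seteqP; split=> w; rewrite /rays /= in_itv/= => /andP.
Qed.

Let indic_rays s w : \1_(rays s) w = (all (fun p => X p.1 w < p.2)%R s)%:R :> R.
Proof. by rewrite indicE; congr ((_ : bool)%:R); apply/idP/idP; rewrite inE. Qed.

(** The phase is what makes the induction close. To add a ray in direction [p.1], the function [Z]
    times the indicator times the cosine is tested against [cos (t * X p.1 + ph)]; the
    product-to-sum formula returns two cosines in the directions [b] plus or minus [t *: p.1]. The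
    phases 0 and [- (pi / 2)] feed [annihilates_ray]. *)
Let annihilates_phase s : (forall p, p \in s -> S p.1) -> forall b th, S b ->
  annihilates P Z (fun w => \1_(rays s) w * cos (X b w + th)).
Proof.
elim: s => [|p s IH] Hs b th Sb.
  have [h1 h2] := HZ Sb.
  have -> : (fun w => \1_(rays [::]) w * cos (X b w + th)) =
      (fun w => cos th * cos (X b w) + (- sin th * sin (X b w) + 0)).
    apply/funext => w; rewrite indicE mem_set// mul1r cosD; ring.
  apply: annihilates_lin => //; apply: annihilates_lin => //; exact: annihilates0.
have Ss q : q \in s -> S q.1 by move=> qs; apply: Hs; rewrite inE qs orbT.
have Sp : S p.1 by apply: Hs; rewrite inE eqxx.
have {Ss Hs}IH := IH Ss.
have mb : measurable_fun [set: T] (fun w => \1_(rays s) w * cos (X b w + th) : R).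
  by case: (IH b th Sb).
have bb w : `|\1_(rays s) w * cos (X b w + th)| <= 1.
  rewrite normrM -[leRHS]mulr1 ler_pM ?cos_max// indicE; case: (_ \in _); rewrite ?normr1 ?normr0//.
have iZ' := integrable_mul_bounded iZ mb bb.
have prod t ph : annihilates P (fun w => Z w * (\1_(rays s) w * cos (X b w + th)))
    (fun w => cos (t * X p.1 w + ph)).
  have S1 : S (t *: p.1 + b) by exact: SL.
  have S2 : S ((- t) *: p.1 + b) by exact: SL.
  have [m0 [C hC] i0] : annihilates P Z
    (fun w => \1_(rays s) w * cos (X b w + th) * cos (t * X p.1 w + ph)).
    have -> : (fun w => \1_(rays s) w * cos (X b w + th) * cos (t * X p.1 w + ph)) =
      (fun w => 2^-1 * (\1_(rays s) w * cos (X (t *: p.1 + b) w + (th + ph))) +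
       (2^-1 * (\1_(rays s) w * cos (X ((- t) *: p.1 + b) w + (th - ph))) + 0)).
      apply/funext => w; rewrite !XL.
      have -> : t * X p.1 w + X b w + (th + ph) = (X b w + th) + (t * X p.1 w + ph) by ring.
      have -> : - t * X p.1 w + X b w + (th - ph) = (X b w + th) - (t * X p.1 w + ph) by ring.
      by set A := X b w + th; set B := t * _ + ph; rewrite cosD cosB; field.
    apply: annihilates_lin => //; first exact: IH.
    by apply: annihilates_lin => //; [exact: IH|exact: annihilates0].
  split.
  - apply: (@measurableT_comp _ _ _ _ _ _ (@cos R)).
      by apply: continuous_measurable_fun; exact: continuous_cos.
    by apply: measurable_funD => //; exact: measurable_funM.
  - by exists 1 => w; exact: cos_max.
  - by rewrite -[RHS]i0; apply: eq_integral => w _; rewrite -!mulrA.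
have [m1 [C hC] i1] : annihilates P (fun w => Z w * (\1_(rays s) w * cos (X b w + th)))
    (fun w => ((X p.1 w < p.2)%R)%:R).
  apply: annihilates_ray => //.
  - by move=> t; have := prod t 0; under [X in annihilates _ _ X]eq_fun do rewrite addr0.
  - by move=> t; have := prod t (- (pi / 2)); under [X in annihilates _ _ X]eq_fun do rewrite cosBpihalf.
have e w : \1_(rays (p :: s)) w * cos (X b w + th) =
    (\1_(rays s) w * cos (X b w + th)) * ((X p.1 w < p.2)%R)%:R.
  by rewrite mulrAC; congr (_ * _); rewrite !indic_rays /= -natrM mulnb andbC.
under [X in annihilates _ _ X]eq_fun do rewrite e.
split; first exact: measurable_funM.
- exists C => w; rewrite normrM -[leRHS]mul1r ler_pM//.
- by rewrite -[RHS]i1; apply: eq_integral => w _; rewrite mulrA.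
Qed.

Let G : set (set T) := [set A | exists s, (forall p, p \in s -> S p.1) /\ A = rays s].

Let GI : setI_closed G.
Proof.
move=> _ _ [s [Ss ->]] [t [St ->]]; exists (s ++ t); split.
  by move=> p; rewrite mem_cat => /orP[/Ss|/St].
by apply/seteqP; split=> w; rewrite /rays /= all_cat => /andP.
Qed.

Let D : set (set T) := [set A | measurable A /\ (\int[P]_(w in A) (Z w)%:E = 0)%E].

Let DG : G `<=` D.
Proof.
move=> _ [s [Ss ->]]; split; first exact: mrays.
have [_ _ h] := annihilates_phase Ss 0 S0.
rewrite -[RHS]h integral_mkcond; apply: eq_integral => w _.
have X0 : X 0 w = 0 by have := XL 1 0 0 w; rewrite scaler0 addr0 mul1r; lra.
by rewrite X0 addr0 cos0 mulr1 patchE indicE; case: (_ \in _); rewrite ?mulr1 ?mulr0.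
Qed.

Let Ddynkin : dynkin D.
Proof.
have iA A : measurable A -> P.-integrable A (EFin \o Z).
  by move=> mA; apply: integrableS iZ.
split.
- by apply: DG; exists [::]; split=> //; apply/seteqP.
- move=> A [mA A0]; split; first exact: measurableC.
  have [_ T0] : D setT by apply: DG; exists [::]; split=> //; apply/seteqP.
  have := @integral_setU _ _ _ P A (~` A) (EFin \o Z) mA (measurableC mA).
  rewrite setUv T0 A0 add0e => -> //; first exact: measurable_int iZ.
  by apply/disj_setPRL.
- move=> F tF DF; split; first by apply: bigcupT_measurable => n; case: (DF n).
  rewrite integral_bigcup//.
  + by apply: eseries0 => n _ _; case: (DF n).
  + by move=> n; case: (DF n).
  + by apply: iA; apply: bigcupT_measurable => n; case: (DF n).
Qed.

(** Dynkin's theorem: finite intersections of rays are closed under intersection and, since half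
    lines generate the Borel sets, generate the sigma-algebra. *)
Lemma integral_sigma_eq0 (J : Type) (I : set J) (Y : J -> V) (f : J -> T -> R) A :
  (forall j, I j -> S (Y j)) -> (forall j w, f j w = X (Y j) w) ->
  <<s \bigcup_(j in I) preimage_set_system [set: T] (f j) measurable >> A ->
  measurable A /\ (\int[P]_(w in A) (Z w)%:E = 0)%E.
Proof.
move=> SY fE sA; suff : D A by [].
have : <<d G >> A.
  rewrite setI_closed_g_dynkin_g_sigma_algebra//.
  apply: smallest_sub sA; first exact: smallest_sigma_algebra.
  move=> _ [j Ij [B mB <-]].
  have : <<s [set: T], preimage_set_system [set: T] (f j) (@RGenInftyO.G R) >> ([set: T] `&` f j @^-1` B).
    rewrite g_sigma_preimageE; exists B => //.
    by rewrite -RGenInftyO.measurableE.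
  apply: smallest_sub; first exact: smallest_sigma_algebra.
  move=> _ [_ [c ->] <-]; apply: sub_sigma_algebra; exists [:: (Y j, c)]; split.
    by move=> p; rewrite inE => /eqP -> /=; exact: SY.
  by rewrite setTI; apply/seteqP; split=> w; rewrite /rays /= in_itv/= fE andbT.
by apply: smallest_sub.
Qed.

End linear_family.

Lemma integrable_bounded {R : realType} {d} {T : measurableType d} (P : probability T R)
  (f : T -> R) (C : R) : measurable_fun [set: T] f -> (forall w, `|f w| <= C) ->
  P.-integrable [set: T] (EFin \o f).
Proof.
move=> mf fC; apply: (@le_integrable _ _ _ P _ _ _ (EFin \o cst C)) => //.
- exact/measurable_EFinP.
- by move=> x _; rewrite /= lee_fin (le_trans (fC x))// ler_norm.
- exact: finite_measure_integrable_cst.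
Qed.

(** * The Gaussian space of the field, in coordinates *)

Section gaussian_family.
Context {R : realType} {d : measure_display} {T : measurableType d}.
Variables (P : probability T R) (N : nat) (phi : box N -> {RV P >-> R}).

(** Coefficient vectors stand for the random variables without any quotient, so [cov] may be
    degenerate. *)
Definition coefs : lmodType R := {ffun box N -> R^o}.

Definition lincomb (a : coefs) (w : T) : R := \sum_v a v * phi v w.

Lemma lincombL a x y w : lincomb (a *: x + y) w = a * lincomb x w + lincomb y w.
Proof.
rewrite /lincomb mulr_sumr -big_split; apply: eq_bigr => v _.
by rewrite !ffunE /= mulrDl mulrA.
Qed.

Lemma measurable_lincomb a : measurable_fun [set: T] (lincomb a).
Proof. by apply: measurable_sum => v; exact: measurable_funM. Qed.

HB.instance Definition _ (a : coefs) :=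
  isMeasurableFun.Build _ _ _ _ (lincomb a) (measurable_lincomb a).

Hypothesis gphi : gaussian_vector phi.
Hypothesis phi0 : forall v, 'E_P[phi v]%E = 0%E.

Let single (v : box N) : coefs := [ffun u => (u == v)%:R].

Let lincomb_single v w : lincomb (single v) w = phi v w.
Proof.
rewrite /lincomb (bigD1 v)//= big1 => [|u uv]; first by rewrite ffunE eqxx mul1r addr0.
by rewrite ffunE (negbTE uv) mul0r.
Qed.

Lemma integrable_gff v : P.-integrable [set: T] (EFin \o phi v).
Proof.
have [m [s [s0 law]]] := gphi (single v).
have -> : EFin \o phi v = EFin \o (lincomb (single v)).
  by apply/funext => w /=; rewrite lincomb_single.
exact: (integrable_gaussian (X := [the {RV P >-> R} of lincomb (single v)]) law).
Qed.

Lemma integral_lincomb a : (\int[P]_w (lincomb a w)%:E = 0)%E.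
Proof.
rewrite /lincomb; under eq_integral do rewrite -sumEFin.
rewrite integral_sum//; last first.
  by move=> v; under eq_fun do rewrite EFinM; apply: integrableZl => //; exact: integrable_gff.
rewrite big1// => v _; under eq_integral do rewrite EFinM.
rewrite integralZl//; last exact: integrable_gff.
by have := phi0 v; rewrite unlock => ->; rewrite mule0.
Qed.

Lemma lincomb_law a : exists s, [/\ 0 <= s,
  forall B : set R, measurable B -> P [set w | B (lincomb a w)] = gaussian_law 0 s B,
  P.-integrable [set: T] (fun w => (lincomb a w ^+ 2)%:E)
  & (\int[P]_w (lincomb a w ^+ 2)%:E = (s ^+ 2)%:E)%E].
Proof.
have [m [s [s0 law]]] := gphi a.
pose X := [the {RV P >-> R} of lincomb a].
have m0 : m = 0.
  by apply: (gaussian_mean0 (X := X) law); rewrite unlock; exact: integral_lincomb.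
have [h1 h2] := gaussian_second_moment (X := X) law m0 (integral_lincomb a).
by exists s; split=> // B mB; rewrite -m0; exact: law.
Qed.

Lemma integrable_lincombM a b : P.-integrable [set: T] (fun w => (lincomb a w * lincomb b w)%:E).
Proof.
have [s [_ _ ia _]] := lincomb_law a; have [t [_ _ ib _]] := lincomb_law b.
apply: (le_integrable measurableT _ _ (integrableD measurableT ia ib)).
- apply/measurable_EFinP; apply: measurable_funM; exact: measurable_lincomb.
- move=> w _; rewrite /= lee_fin; set x := lincomb a w; set y := lincomb b w.
  rewrite [leRHS]ger0_norm ?addr_ge0 ?sqr_ge0// ler_norml; apply/andP; split.
    by have := sqr_ge0 (x + y); nra.
  by have := sqr_ge0 (x - y); nra.
Qed.

Definition second_moment (u v : box N) : R := fine (\int[P]_w (phi u w * phi v w)%:E).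

Lemma covariance_second_moment u v : covariance P (phi u) (phi v) = (second_moment u v)%:E.
Proof.
have e : (\int[P]_w (phi u w * phi v w)%:E = \int[P]_w (lincomb (single u) w * lincomb (single v) w)%:E)%E.
  by apply: eq_integral => w _; rewrite !lincomb_single.
rewrite covariance.unlock !phi0 /= unlock /second_moment fineK.
  by apply: eq_integral => w _; congr EFin; rewrite -[LHS]/((phi u w - 0) * (phi v w - 0)) !subr0.
rewrite e; exact: (integrable_fin_num measurableT (integrable_lincombM _ _)).
Qed.

Definition cov (a b : coefs) : R := \sum_u \sum_v a u * b v * second_moment u v.

Lemma cov_sum a b : cov a b = \sum_u \sum_v a u * b v * second_moment u v. Proof. by []. Qed.

Lemma covE a b : (\int[P]_w (lincomb a w * lincomb b w)%:E = (cov a b)%:E)%E.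
Proof.
have i u v : P.-integrable [set: T] (fun w => (phi u w * phi v w)%:E).
  have -> : (fun w => (phi u w * phi v w)%:E) = (fun w => (lincomb (single u) w * lincomb (single v) w)%:E).
    by apply/funext => w; rewrite !lincomb_single.
  exact: integrable_lincombM.
have iuv u v : P.-integrable [set: T] (fun w => (a u * b v * (phi u w * phi v w))%:E).
  by under eq_fun do rewrite EFinM; apply: integrableZl.
transitivity (\int[P]_w (\sum_u \sum_v (a u * b v * (phi u w * phi v w))%:E))%E.
  apply: eq_integral => w _; rewrite /lincomb mulr_suml -sumEFin; apply: eq_bigr => u _.
  by rewrite mulr_sumr -sumEFin; apply: eq_bigr => v _; congr EFin; ring.
rewrite integral_sum//; last by move=> u; apply: integrable_sum.
rewrite /cov -sumEFin; apply: eq_bigr => u _.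
rewrite integral_sum// -sumEFin; apply: eq_bigr => v _.
under eq_integral do rewrite EFinM.
rewrite integralZl// [RHS]EFinM /second_moment fineK//.
exact: (integrable_fin_num measurableT (i u v)).
Qed.

Lemma cov_ge0 a : 0 <= cov a a.
Proof.
rewrite -lee_fin -covE; apply: integral_ge0 => w _; rewrite lee_fin -expr2; exact: sqr_ge0.
Qed.

Lemma covC a b : cov a b = cov b a.
Proof. by apply: EFin_inj; rewrite -!covE; apply: eq_integral => w _; rewrite mulrC. Qed.

Lemma covL a x y z : cov (a *: x + y) z = a * cov x z + cov y z.
Proof.
rewrite /cov mulr_sumr -big_split; apply: eq_bigr => u _ /=.
rewrite mulr_sumr -big_split; apply: eq_bigr => v _ /=.
by rewrite !ffunE /= -[_ *: _]/(a * _); ring.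
Qed.

Lemma lincomb_lawE a : exists s, [/\ 0 <= s, s ^+ 2 = cov a a &
  forall B : set R, measurable B -> P [set w | B (lincomb a w)] = gaussian_law 0 s B].
Proof.
have [s [s0 law _ h]] := lincomb_law a; exists s; split=> //.
by apply: EFin_inj; rewrite -h -covE; apply: eq_integral => w _; rewrite expr2.
Qed.

Lemma lincomb_mgf a : (\int[P]_w (expR (lincomb a w))%:E = (expR (cov a a / 2))%:E)%E.
Proof.
have [s [s0 sE law]] := lincomb_lawE a.
have := gaussian_mgf (X := [the {RV P >-> R} of lincomb a]) law 1.
rewrite mulr0 add0r expr1n mul1r sE => <-.
by apply: eq_integral => w _; rewrite mul1r.
Qed.

(** A centered Gaussian law is determined by its variance. *)
Lemma lincomb_same_law a b (f : R -> R) C : cov a a = cov b b ->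
  measurable_fun [set: R] f -> (forall x, `|f x| <= C) ->
  (\int[P]_w (f (lincomb a w))%:E = \int[P]_w (f (lincomb b w))%:E)%E.
Proof.
move=> ab mf fC.
have [s [s0 sE lawa]] := lincomb_lawE a; have [t [t0 tE lawb]] := lincomb_lawE b.
have st : s = t by apply/eqP; rewrite -(@eqrXn2 _ 2)// sE tE ab.
have h c (r : R) : (forall B : set R, measurable B -> P [set w | B (lincomb c w)] = gaussian_law 0 r B) ->
    exists Q : probability (measurableTypeR R) R, (forall B, measurable B -> Q B = gaussian_law 0 r B) /\
    (\int[P]_w (f (lincomb c w))%:E = \int[Q]_x (f x)%:E)%E.
  move=> law; pose X := lincomb c.
  have mX' : measurable_fun [set: T] (X : T -> measurableTypeR R).
    by move=> _ B mB; exact: (@measurable_lincomb c measurableT B mB).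
  pose X'mixin := isMeasurableFun.Build _ _ T (measurableTypeR R) X mX'.
  pose X' : {mfun T >-> measurableTypeR R} := HB.pack (X : T -> measurableTypeR R) X'mixin.
  exists (distribution P X'); split=> [B mB|]; first exact: law.
  transitivity (\int[distribution P X']_x (EFin \o f) x)%E => //.
  rewrite integral_distribution//; first exact/measurable_EFinP.
  apply: (@integrable_bounded _ _ _ P (f \o X) C) => [|w]; last exact: fC.
  exact: measurableT_comp.
have [Q [Q1 ->]] := h _ _ lawa; have [Q' [Q2 ->]] := h _ _ lawb.
apply: eq_measure_integral => B mB _.
by transitivity (gaussian_law 0 s B); [exact: Q1|rewrite st; symmetry; exact: Q2].
Qed.

Lemma integral_sin_lincomb a : (\int[P]_w (sin (lincomb a w))%:E = 0)%E.
Proof.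
have ms : measurable_fun [set: R] (@sin R).
  by apply: continuous_measurable_fun; exact: continuous_sin.
have N1 : lincomb (- a) = (fun w => - lincomb a w).
  by apply/funext => w; have := lincombL (-1) a 0 w; rewrite scaleN1r addr0 => ->;
    rewrite mulN1r /lincomb [X in _ + X]big1 ?addr0// => v _; rewrite ffunE mul0r.
have e : cov (- a) (- a) = cov a a.
  apply: EFin_inj; rewrite -!covE; apply: eq_integral => w _.
  by rewrite N1 mulrNN.
have := lincomb_same_law e ms (@sin_max R); rewrite N1.
have isin : P.-integrable [set: T] (fun w => (sin (lincomb a w))%:E).
  apply: (@integrable_bounded _ _ _ P (fun w => sin (lincomb a w)) 1) => [|w]; last exact: sin_max.
  by apply: measurableT_comp => //; exact: measurable_lincomb.
under eq_integral do rewrite sinN -mulN1r EFinM.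
rewrite integralZl//.
have := integrable_fin_num measurableT isin; set I := integral _ _ _.
by move: I => [r| |]//= _ [] h; congr EFin; lra.
Qed.

End gaussian_family.

Section gff_conditional.
Context {R : realType} {d : measure_display} {T : measurableType d}.
Variables (P : probability T R) (N : nat) (phi : box N -> {RV P >-> R}).
Hypothesis gphi : gaussian_vector phi.
Hypothesis phi0 : forall v, 'E_P[phi v]%E = 0%E.

Local Notation V := (coefs (R := R) N).
Local Notation X := (@lincomb R d T P N phi).
Local Notation cov := (cov phi).

(** [X z] is the limit of [k * sin (X z / k)]. By product-to-sum, the sine of [t * X z] times a
    cosine or sine of [X b] reduces to functions of [X (t *: z + b)] and [X (- t *: z + b)]. The
    sine has mean zero, and the cosines cancel because the two variances agree when
    [cov z b = 0]. *)
Lemma annihilates_orthogonal z b : cov z b = 0 ->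
  annihilates P (X z) (fun w => cos (X b w)) /\ annihilates P (X z) (fun w => sin (X b w)).
Proof.
move=> zb.
have mc : measurable_fun [set: R] (@cos R).
  by apply: continuous_measurable_fun; exact: continuous_cos.
have ms : measurable_fun [set: R] (@sin R).
  by apply: continuous_measurable_fun; exact: continuous_sin.
have mX a : measurable_fun [set: T] (X a) by exact: measurable_lincomb.
have icos a : P.-integrable [set: T] (fun w => (cos (X a w))%:E).
  apply: (@integrable_bounded _ _ _ P (fun w => cos (X a w)) 1) => [|w]; last exact: cos_max.
  exact: measurableT_comp.
have isin a : P.-integrable [set: T] (fun w => (sin (X a w))%:E).
  apply: (@integrable_bounded _ _ _ P (fun w => sin (X a w)) 1) => [|w]; last exact: sin_max.
  exact: measurableT_comp.
have XE t w : X (t *: z + b) w = t * X z w + X b w by exact: lincombL.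
have c0 t : (\int[P]_w (sin (t * X z w) * cos (X b w))%:E = 0)%E.
  have -> : (fun w => (sin (t * X z w) * cos (X b w))%:E) =
    (fun w => (2^-1)%:E * (sin (X (t *: z + b) w))%:E + (- 2^-1)%:E * (sin (X ((- t) *: z + b) w))%:E)%E.
    apply/funext => w; rewrite -!EFinM -EFinD !XE !mulNr; congr EFin.
    have -> : - (t * X z w) + X b w = - (t * X z w - X b w) by ring.
    by rewrite sinN sinD sinB; field.
  rewrite integralD//; [|exact: integrableZl|exact: integrableZl].
  by rewrite !integralZl// !integral_sin_lincomb// !mule0 adde0.
have s0 t : (\int[P]_w (sin (t * X z w) * sin (X b w))%:E = 0)%E.
  have -> : (fun w => (sin (t * X z w) * sin (X b w))%:E) =
    (fun w => (2^-1)%:E * (cos (X ((- t) *: z + b) w))%:E + (- 2^-1)%:E * (cos (X (t *: z + b) w))%:E)%E.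
    apply/funext => w; rewrite -!EFinM -EFinD !XE !mulNr; congr EFin.
    have -> : - (t * X z w) + X b w = - (t * X z w - X b w) by ring.
    by rewrite cosN cosB cosD; field.
  rewrite integralD//; [|exact: integrableZl|exact: integrableZl].
  rewrite !integralZl//.
  have e : cov ((- t) *: z + b) ((- t) *: z + b) = cov (t *: z + b) (t *: z + b).
    rewrite !covL ![cov _ (_ *: _ + _)]covC// !covL ![cov b z]covC// zb; ring.
  rewrite (lincomb_same_law gphi phi0 e mc (@cos_max R)).
  have := integrable_fin_num measurableT (icos (t *: z + b)).
  by move: (integral _ _ _) => [r| |]//= _; rewrite -!EFinM -EFinD; congr EFin; ring.
have iz : P.-integrable [set: T] (EFin \o X z).
  have [s [_ _ law]] := lincomb_lawE gphi phi0 z.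
  exact: (integrable_gaussian (X := [the {RV P >-> R} of X z]) law).
have lim (g : T -> R) : measurable_fun [set: T] g -> (forall w, `|g w| <= 1) ->
    (forall t, (\int[P]_w (sin (t * X z w) * g w)%:E = 0)%E) -> annihilates P (X z) g.
  move=> mg g1 H; split=> //; first by exists 1.
  pose f k w := k.+1%:R * sin (k.+1%:R^-1 * X z w) * g w.
  have [|||||_ _] := @dominated_convergence _ _ _ P _ measurableT (fun k w => (f k w)%:E)
    (fun w => (X z w * g w)%:E) (abse \o (EFin \o X z)).
  - move=> k; apply/measurable_EFinP; apply: measurable_funM => //.
    by apply: measurable_funM => //; apply: measurableT_comp => //; exact: measurable_funM.
  - by apply/measurable_EFinP; exact: measurable_funM.
  - apply: aeW => w _; apply: cvg_EFin; [exact: nearW|].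
    by apply: cvgMr_tmp; exact: cvg_sin_scale.
  - exact: integrable_abse.
  - apply: aeW => w k _; rewrite /= lee_fin /f !normrM.
    rewrite -[leRHS]mulr1 ler_pM ?mulr_ge0// (ger0_norm (ler0n _ _)).
    have := norm_sin_le (k.+1%:R^-1 * X z w); rewrite normrM ger0_norm ?invr_ge0// => h.
    by rewrite -ler_pdivlMl.
  have e0 : [sequence (\int[P]_w (f n w)%:E)%E]_n = (fun=> 0%E).
    apply/funext => n /=; rewrite /f.
    under eq_integral do rewrite -mulrA EFinM.
    rewrite integralZl//; first by rewrite H mule0.
    apply: (@integrable_bounded _ _ _ P (fun w => sin (n.+1%:R^-1 * X z w) * g w) 1) => [|w].
      by apply: measurable_funM => //; apply: measurableT_comp => //; exact: measurable_funM.
    by rewrite normrM -[leRHS]mulr1 ler_pM// sin_max.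
  by rewrite e0 => h; have := cvg_unique _ h (cvg_cst _) => ->.
split; apply: lim => //; try exact: measurableT_comp.
- by move=> w; exact: cos_max.
- by move=> w; exact: sin_max.
Qed.

Lemma null_field_ae a : cov a a = 0 -> P [set w | X a w != 0] = 0%E.
Proof.
move=> a0; have [s [s0 sE law]] := lincomb_lawE gphi phi0 a.
have -> : [set w | X a w != 0] = [set w | (~` [set 0]) (X a w)].
  by apply/seteqP; split=> w /eqP.
rewrite law; last exact: measurableC.
have -> : s = 0 by apply/eqP; rewrite -sqrf_eq0 sE a0.
by rewrite /gaussian_law eqxx diracE memNset// => /(_ erefl).
Qed.

(* A version of the conditional expectation is unique up to a null set, so it
   suffices that [X y] is measurable for the sigma-algebra and [X z] is
   orthogonal to it. *)
Lemma cond_expectation_lincomb (I : set (box N)) (x y z : V) (f : T -> R) :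
  is_cond_expectation P
    <<s \bigcup_(v in I) preimage_set_system [set: T] (phi v) measurable >> (X x) f ->
  x = y + z -> (forall v, ~ I v -> y v = 0) ->
  (forall v, I v -> cov z [ffun u => (u == v)%:R] = 0) ->
  P [set w | f w != X y w] = 0%E.
Proof.
set F := <<s _ >> => -[mf iF hf] xE yI zI.
pose S b := cov z b = 0.
have single v w : phi v w = X [ffun u => (u == v)%:R] w.
  rewrite /lincomb (bigD1 v)//= big1 => [|u uv]; first by rewrite ffunE eqxx mul1r addr0.
  by rewrite ffunE (negbTE uv) mul0r.
have iX a : P.-integrable [set: T] (EFin \o X a).
  have [s [_ _ law]] := lincomb_lawE gphi phi0 a.
  exact: (integrable_gaussian (X := [the {RV P >-> R} of X a]) law).
have FZ A : F A -> measurable A /\ (\int[P]_(w in A) (X z w)%:E = 0)%E.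
  apply: (@integral_sigma_eq0 _ _ _ P V X _ _ (X z) S (iX z) _ _ _ _ I
    (fun v => [ffun u => (u == v)%:R]) (fun v => phi v)) => //.
  - by move=> *; exact: lincombL.
  - by move=> a b c hb hc; rewrite /S covC// covL ![cov _ z]covC// hb hc mulr0 addr0.
  - rewrite /S covC// -[X in cov X z](scale0r (0 : V)) -[X in cov X z]addr0 covL mul0r add0r.
    by rewrite /cov big1// => u _; rewrite big1// => v _; rewrite ffunE !mul0r.
  - by move=> b; exact: annihilates_orthogonal.
have sF : sigma_algebra [set: T] F by exact: smallest_sigma_algebra.
have FX : forall B : set R, measurable B -> F (X y @^-1` B).
  (* The same carrier with [F] as its sigma-algebra, so that closure of measurable functions under
     sums gives measurability for [F]. *)
  pose TF := g_sigma_algebraType (\bigcup_(v in I) preimage_set_system [set: T] (phi v) measurable).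
  have mphi v : I v -> measurable_fun [set: TF] (phi v : TF -> R).
    move=> Iv _ B mB; rewrite setTI; apply: sub_sigma_algebra; exists v => //.
    by exists B => //; rewrite setTI.
  have : measurable_fun [set: TF] (X y : TF -> R).
    apply: measurable_sum => v; have [Iv|nIv] := pselect (I v).
      by apply: measurable_funM => //; exact: mphi.
    rewrite (_ : (fun w => _) = cst 0); first exact: measurable_cst.
    by apply/funext => w; rewrite (yI _ nIv) mul0r.
  by move=> h B mB; have := h measurableT B mB; rewrite setTI.
have mT (A : set T) : F A -> measurable A by move=> /FZ[].
have mfT : measurable_fun [set: T] f.
  by move=> _ B mB; rewrite setTI; apply: mT; exact: mf.
have mXy : measurable_fun [set: T] (X y) by exact: measurable_lincomb.
have FI A : F A -> (\int[P]_(w in A) (f w - X y w)%:E = 0)%E.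
  move=> FA; have [mA Z0] := FZ _ FA.
  have iS g : P.-integrable [set: T] g -> P.-integrable A g by apply: integrableS.
  transitivity (\int[P]_(w in A) ((EFin \o f) \- (EFin \o X y)) w)%E => //.
  rewrite integralB ?iS//= hf//.
  have -> : (\int[P]_(w in A) (X x w)%:E = \int[P]_(w in A) ((X y w)%:E + (X z w)%:E))%E.
    apply: eq_integral => w _; rewrite xE -EFinD.
    by have := lincombL phi 1 y z w; rewrite scale1r mul1r => <-.
  have := @integralD _ _ _ P A mA (EFin \o X y) (EFin \o X z) (iS _ (iX y)) (iS _ (iX z)).
  move=> /= ->; rewrite Z0 adde0 subee//.
  exact: (integrable_fin_num mA (iS _ (iX y))).
have FD : forall B : set R, measurable B -> F ((fun w => f w - X y w) @^-1` B).
  pose TF := g_sigma_algebraType (\bigcup_(v in I) preimage_set_system [set: T] (phi v) measurable).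
  have h1 : measurable_fun [set: TF] (X y : TF -> R) by move=> _ B mB; rewrite setTI; exact: FX.
  have h2 : measurable_fun [set: TF] (f : TF -> R) by move=> _ B mB; rewrite setTI; exact: mf.
  by move=> B mB; have := measurable_funB h2 h1 measurableT mB; rewrite setTI.
(* The set where the difference has sign [s] belongs to [F], and the difference integrates to zero
   over it; a positive function with zero integral lives on a null set. *)
have pos (s : R) : s ^+ 2 = 1 -> P [set w | 0 < s * (f w - X y w)] = 0%E.
  move=> s1; set A := [set w | _].
  have FA : F A.
    have -> : A = (fun w => f w - X y w) @^-1` ( *%R s @^-1` `]0, +oo[).
      by apply/seteqP; split=> w; rewrite /A /= in_itv/= andbT.
    apply: FD; rewrite -[X in measurable X]setTI.
    by apply: (measurable_funM (f := cst s) (g := id)) => //; exact: measurable_cst.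
  have mA := mT _ FA.
  have mg : measurable_fun A (fun w => (s * (f w - X y w))%:E).
    apply: measurable_funTS; apply/measurable_EFinP; apply: measurable_funM => //.
    exact: measurable_funB.
  have I0 : (\int[P]_(w in A) (s * (f w - X y w))%:E = 0)%E.
    under eq_integral do rewrite EFinM.
    rewrite integralZl// ?FI ?mule0//; apply: integrableS (measurableT) mA _ _ => //.
    by have := integrableB measurableT iF (iX y).
  have [|B [mB B0 AB]] := (ae_eq_integral_abs P mA mg).1.
    rewrite -[RHS]I0; apply: eq_integral => w; rewrite inE /A /= => Aw.
    by rewrite ger0_norm// ltW.
  apply: (subset_measure0 _ _ _ B0) => // w Aw; apply: AB => /(_ Aw) /= [] e.
  by move: Aw; rewrite /A /= e ltxx.
have -> : [set w | f w != X y w] = [set w | 0 < 1 * (f w - X y w)] `|` [set w | 0 < -1 * (f w - X y w)].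
  apply/seteqP; split=> w /=; first by rewrite neq_lt => /orP[h|h]; [right|left]; lra.
  by case=> h; rewrite neq_lt; apply/orP; [right|left]; lra.
apply/eqP; rewrite eq_le measure_ge0 andbT.
have mpos (s : R) : measurable [set w | 0 < s * (f w - X y w)].
  rewrite (_ : [set w | _] = (fun w => s * (f w - X y w)) @^-1` `]0, +oo[).
    rewrite -[X in measurable X]setTI; apply: measurable_funM => //; exact: measurable_funB.
  by apply/seteqP; split=> w; rewrite /= in_itv/= andbT.
have h : (P [set w | 0 < 1 * (f w - X y w)]%R + P [set w | 0 < -1 * (f w - X y w)]%R <= 0)%E.
  by rewrite !pos ?adde0// ?sqrrN expr1n.
exact: le_trans (measureU2 _ (mpos 1) (mpos (-1))) h.
Qed.

End gff_conditional.

Lemma VNE N x : VN N x <-> inV N x.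
Proof. by rewrite /VN /inV /=; split=> [[-> ->]//|/andP]. Qed.

Lemma site_VN N (v : box N) : VN N (site v).
Proof. exact/VNE/site_inV. Qed.

Lemma VN_site N x : VN N x -> exists v : box N, site v = x.
Proof. by move=> /VNE /inV_site. Qed.

Lemma cond_expectation_measurable {R : realType} {d : measure_display} {T : measurableType d}
    (P : probability T R) N (phi : box N -> {RV P >-> R}) v (l : R) (X Y : T -> R) :
  is_cond_expectation P (outer_sigma_algebra (fun w => phi w : T -> R) v l) X Y ->
  measurable_fun [set: T] Y.
Proof.
case=> mY _ _ _ B mB; rewrite setTI; have := mY B mB.
apply: (@smallest_sub _ (sigma_algebra [set: T])); first exact: (@sigma_algebra_measurable _ T).
by move=> _ [u _ [C mC <-]]; exact: measurable_funP.
Qed.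

Lemma measurable_neq {R : realType} {d : measure_display} {T : measurableType d} (f g : T -> R) :
  measurable_fun [set: T] f -> measurable_fun [set: T] g -> measurable [set w | f w != g w].
Proof.
move=> mf mg; rewrite (_ : [set w | _] = (fun w => f w - g w) @^-1` (~` [set 0])).
  by rewrite -[X in measurable X]setTI; apply: measurable_funB => //; exact: measurableC.
by apply/seteqP; split=> w /=; rewrite -subr_eq0 => /eqP.
Qed.

(** * From the free field and its conditional expectations to the inner product form *)

Section gff_reduction.
Context {R : realType} {dW : measure_display} {OmW : measurableType dW}.
Variables (PW : Z2 -> probability OmW R) (W : nat -> OmW -> Z2).
Hypothesis hW : forall u, simple_random_walk (PW u) W u.
Context {d : measure_display} {T : measurableType d}.
Variables (P : probability T R) (N : nat) (phi : box N -> {RV P >-> R}).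
Hypothesis gff : is_gff (green PW W (VN N)) phi.

Let gphi : gaussian_vector phi. Proof. by case: gff. Qed.
Let phi0 v : 'E_P[phi v]%E = 0%E. Proof. by case: gff. Qed.
Let phi_green u v : green PW W (VN N) (site u) (site v) = (second_moment phi u v)%:E.
Proof. by case: gff => _ _ h; rewrite -h covariance_second_moment. Qed.

Local Notation V := (coefs (R := R) N).
Local Notation cov := (cov phi).

(** Set to 0 off the open box: at a boundary site the field has variance zero but its coefficient
    vector is not zero, whereas [gff_off] is an equality of vectors. *)
Definition dirac_at (x : Z2) : V := [ffun v => (inI N x && (site v == x))%:R].

Lemma site_inj : injective (@site N).
Proof. by move=> [u1 u2] [v1 v2] [] /ord_inj -> /ord_inj ->. Qed.

Let single (v : box N) : V := [ffun u => (u == v)%:R].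

Lemma dirac_at_site v : inI N (site v) -> dirac_at (site v) = single v.
Proof. by move=> vI; apply/ffunP => u; rewrite !ffunE vI (inj_eq site_inj). Qed.

Lemma dirac_at_out x : ~~ inI N x -> dirac_at x = 0.
Proof. by move=> /negbTE xI; apply/ffunP => u; rewrite !ffunE xI. Qed.

Lemma cov0l b : cov 0 b = 0.
Proof. by rewrite cov_sum big1// => u _; rewrite big1// => v _; rewrite ffunE !mul0r. Qed.

Lemma cov0r b : cov b 0 = 0.
Proof. by rewrite covC// cov0l. Qed.

Lemma cov_single a v : cov a (single v) = \sum_u a u * second_moment phi u v.
Proof.
apply: eq_bigr => u _; rewrite (bigD1 v)//= big1 => [|w wv].
  by rewrite ffunE eqxx mulr1 addr0.
by rewrite ffunE (negbTE wv) mulr0 mul0r.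
Qed.

Lemma cov_boundary a v : ~~ inI N (site v) -> cov a (single v) = 0.
Proof.
move=> vI; rewrite cov_single big1// => u _.
have -> : second_moment phi u v = 0; last by rewrite mulr0.
by apply: EFin_inj; rewrite -phi_green green_boundary//; exact: site_VN.
Qed.

Lemma cov_singles u v : cov (single u) (single v) = second_moment phi u v.
Proof.
rewrite cov_single (bigD1 u)//= big1 => [|w wu]; first by rewrite ffunE eqxx mul1r addr0.
by rewrite ffunE (negbTE wu) mul0r.
Qed.

Lemma green_cov z y : inI N z -> VN N y -> green PW W (VN N) z y = (cov (dirac_at y) (dirac_at z))%:E.
Proof.
move=> zI yV; have [u uy] := VN_site yV.
have [v vz] : exists v : box N, site v = z.
  by apply: VN_site; move: zI; case: (z) => a b; rewrite /inI /= => /andP[/andP[? ?] /andP[? ?]]; split=> /=; lia.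
subst y z; rewrite (dirac_at_site zI) phi_green -cov_singles covC//.
have [uI|uI] := boolP (inI N (site u)); first by rewrite dirac_at_site.
by rewrite dirac_at_out// cov0l covC// cov_boundary.
Qed.

Lemma gff_is_form : gff_form N cov dirac_at.
Proof.
split.
- exact: covL.
- by move=> x y; exact: covC.
- by move=> x; exact: cov_ge0.
- exact: dirac_at_out.
- move=> x z xI; have [zI|zI] := boolP (inI N z); last first.
    rewrite (dirac_at_out zI) /avg !cov0r !addr0 mul0r subrr.
    by rewrite (_ : x == z = false) ?mulr0//; apply/negbTE; apply: contraNneq zI => <-.
  have nbV y : VN N y -> green PW W (VN N) z y = (cov (dirac_at y) (dirac_at z))%:E.
    exact: green_cov.
  have := green_interior hW z xI.
  have [V0 V1 V2 V3 V4] : [/\ VN N x, VN N (xr x), VN N (xl x), VN N (xu x) & VN N (xd x)].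
    by move: xI; case: (x) => a b; rewrite /inI /VN /xr /xl /xu /xd /= => /andP[/andP[? ?] /andP[? ?]];
      split; split=> /=; lia.
  rewrite !nbV//.
  move=> h; have -> := EFin_inj (h : _%:E = (pi / 2 * (z == x)%:R + 4^-1 *
    (cov (dirac_at (xr x)) (dirac_at z) + cov (dirac_at (xl x)) (dirac_at z)
     + cov (dirac_at (xu x)) (dirac_at z) + cov (dirac_at (xd x)) (dirac_at z)))%:E).
  by rewrite /avg eq_sym; field.
Qed.

(** A point is inner exactly when it and its four neighbours belong to the neighborhood; in each
    coordinate this lowers the radius by one. *)
Lemma inner_nbhd (l : R) v x : VN N v -> 0 <= l <= 1 ->
  inner (nbhd N l v) x <-> bx N v (rad N l) x.
Proof.
move=> vV /andP[l0 l1].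
have innerE B : inner B x <-> B x /\ [/\ B (xr x), B (xl x), B (xu x) & B (xd x)].
  split=> [[Bx nb]|[Bx [b1 b2 b3 b4]]].
    have h y : lattice_adj x y -> B y.
      by move=> xy; apply: contrapT => nB; apply: nb; split=> //; exists y.
    split=> //; split; apply: h; rewrite lattice_adjE /xr /xl /xu /xd;
      case: (x) => a b /=; rewrite !xpair_eqE /=; lia.
  split=> // -[_ [y [nB]]]; rewrite lattice_adjE => /or4P[] /eqP h; apply: nB; move: b1 b2 b3 b4; rewrite h /xr /xl /xu /xd /= ?addrK ?subrK -surjective_pairing//.
have inIE : inI N x <-> VN N x /\ [/\ VN N (xr x), VN N (xl x), VN N (xu x) & VN N (xd x)].
  case: x {innerE} => a b; rewrite /inI /VN /xr /xl /xu /xd /=; split=> [h|[h [h1 h2 h3 h4]]].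
    by do ?split; lia.
  by lia.
rewrite innerE /nbhd /bx /rad.
have [_|l00] := eqVneq l 0.
  rewrite -inIE addrK; split=> [xI|/andP[]//]; rewrite xI /=.
  apply: inV_within; last by case: vV => h1 h2; rewrite /inV h1 h2.
  by exact: inI_inV.
have [_|l11] := eqVneq l 1.
  split=> [[-> [h _ _ _]]|/andP[_]].
    by move: h; rewrite /xr; case: (v) => a b /= []; lia.
  by rewrite /within sub0r => /andP[+ _]; rewrite leNgt (lt_le_trans _ (normr_ge0 _))// oppr_lt0.
set r := 2^-1 * _.
have E (a b : int) : (a%:~R \in `[b%:~R - r, b%:~R + r]) = (`|(a - b)%:~R| <= r).
  by rewrite in_itv/= ler_norml rmorphB/=; apply/idP/idP => /andP[h1 h2]; apply/andP; split; lra.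
have F (a : int) : (`|(a + 1)%:~R| <= r) /\ (`|(a - 1)%:~R| <= r) <-> `|a%:~R| <= r - 1.
  rewrite !rmorphD/= rmorphN/= !ler_norml; split=> [[/andP[h1 h2] /andP[h3 h4]]|/andP[h1 h2]].
    by apply/andP; split; lra.
  by do 2?split; apply/andP; split; lra.
have W0 (a : int) : `|a%:~R| <= r - 1 -> `|a%:~R| <= r by lra.
move: inIE; rewrite /within /zsub /xr /xl /xu /xd /=.
have c1 (a b : int) : a + 1 - b = a - b + 1 by ring.
have c2 (a b : int) : a - 1 - b = a - b - 1 by ring.
rewrite !E !c1 !c2 => inIE; split.
  move=> [[Vx [x1 x2]] [[V1 [y1 _]] [V2 [y2 _]] [V3 [_ y3]] [V4 [_ y4]]]].
  by apply/andP; split; [apply/inIE|apply/andP; split; apply/F].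
move=> /andP[/inIE[Vx [V1 V2 V3 V4]] /andP[/[dup] /W0 x1 /F[x1a x1b] /[dup] /W0 x2 /F[x2a x2b]]].
by split; [split|split; split].
Qed.

(** The field at [v] splits into a combination of the field outside the inner box and a vector [z]
    orthogonal to that field, which is what [cond_expectation_lincomb] requires. *)
Lemma cond_field_ae (phic : R -> box N -> T -> R) (l : R) (v : box N) : 0 <= l <= 1 ->
  is_cond_expectation P (outer_sigma_algebra (fun w => phi w : T -> R) v l) (phi v) (phic l v) ->
  P [set w | phic l v w != lincomb phi
     (dirac_at (site v) - prj gff_is_form (bx N (site v) (rad N l)) (site v)) w] = 0%E.
Proof.
move=> l01 hc; set A := bx _ _ _; set z := prj _ _ _.
have vV := site_VN v.
have inA u : ~ (~ inner (nbhd N l (site v)) (site u)) <-> A (site u).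
  by rewrite -(inner_nbhd (site u) vV l01); split=> [/contrapT|h /(_ h)].
have AI x : A x -> inI N x by exact: bxI.
have Xs : phi v = lincomb phi (single v) :> (T -> R).
  apply/funext => w; rewrite /lincomb (bigD1 v)//= big1 => [|u uv]; first by rewrite ffunE eqxx mul1r addr0.
  by rewrite ffunE (negbTE uv) mul0r.
rewrite Xs in hc.
have H : P [set w | phic l v w != lincomb phi (single v - z) w] = 0%E.
  apply: (cond_expectation_lincomb gphi phi0 hc (z := z)); first by rewrite subrK.
    move=> u /inA Au; have [vI|vI] := boolP (inI N (site v)).
      rewrite -dirac_at_site//.
      have [c [c0 ->]] := prj_span gff_is_form A (site v).
      rewrite (big_morph (fun a : V => a u) (id1 := 0) (op1 := +%R)).
      - rewrite big1// => x _; rewrite !ffunE; case: eqP => [xu|_]; last by rewrite andbF scaler0.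
        by rewrite -xu c0 ?scale0r.
      - by move=> a b; rewrite !ffunE.
      - by rewrite ffunE.
    have nAv : ~~ A (site v) by apply: contra vI; exact: AI.
    rewrite /z prj_out// subr0 ffunE; case: eqP => // uv.
    by rewrite -uv Au in nAv.
  move=> u nAu; have {}nAu : ~~ A (site u).
    by apply/negP => /inA; apply.
  have [uI|uI] := boolP (inI N (site u)); last exact: cov_boundary.
  by have := prj_orth gff_is_form (site v) nAu; rewrite dirac_at_site.
(* At a boundary site [single v] and [dirac_at] are different vectors; they differ by one of
   variance zero, so the variables agree up to a null set. *)
have [vI|vI] := boolP (inI N (site v)); first by rewrite dirac_at_site.
have z0 : z = 0 by rewrite /z prj_out//; apply: contra vI; exact: AI.
have S0 : P [set w | lincomb phi (single v) w != 0] = 0%E.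
  by apply: null_field_ae => //; exact: cov_boundary.
move: H; rewrite z0 !subr0 dirac_at_out// => H.
have X0 w : lincomb phi 0 w = 0 by rewrite /lincomb big1// => u _; rewrite ffunE mul0r.
have mf : measurable_fun [set: T] (phic l v).
  exact: (cond_expectation_measurable hc).
have mne a : measurable [set w | phic l v w != lincomb phi a w].
  by apply: measurable_neq => //; exact: measurable_lincomb.
have mS : measurable [set w | lincomb phi (single v) w != 0].
  by apply: (measurable_neq (g := fun=> 0)) => //; exact: measurable_lincomb.
apply: (@subset_measure0 _ _ _ P _ ([set w | phic l v w != lincomb phi (single v) w] `|`
    [set w | lincomb phi (single v) w != 0])).
- exact: mne.
- exact: measurableU.
- move=> w /=; rewrite X0 => h; have [e|] := eqVneq (phic l v w) (lincomb phi (single v) w).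
    by right; rewrite -e.
  by left.
- exact: null_set_setU.
Qed.

End gff_reduction.

(** * Increments of the field and exponential moments *)

Lemma near_infty (Q : nat -> Prop) : (exists N0 : nat, (0 < N0)%N /\ forall N, (N0 <= N)%N -> Q N) ->
  \forall N \near \oo, Q N.
Proof. by move=> [N0 [_ H]]; exists N0. Qed.

Lemma near_pos : \forall N \near \oo, (0 < N)%N.
Proof. by exists 1%N. Qed.

Lemma near_ln {R : realType} (eps B : R) : 0 < eps -> \forall N \near \oo, B <= eps * ln N%:R.
Proof. by move=> e0; apply: near_infty; exact: eps_ln_large. Qed.

Lemma near_exp_small {R : realType} (C a eta : R) : 0 < a -> 0 < eta ->
  \forall N \near \oo, C * expR (- (a * ln N%:R)) <= eta.
Proof.
move=> a0 e0; near=> N.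
have h : ln (Num.max C 1 / eta) <= a * ln N%:R by near: N; exact: near_ln.
have m0 : 0 < Num.max C 1 by rewrite lt_max ltr01 orbT.
apply: (@le_trans _ _ (Num.max C 1 * expR (- (a * ln N%:R)))).
  by rewrite ler_wpM2r ?expR_ge0// le_max lexx.
rewrite expRN ler_pdivrMr ?expR_gt0// mulrC -ler_pdivrMr//.
by rewrite -[leLHS]lnK ?posrE ?divr_gt0// ler_expR.
Unshelve. all: by end_near. Qed.

(** What the tail bounds retain of Gaussianity: linearity and the Laplace transform. *)
Record gaussian_field {R : realType} {d : measure_display} {T : measurableType d}
    (P : probability T R) (V : lmodType R) (ip : V -> V -> R) (X : V -> T -> R) : Prop :=
  GaussianField {
    gf_lin : forall a x y w, X (a *: x + y) w = a * X x w + X y w;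
    gf_meas : forall x, measurable_fun [set: T] (X x);
    gf_mgf : forall x, (\int[P]_w (expR (X x w))%:E = (expR (sq ip x / 2))%:E)%E }.

Section gaussian_field_bounds.
Context {R : realType} {d : measure_display} {T : measurableType d}.
Context {P : probability T R} {V : lmodType R} {ip : V -> V -> R} {X : V -> T -> R}.
Hypothesis F : gaussian_field P ip X.

Lemma gfD x y w : X (x + y) w = X x w + X y w.
Proof. by rewrite -[x]scale1r (gf_lin F) mul1r scale1r. Qed.
Lemma gf0 w : X 0 w = 0.
Proof. by have := gfD 0 0 w; rewrite addr0; lra. Qed.
Lemma gfZ a x w : X (a *: x) w = a * X x w.
Proof. by rewrite -[a *: x]addr0 (gf_lin F) gf0 addr0. Qed.
Lemma gfN x w : X (- x) w = - X x w.
Proof. by rewrite -scaleN1r gfZ mulN1r. Qed.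
Lemma gfB x y w : X (x - y) w = X x w - X y w.
Proof. by rewrite gfD gfN. Qed.

Lemma gf_integrable x : P.-integrable [set: T] (fun w => (expR (X x w))%:E).
Proof.
apply/integrableP; split.
  by apply/measurable_EFinP; apply: measurableT_comp => //; exact: (gf_meas F).
under eq_integral do rewrite abse_EFin ger0_norm ?expR_ge0//.
by rewrite (gf_mgf F) ltry.
Qed.

Lemma integral_exp_sum (I : Type) (s : seq I) (c : I -> R) (a : I -> V) :
  P.-integrable [set: T] (fun w => (\sum_(i <- s) c i * expR (X (a i) w))%:E) /\
  (\int[P]_w (\sum_(i <- s) c i * expR (X (a i) w))%:E =
    (\sum_(i <- s) c i * expR (sq ip (a i) / 2))%:E)%E.
Proof.
have h i : P.-integrable [set: T] (fun w => (c i * expR (X (a i) w))%:E).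
  by under eq_fun do rewrite EFinM; apply: integrableZl => //; exact: gf_integrable.
have e : (fun w => (\sum_(i <- s) c i * expR (X (a i) w))%:E) =
    (fun w => \sum_(i <- s) (c i * expR (X (a i) w))%:E)%E.
  by apply/funext => w; rewrite sumEFin.
rewrite e; split; first exact: integrable_sum.
rewrite integral_sum// -sumEFin; apply: eq_bigr => i _.
under eq_integral do rewrite EFinM.
by rewrite integralZl ?(gf_mgf F)//; exact: gf_integrable.
Qed.

Lemma prob_le_exp_sum (I : Type) (s : seq I) (c : I -> R) (a : I -> V) (E : set T) : measurable E ->
  (forall w, (w \in E)%:R <= \sum_(i <- s) c i * expR (X (a i) w)) ->
  (P E <= (\sum_(i <- s) c i * expR (sq ip (a i) / 2))%:E)%E.
Proof.
move=> mE H; have [h1 <-] := integral_exp_sum s c a.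
have -> : P E = (\int[P]_w (\1_E w)%:E)%E by rewrite integral_indic// setIT.
apply: le_integral => //.
  by apply: integrable_indic => //; rewrite -ge0_fin_numE// fin_num_measure.
by move=> w _; rewrite lee_fin indicE.
Qed.

Lemma prob_ge_exp_sum (I : Type) (s : seq I) (c : I -> R) (a : I -> V) (E : set T) : measurable E ->
  (forall w, \sum_(i <- s) c i * expR (X (a i) w) <= (w \in E)%:R) ->
  ((\sum_(i <- s) c i * expR (sq ip (a i) / 2))%:E <= P E)%E.
Proof.
move=> mE H; have [h1 <-] := integral_exp_sum s c a.
have -> : P E = (\int[P]_w (\1_E w)%:E)%E by rewrite integral_indic// setIT.
apply: le_integral => //.
  by apply: integrable_indic => //; rewrite -ge0_fin_numE// fin_num_measure.
by move=> w _; rewrite lee_fin indicE.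
Qed.

(** Union of Chernoff bounds. Exponent and threshold depend on the index, so that net points and
    fluctuations around them fit into one application. *)
Lemma gf_union_bound N phi (G : gff_form N ip phi) (I : finType) (a : I -> V) (th t : I -> R) (E : set T) : measurable E ->
  (forall i, 0 <= th i) -> (forall w, E w -> exists i, t i <= X (a i) w) ->
  (P E <= (\sum_i expR (th i ^+ 2 * sq ip (a i) / 2 - th i * t i))%:E)%E.
Proof.
move=> mE th0 H.
have := @prob_le_exp_sum I (index_enum I) (fun i => expR (- (th i * t i))) (fun i => th i *: a i) E mE.
under eq_bigr do rewrite (sqZ G) -expRD addrC.
apply => w; have [wE|wE] := boolP (w \in E); last first.
  by apply: sumr_ge0 => i _; rewrite mulr_ge0 ?expR_ge0.
move: wE; rewrite inE => /H[i ti]; rewrite (bigD1 i)//=.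
apply: ler_wpDr; first by apply: sumr_ge0 => j _; rewrite mulr_ge0 ?expR_ge0.
by rewrite -expRD -expR0 ler_expR gfZ addrC subr_ge0 ler_wpM2l.
Qed.

End gaussian_field_bounds.

(** * Scale increments and their variances *)

Section increments.
Context {R : realType}.
Variable lam : nat -> R.

(** In the Gaussian space this is [phi_x - phi_x(l)], so that [incr] is
    [phi_x(lam i) - phi_x(lam i.-1)] and [fluct] is the difference of the conditional expectations
    at two points. *)
Definition coarse {V : lmodType R} {N} {ip : V -> V -> R} {phi} (G : gff_form N ip phi) (l : R) (x : Z2) : V :=
  prj G (bx N x (rad N l)) x.

Definition incr {V : lmodType R} {N} {ip : V -> V -> R} {phi} (G : gff_form N ip phi) (i : nat) (x : Z2) : V :=
  coarse G (lam i.-1) x - coarse G (lam i) x.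

Definition fluct {V : lmodType R} {N} {ip : V -> V -> R} {phi} (G : gff_form N ip phi) (i : nat) (x y : Z2) : V :=
  (phi x - coarse G (lam i) x) - (phi y - coarse G (lam i) y).

Definition wsum {V : lmodType R} {N} {ip : V -> V -> R} {phi} (G : gff_form N ip phi) (c : nat -> R) (k : nat) (x : Z2) : V :=
  \sum_(1 <= i < k.+1) c i *: incr G i x.

Variable M : nat.
Hypothesis lam0 : 0 <= lam 0%N.
Hypothesis lamS : forall i, (i < M)%N -> lam i < lam i.+1.
Hypothesis lamM : lam M = 1.

Lemma lam_le i j : (i <= j)%N -> (j <= M)%N -> lam i <= lam j.
Proof.
move=> ij; elim: j ij => [|j IH]; first by rewrite leqn0 => /eqP ->.
rewrite leq_eqVlt => /orP[/eqP ->//|ij jM].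
by apply: le_trans (ltW (lamS jM)); apply: IH => //; exact: ltnW.
Qed.

Lemma lam_ge0 i : (i <= M)%N -> 0 <= lam i.
Proof. by move=> iM; apply: (le_trans lam0); exact: lam_le. Qed.

Lemma lam_le1 i : (i <= M)%N -> lam i <= 1.
Proof. by move=> iM; rewrite -lamM lam_le. Qed.

Lemma lam_mid i : (0 < i)%N -> (i < M)%N -> 0 < lam i < 1.
Proof.
move=> i0 iM; have M0 : (0 < M)%N by apply: leq_trans iM.
apply/andP; split.
  by apply: le_lt_trans lam0 _; apply: lt_le_trans (lamS M0) (lam_le _ _) => //; exact: ltnW.
by rewrite -lamM; apply: lt_le_trans (lamS iM) (lam_le _ _).
Qed.

Section form.
Context {V : lmodType R} {N : nat} {ip : V -> V -> R} {phi : Z2 -> V}.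
Variable G : gff_form N ip phi.

Lemma wsumS c k x : wsum G c k.+1 x = wsum G c k x + c k.+1 *: incr G k.+1 x.
Proof. by rewrite /wsum big_nat_recr. Qed.

Lemma wsum0 c x : wsum G c 0 x = 0.
Proof. by rewrite /wsum big_nil. Qed.

Lemma coarse_ip x i j : (0 < N)%N -> (i <= j)%N -> (j <= M)%N ->
  ip (coarse G (lam i) x) (coarse G (lam j) x) = sq ip (coarse G (lam j) x).
Proof.
move=> N0 ij jM; rewrite /coarse prj_nested// => z; apply: bx_mono.
by apply: rad_mono => //; [apply: lam_ge0; apply: leq_trans jM|exact: lam_le|exact: lam_le1].
Qed.

Lemma incr_coarse_orth x i j : (0 < N)%N -> (0 < i)%N -> (i <= j)%N -> (j <= M)%N ->
  ip (incr G i x) (coarse G (lam j) x) = 0.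
Proof.
move=> N0 i0 ij jM; rewrite /incr (ipBl G) !coarse_ip ?subrr//.
by apply: leq_trans ij; exact: leq_pred.
Qed.

(** Increments at one point are orthogonal like martingale differences, by the tower property of
    nested boxes. *)
Lemma wsum_incr_orth c k j x : (0 < N)%N -> (k < j)%N -> (j <= M)%N -> ip (wsum G c k x) (incr G j x) = 0.
Proof.
move=> N0 kj jM; rewrite /wsum (ip_suml G) big_nat big1// => i /andP[i0 ik].
have ij : (i < j)%N by apply: leq_ltn_trans kj.
rewrite (ipZl G) /incr (ipBr G) !incr_coarse_orth ?subrr ?mulr0//=.
- by apply: ltnW.
- by rewrite -ltnS prednK//; apply: leq_trans ij.
- by apply: leq_trans jM; exact: leq_pred.
Qed.

Lemma sq_wsumS c k x : (0 < N)%N -> (k < M)%N ->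
  sq ip (wsum G c k.+1 x) = sq ip (wsum G c k x) + c k.+1 ^+ 2 * sq ip (incr G k.+1 x).
Proof.
by move=> N0 kM; rewrite wsumS (sqD G) (ipZr G) wsum_incr_orth// (sqZ G) mulr0 mulr0 addr0.
Qed.

End form.

Lemma wsum_variance c k eps : (k <= M)%N -> 0 < eps -> \forall N \near \oo,
  forall (V : lmodType R) ip (phi : Z2 -> V) (G : gff_form N ip phi) x, inV N x ->
  sq ip (wsum G c k x) <= (\sum_(1 <= i < k.+1) c i ^+ 2 * (lam i - lam i.-1) + eps) * ln N%:R.
Proof.
elim: k eps => [|k IH] eps kM e0.
  near=> N => V ip phi G x xV; rewrite wsum0 /sq (ip0l G) big_nil add0r.
  by rewrite mulr_ge0 ?(ltW e0)// ln_ge0// ler1n; near: N; exact: near_pos.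
have e2 : 0 < eps / 2 by rewrite divr_gt0.
have e3 : 0 < eps / 2 / (c k.+1 ^+ 2 + 1) by rewrite divr_gt0// ltr_wpDl ?sqr_ge0.
near=> N => V ip phi G x xV.
have N0 : (0 < N)%N by near: N; exact: near_pos.
have L0 : 0 <= ln N%:R :> R by rewrite ln_ge0// ler1n.
rewrite sq_wsumS// big_nat_recr//=.
have h1 : sq ip (wsum G c k x) <= (\sum_(1 <= i < k.+1) c i ^+ 2 * (lam i - lam i.-1) + eps / 2) * ln N%:R.
  by move: V ip phi G x xV; near: N; apply: IH => //; exact: ltnW.
have h2 : sq ip (incr G k.+1 x) <= (lam k.+1 - lam k + eps / 2 / (c k.+1 ^+ 2 + 1)) * ln N%:R.
  move: V ip phi G x xV {h1}; near: N; apply: near_infty.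
  by apply: increment_variance => //; [apply: lam_ge0; exact: ltnW|exact: lamS|exact: lam_le1].
have h3 : c k.+1 ^+ 2 * sq ip (incr G k.+1 x) <=
    (c k.+1 ^+ 2 * (lam k.+1 - lam k) + eps / 2) * ln N%:R.
  apply: le_trans (ler_wpM2l (sqr_ge0 _) h2) _.
  rewrite mulrA ler_wpM2r// mulrDr lerD2l.
  have d0 : 0 < c k.+1 ^+ 2 + 1 by rewrite ltr_wpDl ?sqr_ge0.
  have -> : c k.+1 ^+ 2 * (eps / 2 / (c k.+1 ^+ 2 + 1)) = c k.+1 ^+ 2 / (c k.+1 ^+ 2 + 1) * (eps / 2).
    by field; rewrite gt_eqF.
  by rewrite ler_piMl ?(ltW e2)// ler_pdivrMr// mul1r lerDl.
by apply: le_trans (lerD h1 h3) _; rewrite -mulrDl ler_wpM2r//; lra.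
Unshelve. all: by end_near. Qed.

(** The increment at level [i] differs between the two points by [fluct] at levels [i] and [i.-1].
    Earlier scales have larger radii, so the hypothesis on the distance suffices for [coarse_field]
    at each of them; at level 0 the fluctuation is zero. *)
Lemma wsum_diff_variance c k kap : lam 0%N = 0 -> (0 < k)%N -> (k < M)%N -> 0 < kap -> \forall N \near \oo,
  forall (V : lmodType R) ip (phi : Z2 -> V) (G : gff_form N ip phi) x y, inV N x -> inV N y ->
  within (rad N (lam k) / 4) (zsub x y) ->
  sq ip (wsum G c k x - wsum G c k y) <= kap * ln N%:R.
Proof.
move=> lam00 k0 kM.
have hD i : (i <= k)%N -> forall e, 0 < e -> \forall N \near \oo,
  forall (V : lmodType R) ip (phi : Z2 -> V) (G : gff_form N ip phi) x y, inV N x -> inV N y ->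
  within (rad N (lam k) / 4) (zsub x y) -> sq ip (fluct G i x y) <= e * ln N%:R.
  move=> ik e e0; case: i ik => [|i] ik.
    near=> N => V ip phi G x y xV yV _.
    have N0 : (0 < N)%N by near: N; exact: near_pos.
    have z0 z : inV N z -> sq ip (phi z - coarse G (lam 0) z) = 0.
      move=> zV; rewrite (sq_phi_sub G) /coarse lam00.
      have -> : bx N z (rad N (0 : R)) = inI N.
        apply/funext => u; rewrite /bx /rad eqxx addrK; apply/andP/idP => [[]//|uI]; split=> //.
        by apply: inV_within => //; exact: inI_inV.
      by rewrite subrr /sq (ip0l G).
    apply: (le_trans (sqD_le G _ _)); rewrite (sqN G) !z0// addr0 mulr0 mulr_ge0 ?(ltW e0)//.
    by rewrite ln_ge0// ler1n.
  have iM : (i.+1 < M)%N by apply: leq_ltn_trans kM.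
  near=> N => V ip phi G x y xV yV xy.
  have N0 : (0 < N)%N by near: N; exact: near_pos.
  have xy' : within (rad N (lam i.+1) / 4) (zsub x y).
    apply: within_le xy; rewrite ler_pM2r//; apply: rad_mono => //.
    + by apply: lam_ge0; exact: ltnW.
    + by apply: lam_le => //; exact: ltnW.
    + by apply: lam_le1; exact: ltnW.
  move: V ip phi G x y xV yV xy' {xy}; near: N; apply: near_infty.
  exact: (@coarse_field R (lam i.+1) e (lam_mid (ltn0Sn i) iM) e0).
suff : forall j, (j <= k)%N -> forall kap, 0 < kap -> \forall N \near \oo,
  forall (V : lmodType R) ip (phi : Z2 -> V) (G : gff_form N ip phi) x y, inV N x -> inV N y ->
  within (rad N (lam k) / 4) (zsub x y) ->
  sq ip (wsum G c j x - wsum G c j y) <= kap * ln N%:R.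
  by apply.
elim=> [|j IH] jk {}kap kap0.
  near=> N => V ip phi G x y xV yV _; rewrite !wsum0 subrr /sq (ip0l G).
  by rewrite mulr_ge0 ?(ltW kap0)// ln_ge0// ler1n; near: N; exact: near_pos.
have c0 : 0 < c j.+1 ^+ 2 + 1 by rewrite ltr_wpDl ?sqr_ge0.
have [e [e0 eE]] : exists e, 0 < e /\ e = kap / (16 * (c j.+1 ^+ 2 + 1)).
  by eexists; split; last reflexivity; rewrite divr_gt0// mulr_gt0.
have k4 : 0 < kap / 4 by rewrite divr_gt0.
near=> N => V ip phi G x y xV yV xy.
have N0 : (0 < N)%N by near: N; exact: near_pos.
have L0 : 0 <= ln N%:R :> R by rewrite ln_ge0// ler1n.
have h1 : sq ip (wsum G c j x - wsum G c j y) <= kap / 4 * ln N%:R.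
  by move: V ip phi G x y xV yV xy; near: N; apply: IH => //; exact: ltnW.
have h2 : sq ip (fluct G j x y) <= e * ln N%:R.
  by move: V ip phi G x y xV yV xy {h1}; near: N; exact: (hD _ (ltnW jk) _ e0).
have h3 : sq ip (fluct G j.+1 x y) <= e * ln N%:R.
  by move: V ip phi G x y xV yV xy {h1 h2}; near: N; have := hD j.+1 jk e e0; exact.
have -> : wsum G c j.+1 x - wsum G c j.+1 y = (wsum G c j x - wsum G c j y) +
    c j.+1 *: (fluct G j.+1 x y - fluct G j x y).
  rewrite !wsumS opprD addrACA; congr (_ + _); rewrite -scalerBr; congr (_ *: _).
  rewrite /incr /fluct /=; set a := coarse G _ x; set b := coarse G _ x.
  set a' := coarse G _ y; set b' := coarse G _ y.
  have E (p q r : V) : (p - q) - (p - r) = r - q.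
    by rewrite opprB addrC addrA subrK.
  have E2 (p q r s : V) : (p - q) - (r - s) = (p - r) - (q - s).
    by rewrite !opprB addrACA [RHS]addrACA [- q - r]addrC.
  by rewrite (E2 (phi x - b)) !E.
apply: (le_trans (sqD_le G _ _)); rewrite (sqZ G).
have h4 : sq ip (fluct G j.+1 x y - fluct G j x y) <= 4 * e * ln N%:R.
  apply: (le_trans (sqD_le G _ _)); rewrite (sqN G).
  by move: h2 h3; set u := sq ip _; set v := sq ip _; lra.
have h5 : c j.+1 ^+ 2 * (4 * e * ln N%:R) <= kap / 4 * ln N%:R.
  have -> : c j.+1 ^+ 2 * (4 * e * ln N%:R) = c j.+1 ^+ 2 / (c j.+1 ^+ 2 + 1) * (kap / 4 * ln N%:R).
    by rewrite eE; field; rewrite gt_eqF.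
  rewrite -[leRHS]mul1r.
  have : 0 <= kap / 4 * ln N%:R by apply: mulr_ge0 => //; rewrite divr_ge0 ?(ltW kap0).
  move=> /ler_wpM2r; apply.
  by rewrite ler_pdivrMr// mul1r lerDl.
have h6 := ler_wpM2l (sqr_ge0 (c j.+1)) h4.
move: h1 h5 h6; set u := sq ip _; set v := c _ ^+ 2 * sq ip _; lra.
Unshelve. all: by end_near. Qed.

End increments.

(** * Upper bound *)

Lemma card_box N : #|{: box N}| = (N.+1 ^ 2)%N.
Proof. by rewrite card_prod !card_ord mulnn. Qed.

Lemma box_count {R : realType} N (a : R) : (0 < N)%N ->
  (N.+1 ^ 2)%:R * expR (- ((2 + a) * ln N%:R)) <= 4 * expR (- (a * ln N%:R)).
Proof.
move=> N0; have N1 : 0 < N%:R :> R by rewrite ltr0n.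
rewrite mulrDl opprD expRD mulrA ler_wpM2r ?expR_ge0//.
have -> : expR (- (2 * ln N%:R)) = (N%:R ^+ 2)^-1 :> R.
  by rewrite expRN expRM_natl lnK.
rewrite ler_pdivrMr ?exprn_gt0// -natrX -natrM ler_nat.
by rewrite (_ : 4 = 2 ^ 2)%N// -expnMn leq_sqr; lia.
Qed.

Section upper_bound.
Context {R : realType}.
Variables (lam : nat -> R) (M : nat).
Hypothesis lam0 : lam 0%N = 0.
Hypothesis lamS : forall i, (i < M)%N -> lam i < lam i.+1.
Hypothesis lamM : lam M = 1.

Let lam0ge : 0 <= lam 0%N. Proof. by rewrite lam0. Qed.

Lemma upper_top (c : nat -> R) del eta : \sum_(1 <= i < M.+1) c i ^+ 2 * (lam i - lam i.-1) <= 1 ->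
  0 < del -> 0 < eta -> \forall N \near \oo,
  forall (V : lmodType R) ip (phi : Z2 -> V) (G : gff_form N ip phi)
    d (T : measurableType d) (P : probability T R) X, gaussian_field P ip X ->
  forall E : set T, measurable E ->
  (forall w, E w -> exists2 x, inV N x & 2 * (1 + del) * ln N%:R <= X (wsum lam G c M x) w) ->
  (P E <= eta%:E)%E.
Proof.
move=> cM d0 e0; near=> N => V ip phi G d T P X F E mE H.
have N0 : (0 < N)%N by near: N; exact: near_pos.
have L0 : 0 <= ln N%:R :> R by rewrite ln_ge0// ler1n.
pose t := 2 * (1 + del) * ln N%:R.
have H' w : E w -> exists v : box N, t <= X (wsum lam G c M (site v)) w.
  by move=> /H[x /inV_site[v <-] h]; exists v.
(* The optimal Chernoff exponent: threshold [2 * (1 + del) * ln N] over variance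
   [(1 + del) * ln N]. *)
apply: (le_trans (gf_union_bound F G (th := fun=> 2) mE _ H')) => //.
have var (v : box N) : sq ip (wsum lam G c M (site v)) <= (1 + del) * ln N%:R.
  have : sq ip (wsum lam G c M (site v)) <=
      (\sum_(1 <= i < M.+1) c i ^+ 2 * (lam i - lam i.-1) + del) * ln N%:R.
    have := site_inV v; move: (site v) => x; move: V ip phi G d T P X F E mE H t H' v x.
    near: N.
    have := @wsum_variance R lam M lam0ge lamS lamM c M del (leqnn _) d0.
    by apply: filterS => N h V ip phi G _ _ _ _ _ _ _ _ _ _ _ x xV; exact: h.
  by move=> /le_trans; apply; rewrite ler_wpM2r// lerD2r.
rewrite lee_fin.
apply: (@le_trans _ _ (\sum_(v : box N) expR (- ((2 + 2 * del) * ln N%:R)))).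
  apply: ler_sum => v _; rewrite ler_expR /t; have := var v; lra.
rewrite sumr_const card_box -[leLHS]mulr_natl; apply: (le_trans (box_count _ N0)).
by near: N; apply: near_exp_small => //; rewrite mulr_gt0.
Unshelve. all: by end_near. Qed.

(** Rounding a quarter of the radius down at most halves it, so [N / m] is at most [8 * N / rad],
    that is [16 * N ^ l]; the endpoint makes it 17. *)
Lemma net_spacing (l : R) : 0 < l < 1 -> \forall N \near \oo, exists m : nat,
  [/\ (0 < m)%N, m%:R <= rad N l / 4 & ((N %/ m).+1)%:R <= 17 * expR (l * ln N%:R)].
Proof.
move=> l01; near=> N.
have N0 : (0 < N)%N by near: N; exact: near_pos.
have N1 : 0 < N%:R :> R by rewrite ltr0n.
have r4 : 4 <= rad N l by near: N; apply: near_infty; exact: rad_large.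
have r0 : 0 <= rad N l / 4 by lra.
have /andP[t1 t2] := truncn_itv r0.
exists (Num.truncn (rad N l / 4)); set m := Num.truncn _ in t1 t2 *.
have m0 : (0 < m)%N.
  have : 0 < m%:R :> R by rewrite -[m.+1%:R]natr1 in t2; lra.
  by rewrite ltr0n.
have m8 : rad N l / 8 <= m%:R.
  have : 1 <= m%:R :> R by rewrite ler1n.
  by rewrite -[m.+1%:R]natr1 in t2; lra.
split=> //; rewrite -[_.+1%:R]natr1.
have -> : expR (l * ln N%:R) = N%:R `^ l by rewrite /powR gt_eqF.
have p1 : 1 <= N%:R `^ l :> R by rewrite -[leLHS](powRr0 N%:R) ler_powR ?ler1n// ltW//; have /andP[] := l01.
suff : (N %/ m)%:R <= 16 * N%:R `^ l :> R by lra.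
apply: (@le_trans _ _ (N%:R / m%:R)).
  by rewrite ler_pdivlMr ?ltr0n// -natrM ler_nat leq_divM.
rewrite ler_pdivrMr ?ltr0n//; apply: (@le_trans _ _ (16 * N%:R `^ l * (rad N l / 8))); last first.
  by rewrite ler_wpM2l// mulr_ge0// (le_trans ler01).
have -> : rad N l = 2^-1 * N%:R `^ (1 - l).
  by have /andP[l0 l1] := l01; rewrite /rad gt_eqF// lt_eqF.
have -> : 16 * N%:R `^ l * (2^-1 * N%:R `^ (1 - l) / 8) = N%:R `^ l * N%:R `^ (1 - l) :> R by field.
rewrite -powRD; last by rewrite (gt_eqF N1) implybT.
by have -> : l + (1 - l) = 1 by [ring]; rewrite powRr1// ltW.
Unshelve. all: by end_near. Qed.

Definition netpt N m (v : box (N %/ m)) : Z2 := ((v.1 * m)%N%:Z, (v.2 * m)%N%:Z).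

Lemma netpt_inV N m (v : box (N %/ m)) : inV N (netpt v).
Proof.
have h (i : 'I_(N %/ m).+1) : (i * m <= N)%N.
  by apply: leq_trans (leq_divM N m); rewrite leq_mul2r -ltnS ltn_ord orbT.
by rewrite /inV /netpt /= !lez_nat !h.
Qed.

Lemma netpt_near N m x : (0 < m)%N -> inV N x -> exists v : box (N %/ m), within (m%:R : R) (zsub x (netpt v)).
Proof.
move=> m0 /inV_site[[a b] <-].
have h (i : 'I_N.+1) : (i %/ m < (N %/ m).+1)%N by rewrite ltnS leq_div2r// -ltnS.
exists (Ordinal (h a), Ordinal (h b)); rewrite /within /zsub /netpt /site /=.
have q (i : nat) : `|(i%:Z - (i %/ m * m)%N%:Z)%:~R| <= m%:R :> R.
  rewrite -intr_norm -[m%:R]/(m%:Z%:~R) ler_int.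
  have := divn_eq i m; have := ltn_pmod i m0; lia.
by rewrite !q.
Qed.

(** A union over all sites would cost [N ^ 2]. Instead the field is controlled on a net with about
    [N ^ (2 * lam k)] points, and at the other sites through the difference with a nearby net
    point. *)
Lemma upper_mid (c : nat -> R) k del eta : (0 < k)%N -> (k < M)%N ->
  \sum_(1 <= i < k.+1) c i ^+ 2 * (lam i - lam i.-1) <= lam k ->
  0 < del -> 0 < eta -> \forall N \near \oo,
  forall (V : lmodType R) ip (phi : Z2 -> V) (G : gff_form N ip phi)
    d (T : measurableType d) (P : probability T R) X, gaussian_field P ip X ->
  forall E : set T, measurable E ->
  (forall w, E w -> exists2 x, inV N x & 2 * (lam k + del) * ln N%:R <= X (wsum lam G c k x) w) ->
  (P E <= eta%:E)%E.
Proof.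
move=> k0 kM ck d0 e0; have l01 := lam_mid lam0ge lamS lamM k0 kM.
have d2 : 0 < del / 2 by rewrite divr_gt0.
have kap0 : 0 < del ^+ 2 / 8 by rewrite divr_gt0// exprn_gt0.
have e2 : 0 < eta / 2 by rewrite divr_gt0.
near=> N => V ip phi G.
have var1 : forall x, inV N x -> sq ip (wsum lam G c k x) <=
    (\sum_(1 <= i < k.+1) c i ^+ 2 * (lam i - lam i.-1) + del / 2) * ln N%:R.
  move: V ip phi G; near: N.
  exact: (@wsum_variance R lam M lam0ge lamS lamM c k (del / 2) (ltnW kM) d2).
have var2 : forall x y, inV N x -> inV N y -> within (rad N (lam k) / 4) (zsub x y) ->
    sq ip (wsum lam G c k x - wsum lam G c k y) <= del ^+ 2 / 8 * ln N%:R.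
  move: V ip phi G {var1}; near: N.
  exact: (@wsum_diff_variance R lam M lam0ge lamS lamM c k (del ^+ 2 / 8) lam0 k0 kM kap0).
move=> d T P X F E mE H.
have N0 : (0 < N)%N by near: N; exact: near_pos.
have L0 : 0 <= ln N%:R :> R by rewrite ln_ge0// ler1n.
have [m [m0 mr mc]] : exists m : nat, [/\ (0 < m)%N, m%:R <= rad N (lam k) / 4
   & ((N %/ m).+1)%:R <= 17 * expR (lam k * ln N%:R)] by near: N; exact: net_spacing.
pose near_v (v : box N) := sval (cid (netpt_near m0 (site_inV v))).
have nv v : within m%:R (zsub (site v) (netpt (near_v v))) := svalP (cid (netpt_near m0 (site_inV v))).
pose Y := wsum lam G c k.
pose a (i : box (N %/ m) + box N) : V := match i with
  | inl u => Y (netpt u) | inr v => Y (site v) - Y (netpt (near_v v)) end.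
(* For a difference, of variance at most [del ^+ 2 / 8 * ln N], the exponent [4 / del] at threshold
   [del * ln N] yields [N ^ (- 3)], enough against [N ^ 2] sites. *)
pose th (i : box (N %/ m) + box N) : R := match i with inl _ => 2 | inr _ => 4 / del end.
pose t (i : box (N %/ m) + box N) : R := match i with
  inl _ => 2 * (lam k + del / 2) * ln N%:R | inr _ => del * ln N%:R end.
have th0 i : 0 <= th i by case: i => _ //=; rewrite divr_ge0 ?(ltW d0).
have H' w : E w -> exists i, t i <= X (a i) w.
  move=> /H[x /inV_site[v <-] h].
  have [h1|h1] := leP (t (inr v)) (X (a (inr v)) w); first by exists (inr v).
  exists (inl (near_v v)); move: h1 h; rewrite /a /t (gfB F) /Y; lra.
apply: (le_trans (gf_union_bound F G mE th0 H')).
rewrite lee_fin big_sumType /=.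
have h1 : \sum_(u : box (N %/ m)) expR (2 ^+ 2 * sq ip (Y (netpt u)) / 2 -
    2 * (2 * (lam k + del / 2) * ln N%:R)) <= eta / 2.
  have var (u : box (N %/ m)) : sq ip (Y (netpt u)) <= (lam k + del / 2) * ln N%:R.
    have := var1 _ (netpt_inV u).
    by move=> /le_trans; apply; rewrite ler_wpM2r// lerD2r.
  apply: (@le_trans _ _ (\sum_(u : box (N %/ m)) expR (- ((2 * lam k + del) * ln N%:R)))).
    by apply: ler_sum => u _; rewrite ler_expR; have := var u; lra.
  rewrite sumr_const card_box -[leLHS]mulr_natl natrX.
  apply: (@le_trans _ _ ((17 * expR (lam k * ln N%:R)) ^+ 2 * expR (- ((2 * lam k + del) * ln N%:R)))).
    by rewrite ler_wpM2r ?expR_ge0// lerXn2r ?nnegrE ?mulr_ge0 ?expR_ge0.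
  rewrite exprMn -expRM_natl -mulrA -expRD.
  have -> : 2%:R * (lam k * ln N%:R) - (2 * lam k + del) * ln N%:R = - (del * ln N%:R) by ring.
  by near: N; exact: near_exp_small.
have h2 : \sum_(v : box N) expR ((4 / del) ^+ 2 * sq ip (Y (site v) - Y (netpt (near_v v))) / 2 -
    4 / del * (del * ln N%:R)) <= eta / 2.
  have var v : sq ip (Y (site v) - Y (netpt (near_v v))) <= del ^+ 2 / 8 * ln N%:R.
    by apply: var2; [exact: site_inV|exact: netpt_inV|exact: within_le mr (nv v)].
  apply: (@le_trans _ _ (\sum_(v : box N) expR (- ((2 + 1) * ln N%:R)))).
    apply: ler_sum => v _; rewrite ler_expR.
    have -> : 4 / del * (del * ln N%:R) = 4 * ln N%:R by field; rewrite gt_eqF.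
    have h : (4 / del) ^+ 2 * sq ip (Y (site v) - Y (netpt (near_v v))) <= (4 / del) ^+ 2 * (del ^+ 2 / 8 * ln N%:R).
      by rewrite ler_wpM2l ?sqr_ge0.
    have e : (4 / del) ^+ 2 * (del ^+ 2 / 8 * ln N%:R) = 2 * ln N%:R by field; rewrite gt_eqF.
    rewrite e in h; lra.
  rewrite sumr_const card_box -[leLHS]mulr_natl; apply: (le_trans (box_count _ N0)).
  by near: N; exact: near_exp_small.
by apply: le_trans (lerD h1 h2) _; lra.
Unshelve. all: by end_near. Qed.

(** Summation by parts: lowering [b] raises its product with the nonpositive defect [y k - z k]. The
    final defect is kept because it will be strict. *)
Lemma abel_upper (b y z : nat -> R) n : y 0%N = z 0%N ->
  (forall k, (0 < k <= n)%N -> y k <= z k) -> (forall k, (0 < k < n)%N -> b k.+1 <= b k) ->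
  forall k, (k <= n)%N -> \sum_(1 <= i < k.+1) b i * (y i - y i.-1) <=
    \sum_(1 <= i < k.+1) b i * (z i - z i.-1) + b k * (y k - z k).
Proof.
move=> y0 yz bn; elim=> [|k IH] kn; first by rewrite !big_nil y0 subrr mulr0 addr0.
rewrite big_nat_recr//= [X in _ <= X + _]big_nat_recr//=; have {}IH := IH (ltnW kn).
have : b k * (y k - z k) <= b k.+1 * (y k - z k).
  case: k kn {IH} => [|k] kn; first by rewrite y0 subrr !mulr0.
  by rewrite ler_wnM2r ?bn ?kn// subr_le0 yz//= ltnW.
by move: IH; set S := \sum_(_ <= i < _) _; set S' := \sum_(_ <= i < _) _; nra.
Qed.

Lemma wsum_abel (V : lmodType R) N ip (phi : Z2 -> V) d (T : measurableType d)
    (P : probability T R) X (F : gaussian_field P ip X) (G : gff_form N ip phi) (sigma b : nat -> R) n x w :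
  (forall k, (0 < k <= n)%N -> b k != 0) ->
  \sum_(1 <= i < n.+1) b i * (X (wsum lam G (fun i => sigma i / b i) i x) w
     - X (wsum lam G (fun i => sigma i / b i) i.-1 x) w) = X (wsum lam G sigma n x) w.
Proof.
elim: n => [|n IH] b0; first by rewrite big_nil wsum0 (gf0 F).
rewrite big_nat_recr//= IH; last by move=> k /andP[k0 kn]; apply: b0; rewrite k0 ltnW.
rewrite (wsumS _ _ sigma) (wsumS _ _ (fun i => sigma i / b i)).
rewrite ![_ + _ *: incr _ _ _ _]addrC !(gf_lin F).
have bn : b n.+1 != 0 by apply: b0; rewrite /= leqnn.
by move: (X (incr _ _ _ _) w) => u; field.
Qed.

(** All levels share the excess [eps / b 1], so only the first increment of [z] carries it, with
    weight [b 1]. *)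
Lemma threshold_sum (b : nat -> R) eps L n : b 1%N != 0 ->
  let z k : R := if k == 0%N then 0 else 2 * (lam k + eps / b 1%N) * L in
  \sum_(1 <= i < n.+2) b i * (z i - z i.-1) =
  2 * (\sum_(1 <= i < n.+2) b i * (lam i - lam i.-1) + eps) * L.
Proof.
move=> b1 z; elim: n => [|n IH]; first by rewrite !big_nat1 /z /= lam0; field.
rewrite big_nat_recr//= IH [in RHS]big_nat_recr//= /z /=.
by set S := \sum_(_ <= _ < _) _; ring.
Qed.

Lemma upper_tail (sigma b : nat -> R) eps eta : (0 < M)%N ->
  (forall k, (0 < k <= M)%N -> 0 < b k) -> (forall k, (0 < k < M)%N -> b k.+1 <= b k) ->
  (forall k, (0 < k <= M)%N ->
     \sum_(1 <= i < k.+1) (sigma i / b i) ^+ 2 * (lam i - lam i.-1) <= lam k) ->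
  0 < eps -> 0 < eta -> \forall N \near \oo,
  forall (V : lmodType R) ip (phi : Z2 -> V) (G : gff_form N ip phi)
    d (T : measurableType d) (P : probability T R) X, gaussian_field P ip X ->
  forall E : set T, measurable E ->
  (forall w, E w -> exists2 x, inV N x &
     2 * (\sum_(1 <= i < M.+1) b i * (lam i - lam i.-1) + eps) * ln N%:R <= X (wsum lam G sigma M x) w) ->
  (P E <= eta%:E)%E.
Proof.
move=> M0 b0 bn ck e0 eta0.
pose c i := sigma i / b i.
have b10 : 0 < b 1%N by apply: b0; rewrite M0.
have del0 : 0 < eps / b 1%N by rewrite divr_gt0.
have eM : 0 < eta / M%:R by rewrite divr_gt0// ltr0n.
have near_level k : (0 < k <= M)%N -> \forall N \near \oo,
  forall (V : lmodType R) ip (phi : Z2 -> V) (G : gff_form N ip phi)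
    d (T : measurableType d) (P : probability T R) X, gaussian_field P ip X ->
  forall E : set T, measurable E ->
  (forall w, E w -> exists2 x, inV N x & 2 * (lam k + eps / b 1%N) * ln N%:R <= X (wsum lam G c k x) w) ->
  (P E <= (eta / M%:R)%:E)%E.
  move=> /andP[k0]; rewrite leq_eqVlt => /orP[/eqP ->|kM].
    by rewrite lamM; apply: upper_top => //; rewrite -lamM; apply: ck; rewrite M0 leqnn.
  by apply: upper_mid => //; apply: ck; rewrite k0 ltnW.
have near_all : \forall N \near \oo, forall k : 'I_M,
  forall (V : lmodType R) ip (phi : Z2 -> V) (G : gff_form N ip phi)
    d (T : measurableType d) (P : probability T R) X, gaussian_field P ip X ->
  forall E : set T, measurable E ->
  (forall w, E w -> exists2 x, inV N x & 2 * (lam k.+1 + eps / b 1%N) * ln N%:R <= X (wsum lam G c k.+1 x) w) ->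
  (P E <= (eta / M%:R)%:E)%E.
  by apply: filter_forall => k; apply: near_level; rewrite /= ltn_ord.
near=> N => V ip phi G d T P X F E mE H.
have N0 : (0 < N)%N by near: N; exact: near_pos.
have L0 : 0 <= ln N%:R :> R by rewrite ln_ge0// ler1n.
pose z k : R := if k == 0%N then 0 else 2 * (lam k + eps / b 1%N) * ln N%:R.
pose Ek (k : nat) : set T := \bigcup_(v in [set: box N]) [set w | z k <= X (wsum lam G c k (site v)) w].
have mEk k : measurable (Ek k).
  apply: fin_bigcup_measurable; first exact: finite_finset.
  move=> v _; rewrite (_ : [set w | _] = (X (wsum lam G c k (site v))) @^-1` `[z k, +oo[).
    by rewrite -[X in measurable X]setTI; exact: (gf_meas F).
  by apply/seteqP; split=> w; rewrite /= in_itv/= andbT.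
have PEk (k : 'I_M) : (P (Ek k.+1) <= (eta / M%:R)%:E)%E.
  have Hk : forall (k : 'I_M) d (T : measurableType d) (P : probability T R) X, gaussian_field P ip X ->
    forall E : set T, measurable E ->
    (forall w, E w -> exists2 x, inV N x & 2 * (lam k.+1 + eps / b 1%N) * ln N%:R <= X (wsum lam G c k.+1 x) w) ->
    (P E <= (eta / M%:R)%:E)%E.
    by move=> k'; move: V ip phi G {d T P X F E mE H Ek mEk}; move: k' {k}; near: N.
  apply: (Hk k _ _ _ _ F _ (mEk _)) => w [v _ h]; exists (site v) => //; exact: site_inV.
have EU : E `<=` \big[setU/set0]_(k < M) Ek k.+1.
  (* Outside the level events every partial sum is strictly below its threshold, and Abel summation
     carries this to the field. *)
  move=> w /H[x xV hx]; apply: contrapT => nU.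
  have yz k : (0 < k <= M)%N -> X (wsum lam G c k x) w < z k.
    move=> /andP[k0 kM]; rewrite ltNge; apply/negP => h; apply: nU.
    have k1M : (k.-1 < M)%N by rewrite prednK.
    rewrite -(bigcup_mkord M (fun k => Ek k.+1)); exists k.-1 => //; rewrite prednK//.
    by have [v vx] := inV_site xV; exists v => //; rewrite /= vx.
  pose y k := X (wsum lam G c k x) w.
  have y0 : y 0%N = z 0%N by rewrite /y wsum0 (gf0 F).
  have := abel_upper y0 (fun k h => ltW (yz k h)) bn (leqnn M).
  have -> : \sum_(1 <= i < M.+1) b i * (y i - y i.-1) = X (wsum lam G sigma M x) w.
    by apply: (wsum_abel F G) => k /b0 bk; rewrite gt_eqF.
  have -> : \sum_(1 <= i < M.+1) b i * (z i - z i.-1) =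
      2 * (\sum_(1 <= i < M.+1) b i * (lam i - lam i.-1) + eps) * ln N%:R.
    by rewrite -(prednK M0); apply: threshold_sum; rewrite gt_eqF.
  have := yz M; rewrite M0 leqnn => /(_ isT); have := b0 M; rewrite M0 leqnn => /(_ isT) bM yM.
  rewrite leNgt => /negP; apply; apply: lt_le_trans hx.
  by rewrite gtrDl (pmulr_rlt0 _ bM) subr_lt0.
apply: (@le_trans _ _ (P (\big[setU/set0]_(k < M) Ek k.+1))).
  by apply: le_measure => //; rewrite inE//; apply: bigsetU_measurable.
apply: (le_trans (@Boole_inequality _ _ _ P (fun k => Ek k.+1) M (fun k _ => mEk k.+1))).
apply: (@le_trans _ _ (\sum_(k < M) (eta / M%:R)%:E)%E); first by apply: lee_sum => k _; exact: PEk.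
rewrite sumEFin lee_fin sumr_const card_ord -[leLHS]mulr_natl mulrC divfK// pnatr_eq0; lia.
Unshelve. all: by end_near. Qed.

End upper_bound.

(** * Lower bound *)

Section exponential_combinations.
Context {R : realType} {d : measure_display} {T : measurableType d}.
Context {P : probability T R} {V : lmodType R} {ip : V -> V -> R} {X : V -> T -> R}.
Hypothesis F : gaussian_field P ip X.

(** Carries the expectation [e] along with the combination, so that bounds can be assembled linearly
    and integrated once. *)
Definition exp_comb (f : T -> R) (e : R) : Prop := exists s : seq (R * V),
  (forall w, f w = \sum_(i <- s) i.1 * expR (X i.2 w)) /\
  e = \sum_(i <- s) i.1 * expR (sq ip i.2 / 2).

Lemma exp_comb1 c a : exp_comb (fun w => c * expR (X a w)) (c * expR (sq ip a / 2)).
Proof. by exists [:: (c, a)]; split=> [w|]; rewrite big_seq1. Qed.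

Lemma exp_comb0 : exp_comb (fun=> 0) 0.
Proof. by exists [::]; split=> [w|]; rewrite big_nil. Qed.

Lemma exp_combD f g a b : exp_comb f a -> exp_comb g b -> exp_comb (fun w => f w + g w) (a + b).
Proof.
by move=> [s [s1 ->]] [t [t1 ->]]; exists (s ++ t); split=> [w|]; rewrite big_cat// s1 t1.
Qed.

Lemma exp_combZ c f a : exp_comb f a -> exp_comb (fun w => c * f w) (c * a).
Proof.
move=> [s [s1 ->]]; exists [seq (c * i.1, i.2) | i <- s]; split=> [w|].
  by rewrite s1 mulr_sumr big_map; apply: eq_bigr => i _ /=; rewrite mulrA.
by rewrite mulr_sumr big_map; apply: eq_bigr => i _ /=; rewrite mulrA.
Qed.

Lemma exp_comb_sum (I : Type) (r : seq I) (f : I -> T -> R) (a : I -> R) :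
  (forall i, exp_comb (f i) (a i)) -> exp_comb (fun w => \sum_(i <- r) f i w) (\sum_(i <- r) a i).
Proof.
move=> H; elim: r => [|i r IH].
  by under eq_fun do rewrite big_nil; rewrite big_nil; exact: exp_comb0.
by under eq_fun do rewrite big_cons; rewrite big_cons; exact: exp_combD.
Qed.

Lemma prob_ge_exp_comb f e (E : set T) : exp_comb f e -> measurable E ->
  (forall w, f w <= (w \in E)%:R) -> (e%:E <= P E)%E.
Proof.
move=> [s [s1 ->]] mE H; apply: (prob_ge_exp_sum F (c := fst) (a := snd)) => // w.
by rewrite -s1.
Qed.

Lemma exp_comb_eq f g a b : exp_comb f a -> f =1 g -> a = b -> exp_comb g b.
Proof. by move=> [s [s1 ->]] fg <-; exists s; split=> // w; rewrite -fg. Qed.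

End exponential_combinations.

(* Truncated second moment method without division: with [Z] the truncated sum
   of the weights [W], the indicator of [Z > 0] is at least [2 t Z - (t Z)^2]. *)
Section second_moment_method.
Context {R : realType} {I : finType}.

Lemma second_moment_pointwise (t : R) (A : I -> bool) (W B : I -> R) (U : I -> I -> R) (e : bool) :
  0 <= t -> (forall v, 0 <= W v) -> (forall v, 0 <= B v) ->
  (forall v, ~~ A v -> W v <= B v) -> (forall u v, 0 <= U u v) ->
  (forall u v, A u -> A v -> W u * W v <= U u v) ->
  (forall v, A v -> e) ->
  2 * t * (\sum_v (W v - B v)) - t ^+ 2 * \sum_u \sum_v U u v <= e%:R.
Proof.
move=> t0 W0 B0 AB U0 AU Ae.
pose Z := \sum_v W v * (A v)%:R.
have h1 : \sum_v (W v - B v) <= Z.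
  apply: ler_sum => v _; have [Av|nAv] := boolP (A v).
    by rewrite mulr1 gerBl.
  by rewrite mulr0 subr_le0 AB.
have h2 : Z ^+ 2 <= \sum_u \sum_v U u v.
  rewrite expr2 mulr_suml; apply: ler_sum => u _; rewrite mulr_sumr; apply: ler_sum => v _.
  have [Au|_] := boolP (A u); last by rewrite mulr0 mul0r.
  have [Av|_] := boolP (A v); last by rewrite !mulr0.
  by rewrite !mulr1 AU.
have Z0 : 0 <= Z by apply: sumr_ge0 => v _; rewrite mulr_ge0.
case: e Ae => [_|Ae].
  have h3 := ler_wpM2l t0 h1; have h4 := ler_wpM2l (sqr_ge0 t) h2.
  have -> : true%:R = 1 :> R by [].
  have := sqr_ge0 (1 - t * Z); rewrite sqrrB expr1n mul1r exprMn mulr2n.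
  by move: h3 h4; set p := t ^+ 2 * Z ^+ 2; set q := t * Z; rewrite -!mulrA; lra.
have ZE : Z = 0 by rewrite /Z big1// => v _; case: (boolP (A v)) => [/Ae//|_]; rewrite mulr0.
have h3 := ler_wpM2l t0 h1; have h4 := ler_wpM2l (sqr_ge0 t) h2.
have -> : false%:R = 0 :> R by [].
rewrite ZE mulr0 in h3; rewrite ZE expr0n/= mulr0 in h4.
by move: h3 h4; rewrite -!mulrA; lra.
Qed.

End second_moment_method.

Lemma ipBB {R : realType} {V : lmodType R} N ip (phi : Z2 -> V) (G : gff_form N ip phi) a b c d :
  ip (a - b) (c - d) = ip a c - ip a d - (ip b c - ip b d).
Proof. by rewrite (ipBl G) (ipBr G) (ipBr G). Qed.

Lemma norm_diff4 {R : realType} (a b c d m : R) : `|a| <= m -> `|b| <= m -> `|c| <= m -> `|d| <= m ->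
  `|a - b - (c - d)| <= 4 * m.
Proof.
rewrite !ler_norml => /andP[? ?] /andP[? ?] /andP[? ?] /andP[? ?].
by apply/andP; split; lra.
Qed.

Section bulk.
Context {R : realType}.

(** Sites of a central square: boxes around them of radius at most [N %/ 4] stay away from the
    sides. *)
Definition bulkpt N (v : box (N %/ 2)) : Z2 := ((N %/ 4 + v.1)%N%:Z, (N %/ 4 + v.2)%N%:Z).

Lemma bulkpt_inV N v : inV N (@bulkpt N v).
Proof.
have h (i : 'I_(N %/ 2).+1) : (N %/ 4 + i <= N)%N.
  have : (i <= N %/ 2)%N by rewrite -ltnS.
  lia.
by rewrite /inV /bulkpt /= !lez_nat !h.
Qed.

Lemma bulkpt_deep N v w (r : R) : (0 < N)%N -> r <= (N %/ 4)%:R -> inV N w -> ~~ inI N w ->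
  ~~ within (r - 1) (zsub w (@bulkpt N v)).
Proof.
move=> N0 rN; case: w => a b; rewrite /inV /inI /= => wV wI; apply/negP => /andP[].
rewrite /zsub /bulkpt /= -!intr_norm => h1 h2.
have i1 : (v.1 <= N %/ 2)%N by rewrite -ltnS.
have i2 : (v.2 <= N %/ 2)%N by rewrite -ltnS.
have q (c : int) : `|c|%:~R <= r - 1 -> `|c| < (N %/ 4)%N%:Z.
  move=> hc; rewrite -(@ltr_int R); apply: (le_lt_trans hc); rewrite -[X in _ < X]/((N %/ 4)%:R); lra.
have {}h1 := q _ h1; have {}h2 := q _ h2.
move: wV wI h1 h2; move: (nat_of_ord v.1) (nat_of_ord v.2) i1 i2 => i j i1 i2.
by case/andP => /andP[? ?] /andP[? ?]; rewrite -!andbA => ? ? ?; lia.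
Qed.

End bulk.

Section lower_bound.
Context {R : realType}.
Variables (mu : nat -> R) (n : nat).
Hypothesis mu0 : 0 < mu 0%N.
Hypothesis muS : forall i, (i < n)%N -> mu i < mu i.+1.
Hypothesis mun : mu n = 1.

Let mu0ge : 0 <= mu 0%N. Proof. exact: ltW. Qed.

Section variances.
Variable eps : R.
Hypothesis e0 : 0 < eps.

Lemma coarse_variance i : (i <= n)%N -> \forall N \near \oo,
  forall (V : lmodType R) ip (phi : Z2 -> V) (G : gff_form N ip phi) v,
  `|sq ip (coarse G (mu i) (@bulkpt N v)) - (1 - mu i) * ln N%:R| <= eps * ln N%:R.
Proof.
rewrite leq_eqVlt => /orP[/eqP ->|iM].
  near=> N => V ip phi G v; rewrite mun subrr mul0r subr0 /coarse.
  rewrite prj_out ?/sq ?(ip0l G) ?normr0.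
    rewrite mulr_ge0 ?(ltW e0)// ln_ge0// ler1n; near: N; exact: near_pos.
  by rewrite /rad oner_eq0 eqxx bx_lt1.
have m1 : 0 < mu i < 1.
  apply/andP; split; first by apply: lt_le_trans mu0 (lam_le muS _ _) => //; exact: ltnW.
  by rewrite -mun; apply: lt_le_trans (muS iM) (lam_le muS _ _).
have [N1 [N10 H1]] := @center_variance_eps R (mu i) eps m1 e0.
near=> N => V ip phi G v.
have N0 : (0 < N)%N by near: N; exact: near_pos.
have hN : (N1 <= N)%N by near: N; exists N1.
(* As [mu i] is positive, the radius [N ^ (1 - mu i) / 2] is at most [N / 16], which is below
   [N %/ 4]. *)
have p4 : 8 <= N%:R `^ (1 - (1 - mu i)) :> R.
  near: N; apply: near_infty; apply: powN_large; have /andP[] := m1; lra.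
have rN : rad N (mu i) <= (N %/ 4)%:R.
  have -> : rad N (mu i) = 2^-1 * N%:R `^ (1 - mu i) by have /andP[? ?] := m1; rewrite /rad gt_eqF// lt_eqF.
  have pp : N%:R `^ (1 - (1 - mu i)) * N%:R `^ (1 - mu i) = N%:R :> R.
    rewrite -powRD; last by rewrite pnatr_eq0 -lt0n N0 implybT.
    by have -> : 1 - (1 - mu i) + (1 - mu i) = 1 by [ring]; rewrite powRr1.
  have p1 : 1 <= N%:R `^ (1 - mu i) :> R by apply: powN_ge1 => //; have /andP[_ /ltW] := m1.
  have d4 : (N%:R : R) <= 4 * (N %/ 4)%:R + 3.
    by rewrite -natrM -natrD ler_nat {1}(divn_eq N 4) mulnC leq_add2l -ltnS ltn_pmod.
  move: p4 pp p1 d4; set a := _ `^ _; set b := _ `^ _; nra.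
apply: H1 => //; first exact: bulkpt_inV.
  apply: within_sub0; rewrite divr_ge0//; exact: rad_ge0.
move=> w wV wI; exact: bulkpt_deep.
Unshelve. all: by end_near. Qed.

Lemma incr_variance_lb i : (0 < i)%N -> (i <= n)%N -> \forall N \near \oo,
  forall (V : lmodType R) ip (phi : Z2 -> V) (G : gff_form N ip phi) v,
  (mu i - mu i.-1 - 2 * eps) * ln N%:R <= sq ip (incr mu G i (@bulkpt N v)).
Proof.
move=> i0 iM; near=> N => V ip phi G.
have N0 : (0 < N)%N by near: N; exact: near_pos.
have h1 : forall v, `|sq ip (coarse G (mu i) (@bulkpt N v)) - (1 - mu i) * ln N%:R| <= eps * ln N%:R.
  by move: V ip phi G; near: N; exact: coarse_variance.
have h2 : forall v, `|sq ip (coarse G (mu i.-1) (@bulkpt N v)) - (1 - mu i.-1) * ln N%:R| <= eps * ln N%:R.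
  move: V ip phi G {h1}; near: N; apply: coarse_variance.
  by apply: leq_trans iM; exact: leq_pred.
move=> v; rewrite /incr (sqB G) (coarse_ip mu0ge muS mun)//; last exact: leq_pred.
have := h1 v; have := h2 v; rewrite !ler_norml => /andP[a1 a2] /andP[a3 a4]; lra.
Unshelve. all: by end_near. Qed.

Lemma wsum_cov_lb c c' k : (k <= n)%N -> (forall i, (0 < i <= n)%N -> 0 <= c i * c' i) ->
  \forall N \near \oo,
  forall (V : lmodType R) ip (phi : Z2 -> V) (G : gff_form N ip phi) v,
  (\sum_(1 <= i < k.+1) c i * c' i * (mu i - mu i.-1 - 2 * eps)) * ln N%:R <=
     ip (wsum mu G c k (@bulkpt N v)) (wsum mu G c' k (@bulkpt N v)).
Proof.
move=> kn cc; elim: k kn => [|k IH] kn.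
  by near=> N => V ip phi G v; rewrite big_nil mul0r !wsum0 (ip0l G).
near=> N => V ip phi G.
have N0 : (0 < N)%N by near: N; exact: near_pos.
have h1 : forall v, (\sum_(1 <= i < k.+1) c i * c' i * (mu i - mu i.-1 - 2 * eps)) * ln N%:R <=
     ip (wsum mu G c k (@bulkpt N v)) (wsum mu G c' k (@bulkpt N v)).
  by move: V ip phi G; near: N; apply: IH; exact: ltnW.
have h2 : forall v, (mu k.+1 - mu k - 2 * eps) * ln N%:R <= sq ip (incr mu G k.+1 (@bulkpt N v)).
  by move: V ip phi G {h1}; near: N; exact: (@incr_variance_lb k.+1).
move=> v; rewrite big_nat_recr//= mulrDl !wsumS (ipDl G) !(ipDr G) !(ipZl G) !(ipZr G).
rewrite (wsum_incr_orth mu0ge muS mun)// mulr0 addr0.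
rewrite ((gff_sym G) (incr _ _ _ _)) (wsum_incr_orth mu0ge muS mun)// mulr0 add0r.
rewrite mulrA -mulrA; apply: lerD; first exact: h1.
by apply: ler_wpM2l (h2 v); apply: cc.
Unshelve. all: by end_near. Qed.

End variances.

Lemma wsum_prefix_ip (V : lmodType R) N ip (phi : Z2 -> V) (G : gff_form N ip phi) c k j x :
  (0 < N)%N -> (k <= j)%N -> (j <= n)%N -> ip (wsum mu G c k x) (wsum mu G c j x) = sq ip (wsum mu G c k x).
Proof.
move=> N0; elim: j => [|j IH]; first by rewrite leqn0 => /eqP ->.
rewrite leq_eqVlt => /orP[/eqP ->//|kj jn].
rewrite wsumS (ipDr G) (ipZr G) (wsum_incr_orth mu0ge muS mun)// mulr0 addr0.
by apply: IH => //; exact: ltnW.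
Qed.

(** Beyond twice the coarsest radius the boxes are disjoint and the covariance vanishes exactly.
    Most pairs are of this kind, and their weights must contribute no more than the squared mean;
    hence the scales start at a positive [mu 0]. *)
Lemma far_cov (V : lmodType R) N ip (phi : Z2 -> V) (G : gff_form N ip phi) c k j u v :
  (0 < N)%N -> (k <= n)%N -> (j <= n)%N ->
  ~~ within (2 * rad N (mu 0%N)) (zsub u v) ->
  ip (wsum mu G c k u) (wsum mu G c j v) = 0.
Proof.
move=> N0 kn jn uv.
have co i i' : (i <= n)%N -> (i' <= n)%N -> ip (coarse G (mu i) u) (coarse G (mu i') v) = 0.
  move=> ii ii'; apply: disjoint_cov => [x|x xA]; first exact: bxI.
  have r1 : rad N (mu i) <= rad N (mu 0%N).
    by apply: rad_mono => //; [exact: (lam_le muS)|exact: (lam_le1 muS mun)].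
  have r2 : rad N (mu i') <= rad N (mu 0%N).
    by apply: rad_mono => //; [exact: (lam_le muS)|exact: (lam_le1 muS mun)].
  apply/negP => /andP[_ xv]; move/negP : uv; apply.
  have xu : within (rad N (mu i)) (zsub x u).
    by case/orP : xA => [/andP[_]|/bd_bx[]//]; apply: within_le; lra.
  rewrite within_subC in xu; apply: within_le (within_sub xu xv); lra.
have ci i i' : (0 < i <= n)%N -> (0 < i' <= n)%N -> ip (incr mu G i u) (incr mu G i' v) = 0.
  move=> /andP[i0 ii] /andP[i'0 ii']; rewrite /incr (ipBB G).
  have i1 : (i.-1 <= n)%N by apply: leq_trans ii; exact: leq_pred.
  have i'1 : (i'.-1 <= n)%N by apply: leq_trans ii'; exact: leq_pred.
  by rewrite !co ?subrr.
rewrite /wsum (ip_suml G) big_nat big1// => i /andP[i0 ik].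
rewrite (ip_sumr G) big_nat big1// => i' /andP[i'0 ik'].
rewrite (ipZl G) (ipZr G) ci ?mulr0//.
- by rewrite i0 (leq_trans _ kn).
- by rewrite i'0 (leq_trans _ jn).
Qed.

(** The increments of [u] beyond level [k] live in boxes of radius at most [rad N (mu k)], and [v]
    is outside twice that radius. Each pair of increments expands into four covariances controlled
    by [separated_cov_eps]. *)
Lemma near_cov c kap : 0 < kap -> \forall N \near \oo,
  forall (V : lmodType R) ip (phi : Z2 -> V) (G : gff_form N ip phi) k u v, (k <= n)%N -> inV N v ->
  ~~ within (2 * rad N (mu k)) (zsub u v) ->
  ip (wsum mu G c n u - wsum mu G c k u) (wsum mu G c n v) <= kap * ln N%:R.
Proof.
move=> k0; pose A := \sum_(1 <= i < n.+1) `|c i|.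
have A0 : 0 <= A by apply: sumr_ge0.
have d0 : 0 < 4 * (A ^+ 2 + 1) by rewrite mulr_gt0// ltr_wpDl ?sqr_ge0.
have e0 : 0 < kap / (4 * (A ^+ 2 + 1)) by rewrite divr_gt0.
near=> N => V ip phi G.
have N0 : (0 < N)%N by near: N; exact: near_pos.
have L0 : 0 <= ln N%:R :> R by rewrite ln_ge0// ler1n.
have sep : forall u v (ru rv : R), inV N v -> 0 <= rv -> ~~ within (2 * ru) (zsub u v) ->
    `|ip (prj G (bx N u ru) u) (prj G (bx N v rv) v)| <= kap / (4 * (A ^+ 2 + 1)) * ln N%:R.
  move: V ip phi G; near: N; apply: near_infty; exact: separated_cov_eps.
move=> k u v kn vV uv; set m := kap / _ * _ in sep.
have m0 : 0 <= m by rewrite mulr_ge0// ltW.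
have ci i i' : (k < i)%N -> (i <= n)%N -> (0 < i' <= n)%N -> `|ip (incr mu G i u) (incr mu G i' v)| <= 4 * m.
  move=> ki ii /andP[i'0 ii'].
  have co j l : (k <= j)%N -> (j <= n)%N -> (l <= n)%N -> `|ip (coarse G (mu j) u) (coarse G (mu l) v)| <= m.
    move=> kj jn ln; apply: sep => //; first exact: rad_ge0.
    apply: contra uv; apply: within_le; rewrite ler_pM2l//; apply: rad_mono => //.
    + exact: (lam_ge0 mu0ge muS).
    + exact: (lam_le muS).
    + exact: (lam_le1 muS mun).
  have kp : (k <= i.-1)%N by rewrite -ltnS prednK//; apply: leq_ltn_trans ki.
  have h1 : `|ip (coarse G (mu i.-1) u) (coarse G (mu i'.-1) v)| <= m.
    by apply: co => //; [apply: leq_trans ii|apply: leq_trans ii']; exact: leq_pred.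
  have h2 : `|ip (coarse G (mu i.-1) u) (coarse G (mu i') v)| <= m.
    by apply: co => //; apply: leq_trans ii; exact: leq_pred.
  have h3 : `|ip (coarse G (mu i) u) (coarse G (mu i'.-1) v)| <= m.
    by apply: co => //; [exact: ltnW|apply: leq_trans ii'; exact: leq_pred].
  have h4 : `|ip (coarse G (mu i) u) (coarse G (mu i') v)| <= m by apply: co => //; exact: ltnW.
  by rewrite /incr (ipBB G); exact: norm_diff4.
have ds : wsum mu G c n u - wsum mu G c k u = \sum_(k.+1 <= i < n.+1) c i *: incr mu G i u.
  by rewrite /wsum (@big_cat_nat _ _ _ k.+1)//= addrAC subrr add0r.
have row i : (k < i)%N -> (i <= n)%N -> `|ip (incr mu G i u) (wsum mu G c n v)| <= A * (4 * m).
  move=> ki ii; rewrite /wsum (ip_sumr G) /A mulr_suml !big_nat; apply: (le_trans (ler_norm_sum _ _ _)).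
  apply: ler_sum => i' h; rewrite (ipZr G) normrM ler_wpM2l//; exact: ci.
apply: (le_trans (ler_norm _)); rewrite ds (ip_suml G) big_nat.
apply: (le_trans (ler_norm_sum _ _ _)).
apply: (@le_trans _ _ (\sum_(k.+1 <= i < n.+1) `|c i| * (A * (4 * m)))).
  rewrite [leRHS]big_nat; apply: ler_sum => i /andP[ki ii].
  by rewrite (ipZl G) normrM ler_wpM2l// row.
rewrite -mulr_suml; apply: (@le_trans _ _ (A * (A * (4 * m)))).
  apply: ler_wpM2r; first by apply: mulr_ge0 => //; exact: mulr_ge0.
  by rewrite /A [leRHS](@big_cat_nat _ _ _ k.+1)//= lerDr; apply: sumr_ge0.
have -> : A * (A * (4 * m)) = A ^+ 2 / (A ^+ 2 + 1) * (kap * ln N%:R).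
  by rewrite /m; field; rewrite gt_eqF// ltr_wpDl ?sqr_ge0.
rewrite ler_piMl ?mulr_ge0 ?(ltW k0)// ler_pdivrMr ?ltr_wpDl ?sqr_ge0// mul1r lerDl//.
Unshelve. all: by end_near. Qed.

End lower_bound.

(** * The truncated second moment bound for tilted exponential weights *)

Section second_moment_bound.
Context {R : realType} {d : measure_display} {T : measurableType d}.
Context {P : probability T R} {V : lmodType R} {ip : V -> V -> R} {X : V -> T -> R}.
Hypothesis F : gaussian_field P ip X.
Context {N : nat} {phi : Z2 -> V}.
Hypothesis G : gff_form N ip phi.
Variables (I : finType) (n : nat) (S : I -> V) (Sk : nat -> I -> V) (Ps : I -> V).
Variables (q th C kap : R) (y : nat -> R) (far : I -> I -> bool) (good : nat -> I -> I -> bool).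
Variable E : set T.
Hypothesis mE : measurable E.
Hypothesis th0 : 0 <= th.
Hypothesis S_Sk : forall k v, (k < n)%N -> ip (S v) (Sk k v) = sq ip (Sk k v).
Hypothesis var_Sk : forall k v, (k < n)%N -> sq ip (Sk k v) <= C.
Hypothesis var_Ps : forall v, sq ip (Ps v) <= C.
Hypothesis S_far : forall u v, far u v -> ip (S u) (S v) = 0.
Hypothesis close_good : forall u v, ~~ far u v -> exists2 k, (k < n)%N & good k u v.
Hypothesis good_cov : forall k u v, (k < n)%N -> good k u v -> ip (S u - Sk k u) (S v) <= kap.
Hypothesis good_var : forall k u, (k < n)%N -> sq ip (Sk k u) / 2 + q + kap <= y k.
Hypothesis HE : forall v w, ip (S v) (Ps v) - q <= X (Ps v) w -> E w.

(* [W v] is the density tilting by [S v].  By Chernoff bounds, [BS] and [BP]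
   dominate it where a truncation fails; [UF] and [UG] dominate [W u * W v] on
   pairs satisfying the truncations. *)
Let W v w := expR (- (sq ip (S v) / 2)) * expR (X (S v) w).
Let BS k v w := expR (- (sq ip (S v) / 2) - th * (sq ip (Sk k v) + q)) * expR (X (S v + th *: Sk k v) w).
Let BP v w := expR (- (sq ip (S v) / 2) + th * (ip (S v) (Ps v) - q)) * expR (X (S v - th *: Ps v) w).
Let UF u v w := expR (- (sq ip (S u) / 2) - sq ip (S v) / 2) * expR (X (S u + S v) w).
Let UG k u v w := expR (- (sq ip (S u) / 2) - sq ip (S v) / 2 + sq ip (Sk k u) + q)
  * expR (X (S u - Sk k u + S v) w).

Let W_comb v : exp_comb (ip := ip) (X := X) (W v) 1.
Proof.
apply: (exp_comb_eq (exp_comb1 (expR (- (sq ip (S v) / 2))) (S v))) => //.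
by rewrite -expRD addNr expR0.
Qed.

Let BS_comb k v : (k < n)%N -> exp_comb (ip := ip) (X := X) (BS k v)
  (expR (th ^+ 2 * sq ip (Sk k v) / 2 - th * q)).
Proof.
move=> kn; apply: (exp_comb_eq (exp_comb1 _ _)) => //.
by rewrite -expRD; congr expR; rewrite (sqD G) (sqZ G) (ipZr G) S_Sk//; field.
Qed.

Let BP_comb v : exp_comb (ip := ip) (X := X) (BP v) (expR (th ^+ 2 * sq ip (Ps v) / 2 - th * q)).
Proof.
apply: (exp_comb_eq (exp_comb1 _ _)) => //.
by rewrite -expRD; congr expR; rewrite (sqB G) (sqZ G) (ipZr G); field.
Qed.

Let UF_comb u v : exp_comb (ip := ip) (X := X) (UF u v) (expR (ip (S u) (S v))).
Proof.
apply: (exp_comb_eq (exp_comb1 _ _)) => //.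
by rewrite -expRD; congr expR; rewrite (sqD G); field.
Qed.

Let UG_comb k u v : (k < n)%N -> exp_comb (ip := ip) (X := X) (UG k u v)
  (expR (sq ip (Sk k u) / 2 + q + ip (S u - Sk k u) (S v))).
Proof.
move=> kn; apply: (exp_comb_eq (exp_comb1 _ _)) => //.
by rewrite -expRD; congr expR; rewrite (sqD G) (sqB G) S_Sk//; field.
Qed.

Let B v w := \sum_(k < n) BS k v w + BP v w.
Let U u v w := if far u v then UF u v w else \sum_(k < n) (good k u v)%:R * UG k u v w.

(** Tilting by [S v] gives [X (Sk k v)] the mean [sq ip (Sk k v)] and [X (Ps v)] the mean
    [ip (S v) (Ps v)]; the truncation allows the deviation [q] on the relevant side. *)
Let A w v := [forall k : 'I_n, X (Sk k v) w <= sq ip (Sk k v) + q] && (ip (S v) (Ps v) - q <= X (Ps v) w).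

Let W0 v w : 0 <= W v w. Proof. by rewrite mulr_ge0 ?expR_ge0. Qed.
Let BS0 k v w : 0 <= BS k v w. Proof. by rewrite mulr_ge0 ?expR_ge0. Qed.
Let BP0 v w : 0 <= BP v w. Proof. by rewrite mulr_ge0 ?expR_ge0. Qed.
Let UG0 k u v w : 0 <= UG k u v w. Proof. by rewrite mulr_ge0 ?expR_ge0. Qed.

Let A_bad w v : ~~ A w v -> W v w <= B v w.
Proof.
rewrite negb_and => /orP[/forallPn[k hk]|hk].
  rewrite /B (bigD1 k)//= -addrA; apply: ler_wpDr.
    by rewrite addr_ge0// sumr_ge0.
  rewrite /W /BS -!expRD ler_expR (gfD F) (gfZ F).
  rewrite -ltNge in hk; have := ler_wpM2l th0 (ltW hk); lra.
rewrite /B; apply: ler_wpDl; first exact: sumr_ge0.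
rewrite /W /BP -!expRD ler_expR (gfB F) (gfZ F).
rewrite -ltNge in hk; have := ler_wpM2l th0 (ltW hk); lra.
Qed.

(** For close pairs the truncation at [u] replaces [X (Sk k u)], the part of the field shared by
    both points, by its upper bound; the common increments are thus not counted twice in the
    exponential moment. *)
Let A_good w u v : A w u -> A w v -> W u w * W v w <= U u v w.
Proof.
move=> /andP[/forallP Au _] _; rewrite /U; case: ifPn => [_|/close_good[k kn gk]].
  by rewrite /W /UF -!expRD ler_expR (gfD F); lra.
rewrite (bigD1 (Ordinal kn))//= gk mul1r; apply: ler_wpDr.
  by apply: sumr_ge0 => j _; rewrite mulr_ge0.
rewrite /W /UG -!expRD ler_expR (gfD F) (gfB F).
by have := Au (Ordinal kn); rewrite /=; lra.
Qed.

(** Each weight has mean 1, so with [t] the inverse of the cardinal the linear term gives 2 and the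
    far pairs at most 1. Truncation errors and close pairs are subtracted from the difference. *)
Lemma second_moment_lower_bound (t : R) : t = #|I|%:R^-1 -> (0 < #|I|)%N ->
  ((1 - 2 * n.+1%:R * expR (th ^+ 2 * C / 2 - th * q)
    - t ^+ 2 * \sum_u \sum_v \sum_(k < n) (good k u v)%:R * expR (y k))%:E <= P E)%E.
Proof.
move=> tE I0; have I0R : 0 < #|I|%:R :> R by rewrite ltr0n.
have t0 : 0 <= t by rewrite tE invr_ge0.
pose eB v := \sum_(k < n) expR (th ^+ 2 * sq ip (Sk k v) / 2 - th * q)
  + expR (th ^+ 2 * sq ip (Ps v) / 2 - th * q).
pose eU u v := if far u v then expR (ip (S u) (S v)) else
  \sum_(k < n) (good k u v)%:R * expR (sq ip (Sk k u) / 2 + q + ip (S u - Sk k u) (S v)).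
have comb : exp_comb (ip := ip) (X := X)
    (fun w => 2 * t * (\sum_v (W v w - B v w)) - t ^+ 2 * \sum_u \sum_v U u v w)
    (2 * t * (\sum_v (1 - eB v)) - t ^+ 2 * \sum_u \sum_v eU u v).
  apply: exp_combD.
    apply: exp_combZ; apply: exp_comb_sum => v; apply: exp_combD; first exact: W_comb.
    apply: (exp_comb_eq (exp_combZ (-1) _)) => [|w|]; last 2 first.
    - by rewrite mulN1r.
    - by rewrite mulN1r.
    - apply: exp_combD; last exact: BP_comb.
      by apply: exp_comb_sum => k; exact: BS_comb.
  apply: (exp_comb_eq (exp_combZ (- t ^+ 2) _)) => [|w|]; last 2 first.
  - by rewrite mulNr.
  - by rewrite mulNr.
  - apply: exp_comb_sum => u; apply: exp_comb_sum => v; rewrite /U /eU; case: ifP => _; first exact: UF_comb.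
    by apply: exp_comb_sum => k; apply: exp_combZ; exact: UG_comb.
apply: le_trans (prob_ge_exp_comb F comb mE _); last first.
  move=> w; apply: (@second_moment_pointwise _ _ t (A w) (W^~ w) (B^~ w) (fun u v => U u v w)) => //.
  - by move=> v; rewrite addr_ge0// sumr_ge0.
  - exact: A_bad.
  - move=> u v; rewrite /U; case: ifP => _; first by rewrite mulr_ge0 ?expR_ge0.
    by apply: sumr_ge0 => k _; rewrite mulr_ge0.
  - exact: A_good.
  - by move=> v /andP[_ /HE wE]; rewrite inE.
rewrite lee_fin; set bb := expR (th ^+ 2 * C / 2 - th * q).
have mono s : s <= C -> expR (th ^+ 2 * s / 2 - th * q) <= bb.
  by move=> sC; rewrite ler_expR lerD2r ler_pM2r// ler_wpM2l ?sqr_ge0.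
have h1 v : eB v <= n.+1%:R * bb.
  rewrite -natr1 mulrDl mul1r; apply: lerD; last exact: mono.
  apply: (@le_trans _ _ (\sum_(k < n) bb)).
    by apply: ler_sum => k _; apply: mono; exact: var_Sk.
  by rewrite sumr_const card_ord -[leLHS]mulr_natl.
have h2 : #|I|%:R * (1 - n.+1%:R * bb) <= \sum_v (1 - eB v).
  have -> : #|I|%:R * (1 - n.+1%:R * bb) = \sum_(v : I) (1 - n.+1%:R * bb) by rewrite sumr_const mulr_natl.
  apply: ler_sum => v _.
  by rewrite lerD2l lerN2.
have h3 u v : eU u v <= 1 + \sum_(k < n) (good k u v)%:R * expR (y k).
  rewrite /eU; case: ifPn => [/S_far ->|_].
    by rewrite expR0 lerDl; apply: sumr_ge0 => k _; rewrite mulr_ge0 ?expR_ge0.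
  rewrite -[leLHS]add0r; apply: lerD => //; apply: ler_sum => k _.
  case: (boolP (good k u v)) => [gk|_]; last by rewrite !mul0r.
  rewrite !mul1r ler_expR; apply: le_trans (good_var u (ltn_ord k)).
  by rewrite lerD2l; exact: good_cov gk.
have h4 : \sum_u \sum_v eU u v <= #|I|%:R ^+ 2 +
    \sum_u \sum_v \sum_(k < n) (good k u v)%:R * expR (y k).
  apply: (@le_trans _ _ (\sum_u \sum_v (1 + \sum_(k < n) (good k u v)%:R * expR (y k)))).
    by apply: ler_sum => u _; apply: ler_sum => v _; exact: h3.
  under eq_bigr do rewrite big_split.
  rewrite big_split /= lerD2r.
  have e1 : \sum_(i : I) 1 = #|I|%:R :> R by rewrite sumr_const.
  by rewrite e1 sumr_const -[leLHS]mulr_natl expr2.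
have tI : t * #|I|%:R = 1 by rewrite tE mulVf// gt_eqF.
have h5 := ler_wpM2l t0 h2; have h6 := ler_wpM2l (sqr_ge0 t) h4.
move: h5 h6; set Q := \sum_u \sum_v \sum_(k < n) _; set s1 := \sum_v (1 - _); set s2 := \sum_u \sum_v _.
rewrite mulrA tI mul1r mulrDr -exprMn tI expr1n -[2 * t * s1]mulrA; lra.
Qed.

End second_moment_bound.

(** * Counting the central sites near a given point *)

Section counting.
Context {R : realType}.

Lemma interval_count (m : nat) (o : nat) (b : int) (rho : R) : 0 <= rho ->
  #|[pred j : 'I_m | `|(b - (o + j)%N%:Z)%:~R| <= rho]|%:R <= 2 * rho + 1.
Proof.
move=> r0; set S := [pred j | _].
have [j0 Sj0|S0] := pickP S; last first.
  by rewrite (eq_card0 S0) addr_ge0// mulr_ge0.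
pose jm := [arg min_(j < j0 in S) (j : nat)].
have [Sm jmin] : S jm /\ forall j, S j -> (jm <= j)%N.
  by rewrite /jm; case: arg_minnP.
pose K := Num.truncn (2 * rho).
have lt j : S j -> (j - jm < K.+1)%N.
  move=> Sj; rewrite ltnS /K truncn_ge_nat; last by rewrite mulr_ge0.
  rewrite natrB ?jmin//.
  move: Sm Sj; rewrite /S /= !ler_norml => /andP[h1 h2] /andP[h3 h4].
  rewrite -[j%:R]/(j%:Z%:~R) -[jm%:R]/(jm%:Z%:~R).
  have e (i : nat) : (b - (o + i)%N%:Z)%:~R = b%:~R - o%:R - i%:Z%:~R :> R.
    by rewrite PoszD opprD addrA !rmorphB.
  move: h1 h2 h3 h4; rewrite !e; lra.
have : (#|S| <= #|{: 'I_K.+1}|)%N.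
  pose f (j : 'I_m) : 'I_K.+1 := inord (j - jm).
  suff fi : {in S &, injective f} by exact: leq_card_in fi.
  move=> i j Si Sj /(congr1 val); rewrite /f /= !inordK ?lt// => ij; apply: val_inj => /=.
  by have := jmin i Si; have := jmin j Sj; lia.
rewrite card_ord -(ler_nat R) => /le_trans; apply; rewrite -natr1 lerD2r.
by rewrite /K truncn_le mulr_ge0.
Qed.

Lemma bulk_count N (rho : R) u : 0 <= rho ->
  \sum_(v : box (N %/ 2)) (within rho (zsub u (@bulkpt N v)))%:R <= (2 * rho + 1) ^+ 2.
Proof.
move=> r0; rewrite -natr_sum.
have -> : (\sum_(v : box (N %/ 2)) within rho (zsub u (@bulkpt N v)))%N =
    #|[pred v : box (N %/ 2) | within rho (zsub u (@bulkpt N v))]|.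
  by rewrite -sum1_card [RHS]big_mkcond /=; apply: eq_bigr => v _; rewrite inE; case: (within _ _).
have -> : #|[pred v : box (N %/ 2) | within rho (zsub u (@bulkpt N v))]| =
   (#|[pred j : 'I_(N %/ 2).+1 | (`|(u.1 - (N %/ 4 + j)%N%:Z)%:~R| <= rho)%R]| *
    #|[pred j : 'I_(N %/ 2).+1 | (`|(u.2 - (N %/ 4 + j)%N%:Z)%:~R| <= rho)%R]|)%N.
  by rewrite -cardX; apply: eq_card => -[i j]; rewrite !inE.
rewrite natrM expr2 ler_pM//; exact: interval_count.
Qed.

End counting.

Lemma half_box_size N : (N ^ 2 <= (N %/ 2).+1 ^ 2 * 4)%N.
Proof. by rewrite (_ : 4 = 2 ^ 2)%N// -expnMn leq_sqr; lia. Qed.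

Section lower_core.
Context {R : realType}.
Variables (mu : nat -> R) (n : nat).
Hypothesis mu0 : 0 < mu 0%N.
Hypothesis muS : forall i, (i < n)%N -> mu i < mu i.+1.
Hypothesis mun : mu n = 1.
Hypothesis n0 : (0 < n)%N.
Variables (a s : nat -> R) (tau eps eta : R).
Hypothesis a0 : forall i, (0 < i <= n)%N -> 0 <= a i.
Hypothesis s0 : forall i, (0 < i <= n)%N -> 0 <= s i.
Hypothesis tau0 : 0 < tau.
Hypothesis eps0 : 0 < eps.
Hypothesis eta0 : 0 < eta.
Hypothesis a_tau : forall k, (k < n)%N ->
  \sum_(1 <= i < k.+2) a i ^+ 2 * (mu i - mu i.-1) <= mu k - tau.

Let mu0ge : 0 <= mu 0%N. Proof. exact: ltW. Qed.

(** Tilting along an increment of variance about [(mu i - mu i.-1) * ln N] with weight [2 * a i]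
    shifts it by [2 * a i] times that variance. *)
Let c (i : nat) : R := 2 * a i.

Let sum_c k : \sum_(1 <= i < k.+1) c i ^+ 2 * (mu i - mu i.-1) =
  4 * \sum_(1 <= i < k.+1) a i ^+ 2 * (mu i - mu i.-1).
Proof. by rewrite mulr_sumr; apply: eq_bigr => i _; rewrite /c; ring. Qed.

Lemma scale_search (f : nat -> bool) m : (0 < m)%N -> f 0%N ->
  exists2 k, (k < m)%N & f k && (~~ f k.+1 || (k.+1 == m)).
Proof.
move=> m0 f0.
have H j : (j < m)%N -> f j \/ exists2 k, (k < m)%N & f k && ~~ f k.+1.
  elim: j => [|j IH] jm; first by left.
  have [fj|] := IH (ltnW jm); last by right.
  by case fj1: (f j.+1); [left|right; exists j; rewrite ?(ltnW jm)// fj fj1].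
have [|fm|[k km /andP[fk nfk]]] := H m.-1; first by rewrite prednK.
  by exists m.-1; rewrite prednK// fm eqxx orbT.
by exists k; rewrite // fk nfk.
Qed.

Let count_bound N k : (0 < N)%N -> (k < n)%N ->
  (2 * (2 * rad N (mu k)) + 1) ^+ 2 * expR ((2 * mu k - tau) * ln N%:R) <= 81 * expR ((2 - tau) * ln N%:R).
Proof.
move=> N0 kn; have m1 : mu k < 1.
  by rewrite -mun; apply: lt_le_trans (muS kn) (lam_le muS _ _).
have r := rad_ub N0 m1; have p1 := powN_ge1 N0 (ltW m1); have r0 := rad_ge0 N (mu k).
have -> : 81 * expR ((2 - tau) * ln N%:R) =
    (9 * N%:R `^ (1 - mu k)) ^+ 2 * expR ((2 * mu k - tau) * ln N%:R).
  have -> : N%:R `^ (1 - mu k) = expR ((1 - mu k) * ln N%:R) :> R.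
    by rewrite /powR pnatr_eq0 gtn_eqF.
  rewrite exprMn -expRM_natl -mulrA -expRD; congr (_ * expR _); first by ring.
  by ring.
rewrite ler_wpM2r ?expR_ge0// lerXn2r ?nnegrE ?addr_ge0 ?mulr_ge0//; last by lra.
Qed.

(** About [N ^ (2 - 2 * mu k)] sites are at scale [k] from a given site, and such a pair costs
    [N ^ (2 * mu k - tau)]; divided by the number of sites, of order [N ^ 2], this sums to
    [N ^ (- tau)]. Separation is only known at scale [k.+1], so increment [k.+1] counts as shared;
    this is why [a_tau] compares its sum with [mu k]. *)
Lemma lower_core : \forall N \near \oo,
  forall (V : lmodType R) ip (phi : Z2 -> V) (G : gff_form N ip phi)
    d (T : measurableType d) (P : probability T R) X, gaussian_field P ip X ->
  forall E : set T, measurable E ->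
  (forall (v : box (N %/ 2)) w,
    2 * (\sum_(1 <= i < n.+1) s i * a i * (mu i - mu i.-1) - eps) * ln N%:R
      <= X (wsum mu G s n (bulkpt v)) w -> E w) ->
  ((1 - eta)%:E <= P E)%E.
Proof.
pose A := \sum_(1 <= i < n.+1) s i * a i.
have A0 : 0 <= A.
  by rewrite /A big_nat; apply: sumr_ge0 => i h; rewrite mulr_ge0 ?s0 ?a0.
have [e2 [e20 e2A]] : exists e2, 0 < e2 /\ 4 * e2 * A <= eps.
  exists (eps / (4 * (A + 1))); have A1 : 0 < A + 1 by rewrite ltr_wpDl.
  split; first by rewrite divr_gt0// mulr_gt0.
  have -> : 4 * (eps / (4 * (A + 1))) * A = eps * (A / (A + 1)) by field; rewrite gt_eqF.
  by rewrite ler_piMr ?(ltW eps0)// ler_pdivrMr// mul1r lerDl.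
(* Half the variance of the shared part is at most [2 * mu k - 2 * tau + tau / 4] in units of
   [ln N]. Adding [del] and the covariance error [tau / 4] stays below [2 * mu k - tau]. *)
have [del [del0 delt dele]] : exists del, [/\ 0 < del, del <= tau / 4 & del <= eps].
  exists (Num.min (tau / 4) eps); split; rewrite ?ge_min ?lexx ?orbT//.
  by rewrite lt_min eps0 divr_gt0.
pose S2 := \sum_(1 <= i < n.+1) s i ^+ 2 * (mu i - mu i.-1).
have S20 : 0 <= S2.
  rewrite /S2 big_nat; apply: sumr_ge0 => -[//|i] /andP[_ ii].
  by rewrite mulr_ge0 ?sqr_ge0// subr_ge0 ltW// muS.
have [C0 [C00 C0a C0s]] : exists C0, [/\ 0 < C0, 4 + tau <= C0 & S2 + 1 <= C0].
  by exists (4 + tau + S2 + 1); split; lra.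
have t2 : 0 < tau / 2 by rewrite divr_gt0.
have t4 : 0 < tau / 4 by rewrite divr_gt0.
have rate0 : 0 < del ^+ 2 / (2 * C0) by rewrite divr_gt0 ?exprn_gt0// mulr_gt0.
have eta2 : 0 < eta / 2 by rewrite divr_gt0.
have allvar : \forall N \near \oo, forall k : 'I_n,
  forall (V : lmodType R) ip (phi : Z2 -> V) (G : gff_form N ip phi) x, inV N x ->
  sq ip (wsum mu G c k.+1 x) <= (\sum_(1 <= i < k.+2) c i ^+ 2 * (mu i - mu i.-1) + tau / 2) * ln N%:R.
  apply: filter_forall => k; exact: (wsum_variance mu0ge muS mun c (ltn_ord k) t2).
near=> N => V ip phi G.
have N0 : (0 < N)%N by near: N; exact: near_pos.
have L0 : 0 <= ln N%:R :> R by rewrite ln_ge0// ler1n.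
have varS : forall k v, (k < n)%N -> sq ip (wsum mu G c k.+1 (@bulkpt N v)) <= (4 * (mu k - tau) + tau / 2) * ln N%:R.
  have : forall (k : 'I_n) x, inV N x ->
      sq ip (wsum mu G c k.+1 x) <= (\sum_(1 <= i < k.+2) c i ^+ 2 * (mu i - mu i.-1) + tau / 2) * ln N%:R.
    by move=> k; move: V ip phi G; move: k; near: N.
  move=> h k v kn; have := h (Ordinal kn) _ (bulkpt_inV v) => /= /le_trans; apply.
  by rewrite ler_wpM2r// lerD2r sum_c ler_pM2l// a_tau.
have varP : forall v, sq ip (wsum mu G s n (@bulkpt N v)) <= (S2 + 1) * ln N%:R.
  move=> v; move: (bulkpt v) (bulkpt_inV v) => x xV; move: V ip phi G x xV {varS v}; near: N.
  exact: (wsum_variance mu0ge muS mun s (leqnn n) ltr01).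
have covSP : forall v, (\sum_(1 <= i < n.+1) c i * s i * (mu i - mu i.-1 - 2 * e2)) * ln N%:R <=
     ip (wsum mu G c n (@bulkpt N v)) (wsum mu G s n (@bulkpt N v)).
  move: V ip phi G {varS varP}; near: N.
  apply: (@wsum_cov_lb R mu n mu0 muS mun e2 e20 c s n (leqnn n)) => i h.
  by rewrite mulr_ge0 ?s0// mulr_ge0// a0.
have ncov : forall k u v, (k <= n)%N -> inV N v -> ~~ within (2 * rad N (mu k)) (zsub u v) ->
  ip (wsum mu G c n u - wsum mu G c k u) (wsum mu G c n v) <= tau / 4 * ln N%:R.
  move: V ip phi G {varS varP covSP}; near: N; exact: near_cov.
move=> d T P X F E mE HE.
pose I := box (N %/ 2).
have I0 : (0 < #|{: I}|)%N by rewrite card_box.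
pose far (u v : I) := ~~ within (2 * rad N (mu 0%N)) (zsub (bulkpt u) (bulkpt v)).
pose good k (u v : I) := within (2 * rad N (mu k)) (zsub (bulkpt u) (bulkpt v)) &&
  (~~ within (2 * rad N (mu k.+1)) (zsub (bulkpt u) (bulkpt v)) || (k.+1 == n)).
(* The Chernoff exponent [del / C0] is the truncation width over the variance bound, leaving the
   rate [del ^+ 2 / (2 * C0)]. *)
have := @second_moment_lower_bound R d T P V ip X F N phi G I n (fun v => wsum mu G c n (bulkpt v))
  (fun k v => wsum mu G c k.+1 (bulkpt v)) (fun v => wsum mu G s n (bulkpt v))
  (del * ln N%:R) (del / C0) (C0 * ln N%:R) (tau / 4 * ln N%:R) (fun k => (2 * mu k - tau) * ln N%:R)
  far good E mE.
have muk k : (k < n)%N -> mu k <= 1 by move=> kn; apply: (lam_le1 muS mun); exact: ltnW.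
move=> /(_ _ _ _ _ _ _ _ _ _ _ erefl I0) H; apply: le_trans (H _ _ _ _ _ _ _ _ _); last first.
- move=> v w h; apply: HE; apply: le_trans h.
  have := covSP v.
  have -> : \sum_(1 <= i < n.+1) c i * s i * (mu i - mu i.-1 - 2 * e2) =
     2 * (\sum_(1 <= i < n.+1) s i * a i * (mu i - mu i.-1)) - 4 * e2 * A.
    rewrite /A !mulr_sumr -sumrB; apply: eq_bigr => i _; rewrite /c; ring.
  have h1 := ler_wpM2r L0 e2A; have h2 := ler_wpM2r L0 dele.
  by set B := \sum_(1 <= i < n.+1) s i * a i * _; move: h1 h2; set L := ln _; move=> h1 h2 h3; lra.
- move=> k u kn; have := varS k u kn; have := ler_wpM2r L0 delt.
  have : 0 <= tau * ln N%:R by rewrite mulr_ge0 ?(ltW tau0).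
  lra.
- move=> k u v kn /andP[_ /orP[uv|/eqP ->]].
    exact: ncov (bulkpt_inV v) uv.
  by rewrite subrr (ip0l G) mulr_ge0 ?(ltW t4).
- move=> u v; rewrite negbK => uv.
  exact: (scale_search (f := fun k => within (2 * rad N (mu k)) (zsub (bulkpt u) (bulkpt v))) n0 uv).
- by move=> u v uv; apply: (far_cov mu0 muS mun).
- move=> v; apply: (le_trans (varP v)); exact: ler_wpM2r.
- move=> k v kn; apply: (le_trans (varS k v kn)); apply: ler_wpM2r => //.
  have := muk k kn; lra.
- by move=> k v kn; rewrite (gff_sym G) (wsum_prefix_ip mu0 muS mun).
- by rewrite divr_ge0 ?(ltW del0) ?(ltW C00).
rewrite lee_fin.
have hb : 2 * n.+1%:R * expR ((del / C0) ^+ 2 * (C0 * ln N%:R) / 2 - del / C0 * (del * ln N%:R)) <= eta / 2.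
  have -> : (del / C0) ^+ 2 * (C0 * ln N%:R) / 2 - del / C0 * (del * ln N%:R) =
     - (del ^+ 2 / (2 * C0) * ln N%:R) by field; rewrite gt_eqF.
  by near: N; exact: near_exp_small.
have hc : (#|{: I}|%:R^-1) ^+ 2 * \sum_(u : I) \sum_(v : I) \sum_(k < n) (good k u v)%:R *
    expR ((2 * mu k - tau) * ln N%:R) <= eta / 2.
  have row (u : I) : \sum_(v : I) \sum_(k < n) (good k u v)%:R * expR ((2 * mu k - tau) * ln N%:R) <=
      n%:R * (81 * expR ((2 - tau) * ln N%:R)).
    rewrite exchange_big /=.
    apply: (@le_trans _ _ (\sum_(k < n) 81 * expR ((2 - tau) * ln N%:R))); last first.
      by rewrite sumr_const card_ord -[leLHS]mulr_natl.
    apply: ler_sum => k _; rewrite -mulr_suml.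
    apply: le_trans (count_bound N0 (ltn_ord k)); rewrite ler_wpM2r ?expR_ge0//.
    have r0 : 0 <= 2 * rad N (mu k) by rewrite mulr_ge0// rad_ge0.
    apply: le_trans (@bulk_count R N _ (bulkpt u) r0); apply: ler_sum => v _.
    by rewrite ler_nat /good; case: (within _ _) => //=; case: (_ || _).
  have hI : (#|{: I}|%:R)^-1 <= 4 * expR (- (2 * ln N%:R)) :> R.
    have -> : expR (- (2 * ln N%:R)) = (N%:R ^+ 2)^-1 :> R.
      by rewrite expRN expRM_natl lnK// posrE ltr0n.
    rewrite -[4 * _]invrK invfM invrK lef_pV2 ?posrE ?mulr_gt0 ?invr_gt0 ?exprn_gt0 ?ltr0n//.
    rewrite card_box mulrC ler_pdivrMr// -!natrX -natrM ler_nat.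
    exact: half_box_size.
  apply: (@le_trans _ _ ((#|{: I}|%:R^-1) ^+ 2 * (#|{: I}|%:R * (n%:R * (81 * expR ((2 - tau) * ln N%:R)))))).
    rewrite ler_wpM2l ?sqr_ge0// mulr_natl -sumr_const; apply: ler_sum => u _; exact: row.
  have -> : (#|{: I}|%:R^-1) ^+ 2 * (#|{: I}|%:R * (n%:R * (81 * expR ((2 - tau) * ln N%:R)))) =
     #|{: I}|%:R^-1 * (n%:R * (81 * expR ((2 - tau) * ln N%:R))) :> R.
    by field; rewrite pnatr_eq0 -lt0n.
  apply: (@le_trans _ _ (4 * expR (- (2 * ln N%:R)) * (n%:R * (81 * expR ((2 - tau) * ln N%:R))))).
    by rewrite ler_wpM2r// !mulr_ge0 ?expR_ge0.
  have -> : 4 * expR (- (2 * ln N%:R)) * (n%:R * (81 * expR ((2 - tau) * ln N%:R))) =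
     324 * n%:R * expR (- (tau * ln N%:R)).
    have -> : expR (- (tau * ln N%:R)) = expR (- (2 * ln N%:R)) * expR ((2 - tau) * ln N%:R) :> R.
      by rewrite -expRD; congr expR; ring.
    by set e1 := expR _; set e3 := expR _; set nn := n%:R; ring.
  by near: N; exact: near_exp_small.
move: hb hc; set u := _ * expR _; set v := _ ^+ 2 * _; lra.
Unshelve. all: by end_near. Qed.

End lower_core.

(** * Refining the scales *)

Section refinement.
Context {R : realType}.
Variables (lam : nat -> R) (K : nat).
Hypothesis K0 : (0 < K)%N.

Definition grid (k : nat) : R :=
  lam (k %/ K) + (k %% K)%:R / K%:R * (lam (k %/ K).+1 - lam (k %/ K)).

(** Counting from 1, the [k]-th grid interval lies in the [piece k]-th original interval; the
    predecessor keeps right endpoints in their own interval. *)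
Definition piece (k : nat) : nat := (k.-1 %/ K).+1.

Let KR : K%:R != 0 :> R. Proof. by rewrite pnatr_eq0 -lt0n. Qed.

Lemma grid_step k : grid k.+1 = grid k + K%:R^-1 * (lam (k %/ K).+1 - lam (k %/ K)) /\
  ((k.+1 %/ K = k %/ K)%N \/ (k.+1 %/ K = (k %/ K).+1)%N /\ grid k.+1 = lam (k %/ K).+1).
Proof.
have [rK|rK] := ltnP (k %% K).+1 K.
  have e : k.+1 = (k %/ K * K + (k %% K).+1)%N by rewrite addnS -divn_eq.
  have d : (k.+1 %/ K = k %/ K)%N by rewrite {1}e divnMDl// (divn_small rK) addn0.
  have m : (k.+1 %% K = (k %% K).+1)%N by rewrite {1}e modnMDl (modn_small rK).
  by split; [rewrite /grid d m -natr1; field|left].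
have rE : (k %% K).+1 = K by apply/eqP; rewrite eqn_leq rK ltn_pmod.
have e : k.+1 = ((k %/ K).+1 * K)%N by rewrite mulSn -{1}rE addSn addnC -divn_eq.
have d : (k.+1 %/ K = (k %/ K).+1)%N by rewrite e mulnK.
have m : (k.+1 %% K = 0)%N by rewrite e modnMl.
have g : grid k.+1 = lam (k %/ K).+1 by rewrite /grid d m mul0r mul0r addr0.
split; last by right.
have rR : (k %% K)%:R = K%:R - 1 :> R by rewrite -{2}rE -natr1 addrK.
by rewrite g /grid rR; field.
Qed.

(** Telescoping inside each original interval, where [f] is constant. The values are in a module so
    that the identity serves both the field and real sums. *)
Lemma grid_sum (U : lmodType R) (f : nat -> R) (H : R -> U) k :
  \sum_(1 <= i < k.+1) f (piece i) *: (H (grid i.-1) - H (grid i)) =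
  \sum_(1 <= i < (k %/ K).+1) f i *: (H (lam i.-1) - H (lam i)) +
  f (k %/ K).+1 *: (H (lam (k %/ K)) - H (grid k)).
Proof.
elim: k => [|k IH].
  rewrite div0n !big_nil add0r.
  have -> : grid 0 = lam 0%N by rewrite /grid div0n mod0n mul0r mul0r addr0.
  by rewrite subrr scaler0.
have tr (x y z : U) : x - y + (y - z) = x - z by rewrite addrA subrK.
rewrite big_nat_recr//= IH /piece /= -addrA -scalerDr tr.
have [_ [->//|[-> ->]]] := grid_step k.
by rewrite [in RHS]big_nat_recr//= subrr scaler0 addr0.
Qed.

Lemma grid_mul j : grid (j * K) = lam j.
Proof. by rewrite /grid mulnK// modnMl mul0r mul0r addr0. Qed.

Variable M : nat.
Hypothesis lamS : forall i, (i < M)%N -> lam i < lam i.+1.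

Lemma grid_lt k : (k < M * K)%N -> grid k < grid k.+1.
Proof.
move=> kM; have [-> _] := grid_step k; rewrite ltrDl mulr_gt0 ?invr_gt0 ?ltr0n//.
by rewrite subr_gt0 lamS// ltn_divLR.
Qed.

Lemma grid_step_le k : lam 0%N = 0 -> lam M = 1 -> (k < M * K)%N -> grid k.+1 <= grid k + K%:R^-1.
Proof.
move=> l0 l1 kM; have [-> _] := grid_step k.
have jM : (k %/ K < M)%N by rewrite ltn_divLR.
rewrite lerD2l ler_piMr ?invr_ge0//.
have l0' : 0 <= lam 0%N by rewrite l0.
have := lam_le1 lamS l1 jM; have := lam_ge0 l0' lamS (ltnW jM); lra.
Qed.

(** Both sides are affine between consecutive breakpoints, so the inequality there interpolates to
    the grid. *)
Lemma grid_convex (a : nat -> R) k : (forall j, (j <= M)%N ->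
    \sum_(1 <= i < j.+1) a i * (lam i - lam i.-1) <= lam j) -> (k <= M * K)%N ->
  \sum_(1 <= i < k.+1) a (piece i) * (grid i - grid i.-1) <= grid k.
Proof.
move=> aM kM; have := @grid_sum R^o a (fun x => - x) k.
have e (x y : R) : - x - - y = y - x by ring.
under eq_bigr do rewrite e; under [in RHS]eq_bigr do rewrite e.
rewrite e => h; rewrite -[leLHS]/(\sum_(1 <= i < k.+1) a (piece i) *: ((grid i - grid i.-1) : R^o)) h.
set j := (k %/ K)%N; have jM : (j <= M)%N by rewrite -(leq_pmul2r K0) (leq_trans _ kM)// leq_divM.
move: jM; rewrite leq_eqVlt => /orP[/eqP jM|jM].
  have kE : k = (M * K)%N.
    by apply/eqP; rewrite eqn_leq kM -jM leq_divM.
  by rewrite kE grid_mul -jM subrr scaler0 addr0; apply: aM; rewrite jM.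
have h1 := aM j (ltnW jM); have := aM j.+1 jM; rewrite big_nat_recr//= => h2.
pose t : R := (k %% K)%:R / K%:R.
have t0 : 0 <= t by rewrite divr_ge0.
have t1 : t <= 1 by rewrite ler_pdivrMr ?ltr0n// mul1r ler_nat ltnW// ltn_pmod.
have gE : grid k = lam j + t * (lam j.+1 - lam j) by [].
rewrite gE addrAC subrr add0r -[_ *: _]/(a j.+1 * (t * (lam j.+1 - lam j))).
rewrite -[\sum_(_ <= _ < _) _]/(\sum_(1 <= i < j.+1) a i * (lam i - lam i.-1)).
move: h1 h2; set S := \sum_(_ <= _ < _) _; set D := lam j.+1 - lam j => h1 h2.
have s0 : 0 <= 1 - t by rewrite subr_ge0.
have := ler_wpM2l s0 h1; have := ler_wpM2l t0 h2; rewrite /D; lra.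
Qed.

End refinement.

(** * The lower tail for the original scales *)

Section lower_tail.
Context {R : realType}.
Variables (lam : nat -> R) (M : nat).
Hypothesis lam0 : lam 0%N = 0.
Hypothesis lamS : forall i, (i < M)%N -> lam i < lam i.+1.
Hypothesis lamM : lam M = 1.
Hypothesis M0 : (0 < M)%N.
Variables (sigma b : nat -> R).
Hypothesis sigma0 : forall i, (0 < i <= M)%N -> 0 < sigma i.
Hypothesis b0 : forall i, (0 < i <= M)%N -> 0 < b i.
Hypothesis ck : forall k, (0 < k <= M)%N ->
     \sum_(1 <= i < k.+1) (sigma i / b i) ^+ 2 * (lam i - lam i.-1) <= lam k.
Variables (eps eta : R).
Hypothesis eps0 : 0 < eps.
Hypothesis eta0 : 0 < eta.

Let a i := sigma i / b i.
Let a10 : 0 < a 1%N. Proof. by rewrite divr_gt0 ?sigma0 ?b0. Qed.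
Let s10 : 0 < sigma 1%N. Proof. by rewrite sigma0. Qed.
Let lam1 : 0 < lam 1%N. Proof. by rewrite -lam0 lamS. Qed.

(** Dropping the first [k0] grid intervals saves [a 1 ^+ 2 * grid lam K k0] of the budget. This must
    cover two steps [1 / K]: the lag between [mu k.+1] and [mu k] in [a_tau], and the margin [tau].
    So [k0] is fixed first, and then [K] is taken so large that the dropped part barely matters for
    variance and speed. *)
Let choose_grid : exists k0 K, [/\ (0 < k0)%N, (k0 < K)%N,
  K%:R^-1 <= a 1%N ^+ 2 * grid lam K k0 - K%:R^-1,
  sigma 1%N ^+ 2 * (2 * grid lam K k0) <= eps ^+ 2 / 8 & sigma 1%N * a 1%N * grid lam K k0 <= eps / 4].
Proof.
have c0 : 0 < a 1%N ^+ 2 * lam 1%N by rewrite mulr_gt0// exprn_gt0.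
pose k0 := (Num.truncn (2 / (a 1%N ^+ 2 * lam 1%N))).+1.
have k0c : 2 <= a 1%N ^+ 2 * lam 1%N * k0%:R.
  by rewrite mulrC -ler_pdivrMr// ltW// truncnS_gt.
pose B := Num.min (eps ^+ 2 / (16 * sigma 1%N ^+ 2)) (eps / (4 * (sigma 1%N * a 1%N))).
have B0 : 0 < B.
  have h16 : 0 < 16 * sigma 1%N ^+ 2 by rewrite mulr_gt0// exprn_gt0.
  have h4 : 0 < 4 * (sigma 1%N * a 1%N) by rewrite mulr_gt0// mulr_gt0.
  have e2 : 0 < eps ^+ 2 by rewrite exprn_gt0.
  by rewrite lt_min !divr_gt0.
pose K := ((Num.truncn (lam 1%N * k0%:R / B)).+1 + k0)%N.
have kK : (k0 < K)%N by rewrite /K addSn ltnS leq_addl.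
have K0 : (0 < K)%N by apply: leq_trans kK.
have KR : 0 < K%:R :> R by rewrite ltr0n.
have gE : grid lam K k0 = lam 1%N * k0%:R / K%:R.
  by rewrite /grid divn_small// modn_small// lam0 add0r subr0; ring.
have gB : grid lam K k0 <= B.
  rewrite gE ler_pdivrMr// [B * _]mulrC -ler_pdivrMr//; apply: le_trans (ltW (truncnS_gt _)) _.
  by rewrite ler_nat /K leq_addr.
exists k0, K; split=> //.
- rewrite lerBrDr gE.
  have -> : a 1%N ^+ 2 * (lam 1%N * k0%:R / K%:R) = (a 1%N ^+ 2 * lam 1%N * k0%:R) / K%:R by ring.
  have -> : K%:R^-1 + K%:R^-1 = 2 / K%:R :> R by field; rewrite gt_eqF.
  by rewrite ler_pM2r ?invr_gt0.
- have : grid lam K k0 <= eps ^+ 2 / (16 * sigma 1%N ^+ 2) by apply: (le_trans gB); rewrite ge_min lexx.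
  rewrite ler_pdivlMr ?mulr_gt0 ?exprn_gt0//; lra.
- have sa : 0 < 4 * (sigma 1%N * a 1%N) by rewrite mulr_gt0// mulr_gt0.
  have : grid lam K k0 <= eps / (4 * (sigma 1%N * a 1%N)) by apply: (le_trans gB); rewrite ge_min lexx orbT.
  rewrite ler_pdivlMr// => h; rewrite ler_pdivlMr//; lra.
Qed.

Lemma lower_tail : \forall N \near \oo,
  forall (V : lmodType R) ip (phi : Z2 -> V) (G : gff_form N ip phi)
    d (T : measurableType d) (P : probability T R) X, gaussian_field P ip X ->
  forall E : set T, measurable E ->
  (forall x w, inV N x ->
    2 * (\sum_(1 <= i < M.+1) sigma i ^+ 2 / b i * (lam i - lam i.-1) - eps) * ln N%:R
      <= X (wsum lam G sigma M x) w -> E w) ->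
  ((1 - eta)%:E <= P E)%E.
Proof.
have [k0 [K [k00 kK tauK varK biasK]]] := choose_grid.
have K0 : (0 < K)%N by apply: leq_trans kK.
have kMK : (k0 < M * K)%N by apply: (leq_trans kK); rewrite leq_pmull.
pose n := (M * K - k0)%N.
have n0 : (0 < n)%N by rewrite subn_gt0.
have nE : (k0 + n = M * K)%N by rewrite subnKC// ltnW.
pose mu i := grid lam K (k0 + i).
pose s i := sigma (piece K (k0 + i)).
pose a' i := a (piece K (k0 + i)).
have pieceM i : (0 < i <= n)%N -> (0 < piece K (k0 + i) <= M)%N.
  move=> /andP[i0 ii]; rewrite /piece /= ltn_divLR// prednK ?addn_gt0 ?k00//.
  by rewrite -nE leq_add2l.
have shift (U : lmodType R) (f : nat -> R) (H : R -> U) k :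
    \sum_(1 <= i < k.+1) f (piece K (k0 + i)) *: (H (mu i.-1) - H (mu i)) =
    (\sum_(1 <= i < (k0 + k).+1) f (piece K i) *: (H (grid lam K i.-1) - H (grid lam K i)))
    - f 1%N *: (H (lam 0%N) - H (grid lam K k0)).
  have -> : f 1%N *: (H (lam 0%N) - H (grid lam K k0)) =
      \sum_(1 <= i < k0.+1) f (piece K i) *: (H (grid lam K i.-1) - H (grid lam K i)).
    by rewrite grid_sum// divn_small// big_nil add0r.
  elim: k => [|k IH]; first by rewrite addn0 big_nil subrr.
  by rewrite big_nat_recr//= IH addnS [in RHS]big_nat_recr//= addrAC /mu addnS.
pose be := grid lam K k0.
have mu0E : mu 0%N = be by rewrite /mu addn0.
have KV : 0 < K%:R^-1 :> R by rewrite invr_gt0 ltr0n.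
have be0 : 0 < be.
  by have : 0 < a 1%N ^+ 2 * be by [rewrite /be; lra]; rewrite pmulr_rgt0// exprn_gt0.
have mu0 : 0 < mu 0%N by rewrite mu0E.
have muS i : (i < n)%N -> mu i < mu i.+1.
  by move=> ii; rewrite /mu addnS; apply: (grid_lt K0 lamS); rewrite -nE ltn_add2l.
have mun : mu n = 1 by rewrite /mu nE grid_mul.
have be1 : be <= 1.
  by rewrite -mu0E -mun; apply: (lam_le muS).
have real_shift (f : nat -> R) k :
    \sum_(1 <= i < k.+1) f (piece K (k0 + i)) * (mu i - mu i.-1) =
    \sum_(1 <= i < (k0 + k).+1) f (piece K i) * (grid lam K i - grid lam K i.-1) - f 1%N * be.
  have := shift R^o f (fun x => - x) k.
  have e (x y : R) : - x - - y = y - x by ring.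
  under eq_bigr do rewrite e; under [X in _ = X - _ -> _]eq_bigr do rewrite e.
  by rewrite e lam0 subr0 => ->.
have a_tau k : (k < n)%N -> \sum_(1 <= i < k.+2) a' i ^+ 2 * (mu i - mu i.-1) <= mu k - K%:R^-1.
  move=> kn; rewrite (real_shift (fun i => a i ^+ 2)).
  have km : (k0 + k.+1 <= M * K)%N by rewrite -nE leq_add2l.
  have ck' j : (j <= M)%N -> \sum_(1 <= i < j.+1) a i ^+ 2 * (lam i - lam i.-1) <= lam j.
    by case: j => [|j] jM; [rewrite big_nil lam0|apply: ck].
  have h1 := @grid_convex R lam K K0 M (fun i => a i ^+ 2) (k0 + k.+1) ck' km.
  have h2 : grid lam K (k0 + k.+1) <= mu k + K%:R^-1.
    by rewrite addnS; apply: (grid_step_le K0 lamS lam0 lamM); rewrite -addnS.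
  by move: tauK; rewrite -/be; lra.
have s'0 i : (0 < i <= n)%N -> 0 <= s i by move=> /pieceM h; rewrite ltW// sigma0.
have a'0 i : (0 < i <= n)%N -> 0 <= a' i.
  by move=> /pieceM h; rewrite divr_ge0 ?ltW// ?sigma0 ?b0.
have e4 : 0 < eps / 4 by rewrite divr_gt0.
have h2 : 0 < eta / 2 by rewrite divr_gt0.
have core := lower_core mu0 muS mun n0 a'0 s'0 KV e4 h2 a_tau.
(* The dropped intervals all lie in the first original one, so their contribution is a single
   increment with weight [sigma 1]. *)
have fullE (V : lmodType R) N ip (phi : Z2 -> V) (G : gff_form N ip phi) x :
    wsum lam G sigma M x = sigma 1%N *: (coarse G 0 x - coarse G be x) + wsum mu G s n x.
  rewrite [wsum mu G s n x](shift V sigma (fun l => coarse G l x)) nE.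
  rewrite (@grid_sum _ lam K K0 V sigma (fun l => coarse G l x)) mulnK//.
  by rewrite grid_mul// subrr scaler0 addr0 lam0 addrC subrK.
have gammaE : \sum_(1 <= i < n.+1) s i * a' i * (mu i - mu i.-1) =
    \sum_(1 <= i < M.+1) sigma i ^+ 2 / b i * (lam i - lam i.-1) - sigma 1%N * a 1%N * be.
  rewrite (real_shift (fun i => sigma i * a i)) nE; congr (_ - _).
  have := grid_sum lam K0 (U := R^o) (fun i => sigma i * a i) (fun x => - x) (M * K).
  have e (x y : R) : - x - - y = y - x by ring.
  under eq_bigr do rewrite e; under [X in _ = X + _ -> _]eq_bigr do rewrite e.
  rewrite mulnK// grid_mul// subrr scaler0 addr0 => ->.
  by apply: eq_bigr => i _; rewrite /a -[LHS]/(_ * _); ring.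
near=> N => V ip phi G.
have N0 : (0 < N)%N by near: N; exact: near_pos.
have L0 : 0 <= ln N%:R :> R by rewrite ln_ge0// ler1n.
(* [increment_variance] with the error [be] itself, whence the factor 2. *)
have var x : inV N x -> sq ip (coarse G 0 x - coarse G be x) <= 2 * be * ln N%:R.
  have -> : 2 * be = be - 0 + be by ring.
  move: V ip phi G x; near: N; apply: near_infty.
  have := be0; exact (increment_variance (lexx 0) be0 be1).
have coreN : forall d (T : measurableType d) (P : probability T R) X, gaussian_field P ip X ->
  forall E : set T, measurable E ->
  (forall (v : box (N %/ 2)) w,
    2 * (\sum_(1 <= i < n.+1) s i * a' i * (mu i - mu i.-1) - eps / 4) * ln N%:R
      <= X (wsum mu G s n (bulkpt v)) w -> E w) -> ((1 - eta / 2)%:E <= P E)%E.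
  by move: V ip phi G {var}; near: N.
move=> d T P X F E mE HE.
pose D (v : box N) := - sigma 1%N *: (coarse G 0 (site v) - coarse G be (site v)).
pose Bd : set T := \bigcup_(v in [set: box N]) [set w | eps * ln N%:R <= X (D v) w].
have mBd : measurable Bd.
  apply: fin_bigcup_measurable; first exact: finite_finset.
  move=> v _; rewrite (_ : [set w | _] = X (D v) @^-1` `[eps * ln N%:R, +oo[).
    by rewrite -[X in measurable X]setTI; exact: (gf_meas F).
  by apply/seteqP; split=> w; rewrite /= in_itv/= andbT.
have PBd : (P Bd <= (eta / 2)%:E)%E.
  have th0 : 0 <= 4 / eps by rewrite divr_ge0 ?(ltW eps0).
  have HB w : Bd w -> exists v, eps * ln N%:R <= X (D v) w by move=> [v _ h]; exists v.
  apply: (le_trans (gf_union_bound F G (th := fun=> 4 / eps) mBd (fun=> th0) HB)).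
  rewrite lee_fin; apply: (@le_trans _ _ (\sum_(v : box N) expR (- ((2 + 1) * ln N%:R)))).
    apply: ler_sum => v _; rewrite ler_expR.
    have -> : 4 / eps * (eps * ln N%:R) = 4 * ln N%:R by field; rewrite gt_eqF.
    have hD : sq ip (D v) <= eps ^+ 2 / 8 * ln N%:R.
      rewrite /D (sqZ G) sqrrN; apply: (@le_trans _ _ (sigma 1%N ^+ 2 * (2 * be * ln N%:R))).
        by rewrite ler_wpM2l ?sqr_ge0// var// site_inV.
      by rewrite mulrA; apply: ler_wpM2r.
    have := ler_wpM2l (sqr_ge0 (4 / eps)) hD.
    have -> : (4 / eps) ^+ 2 * (eps ^+ 2 / 8 * ln N%:R) = 2 * ln N%:R by field; rewrite gt_eqF.
    lra.
  rewrite sumr_const card_box -[leLHS]mulr_natl; apply: (le_trans (box_count _ N0)).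
  by near: N; exact: near_exp_small.
have PU : ((1 - eta / 2)%:E <= P (E `|` Bd))%E.
  apply: (coreN _ _ _ _ F); first exact: measurableU.
  move=> v w h; have [wB|wB] := pselect (Bd w); [by right|left].
  have [u uv] := inV_site (bulkpt_inV v).
  apply: (HE (bulkpt v)); first exact: bulkpt_inV.
  rewrite fullE (gfD F).
  have hu : X (D u) w < eps * ln N%:R.
    by rewrite ltNge; apply/negP => hu; apply: wB; exists u.
  rewrite /D uv scaleNr (gfN F) in hu.
  (* The loss [2 * eps * ln N] is spent as [eps / 2] in the core estimate, [eps / 2] for the speed
     of the dropped part and [eps] for its fluctuation. *)
  have := ler_wpM2r L0 biasK; rewrite -/be; move: h; rewrite gammaE.
  by set S := \sum_(_ <= _ < _) _; set L := ln _; move: hu; rewrite -/L; lra.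
have : (P (E `|` Bd) <= P E + P Bd)%E by exact: measureU2.
move=> /(le_trans PU) hU.
have : ((1 - eta / 2)%:E <= P E + (eta / 2)%:E)%E.
  by apply: (le_trans hU); exact: leeD2l.
rewrite -leeBlDr// -EFinB; apply: le_trans; rewrite lee_fin; lra.
Unshelve. all: by end_near. Qed.

End lower_tail.

(** * The concave hull of the variance profile *)

Section primitive.
Context {R : realType}.
Local Notation mu := lebesgue_measure.

Lemma lebesgue_ocitv_fin (a b : R) : (mu (`]a, b] : set R) < +oo)%E.
Proof. by rewrite lebesgue_measure_itv /=; case: ifP => _; rewrite ?ltry// -EFinB ltry. Qed.

Lemma bounded_integrable_01 (g : R -> R) (C : R) :
  measurable_fun (`]0, 1]%classic : set R) g -> {in `]0, 1], forall r, `|g r| <= C} ->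
  mu.-integrable `]0, 1] (EFin \o g).
Proof.
move=> mg gC; apply: measurable_bounded_integrable => //.
  exact: lebesgue_ocitv_fin.
exists C; split; first exact: num_real.
by move=> A CA r; rewrite /= => hr; apply: le_trans (ltW CA); apply: gC; rewrite inE.
Qed.

Lemma primitive_bounds (g : R -> R) (C x y a b : R) :
  measurable_fun (`]0, 1]%classic : set R) g -> {in `]0, 1], forall r, `|g r| <= C} ->
  0 <= x -> x <= y -> y <= 1 -> {in `]x, y], forall r, a <= g r <= b} ->
  a * (y - x) <= \int[mu]_(r in `[0, y]) g r - \int[mu]_(r in `[0, x]) g r <= b * (y - x).
Proof.
move=> mg gC x0 xy y1 ab.
have ig := bounded_integrable_01 mg gC.
have y0 : 0 <= y by apply: le_trans xy.
have sub u v : 0 <= u -> v <= 1 -> `]u, v]%classic `<=` (`]0, 1]%classic : set R).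
  move=> u0 v1 r /=; rewrite !in_itv/= => /andP[h1 h2]; apply/andP; split; lra.
have iS u v : 0 <= u -> v <= 1 -> mu.-integrable `]u, v] (EFin \o g).
  by move=> u0 v1; apply: integrableS ig => //; apply: sub.
have E v : v <= 1 -> \int[mu]_(r in `[0, v]) g r = \int[mu]_(r in `]0, v]) g r.
  by move=> v1; rewrite Rintegral_itv_obnd_cbnd//; exact: iS.
rewrite !E ?(le_trans xy)// Rintegral_itvB ?bnd_simp//; last exact: iS.
have cI c : mu.-integrable `]x, y] (EFin \o (fun=> c)).
  apply: measurable_bounded_integrable => //.
    exact: lebesgue_ocitv_fin.
  by exists `|c|; split; [exact: num_real|move=> A cA r _; exact: ltW].
have cE c : c * (y - x) = \int[mu]_(r in `]x, y]) c.
  rewrite Rintegral_cst//; congr (_ * _).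
  have e : mu (`]x, y] : set R) = (y - x)%:E; last by rewrite -[LHS]/(fine (y - x)%:E) -e.
  rewrite lebesgue_measure_itv/= lte_fin.
  by case: ltP => // yx; have -> : y = x by [lra]; rewrite subrr.
rewrite !cE; apply/andP; split; apply: le_Rintegral => //; try exact: iS.
- by move=> r rxy; have /andP[] := ab r rxy.
- by move=> r rxy; have /andP[] := ab r rxy.
Qed.

End primitive.

(** * Concave functions against lines, and the hull of a piecewise affine function *)

Section concave.
Context {R : realType}.

Lemma concave01_affine (c m : R) : concave01 (fun s => c + m * s).
Proof.
move=> t x y _ _; have := t%:num; set u := t%:num => _.
change (- (c + m * (u * (x : R) + (1 - u) * (y : R))) <=
  u * - (c + m * (x : R)) + (1 - u) * - (c + m * (y : R))).
lra.
Qed.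

Lemma concave01_chord (f : R -> R) x z y : concave01 f -> 0 <= x -> x < z -> z < y -> y <= 1 ->
  f x * (y - z) + f y * (z - x) <= f z * (y - x).
Proof.
move=> cf x0 xz zy y1.
have yx : 0 < y - x by lra.
have t0 : 0 <= (y - z) / (y - x) by rewrite divr_ge0//; lra.
have t1 : (y - z) / (y - x) <= 1 by rewrite ler_pdivrMr//; lra.
have hx : x \in (`[0, 1]%classic : set R) by rewrite inE /= in_itv/=; apply/andP; split; lra.
have hy : y \in (`[0, 1]%classic : set R) by rewrite inE /= in_itv/=; apply/andP; split; lra.
have : - f ((y - z) / (y - x) * x + (1 - (y - z) / (y - x)) * y) <=
    (y - z) / (y - x) * - f x + (1 - (y - z) / (y - x)) * - f y.
  exact: (cf (Itv01 t0 t1) x y hx hy).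
have -> : (y - z) / (y - x) * x + (1 - (y - z) / (y - x)) * y = z by field; rewrite gt_eqF.
have -> : 1 - (y - z) / (y - x) = (z - x) / (y - x) by field; rewrite gt_eqF.
move=> h; have := ler_wpM2r (ltW yx) h.
have -> : ((y - z) / (y - x) * - f x + (z - x) / (y - x) * - f y) * (y - x) =
  - (f x * (y - z) + f y * (z - x)) by field; rewrite gt_eqF.
lra.
Qed.

(** The gap between a concave function and a line is concave; being nonpositive at [p] and
    nonnegative at [q], it cannot be positive before [p]. *)
Lemma concave01_below_left (f : R -> R) c m x p q : concave01 f -> 0 <= x -> x < p -> p < q ->
  q <= 1 -> f p <= c + m * p -> c + m * q <= f q -> f x <= c + m * x.
Proof.
move=> cf x0 xp pq q1 fp fq; have := concave01_chord cf x0 xp pq q1 => h.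
have h1 : 0 <= (c + m * p - f p) * (q - x) by apply: mulr_ge0; lra.
have h2 : 0 <= (f q - (c + m * q)) * (p - x) by apply: mulr_ge0; lra.
have : 0 <= (c + m * x - f x) * (q - p) by lra.
by rewrite pmulr_lge0 ?subr_gt0// subr_ge0.
Qed.

Lemma concave01_below_right (f : R -> R) c m x p q : concave01 f -> 0 <= p -> p < q -> q < x ->
  x <= 1 -> c + m * p <= f p -> f q <= c + m * q -> f x <= c + m * x.
Proof.
move=> cf p0 pq qx x1 fp fq; have := concave01_chord cf p0 pq qx x1 => h.
have h1 : 0 <= (c + m * q - f q) * (x - p) by apply: mulr_ge0; lra.
have h2 : 0 <= (f p - (c + m * p)) * (x - q) by apply: mulr_ge0; lra.
have : 0 <= (c + m * x - f x) * (q - p) by lra.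
by rewrite pmulr_lge0 ?subr_gt0// subr_ge0.
Qed.

End concave.

Section hull.
Context {R : realType}.
Variables (lam : nat -> R) (M : nat).
Hypothesis lam0 : lam 0%N = 0.
Hypothesis lamS : forall i, (i < M)%N -> lam i < lam i.+1.
Hypothesis lamM : lam M = 1.
Variables (v : nat -> R) (J Jhat : R -> R).
Hypothesis v0 : forall i, (i < M)%N -> 0 <= v i.+1.
Hypothesis J_affine : forall i x y, (i < M)%N -> lam i <= x -> x <= y -> y <= lam i.+1 ->
  J y - J x = v i.+1 * (y - x).
Hypothesis hull : least_concave_majorant J Jhat.

Let concave_hull : concave01 Jhat. Proof. by case: hull. Qed.

Let lam0ge : 0 <= lam 0%N. Proof. by rewrite lam0. Qed.
Let lam_ge i : (i <= M)%N -> 0 <= lam i. Proof. exact: lam_ge0. Qed.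
Let lam_le1' i : (i <= M)%N -> lam i <= 1. Proof. exact: lam_le1. Qed.

Let majorant x : 0 <= x -> x <= 1 -> J x <= Jhat x.
Proof. by move=> x0 x1; case: hull => _ + _; apply; rewrite in_itv/= x0. Qed.

Lemma hull_le_affine c m : (forall x, 0 <= x -> x <= 1 -> J x <= c + m * x) ->
  forall x, 0 <= x -> x <= 1 -> Jhat x <= c + m * x.
Proof.
move=> Jl x x0 x1; case: hull => _ _ /(_ _ (concave01_affine c m)); apply.
  by move=> s; rewrite in_itv/= => /andP[s0 s1]; exact: Jl.
by rewrite in_itv/= x0.
Qed.

Lemma piece_le_affine c m i x : (i < M)%N -> J (lam i) <= c + m * lam i ->
  J (lam i.+1) <= c + m * lam i.+1 -> lam i <= x -> x <= lam i.+1 -> J x <= c + m * x.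
Proof.
move=> iM hp hq px xq; have pq := lamS iM.
have e1 := J_affine iM (lexx _) px xq; have e2 := J_affine iM px xq (lexx _).
have h1 : 0 <= (c + m * lam i - J (lam i)) * (lam i.+1 - x) by apply: mulr_ge0; lra.
have h2 : 0 <= (c + m * lam i.+1 - J (lam i.+1)) * (x - lam i) by apply: mulr_ge0; lra.
have -> : J x = J (lam i) + v i.+1 * (x - lam i) by lra.
have E2 : J (lam i.+1) = J (lam i) + v i.+1 * (lam i.+1 - lam i) by lra.
have : 0 <= (c + m * x - (J (lam i) + v i.+1 * (x - lam i))) * (lam i.+1 - lam i).
  by move: h2; rewrite E2; lra.
by rewrite pmulr_lge0 ?subr_gt0// subr_ge0.
Qed.

Definition hull_slope i : R := (Jhat (lam i) - Jhat (lam i.-1)) / (lam i - lam i.-1).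

(** The chord of the hull over a piece, prolonged to a line, majorizes [J]: on the piece because [J]
    is affine there, elsewhere because the concave hull is below its prolonged chords. Minimality
    puts the hull below the chord, concavity above it. *)
Lemma hull_affine i x : (i < M)%N -> lam i <= x -> x <= lam i.+1 ->
  Jhat x = Jhat (lam i) + hull_slope i.+1 * (x - lam i).
Proof.
move=> iM px xq; set m := hull_slope i.+1; have pq := lamS iM.
have d0 : 0 < lam i.+1 - lam i by rewrite subr_gt0.
have mE : m * (lam i.+1 - lam i) = Jhat (lam i.+1) - Jhat (lam i).
  by rewrite /m /hull_slope /= divfK// gt_eqF.
pose c := Jhat (lam i) - m * lam i.
have ep : c + m * lam i = Jhat (lam i) by rewrite /c; ring.
have eq' : c + m * lam i.+1 = Jhat (lam i.+1) by rewrite /c; lra.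
have p0 := lam_ge (ltnW iM); have q1 := lam_le1' iM.
have p1 := lam_le1' (ltnW iM); have q0 := lam_ge iM.
have Jl y : 0 <= y -> y <= 1 -> J y <= c + m * y.
  move=> y0 y1; have [yp|py] := ltP y (lam i).
    apply: le_trans (majorant y0 y1) _.
    by apply: (concave01_below_left concave_hull y0 yp pq q1); rewrite ?ep ?eq'.
  have [qy|yq] := ltP (lam i.+1) y.
    apply: le_trans (majorant y0 y1) _.
    by apply: (concave01_below_right concave_hull p0 pq qy y1); rewrite ?ep ?eq'.
  by apply: (piece_le_affine iM _ _ py yq); rewrite ?ep ?eq'; apply: majorant.
have x0 : 0 <= x by lra.
have x1 : x <= 1 by lra.
apply/eqP; rewrite eq_le; apply/andP; split.
  have := hull_le_affine Jl x0 x1; rewrite /c; lra.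
have [<-|px'] := eqVneq (lam i) x; first by rewrite subrr mulr0 addr0.
have [->|xq'] := eqVneq x (lam i.+1); first by rewrite mE; lra.
have pltx : lam i < x by rewrite lt_neqAle px'.
have xltq : x < lam i.+1 by rewrite lt_neqAle xq'.
have h := concave01_chord concave_hull p0 pltx xltq q1.
have : 0 <= (Jhat x - (Jhat (lam i) + m * (x - lam i))) * (lam i.+1 - lam i).
  have -> : (Jhat x - (Jhat (lam i) + m * (x - lam i))) * (lam i.+1 - lam i) =
    Jhat x * (lam i.+1 - lam i) - Jhat (lam i) * (lam i.+1 - lam i) -
    (m * (lam i.+1 - lam i)) * (x - lam i) by ring.
  rewrite mE; lra.
by rewrite pmulr_lge0// subr_ge0.
Qed.

(** A strict corner of the hull that does not touch [J] could be cut off by a line of intermediate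
    slope that still majorizes [J], against minimality. *)
Lemma hull_contact i : (i.+1 < M)%N -> hull_slope i.+2 < hull_slope i.+1 ->
  Jhat (lam i.+1) = J (lam i.+1).
Proof.
move=> iM sl; have iM' := ltnW iM; have pq := lamS iM'; have qr := lamS iM.
have p0 := lam_ge (ltnW iM'); have r1 := lam_le1' iM.
have q0 := lam_ge iM'; have q1 := lam_le1' iM'.
apply/eqP; rewrite eq_le; apply/andP; split; last exact: majorant.
rewrite leNgt; apply/negP => gap.
have Eq := hull_affine iM' (ltW pq) (lexx _); have Er := hull_affine iM (ltW qr) (lexx _).
set p := lam i in pq p0 Eq Er; set q := lam i.+1 in pq qr q0 q1 Eq Er gap *.
set r := lam i.+2 in qr r1 Er.
set m1 := hull_slope i.+1 in sl Eq; set m2 := hull_slope i.+2 in sl Er.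
pose m := (m1 + m2) / 2.
have g1 : 0 < (m1 - m) * (q - p) by rewrite mulr_gt0// /m; lra.
have g2 : 0 < (m - m2) * (r - q) by rewrite mulr_gt0// /m; lra.
(* The depth of the cut: small enough for the line to stay above [J] at the corner and above the
   hull at both neighbouring breakpoints. *)
pose del := Num.min (Jhat q - J q) (Num.min ((m1 - m) * (q - p)) ((m - m2) * (r - q))).
have d0 : 0 < del by rewrite /del !lt_min g1 g2 !andbT subr_gt0.
have [d1 d2 d3] : [/\ del <= Jhat q - J q, del <= (m1 - m) * (q - p) & del <= (m - m2) * (r - q)].
  by rewrite /del !ge_min !lexx !orbT.
pose c := Jhat q - del - m * q.
have lp : Jhat p <= c + m * p by rewrite /c; lra.
have lr : Jhat r <= c + m * r by rewrite /c; lra.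
have lq : c + m * q <= Jhat q by rewrite /c; lra.
have Jq : J q <= c + m * q by rewrite /c; lra.
have Jp : J p <= c + m * p by apply: le_trans lp; apply: majorant; lra.
have Jr : J r <= c + m * r by apply: le_trans lr; apply: majorant; lra.
have Jl y : 0 <= y -> y <= 1 -> J y <= c + m * y.
  move=> y0 y1; have [yp|py] := ltP y p.
    apply: le_trans (majorant y0 y1) _.
    exact: (concave01_below_left concave_hull y0 yp pq q1).
  have [ry|yr] := ltP r y.
    apply: le_trans (majorant y0 y1) _.
    exact: (concave01_below_right concave_hull q0 qr ry y1).
  have [yq|qy] := leP y q; first exact: (piece_le_affine iM' _ _ py yq).
  exact: (piece_le_affine iM _ _ (ltW qy) yr).
have := hull_le_affine Jl q0 q1; rewrite /c; lra.
Qed.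

(** [J] is nondecreasing because its slopes are nonnegative, so the constant [J 1] is a concave
    majorant. *)
Lemma hull_end : Jhat 1 = J 1.
Proof.
apply/eqP; rewrite eq_le; apply/andP; split; last exact: majorant.
have Jle i x : (i <= M)%N -> 0 <= x -> x <= lam i -> J x <= J (lam i).
  elim: i x => [|i IH] x iM x0 xi.
    by have -> : x = lam 0%N by rewrite lam0 in xi *; lra.
  have pq := lamS iM.
  have h y : lam i <= y -> y <= lam i.+1 -> J y <= J (lam i.+1).
    move=> py yq; have := J_affine iM py yq (lexx _).
    have : 0 <= v i.+1 * (lam i.+1 - y) by rewrite mulr_ge0 ?v0// subr_ge0.
    lra.
  have [xl|lx] := leP x (lam i); last by apply: h => //; exact: ltW.
  by apply: le_trans (IH _ (ltnW iM) x0 xl) _; apply: h => //; exact: ltW.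
have : forall x, 0 <= x -> x <= 1 -> J x <= J 1 + 0 * x.
  by move=> x x0 x1; rewrite mul0r addr0 -lamM; apply: Jle; rewrite ?lamM.
by move=> /hull_le_affine /(_ 1 ler01 (lexx _)); rewrite mul0r addr0.
Qed.

Lemma hull_slope_anti i : (i.+1 < M)%N -> hull_slope i.+2 <= hull_slope i.+1.
Proof.
move=> iM; have iM' := ltnW iM; have pq := lamS iM'; have qr := lamS iM.
have h := concave01_chord concave_hull (lam_ge (ltnW iM')) pq qr (lam_le1' iM).
have e1 := hull_affine iM' (ltW pq) (lexx _); have e2 := hull_affine iM (ltW qr) (lexx _).
have d0 : 0 < (lam i.+1 - lam i) * (lam i.+2 - lam i.+1) by rewrite mulr_gt0 ?subr_gt0.
have : 0 <= (hull_slope i.+1 - hull_slope i.+2) *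
    ((lam i.+1 - lam i) * (lam i.+2 - lam i.+1)) by move: h; rewrite e2 e1; lra.
by rewrite pmulr_lge0// subr_ge0.
Qed.

Hypothesis J00 : J 0 = 0.
Hypothesis hull00 : Jhat 0 = 0.

(* The defect [J - Jhat] vanishes at every breakpoint where the slope of the
   hull changes, so an Abel summation against a function of the slope leaves
   only its last term. *)
Lemma hull_abel (f : nat -> R) k :
  (forall i, (i.+1 < M)%N -> hull_slope i.+2 = hull_slope i.+1 -> f i.+2 = f i.+1) ->
  (0 < k <= M)%N ->
  \sum_(1 <= i < k.+1) (v i - hull_slope i) * (lam i - lam i.-1) * f i =
  (J (lam k) - Jhat (lam k)) * f k.
Proof.
move=> f_slope; elim: k => [//|k IH] /andP[_ kM]; rewrite big_nat_recr//=.
have pq := lamS kM.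
have e1 := J_affine kM (lexx _) (ltW pq) (lexx _).
have e2 := hull_affine kM (ltW pq) (lexx _).
have -> : (v k.+1 - hull_slope k.+1) * (lam k.+1 - lam k) =
  (J (lam k.+1) - Jhat (lam k.+1)) - (J (lam k) - Jhat (lam k)).
  by rewrite mulrBl -e1 e2; ring.
case: k IH kM {pq e1 e2} => [|k] IH kM.
  by rewrite big_geq// lam0 J00 hull00 add0r subrr subr0.
rewrite IH ?(ltnW kM)//.
have [sl|sl] := eqVneq (hull_slope k.+2) (hull_slope k.+1).
  by rewrite (f_slope _ kM sl); ring.
have := hull_contact kM; rewrite lt_neqAle sl hull_slope_anti// => /(_ isT) ->; ring.
Qed.

End hull.

(** * Primitives of functions constant on each scale interval *)

Section piecewise.
Context {R : realType}.
Variables (lam : nat -> R) (M : nat).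
Hypothesis lam0 : lam 0%N = 0.
Hypothesis lamS : forall i, (i < M)%N -> lam i < lam i.+1.
Hypothesis lamM : lam M = 1.
Local Notation mu := lebesgue_measure.

Definition step_fun (c : nat -> R) (s : R) : R :=
  \sum_(1 <= i < M.+1) c i * \1_(`]lam i.-1, lam i]%classic) s.

Lemma piece_of x : 0 < x -> x <= 1 -> exists2 i, (i < M)%N & x \in `]lam i, lam i.+1].
Proof.
move=> x0; rewrite -lamM; have : (M <= M)%N by [].
elim: {1 3}M => [|k IH] kM xk; first by move: x0; rewrite ltNge -lam0 xk.
have [xl|lx] := leP x (lam k); first exact: IH (ltnW kM) xl.
by exists k => //; rewrite in_itv/= lx.
Qed.

Lemma step_fun_on c i x : (i < M)%N -> x \in `]lam i, lam i.+1] -> step_fun c x = c i.+1.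
Proof.
move=> iM xi; rewrite /step_fun (bigD1_seq i.+1) ?mem_index_iota ?iota_uniq//=.
rewrite indicE mem_set ?mulr1//= big1_seq ?addr0// => j /andP[ji].
rewrite mem_index_iota => /andP[j0 jM]; rewrite indicE memNset ?mulr0//=.
move: xi; rewrite !in_itv/= => /andP[h1 h2] /andP[h3 h4].
have [lt|gt|e] := ltngtP j i.+1; last by rewrite e eqxx in ji.
  have := lam_le lamS (i := j) (j := i) lt (ltnW iM); lra.
have := lam_le lamS (i := i.+1) (j := j.-1); rewrite -ltnS prednK// gt => /(_ isT).
by rewrite (leq_trans (leq_pred _))// => /(_ isT); lra.
Qed.

Variables (g : R -> R) (c : nat -> R).
Hypothesis gE : forall i, (i < M)%N -> {in `]lam i, lam i.+1], forall r, g r = c i.+1}.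

Let g_step : {in (`]0, 1]%classic : set R), step_fun c =1 g}.
Proof.
move=> x; rewrite inE/= in_itv/= => /andP[x0 x1].
by have [i iM xi] := piece_of x0 x1; rewrite (step_fun_on _ iM xi) (gE iM xi).
Qed.

Lemma piecewise_measurable : measurable_fun (`]0, 1]%classic : set R) g.
Proof.
apply: (eq_measurable_fun _ g_step); apply: measurable_sum => i.
by apply: measurable_funM => //; apply: measurable_indic.
Qed.

Lemma piecewise_bounded : {in `]0, 1], forall r, `|g r| <= \sum_(1 <= i < M.+1) `|c i|}.
Proof.
move=> r; rewrite in_itv/= => /andP[r0 r1]; have [i iM ri] := piece_of r0 r1.
rewrite (gE iM ri) (bigD1_seq i.+1) ?mem_index_iota ?iota_uniq//= lerDl.
by apply: sumr_ge0.
Qed.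

Lemma piecewise_primitive i x y : (i < M)%N -> lam i <= x -> x <= y -> y <= lam i.+1 ->
  \int[mu]_(r in `[0, y]) g r - \int[mu]_(r in `[0, x]) g r = c i.+1 * (y - x).
Proof.
move=> iM px xy yq; have l0 : 0 <= lam 0%N by rewrite lam0.
have p0 := lam_ge0 l0 lamS (ltnW iM); have q1 := lam_le1 lamS lamM iM.
have x0 : 0 <= x by lra.
have y1 : y <= 1 by lra.
have ab : {in `]x, y], forall r, c i.+1 <= g r <= c i.+1}.
  move=> r; rewrite in_itv/= => /andP[xr ry]; rewrite (gE iM) ?lexx// in_itv/=.
  by apply/andP; split; lra.
have := primitive_bounds piecewise_measurable piecewise_bounded x0 xy y1 ab.
by rewrite -eq_le => /eqP ->.
Qed.

Lemma piecewise_integral k : (k <= M)%N ->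
  \int[mu]_(r in `[0, lam k]) g r = \sum_(1 <= i < k.+1) c i * (lam i - lam i.-1).
Proof.
elim: k => [_|k IH kM]; first by rewrite lam0 set_itv1 Rintegral_set1 big_nil.
have h := piecewise_primitive kM (lexx _) (ltW (lamS kM)) (lexx _).
by rewrite [RHS]big_nat_recr//= -(IH (ltnW kM)) -h addrC subrK.
Qed.

End piecewise.

(** * The effective deviation as the slope of the hull *)

Section effective_sigma.
Context {R : realType}.
Variables (lam sigma : nat -> R) (M : nat).
Hypothesis lam0 : lam 0%N = 0.
Hypothesis lamS : forall i, (i < M)%N -> lam i < lam i.+1.
Hypothesis lamM : lam M = 1.
Variables (Jhat sbar : R -> R).
Hypothesis hJ : least_concave_majorant (var_integral (sigma_fun M sigma lam)) Jhat.
Hypothesis hs : is_effective_sigma Jhat sbar.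
Local Notation mu := lebesgue_measure.
Local Notation J := (var_integral (sigma_fun M sigma lam)).
Local Notation slope := (hull_slope lam Jhat).

Let M0 : (0 < M)%N.
Proof. by rewrite lt0n; apply/eqP => M0; move: lam0 lamM; rewrite M0 => ->; lra. Qed.

Let lam0ge : 0 <= lam 0%N. Proof. by rewrite lam0. Qed.

Let sbar0 x : 0 < x -> x <= 1 -> 0 < sbar x.
Proof. by move=> x0 x1; case: hs => h _ _ _ _; apply: h; rewrite in_itv/= x0. Qed.

Let sbar_anti x y : 0 < x -> x <= y -> y <= 1 -> sbar y <= sbar x.
Proof.
move=> x0 xy y1; case: hs => _ h _ _ _; apply: h => //; rewrite in_itv/=; apply/andP; split; lra.
Qed.

Let sigma_fun_on i : (i < M)%N ->
  {in `]lam i, lam i.+1], forall r, sigma_fun M sigma lam r = sigma i.+1}.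
Proof.
move=> iM r ri; rewrite /sigma_fun -/(step_fun lam M sigma r) (step_fun_on lamS _ iM ri).
have r0 : 0 < r.
  by move: ri; rewrite in_itv/= => /andP[+ _]; apply: le_lt_trans; exact: lam_ge0 (ltnW iM).
by rewrite indicE memNset ?mulr0 ?add0r//= => r00; rewrite r00 ltxx in r0.
Qed.

(** Monotonicity alone would allow a blow-up at 0; constancy on the first step interval excludes
    it. *)
Let sbar_bound : exists C, forall r, 0 < r -> r <= 1 -> sbar r <= C.
Proof.
case: hs => _ _ _ [n [t [t0 tn tS tc]]] _.
have n0 : (0 < n)%N by rewrite lt0n; apply/eqP => n0; move: t0 tn; rewrite n0 => ->; lra.
have t1 := tS _ n0; have [C hC] := tc _ n0; rewrite t0 in t1 hC; exists C => r r0 r1.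
have [rt|tr] := ltP r (t 1%N); first by rewrite hC// in_itv/= r0.
have u0 : 0 < t 1%N / 2 by rewrite divr_gt0.
rewrite -(hC (t 1%N / 2)); first by apply: sbar_anti => //; lra.
by rewrite in_itv/= u0 /=; lra.
Qed.

Let sbar_measurable : measurable_fun (`]0, 1]%classic : set R) sbar.
Proof.
have [C hC] := sbar_bound.
(* A nonincreasing extension to the whole line, measurable by monotonicity. *)
pose h r := if r <= 0 then C else if r <= 1 then sbar r else 0.
have C0 : 0 <= C by apply: le_trans (hC 1 ltr01 (lexx _)); rewrite ltW// sbar0.
have e : {in (`]0, 1]%classic : set R), h =1 sbar}.
  by move=> x; rewrite inE/= in_itv/= => /andP[x0 x1]; rewrite /h leNgt x0 /= x1.
apply: (eq_measurable_fun _ e); apply: nonincreasing_measurable => // x y yx; rewrite /h.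
case: (leP y 0) => y0; case: (leP x 0) => x0.
- by [].
- by move: (lt_le_trans x0 yx); rewrite ltNge y0.
- by case: (leP y 1) => y1 //; exact: hC.
- case: (leP y 1) => y1; first by rewrite (le_trans yx y1); exact: sbar_anti.
  by case: (leP x 1) => x1 //; rewrite ltW// sbar0.
Qed.

Let hull_bounds x y : 0 < x -> x <= y -> y <= 1 ->
  sbar y ^+ 2 * (y - x) <= Jhat y - Jhat x <= sbar x ^+ 2 * (y - x).
Proof.
move=> x0 xy y1; have [C hC] := sbar_bound.
have E z : 0 < z -> z <= 1 -> Jhat z = \int[mu]_(r in `[0, z]) sbar r ^+ 2.
  by move=> z0 z1; case: hs => _ _ _ _ h; apply: h; rewrite in_itv/= z0.
rewrite !E//; [|lra..].
apply: (@primitive_bounds R (fun r => sbar r ^+ 2) (C ^+ 2)) => //.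
- exact: (measurable_funX 2 sbar_measurable).
- move=> r; rewrite in_itv/= => /andP[r0 r1].
  have s0 := ltW (sbar0 r0 r1); have sC := hC r r0 r1.
  by rewrite ger0_norm ?sqr_ge0// lerXn2r// nnegrE (le_trans s0).
- exact: ltW.
- move=> r; rewrite in_itv/= => /andP[xr ry]; have r0 : 0 < r by lra.
  have r1 : r <= 1 by lra.
  have y0 : 0 < y by lra.
  have x1 : x <= 1 by lra.
  by apply/andP; split; rewrite lerXn2r ?nnegrE ?(ltW (sbar0 _ _))//; apply: sbar_anti => //; lra.
Qed.

Let v i := sigma i ^+ 2.

Let sq_on i : (i < M)%N ->
  {in `]lam i, lam i.+1], forall r, sigma_fun M sigma lam r ^+ 2 = v i.+1}.
Proof. by move=> iM r ri; rewrite (sigma_fun_on iM ri). Qed.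

Let J_affine i x y : (i < M)%N -> lam i <= x -> x <= y -> y <= lam i.+1 ->
  J y - J x = v i.+1 * (y - x).
Proof. exact: (piecewise_primitive lam0 lamS lamM sq_on). Qed.

Let hull_aff := hull_affine lam0 lamS lamM J_affine hJ.

(** On a piece the hull has constant slope, trapped between the values of [sbar ^+ 2] at any two
    points [x < y]. Letting [x] tend to [y] from the left and using left continuity gives equality,
    right endpoint included. *)
Lemma sbar_slope i y : (i < M)%N -> y \in `]lam i, lam i.+1] -> sbar y ^+ 2 = slope i.+1.
Proof.
move=> iM; rewrite in_itv/= => /andP[py yq].
have p0 : 0 <= lam i by apply: lam_ge0 (ltnW iM).
have q1 : lam i.+1 <= 1 by apply: lam_le1 iM.
have y1 : y <= 1 by lra.
have aff x : lam i < x -> x < y ->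
    sbar y ^+ 2 <= slope i.+1 /\ slope i.+1 <= sbar x ^+ 2.
  move=> px xy; have x0 : 0 < x by lra.
  have /andP[] := hull_bounds x0 (ltW xy) y1.
  rewrite (hull_aff iM (ltW py) yq) (hull_aff iM (ltW px)) ?(ltW (lt_le_trans xy yq))//.
  have -> : Jhat (lam i) + slope i.+1 * (y - lam i) - (Jhat (lam i) + slope i.+1 * (x - lam i)) =
    slope i.+1 * (y - x) by ring.
  by rewrite !ler_pM2r ?subr_gt0.
apply/eqP; rewrite eq_le; apply/andP; split.
  by have [] := aff ((lam i + y) / 2) ltac:(lra) ltac:(lra).
have y0 : 0 < y by lra.
have lc : sbar r @[r --> y^'-] --> sbar y by case: hs => _ _ h _ _; apply: h; rewrite in_itv/= y0.
have : sbar r * sbar r @[r --> y^'-] --> sbar y * sbar y by exact: cvgM.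
rewrite expr2; move=> /cvgr_to_ge; apply.
near=> r; rewrite -expr2.
have pr : lam i < r by near: r; exact: nbhs_left_gt.
have ry : r < y by near: r; exact: nbhs_left_lt.
by have [] := aff r pr ry.
Unshelve. all: by end_near. Qed.

Local Notation b i := (sbar (lam i)).

Let lam_pos i : (0 < i <= M)%N -> 0 < lam i /\ lam i <= 1.
Proof.
case: i => [//|i] /= iM; split; last exact: lam_le1 iM.
by apply: le_lt_trans (lamS iM); exact: lam_ge0 (ltnW iM).
Qed.

Let b_on i : (i < M)%N -> {in `]lam i, lam i.+1], forall r, sbar r = b i.+1}.
Proof.
move=> iM r ri; have [h1 h2] := lam_pos (i := i.+1) iM.
have lr : lam i.+1 \in `]lam i, lam i.+1] by rewrite in_itv/= lamS/=.
have := sbar_slope iM ri; rewrite -(sbar_slope iM lr) => /eqP.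
have r01 : 0 < r /\ r <= 1.
  move: ri; rewrite in_itv/= => /andP[h3 h4]; split; last lra.
  by apply: le_lt_trans h3; exact: lam_ge0 (ltnW iM).
by rewrite eqrXn2// ?ltW ?sbar0 ?(proj1 r01) ?(proj2 r01)// => /eqP.
Qed.

Let b_slope i : (0 < i <= M)%N -> b i ^+ 2 = slope i.
Proof.
case: i => [//|i] /= iM; apply: (sbar_slope iM); by rewrite in_itv/= lamS/=.
Qed.

Let b0 i : (0 < i <= M)%N -> 0 < b i.
Proof. by move=> /lam_pos[h1 h2]; exact: sbar0. Qed.

Let J00 : J 0 = 0.
Proof. by rewrite /var_integral set_itv1 Rintegral_set1. Qed.

(** The integral identity for the hull starts only after 0, so the value at 0 is recovered from
    affinity on the first piece. *)
Let hull00 : Jhat 0 = 0.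
Proof.
have [l0 l1] := lam_pos (i := 1) M0.
have e : Jhat (lam 1%N) = slope 1%N * lam 1%N.
  have -> : Jhat (lam 1%N) = \int[mu]_(r in `[0, lam 1%N]) sbar r ^+ 2.
    by case: hs => _ _ _ _ h; apply: h; rewrite in_itv/= l0.
  rewrite (piecewise_integral lam0 lamS lamM (c := fun i => b i ^+ 2) _ M0) => [|i iM r ri]; last first.
    by rewrite (b_on iM ri).
  by rewrite big_nat1 /= lam0 subr0 b_slope ?M0.
by have := hull_aff M0 (ltW (lamS M0)) (lexx _); rewrite e lam0; lra.
Qed.

Let abel (f : R -> R) k : (0 < k <= M)%N ->
  \sum_(1 <= i < k.+1) (v i - slope i) * (lam i - lam i.-1) * f (b i) =
  (J (lam k) - Jhat (lam k)) * f (b k).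
Proof.
move=> kM; apply: (hull_abel lam0 lamS lamM J_affine hJ J00 hull00 (f := fun i => f (b i))) => // i iM sl.
have : b i.+2 ^+ 2 == b i.+1 ^+ 2 by rewrite !b_slope ?(ltnW iM)// sl.
by rewrite eqrXn2 ?ltW ?b0 ?(ltnW iM)// => /eqP ->.
Qed.

Lemma effective_sigma_pos i : (0 < i <= M)%N -> 0 < b i. Proof. exact: b0. Qed.

Lemma effective_sigma_anti i : (0 < i < M)%N -> b i.+1 <= b i.
Proof.
move=> /andP[i0 iM]; have [h1 h2] := lam_pos (i := i.+1) iM.
have [h3 h4] : 0 < lam i /\ lam i <= 1 by apply: lam_pos; rewrite i0 ltnW.
by apply: sbar_anti => //; rewrite ltW// lamS.
Qed.

(** Abel summation against [1 / b ^+ 2]: the excess of the left side over [lam k] equals the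
    nonpositive defect [J - Jhat] at [lam k], divided by [b k ^+ 2]. *)
Lemma effective_sigma_budget k : (0 < k <= M)%N ->
  \sum_(1 <= i < k.+1) (sigma i / b i) ^+ 2 * (lam i - lam i.-1) <= lam k.
Proof.
move=> kM; have := abel (fun x => (x ^+ 2)^-1) kM; have /andP[k0 kM'] := kM.
have [l0 l1] := lam_pos kM.
have e i : (0 < i <= M)%N ->
    (v i - slope i) * (lam i - lam i.-1) * (b i ^+ 2)^-1 =
    (sigma i / b i) ^+ 2 * (lam i - lam i.-1) - (lam i - lam i.-1).
  by move=> iM; rewrite -b_slope// /v; field; rewrite gt_eqF ?b0.
rewrite (eq_big_nat _ _ (F2 := fun i => (sigma i / b i) ^+ 2 * (lam i - lam i.-1) - (lam i - lam i.-1))); last first.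
  by move=> i /andP[i0 ik]; rewrite e// i0 (leq_trans _ kM').
rewrite sumrB.
have -> : \sum_(1 <= i < k.+1) (lam i - lam i.-1) = lam k.
  by rewrite big_add1/= telescope_sumr// lam0 subr0.
move=> h; rewrite -subr_le0 h mulr_le0_ge0 ?invr_ge0 ?sqr_ge0// subr_le0.
by case: hJ => _ + _; apply; rewrite in_itv/= l1 ltW.
Qed.

(** Abel summation against [1 / b]; the last term vanishes because hull and profile agree at 1. *)
Lemma effective_sigma_speed :
  \sum_(1 <= i < M.+1) sigma i ^+ 2 / b i * (lam i - lam i.-1) =
  \sum_(1 <= i < M.+1) b i * (lam i - lam i.-1).
Proof.
have v0 i : (i < M)%N -> 0 <= v i.+1 by rewrite sqr_ge0.
have := abel (fun x => x^-1) (k := M); rewrite M0 leqnn => /(_ isT).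
rewrite lamM (hull_end lam0 lamS lamM v0 J_affine hJ) subrr mul0r => h.
apply/eqP; rewrite -subr_eq0 -sumrB -[X in _ == X]h; apply/eqP/eq_big_nat => i iM.
by rewrite -b_slope// /v; field; rewrite gt_eqF ?b0.
Qed.

Lemma effective_sigma_integral :
  \int[mu]_(s in `[0, 1]) (sigma_fun M sigma lam s ^+ 2 / sbar s) =
  \sum_(1 <= i < M.+1) sigma i ^+ 2 / b i * (lam i - lam i.-1).
Proof.
rewrite -[in LHS]lamM.
rewrite (piecewise_integral lam0 lamS lamM (c := fun i => sigma i ^+ 2 / b i))// => i iM r ri.
by rewrite (sigma_fun_on iM ri) (b_on iM ri).
Qed.

End effective_sigma.

(** * The maximum of the inhomogeneous field *)

Section field_max.
Context {R : realType} {d : measure_display} {T : measurableType d} {N : nat}.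

Lemma measurable_field_max (f : box N -> T -> R) : (forall v, measurable_fun [set: T] (f v)) ->
  measurable_fun [set: T] (fun w => field_max (fun v => f v w)).
Proof.
move=> mf; rewrite /field_max; elim: (index_enum _) => [|v r IH].
  by under eq_fun do rewrite big_nil; exact: mf.
by under eq_fun do rewrite big_cons; exact: measurable_maxr.
Qed.

Lemma field_max_ge (f : box N -> R) v : f v <= field_max f.
Proof. by rewrite /field_max; apply: le_bigmax. Qed.

Lemma field_max_ex (f : box N -> R) : exists v, field_max f = f v.
Proof.
rewrite /field_max; elim/big_ind: _ => [|x y [u ->] [v ->]|v _]; first by exists (ord0, ord0).
  by rewrite /Order.max; case: ifP => _; [exists v|exists u].
by exists v.
Qed.

End field_max.

Section inhomogeneous_gaussian.
Context {R : realType} {dW : measure_display} {OmW : measurableType dW}.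
Variables (PW : Z2 -> probability OmW R) (W : nat -> OmW -> Z2).
Hypothesis hW : forall u, simple_random_walk (PW u) W u.
Context {d : measure_display} {T : measurableType d}.
Variables (P : probability T R) (N : nat) (phi : box N -> {RV P >-> R}).
Hypothesis gff : is_gff (green PW W (VN N)) phi.
Variable phic : R -> box N -> T -> R.
Hypothesis hphic : forall (l : R) (v : box N), 0 <= l <= 1 ->
  is_cond_expectation P (outer_sigma_algebra (fun w => phi w : T -> R) v l) (phi v) (phic l v).
Variables (M : nat) (sigma lam : nat -> R).
Hypothesis lam01 : forall i, (i <= M)%N -> 0 <= lam i <= 1.

Lemma gff_gaussian_field : gaussian_field P (cov phi) (lincomb phi).
Proof.
have [gphi phi0 _] := gff; split.
- exact: lincombL.
- exact: measurable_lincomb.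
- exact: lincomb_mgf.
Qed.

Local Notation G := (gff_is_form hW gff).
Local Notation psi := (inhomogeneous_field M sigma lam phic).

Lemma measurable_inhomogeneous v : measurable_fun [set: T] (psi v).
Proof.
rewrite /inhomogeneous_field; under eq_fun do rewrite big_add1 big_mkord.
apply: measurable_sum => i; apply: measurable_funM => //; apply: measurable_funB.
  exact: cond_expectation_measurable (hphic v (lam01 (ltn_ord i))).
exact: cond_expectation_measurable (hphic v (lam01 (ltnW (ltn_ord i)))).
Qed.

(** Only finitely many scales and sites occur, so the exceptional sets of the conditional
    expectations merge into one measurable null set. *)
Lemma inhomogeneous_wsum : exists B : set T, [/\ measurable B, P B = 0%E & forall w, ~ B w ->
  forall v, psi v w = lincomb phi (wsum lam G sigma M (site v)) w].
Proof.
pose X (l : R) (v : box N) := lincomb phi (dirac_at N (site v) - prj G (bx N (site v) (rad N l)) (site v)).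
pose D (j : 'I_M.+1 * box N) := [set w | phic (lam j.1) j.2 w != X (lam j.1) j.2 w].
have lj (j : 'I_M.+1 * box N) : 0 <= lam j.1 <= 1 by apply: lam01; rewrite -ltnS.
have mD j : measurable (D j).
  apply: measurable_neq; last exact: measurable_lincomb.
  exact: cond_expectation_measurable (hphic j.2 (lj j)).
have nD j : P (D j) = 0%E by exact: cond_field_ae (hphic j.2 (lj j)).
exists (\big[setU/set0]_j D j); split.
- exact: bigsetU_measurable.
- suff [] : measurable (\big[setU/set0]_j D j) /\ P (\big[setU/set0]_j D j) = 0%E by [].
  apply: (big_ind (fun B => measurable B /\ P B = 0%E)) => //.
  by move=> A B [mA A0] [mB B0]; split; [exact: measurableU|exact: null_set_setU].
move=> w wB v.
have E i : (i <= M)%N -> phic (lam i) v w = X (lam i) v w.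
  move=> iM; have [//|ne] := eqVneq (phic (lam i) v w) (X (lam i) v w); case: wB.
  have iM' : (i < M.+1)%N by rewrite ltnS.
  by rewrite (bigD1 (Ordinal iM', v))//=; left.
rewrite /inhomogeneous_field /wsum.
have XB x y : lincomb phi (x - y) w = lincomb phi x w - lincomb phi y w.
  exact: (gfB gff_gaussian_field).
have Xsum (F : nat -> coefs N) : lincomb phi (\sum_(1 <= i < M.+1) sigma i *: F i) w =
    \sum_(1 <= i < M.+1) sigma i * lincomb phi (F i) w.
  elim: (index_iota _ _) => [|i r IH]; first by rewrite !big_nil (gf0 gff_gaussian_field).
  by rewrite !big_cons (gfD gff_gaussian_field) (gfZ gff_gaussian_field) IH.
rewrite Xsum; apply: eq_big_nat => i /andP[i0 iM]; rewrite !E//; last first.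
  by rewrite (leq_trans (leq_pred i)).
have XE l : X l v w = lincomb phi (dirac_at N (site v)) w - lincomb phi (coarse G l (site v)) w.
  exact: XB.
have IE : lincomb phi (incr lam G i (site v)) w =
    lincomb phi (coarse G (lam i.-1) (site v)) w - lincomb phi (coarse G (lam i) (site v)) w.
  exact: XB.
have cancel (x y z : R) : x - y - (x - z) = z - y by ring.
by rewrite !XE IE cancel.
Qed.

End inhomogeneous_gaussian.

Lemma field_max_deviation (R : realType)
  (dW : measure_display) (OmW : measurableType dW)
  (PW : Z2 -> probability OmW R) (W : nat -> OmW -> Z2)
  (hW : forall u, simple_random_walk (PW u) W u)
  (M : nat) (sigma lam : nat -> R)
  (hsigma : forall i, (1 <= i <= M)%N -> 0 < sigma i)
  (hlam0 : lam 0%N = 0) (hlamM : lam M = 1)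
  (hlam : forall i, (i < M)%N -> lam i < lam i.+1)
  (Jhat sbar : R -> R)
  (hJhat : least_concave_majorant (var_integral (sigma_fun M sigma lam)) Jhat)
  (hsbar : is_effective_sigma Jhat sbar) (eps eta : R) : 0 < eps -> 0 < eta ->
  \forall N \near \oo, forall (d : measure_display) (T : measurableType d) (P : probability T R)
    (phi : box N -> {RV P >-> R}) (phic : R -> box N -> T -> R),
  is_gff (green PW W (VN N)) phi ->
  (forall (l : R) (v : box N), 0 <= l <= 1 ->
    is_cond_expectation P (outer_sigma_algebra (fun w => phi w : T -> R) v l)
       (phi v) (phic l v)) ->
  (P [set w : T | (eps < `|field_max (fun v => inhomogeneous_field M sigma lam phic v w)
       / ln (N%:R ^+ 2) - \int[lebesgue_measure]_(s in `[0, 1])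
       ((sigma_fun M sigma lam s) ^+ 2 / sbar s)|)%R] <= eta%:E)%E.
Proof.
move=> eps0 eta0; set gam := \int[_]_(_ in _) _; pose b i := sbar (lam i).
have gamE : gam = \sum_(1 <= i < M.+1) sigma i ^+ 2 / b i * (lam i - lam i.-1).
  exact: (effective_sigma_integral hlam0 hlam hlamM hJhat hsbar).
have M0 : (0 < M)%N.
  by rewrite lt0n; apply/eqP => M0; move: hlam0 hlamM; rewrite M0 => ->; lra.
have b0 := effective_sigma_pos hlam0 hlam hlamM hsbar.
have ban := effective_sigma_anti hlam0 hlam hlamM hsbar.
have ck := effective_sigma_budget hlam0 hlam hlamM hJhat hsbar.
have sp := effective_sigma_speed hlam0 hlam hlamM hJhat hsbar.
have h2 : 0 < eta / 2 by rewrite divr_gt0.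
have up := upper_tail hlam0 hlam hlamM M0 b0 ban ck eps0 h2.
have lo := lower_tail hlam0 hlam hlamM M0 hsigma b0 ck eps0 h2.
rewrite -sp -gamE in up; rewrite -gamE in lo.
have lam01 i : (i <= M)%N -> 0 <= lam i <= 1.
  move=> iM; have l0 : 0 <= lam 0%N by rewrite hlam0.
  by apply/andP; split; [exact: lam_ge0 iM|exact: lam_le1 iM].
near=> N => d T P phi phic gff hphic.
have N1 : (1 < N)%N by near: N; exists 2%N.
have L0 : 0 < ln N%:R :> R by rewrite ln_gt0// ltr1n.
have LE : ln (N%:R ^+ 2) = 2 * ln N%:R :> R by rewrite lnXn ?ltr0n 1?ltnW// mulr_natl.
have F := gff_gaussian_field gff; pose G := gff_is_form hW gff.
have [B [mB B0 HB]] := inhomogeneous_wsum hW gff hphic sigma lam01.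
pose Z w := field_max (fun v => inhomogeneous_field M sigma lam phic v w).
have mZ : measurable_fun [set: T] Z.
  by apply: measurable_field_max => v; exact: (measurable_inhomogeneous hphic sigma lam01 v).
(* The null set is removed from the upper event, where [upper_tail] asks membership to imply a high
   point, and added to the lower one, where [lower_tail] asks for the converse. *)
pose U := [set w | 2 * (gam + eps) * ln N%:R <= Z w] `\` B.
pose L := [set w | 2 * (gam - eps) * ln N%:R <= Z w] `|` B.
have mge c : measurable [set w | c <= Z w].
  rewrite (_ : [set w | _] = Z @^-1` `[c, +oo[); first by rewrite -[X in measurable X]setTI; exact: mZ.
  by apply/seteqP; split=> w; rewrite /= in_itv/= andbT.
have mU : measurable U by exact: measurableD.
have mL : measurable L by exact: measurableU.
have PU : (P U <= (eta / 2)%:E)%E.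
  have upN : forall (V : lmodType R) ip (phi : Z2 -> V) (G : gff_form N ip phi)
      d (T : measurableType d) (P : probability T R) X, gaussian_field P ip X ->
      forall E : set T, measurable E ->
      (forall w, E w -> exists2 x, inV N x &
        2 * (gam + eps) * ln N%:R <= X (wsum lam G sigma M x) w) -> (P E <= (eta / 2)%:E)%E.
    by near: N.
  apply: (upN _ _ _ G _ _ _ _ F _ mU) => w [hw wB].
  have [v vE] := field_max_ex (fun v => inhomogeneous_field M sigma lam phic v w).
  exists (site v); first exact: site_inV.
  by rewrite -(HB w wB v) -vE.
have PL : ((1 - eta / 2)%:E <= P L)%E.
  have loN : forall (V : lmodType R) ip (phi : Z2 -> V) (G : gff_form N ip phi)
      d (T : measurableType d) (P : probability T R) X, gaussian_field P ip X ->
      forall E : set T, measurable E ->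
      (forall x w, inV N x ->
        2 * (gam - eps) * ln N%:R <= X (wsum lam G sigma M x) w -> E w) ->
      ((1 - eta / 2)%:E <= P E)%E.
    by near: N.
  apply: (loN _ _ _ G _ _ _ _ F _ mL) => x w /inV_site[v <-] hw.
  have [wB|wB] := pselect (B w); [by right|left].
  by apply: le_trans hw _; rewrite -(HB w wB v); exact: field_max_ge.
have PCL : (P (~` L) <= (eta / 2)%:E)%E.
  move: PL; rewrite probability_setC// -(fineK (fin_num_measure P L mL)) -EFinB !lee_fin; lra.
set A := [set w | _].
have mA : measurable A.
  rewrite (_ : A = (fun w => `|Z w / ln (N%:R ^+ 2) - gam|) @^-1` `]eps, +oo[).
    rewrite -[X in measurable X]setTI; apply: measurableT_comp => //.
    by apply: measurable_funB => //; exact: measurable_funM.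
  by apply/seteqP; split=> w; rewrite /= in_itv/= andbT.
have AS : A `<=` (U `|` ~` L) `|` B.
  move=> w; rewrite /A /= -/(Z w) LE => hw.
  have [wB|wB] := pselect (B w); [by right|left].
  have d0 : 0 < 2 * ln N%:R :> R by rewrite mulr_gt0.
  have e : Z w = Z w / (2 * ln N%:R) * (2 * ln N%:R) by rewrite divfK// gt_eqF.
  move: hw; rewrite ltr_normr => /orP[h|h]; [left|right].
    split=> //=; rewrite [leRHS]e; have := ler_wpM2r (ltW d0) (ltW h); lra.
  move=> [/= hz|//]; have : 0 < (- (Z w / (2 * ln N%:R) - gam) - eps) * (2 * ln N%:R).
    by rewrite mulr_gt0// subr_gt0.
  by move: hz; rewrite [leRHS]e; lra.
apply: (@le_trans _ _ (P ((U `|` ~` L) `|` B))).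
  by apply: le_measure; rewrite ?inE//; apply: measurableU => //; apply: measurableU => //; exact: measurableC.
have mCL : measurable (~` L) by exact: measurableC.
have mUL : measurable (U `|` ~` L) by exact: measurableU.
have PB : (P B <= 0)%E by rewrite B0.
have := measureU2 P mUL mB => /le_trans; apply; apply: (le_trans (leeD (measureU2 P mU mCL) PB)).
by apply: (le_trans (leeD (leeD PU PCL) (lexx _))); rewrite adde0 -EFinD lee_fin; lra.
Unshelve. all: by end_near. Qed.

Theorem theorem1p2 (R : realType)
  (* simple random walk W, started at u under PW u *)
  (dW : measure_display) (OmW : measurableType dW)
  (PW : Z2 -> probability OmW R) (W : nat -> OmW -> Z2)
  (hW : forall u, simple_random_walk (PW u) W u)
  (* parameters *)
  (M : nat) (sigma lam : nat -> R)
  (hsigma : forall i, (1 <= i <= M)%N -> 0 < sigma i)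
  (hlam0 : lam 0%N = 0) (hlamM : lam M = 1)
  (hlam : forall i, (i < M)%N -> lam i < lam i.+1)
  (* effective variance *)
  (Jhat sbar : R -> R)
  (hJhat : least_concave_majorant (var_integral (sigma_fun M sigma lam)) Jhat)
  (hsbar : is_effective_sigma Jhat sbar)
  (* for each N, a GFF on VN N and versions phic N l v of phi_v(l) *)
  (d : nat -> measure_display) (T : forall N, measurableType (d N))
  (P : forall N, probability (T N) R)
  (phi : forall N, box N -> {RV (P N) >-> R})
  (hphi : forall N, (0 < N)%N -> is_gff (green PW W (VN N)) (phi N))
  (phic : forall N, R -> box N -> T N -> R)
  (hphic : forall N (l : R) (v : box N), (0 < N)%N -> 0 <= l <= 1 ->
     is_cond_expectation (P N)
       (outer_sigma_algebra (fun w => phi N w : T N -> R) v l)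
       (phi N v) (phic N l v)) :
  cvg_in_probability P
    (fun N w =>
       field_max (fun v => inhomogeneous_field M sigma lam (phic N) v w)
       / ln (N%:R ^+ 2))
    (\int[lebesgue_measure]_(s in `[0, 1])
       ((sigma_fun M sigma lam s) ^+ 2 / sbar s)).
Proof.
move=> eps eps0.
pose A N := [set w : T N | eps < `|field_max (fun v => inhomogeneous_field M sigma lam (phic N) v w)
  / ln (N%:R ^+ 2) - \int[lebesgue_measure]_(s in `[0, 1]) (sigma_fun M sigma lam s ^+ 2 / sbar s)|].
have PA eta : 0 < eta -> \forall N \near \oo, (P N (A N) <= eta%:E)%E.
  move=> /(field_max_deviation hW hsigma hlam0 hlamM hlam hJhat hsbar eps0).
  by apply: filterS2 (nbhs_infty_gt 0) => N N0 h; apply: h (hphi N N0) _ => l v; exact: hphic.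
apply/fine_cvgP; split.
  apply: filterS (PA 1 ltr01) => N h; rewrite ge0_fin_numE ?measure_ge0//.
  exact: le_lt_trans h (ltry _).
apply/cvgrPdist_le => eta eta0; apply: filterS (PA eta eta0) => N h.
rewrite sub0r normrN ger0_norm ?fine_ge0 ?measure_ge0//=.
by rewrite -lee_fin fineK// ge0_fin_numE ?measure_ge0//; exact: le_lt_trans h (ltry _).
Qed.
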